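(* Let $p>0$, and let $N\in\mathbf N$, $H>0$, $\kappa>0$ be fixed. (a) If there exists $m\in\mathbf N$ such that $q=q_m:=\frac{m\pi}{Hp}$ and $\vec k=m\mathbf Z$ (i.e. $k_n=mn$), then there exists $r_0=r_0(N,H,\kappa,m)>0$ such that for all $0<r<r_0$, $\epsilon_r(q,\vec k)=\epsilon_r(\frac{\pi}{Hp},\mathbf Z)$, and the minimizers of $\Omega^{per}_r$ in $\mathcal P(q_m,m\mathbf Z)$ coincide with the minimizers of $\Omega^{per}_r$ in $\mathcal P(\frac{\pi}{Hp},\mathbf Z)$. (b) For any other choice of $q>0$ and $\vec k$ there exist constants $r_1,\omega_1>0$ (depending on $N,H,\kappa,q,\vec k$) such that $\epsilon_r(q,\vec k)\ge\omega_1$ for all $0<r<r_1$.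
   Context: Finite stack of $N+1$ planes at heights $z_n=np$, $n=0,\dots,N$. Let $q>0$ and let $\vec k=(k_n)_{n=0}^N$ be integers with $k_0=0$. The sequence $m\mathbf Z$ is $k_n=mn$; $\mathbf Z$ is $k_n=n$. For $\vec k\neq\vec0$ the class $\mathcal P(q,\vec k)$ consists of all $(f_n,\phi_n,\vec A)$, $n=0,\dots,N$, with $\vec A\in H^1_{loc}(\mathbf R^2;\mathbf R^2)$, $f_n\in H^1_{loc}(\mathbf R)$ real, $2q$-periodic, $f_n\ge0$ ($f_n$ is the modulus of the order parameter $\psi_n=f_ne^{i\phi_n}$), $\phi_n\in H^1_{loc}(\mathbf R)$ real, for which there is a constant $\omega\in\mathbf R$ such that: (1) $\phi_n(x+2q)=\phi_n(x)+\omega+2\pi k_n$, $n=0,\dots,N$; (2) $\int_{-q}^q\phi_0\,dx=0=\int_{-q}^q\phi_1\,dx$; (3) $\vec A(x,z)=(Hz,0)+(\partial_z\xi,-\partial_x\xi)$ with $\xi\in H^2_{loc}(\mathbf R^2)$, $\xi(x+2q,z)=\xi(x,z)$, $\xi(x,0)=\xi(x,Np)=0$. For $\vec k=\vec 0$, $\mathcal P(q,\vec0)$ is defined in the same way but omitting (2). Phases are understood modulo $2\pi$: configurations differing only by $\phi_n\mapsto\phi_n+2\pi c_n$, $c_n\in\mathbf Z$, are identified when speaking of coincidence of minimizers. With $\Phi_{n,n-1}(x)=\phi_n(x)-\phi_{n-1}(x)-\int_{z_{n-1}}^{z_n}A_z(x,z)\,dz$ and $r\ge 0$, the energy over one period strip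 is $$\Omega^{per}_r(f_n,\phi_n,\vec A)=\int_{-q}^qp\sum_{n=0}^N\Big[\tfrac12(f_n^2-1)^2+\tfrac1{\kappa^2}(f_n')^2+\tfrac1{\kappa^2}(\phi_n'-A_x(x,z_n))^2f_n^2\Big]dx$$ $$+\frac r2\int_{-q}^qp\sum_{n=1}^N\big(f_n^2+f_{n-1}^2-2f_nf_{n-1}\cos\Phi_{n,n-1}\big)dx+\frac1{\kappa^2}\int_0^{Np}\int_{-q}^q\big(\partial_zA_x-\partial_xA_z-H\big)^2dx\,dz,$$ and $$\epsilon_r(q,\vec k)=\frac1{2qNp}\inf\{\Omega_r^{per}(f_n,\phi_n,\vec A):(f_n,\phi_n,\vec A)\in\mathcal P(q,\vec k)\}.$$
   Formalization: Coincidence of minimizers is meant with the potential A compared only on the strip 0 ≤ z ≤ Np; on all of R² it fails for m ≥ 2, since ξ can be changed outside the stack by a 2q_m-periodic function without changing the energy. *)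

(* Defs.v *)
From HB Require Import structures.
From mathcomp Require Export all_boot all_order all_algebra.
From mathcomp Require Export all_classical all_reals all_analysis.

Set Implicit Arguments.
Unset Strict Implicit.
Unset Printing Implicit Defensive.
Import Order.TTheory GRing.Theory Num.Theory.
Export numFieldNormedType.Exports.

Local Open Scope classical_set_scope.
Local Open Scope ring_scope.

Section TestFunctions.
Context {R : realType} {V : normedModType R}.

Definition iter_derive (s : seq V) (f : V -> R) : V -> R :=
  foldr (fun v g => 'D_v g) f s.

Definition smooth (f : V -> R) : Prop :=
  forall s : seq V, continuous (iter_derive s f) /\
    forall x v : V, derivable (iter_derive s f) x v.

Definition test_function (f : V -> R) : Prop :=
  smooth f /\ compact (closure [set x | f x != 0]).

End TestFunctions.

(* Elements of H^1_loc and H^2_loc are represented by arbitrary Borel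
   representatives; accordingly every pointwise condition on such functions is
   imposed almost everywhere, and their values on lines are taken in the sense
   of traces. *)
Section Sobolev.
Context {R : realType}.
Local Notation mu := (@lebesgue_measure R).

Definition lebesgue2 := (mu \x mu)%E.

Definition L2loc (f : R -> R) : Prop :=
  measurable_fun [set: R] f /\
  forall K : set R, compact K ->
    (\int[mu]_(x in K) ((f x) ^+ 2)%:E < +oo)%E.

Definition is_wderiv (f g : R -> R) : Prop :=
  L2loc g /\ forall phi : R -> R, test_function phi ->
    \int[mu]_x (f x * 'D_1 phi x) = - \int[mu]_x (g x * phi x).

Definition H1loc (f : R -> R) : Prop := L2loc f /\ exists g, is_wderiv f g.

(* Unique up to a null set when f is in H1loc; junk value 0 otherwise. *)
Definition wderiv (f : R -> R) : R -> R :=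
  xget (fun=> 0) [set g | is_wderiv f g].

(* A point of the plane is a pair (x, z). *)
Definition ex : R * R := (1, 0).
Definition ez : R * R := (0, 1).

Definition L2loc2 (u : R * R -> R) : Prop :=
  measurable_fun [set: R * R] u /\
  forall K : set (R * R), compact K ->
    (\int[lebesgue2]_(y in K) ((u y) ^+ 2)%:E < +oo)%E.

Definition is_wpartial (v : R * R) (u g : R * R -> R) : Prop :=
  L2loc2 g /\ forall phi : R * R -> R, test_function phi ->
    \int[lebesgue2]_y (u y * 'D_v phi y) = - \int[lebesgue2]_y (g y * phi y).

Definition wpartial (v : R * R) (u : R * R -> R) : R * R -> R :=
  xget (fun=> 0) [set g | is_wpartial v u g].

Definition H1loc2 (u : R * R -> R) : Prop :=
  [/\ L2loc2 u, exists g, is_wpartial ex u g & exists g, is_wpartial ez u g].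

Definition H2loc2 (u : R * R -> R) : Prop :=
  [/\ H1loc2 u, H1loc2 (wpartial ex u) & H1loc2 (wpartial ez u)].

(* Green's formula on the half-plane {z > c}:
     \int_{z > c} (u d_z phi + phi d_z u) = - \int u(x, c) phi(x, c) dx.
   For u in H1loc2 the trace from {z < c} is the same function. *)
Definition is_trace (u : R * R -> R) (c : R) (g : R -> R) : Prop :=
  L2loc g /\ forall phi : R * R -> R, test_function phi ->
    \int[mu]_x (g x * phi (x, c)) =
    - \int[lebesgue2]_(y in [set y : R * R | c < y.2])
        (u y * 'D_ez phi y + wpartial ez u y * phi y).

Definition trace (u : R * R -> R) (c : R) : R -> R :=
  xget (fun=> 0) [set g | is_trace u c g].

End Sobolev.

Section LawrenceDoniach.
Context {R : realType}.
Local Notation mu := (@lebesgue_measure R).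

Record config (N : nat) := Config {
  modulus : 'I_N.+1 -> R -> R;
  phase : 'I_N.+1 -> R -> R;
  potx : R * R -> R;
  potz : R * R -> R }.

Definition multZ (N m : nat) : 'I_N.+1 -> int := fun n => (m * n)%:Z.

Definition admissible (p : R) (N : nat) (H q : R) (k : 'I_N.+1 -> int)
    (c : config N) : Prop :=
  [/\ H1loc2 (potx c) /\ H1loc2 (potz c),
      forall n, [/\ H1loc (modulus c n),
        {ae mu, forall x : R, modulus c n (x + 2 * q) = modulus c n x} &
        {ae mu, forall x : R, 0 <= modulus c n x}],
      (forall n, H1loc (phase c n)) /\
      exists omega : R, forall n, {ae mu, forall x : R,
        phase c n (x + 2 * q) = phase c n x + omega + 2 * pi * (k n)%:~R},
      (exists n, k n != 0) -> forall n : 'I_N.+1, (n <= 1)%N ->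
        \int[mu]_(x in `[- q, q]) phase c n x = 0 &
      exists xi : R * R -> R,
        [/\ H2loc2 xi,
            {ae lebesgue2, forall y : R * R, xi (y.1 + 2 * q, y.2) = xi y},
            {ae mu, forall x : R, trace xi 0 x = 0},
            {ae mu, forall x : R, trace xi (N%:R * p) x = 0} &
            {ae lebesgue2, forall y : R * R,
              potx c y = H * y.2 + wpartial ez xi y /\
              potz c y = - wpartial ex xi y}]].

(* The gauge-invariant phase difference between planes n.+1 and n. *)
Definition phase_diff (p : R) (N : nat) (c : config N) (n : 'I_N) (x : R) : R :=
  phase c (lift ord0 n) x - phase c (widen_ord (leqnSn N) n) x
  - \int[mu]_(z in `[n%:R * p, n.+1%:R * p]) potz c (x, z).

(* All integrands are nonnegative, so the energy is a well-defined extended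
   real number. *)
Definition energy (p : R) (N : nat) (H kappa r q : R) (c : config N) : \bar R :=
  (\int[mu]_(x in `[(- q)%R, q])
      (p * \sum_(n < N.+1)
        (2^-1 * ((modulus c n x) ^+ 2 - 1) ^+ 2
         + (kappa ^+ 2)^-1 * (wderiv (modulus c n) x) ^+ 2
         + (kappa ^+ 2)^-1
           * (wderiv (phase c n) x - trace (potx c) (n%:R * p) x) ^+ 2
           * (modulus c n x) ^+ 2))%:E
   + (r / 2)%:E * \int[mu]_(x in `[(- q)%R, q])
      (p * \sum_(n < N)
        ((modulus c (lift ord0 n) x) ^+ 2
         + (modulus c (widen_ord (leqnSn N) n) x) ^+ 2
         - 2 * modulus c (lift ord0 n) x
             * modulus c (widen_ord (leqnSn N) n) x
             * cos (phase_diff p c n x)))%:E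
   + ((kappa ^+ 2)^-1)%:E *
     \int[lebesgue2]_(y in `[(- q)%R, q] `*` `[0%R, (N%:R * p)%R])
      ((wpartial ez (potx c) y - wpartial ex (potz c) y - H) ^+ 2)%:E)%E.

Definition min_energy_density (p : R) (N : nat) (H kappa r q : R)
    (k : 'I_N.+1 -> int) : \bar R :=
  (((2 * q * N%:R * p)^-1)%:E *
   ereal_inf [set energy p H kappa r q c | c in admissible p H q k])%E.

Definition minimizer (p : R) (N : nat) (H kappa r q : R) (k : 'I_N.+1 -> int)
    (c : config N) : Prop :=
  admissible p H q k c /\
  forall c', admissible p H q k c' ->
    (energy p H kappa r q c <= energy p H kappa r q c')%E.

(* Phases are taken modulo 2 pi. The energy does not see A outside the stack,
   where xi is subject to no condition but its periodicity, so potentials are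
   compared on the strip 0 <= z <= N p only. *)
Definition same_config (p : R) (N : nat) (c c' : config N) : Prop :=
  [/\ forall n, {ae mu, forall x : R, modulus c n x = modulus c' n x},
      exists d : 'I_N.+1 -> int, forall n, {ae mu, forall x : R,
        phase c n x = phase c' n x + 2 * pi * (d n)%:~R} &
      {ae lebesgue2, forall y : R * R, 0 <= y.2 <= N%:R * p ->
        potx c y = potx c' y /\ potz c y = potz c' y}].

Definition coincide (p : R) (N : nat) (S T : set (config N)) : Prop :=
  (forall c, S c -> exists2 c', T c' & same_config p c c') /\
  (forall c, T c -> exists2 c', S c' & same_config p c c').

End LawrenceDoniach.

(* Main.v *)
(* Everything is expressed through the gauge-invariant fields of a configuration:
   the moduli f_n, the velocities V_n = phi_n' - A_x(., np), the phase
   differences Phi_n, and the excess field h = d_z A_x - d_x A_z - H. They are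
   tied together by
     Phi_n' = V_{n+1} - V_n + \int_{np}^{(n+1)p} h dz + H p.
   Energy dominates the L^2 norms of f_n', h and, once the one-dimensional
   Sobolev inequality has forced f_n close to 1, of V_n.

   (b) Integrating the identity over a period gives
   2 pi (k_{n+1} - k_n) - 2 q p H = \int (V_{n+1} - V_n + \int h), so small
   energy forces k_{n+1} - k_n = q p H / pi for all n.

   (a) Average a configuration of period 2 q_m over its m translates by
   multiples of 2 q_1. Along such averages the energy density is convex up to
   remainders: at low energy the quartic and kinetic terms are uniformly convex
   near f = 1, V = 0, and the coupling, although not convex, costs only
   O(r) times squared deviations; deviations of Phi_n have mean zero, hence are
   bounded through the identity by those of V_n and h. So averaging strictly
   lowers the energy unless all fields are already 2 q_1-periodic. In that case
   eta = xi - average(xi) is harmonic in the strip, vanishes on the outer planes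
   and is periodic, so its Dirichlet integral vanishes and the potentials agree. *)

(* Convexity is usable only at low energy, and low energy comes from an explicit competitor: the
   configuration [ground] has energy O(r), so a configuration above a threshold e is beaten by it
   and only those below e have to be averaged. The threshold is fixed before r, and r is then taken
   small against it. Phases grow linearly, so their mean slope is removed before averaging and
   restored afterwards. Slopes of neighbouring planes differ by exactly Hp, and Hp times 2 q_1 is 2
   pi; hence every weight in a first-order expansion at the average has period 2 q_1 and is
   orthogonal to the deviations. Half of each second-order gain pays for the losses of the kinetic
   and coupling terms; the other half remains and decides the case of equality. Functions are given
   up to null sets, while weak derivatives and traces are chosen representatives. All of them are
   handled in one normal form, a constant (or a function of the transverse variable) plus a
   primitive, in which translation, averaging and traces become explicit. *)
Require Import Defs.
From mathcomp Require Import measurable_realfun zify ring lra.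
Set Implicit Arguments.
Unset Strict Implicit.
Unset Printing Implicit Defensive.
Import Order.TTheory GRing.Theory Num.Theory.
Local Open Scope classical_set_scope.
Local Open Scope ring_scope.

(** * Real-valued integrals and local integrability *)

Section RealIntegral.
Context d (T : measurableType d) (R : realType) (mu : {measure set T -> \bar R}).
Implicit Types (D : set T) (f g : T -> R).

Lemma aeS (P Q : T -> Prop) : (forall x, P x -> Q x) ->
  {ae mu, forall x, P x} -> {ae mu, forall x, Q x}.
Proof. by move=> PQ; exact: filterS. Qed.

Lemma aeI (P Q : T -> Prop) : {ae mu, forall x, P x} -> {ae mu, forall x, Q x} ->
  {ae mu, forall x, P x /\ Q x}.
Proof. by move=> hP hQ; exact: filterI. Qed.

Definition rint D f := mu.-integrable D (EFin \o f).

Lemma rint_meas D f : rint D f -> measurable_fun D f.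
Proof. by move=> /measurable_int /measurable_EFinP. Qed.

Lemma rintD D f g : measurable D -> rint D f -> rint D g ->
  rint D (fun x => f x + g x).
Proof. move=> mD hf hg; exact: (integrableD mD hf hg). Qed.

Lemma rintB D f g : measurable D -> rint D f -> rint D g ->
  rint D (fun x => f x - g x).
Proof. move=> mD hf hg; exact: (integrableB mD hf hg). Qed.

Lemma rintZ D f (k : R) : measurable D -> rint D f -> rint D (fun x => k * f x).
Proof.
move=> mD hf; apply: eq_integrable (integrableZl mD k hf) => // x _ /=.
Qed.

Lemma rint0 D : rint D (fun=> 0).
Proof. exact: integrable0. Qed.

Lemma rint_sum D (I : Type) (s : seq I) (F : I -> T -> R) : measurable D ->
  (forall i, rint D (F i)) -> rint D (fun x => \sum_(i <- s) F i x).
Proof.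
move=> mD h; elim: s => [|i s IH].
  rewrite [X in rint D X](_ : _ = fun=> 0); first exact: rint0.
  by apply/funext => x; rewrite big_nil.
rewrite [X in rint D X](_ : _ = (fun x => F i x + \sum_(j <- s) F j x)).
  exact: rintD.
by apply/funext => x; rewrite big_cons.
Qed.

Lemma Rint_sum D (I : Type) (s : seq I) (F : I -> T -> R) : measurable D ->
  (forall i, rint D (F i)) ->
  \int[mu]_(x in D) (\sum_(i <- s) F i x) = \sum_(i <- s) \int[mu]_(x in D) F i x.
Proof.
move=> mD h; elim: s => [|i s IH].
  rewrite big_nil -[RHS](mul0r (fine (mu D))) -Rintegral_cst //.
  by apply: eq_Rintegral => x _; rewrite big_nil.
rewrite big_cons -IH -RintegralD //; [|exact: h|exact: rint_sum].
by apply: eq_Rintegral => x _; rewrite big_cons.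
Qed.

Lemma rint_eq_ae D f g : measurable D -> measurable_fun D g ->
  {ae mu, forall x, D x -> f x = g x} -> rint D f -> rint D g.
Proof.
move=> mD mg fg /integrableP[mf hf]; apply/integrableP; split.
  exact/measurable_EFinP.
rewrite (@ge0_ae_eq_integral _ _ _ _ _ _ (fun x => `|(f x)%:E|)%E) //.
- by apply: measurableT_comp => //; exact/measurable_EFinP.
- exact: measurableT_comp.
by apply: filterS fg => x /= h Dx; rewrite h.
Qed.

Lemma Rint_eq_ae D f g : measurable D -> measurable_fun D f -> measurable_fun D g ->
  {ae mu, forall x, D x -> f x = g x} ->
  \int[mu]_(x in D) f x = \int[mu]_(x in D) g x.
Proof.
move=> mD mf mg fg; rewrite /Rintegral; congr fine; apply: ae_eq_integral => //.
- exact/measurable_EFinP.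
- exact/measurable_EFinP.
by apply: filterS fg => x /= h Dx; rewrite h.
Qed.

Lemma integral_Rint D f : measurable D -> rint D f ->
  (\int[mu]_(x in D) (f x)%:E)%E = (\int[mu]_(x in D) f x)%:E.
Proof. by move=> mD hf; rewrite /Rintegral fineK //; exact: integrable_fin_num. Qed.

Lemma Rint_ae_le D f g : measurable D -> rint D f -> rint D g ->
  {ae mu, forall x, D x -> f x <= g x} ->
  \int[mu]_(x in D) f x <= \int[mu]_(x in D) g x.
Proof.
move=> mD hf hg fg; rewrite -subr_ge0 -RintegralB //.
rewrite (@Rint_eq_ae D _ (fun x => `|g x - f x|)) //.
- by apply: Rintegral_ge0 => x _; exact: normr_ge0.
- exact: rint_meas (rintB mD hg hf).
- by apply: measurableT_comp => //; exact: rint_meas (rintB mD hg hf).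
by apply: filterS fg => x /= h Dx; rewrite ger0_norm // subr_ge0 h.
Qed.

Lemma Rint_ge0_eq0 D f : measurable D -> rint D f ->
  {ae mu, forall x, D x -> 0 <= f x} -> \int[mu]_(x in D) f x = 0 ->
  {ae mu, forall x, D x -> f x = 0}.
Proof.
move=> mD hf f0 h.
have mf := rint_meas hf.
have e : (\int[mu]_(x in D) `|(f x)%:E| = 0)%E.
  transitivity (\int[mu]_(x in D) (f x)%:E)%E.
    apply: ae_eq_integral => //.
    - by apply: measurableT_comp => //; exact/measurable_EFinP.
    - exact/measurable_EFinP.
    by apply: filterS f0 => x /= h0 Dx; rewrite ger0_norm // h0.
  by rewrite integral_Rint // h.
have mfE : measurable_fun D (EFin \o f) by exact/measurable_EFinP.
have /ae_eq_integral_abs := mfE.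
move=> /(_ mu mD) [/(_ e) H _]; apply: filterS H => x /= H Dx.
by have := H Dx => -[].
Qed.

Lemma rint_bounded_mul D f g (M : R) : measurable D -> measurable_fun D g ->
  (forall x, D x -> `|g x| <= M) -> rint D f -> rint D (fun x => g x * f x).
Proof.
move=> mD mg gM hf.
have mf := rint_meas hf.
apply: (@le_integrable _ _ _ mu D mD _ (EFin \o (fun x => M * f x))).
- by apply/measurable_EFinP; exact: measurable_funM.
- move=> x Dx; rewrite lee_fin !normrM ler_wpM2r //.
  by rewrite (le_trans (gM x Dx)) // ler_norm.
exact: rintZ.
Qed.

Lemma rint_le D f g : measurable D -> measurable_fun D f ->
  (forall x, D x -> `|f x| <= g x) -> rint D g -> rint D f.
Proof.
move=> mD mf fg; apply: le_integrable => //; first exact/measurable_EFinP.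
by move=> x Dx /=; rewrite lee_fin (le_trans (fg x Dx)) // ler_norm.
Qed.

Lemma rint_le_ae D f g : measurable D -> measurable_fun D f ->
  {ae mu, forall x, D x -> `|f x| <= g x} -> rint D g -> rint D f.
Proof.
move=> mD mf fg /integrableP[mg hg]; apply/integrableP; split.
  exact/measurable_EFinP.
apply: le_lt_trans hg; apply: ae_ge0_le_integral => //.
- by apply: measurableT_comp => //; exact/measurable_EFinP.
- exact: measurableT_comp.
by apply: filterS fg => x /= h Dx; rewrite lee_fin (le_trans (h Dx)) // ler_norm.
Qed.

Lemma rintS D D' f : measurable D -> measurable D' -> D' `<=` D ->
  rint D f -> rint D' f.
Proof. move=> mD mD' s; exact: integrableS. Qed.

Lemma rint_restrict D f : measurable D -> rint D f <-> rint setT (f \_ D).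
Proof.
move=> mD; rewrite /rint (integrable_mkcond _ mD) restrict_EFin.
by split.
Qed.

End RealIntegral.

Section LocallyIntegrable.
Context d (T : measurableType d) (R : realType) (mu : {measure set T -> \bar R}).
Variable B : nat -> set T.
Hypothesis mB : forall n, measurable (B n).
Hypothesis muB : forall n, (mu (B n) < +oo)%E.
Implicit Types (D : set T) (f g : T -> R).

(* Local integrability is tested on one exhaustion [B n]: every compact set lies in some box. *)
Definition L1b f := measurable_fun setT f /\ forall n, rint mu (B n) f.
Definition L2b f := measurable_fun setT f /\ forall n, rint mu (B n) (fun x => f x ^+ 2).

Lemma L1b_rint f n D : L1b f -> measurable D -> D `<=` B n -> rint mu D f.
Proof. by move=> [_ h] mD s; apply: rintS (h n). Qed.

Lemma L1bD f g : L1b f -> L1b g -> L1b (fun x => f x + g x).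
Proof.
move=> [mf hf] [mg hg]; split; first exact: measurable_funD.
by move=> n; apply: rintD.
Qed.

Lemma L1bB f g : L1b f -> L1b g -> L1b (fun x => f x - g x).
Proof.
move=> [mf hf] [mg hg]; split; first exact: measurable_funB.
by move=> n; apply: rintB.
Qed.

Lemma L1bZ (k : R) f : L1b f -> L1b (fun x => k * f x).
Proof.
move=> [mf hf]; split; first exact: measurable_funM.
by move=> n; apply: rintZ.
Qed.

Lemma L1b_cst (k : R) : L1b (fun=> k).
Proof.
split; first exact: measurable_cst.
move=> n; apply: measurable_bounded_integrable => //.
by exists `|k|; split; rewrite ?num_real// => M hM x _ /=; exact: ltW.
Qed.

Lemma L1b_sum (I : Type) (s : seq I) (F : I -> T -> R) :
  (forall i, L1b (F i)) -> L1b (fun x => \sum_(i <- s) F i x).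
Proof.
move=> h; elim: s => [|i s IH].
  rewrite [X in L1b X](_ : _ = fun=> 0); first exact: L1b_cst.
  by apply/funext => x; rewrite big_nil.
rewrite [X in L1b X](_ : _ = (fun x => F i x + \sum_(j <- s) F j x)).
  exact: L1bD.
by apply/funext => x; rewrite big_cons.
Qed.

Lemma L1bM_bounded f g (M : R) : measurable_fun setT g ->
  (forall x, `|g x| <= M) -> L1b f -> L1b (fun x => g x * f x).
Proof.
move=> mg gM [mf hf]; split; first exact: measurable_funM.
move=> n; apply: (@rint_bounded_mul _ _ _ _ _ _ _ M) => //.
exact: measurable_funTS.
Qed.

Lemma L1b_le f g : measurable_fun setT f -> (forall x, `|f x| <= g x) ->
  L1b g -> L1b f.
Proof.
move=> mf fg [mg hg]; split => // n; apply: (rint_le (mB n) _ _ (hg n)) => //.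
exact: measurable_funTS.
Qed.

Lemma L2bM f g : L2b f -> L2b g -> L1b (fun x => f x * g x).
Proof.
move=> [mf hf] [mg hg].
apply: (@L1b_le _ (fun x => f x ^+ 2 + g x ^+ 2)).
- exact: measurable_funM.
- move=> x; rewrite ler_norml; apply/andP; split; nra.
split; first by apply: measurable_funD; exact: measurable_funX.
by move=> n; exact: rintD.
Qed.

Lemma L2b_cst (k : R) : L2b (fun=> k).
Proof. by split; [exact: measurable_cst|exact: (L1b_cst (k ^+ 2)).2]. Qed.

Lemma L2b_L1b f : L2b f -> L1b f.
Proof.
move=> hf; have := L2bM (L2b_cst 1) hf.
by under eq_fun do rewrite mul1r.
Qed.

Lemma L2b_sq f : L2b f -> L1b (fun x => f x ^+ 2).
Proof. move=> [mf hf]; split => //; exact: measurable_funX. Qed.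

Lemma L2b_dom f g : measurable_fun setT f -> (forall x, f x ^+ 2 <= g x) ->
  L1b g -> L2b f.
Proof.
move=> mf fg hg; split => //; apply: (L1b_le _ _ hg).2; first exact: measurable_funX.
by move=> x; rewrite ger0_norm ?sqr_ge0.
Qed.

Lemma L2bZ (k : R) f : L2b f -> L2b (fun x => k * f x).
Proof.
move=> hf; apply: (@L2b_dom _ (fun x => k ^+ 2 * f x ^+ 2)).
- by apply: measurable_funM => //; exact: hf.1.
- by move=> x; rewrite exprMn.
by apply: L1bZ; exact: L2b_sq.
Qed.

Lemma L2bD f g : L2b f -> L2b g -> L2b (fun x => f x + g x).
Proof.
move=> hf hg; apply: (@L2b_dom _ (fun x => 2 * f x ^+ 2 + 2 * g x ^+ 2)).
- by apply: measurable_funD; [exact: hf.1|exact: hg.1].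
- by move=> x; have := sqr_ge0 (f x - g x); nra.
by apply: L1bD; apply: L1bZ; exact: L2b_sq.
Qed.

Lemma L2bB f g : L2b f -> L2b g -> L2b (fun x => f x - g x).
Proof.
move=> hf hg; have := L2bD hf (L2bZ (-1) hg).
by under eq_fun do rewrite mulN1r.
Qed.

Lemma L2b_sum (I : Type) (s : seq I) (F : I -> T -> R) :
  (forall i, L2b (F i)) -> L2b (fun x => \sum_(i <- s) F i x).
Proof.
move=> h; elim: s => [|i s IH].
  rewrite [X in L2b X](_ : _ = fun=> 0); first exact: L2b_cst.
  by apply/funext => x; rewrite big_nil.
rewrite [X in L2b X](_ : _ = (fun x => F i x + \sum_(j <- s) F j x)).
  exact: L2bD.
by apply/funext => x; rewrite big_cons.
Qed.

Lemma L2b_eq_ae f g : measurable_fun setT g -> {ae mu, forall x, f x = g x} ->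
  L2b f -> L2b g.
Proof.
move=> mg fg [mf hf]; split=> // n; apply: rint_eq_ae (hf n) => //.
- by apply: measurable_funTS; exact: measurable_funX.
- by apply: filterS fg => x h _; rewrite h.
Qed.

End LocallyIntegrable.

Section Lebesgue1.
Context {R : realType}.
Local Notation mu := (@lebesgue_measure R).
Implicit Types (f g : R -> R) (a b c : R).

Definition box1 (n : nat) : set R := `[- n%:R, n%:R]%classic.

Lemma measurable_box1 n : measurable (box1 n).
Proof. exact: measurable_itv. Qed.

Lemma mu_box1 n : (mu (box1 n) < +oo)%E.
Proof.
rewrite lebesgue_measure_itv; case: ifP => _; last exact: ltry.
by rewrite /= -EFinB ltry.
Qed.

Lemma sub_box1 a b : exists n, `[a, b]%classic `<=` box1 n.
Proof.
exists (Num.truncn (Num.max `|a| `|b|)).+1.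
have := truncnS_gt (Num.max `|a| `|b|).
rewrite /box1; move: _.+1%:R => m; rewrite gt_max.
move=> /andP[/ltr_normlP[a1 a2] /ltr_normlP[b1 b2]] x /=; rewrite !in_itv /=.
by move=> /andP[ax xb]; apply/andP; split; lra.
Qed.

Lemma compact_sub_box1 (K : set R) : compact K -> exists n, K `<=` box1 n.
Proof.
move=> /compact_bounded -[M [_ hM]].
have [n hn] := sub_box1 (- (M + 1)) (M + 1).
exists n => x Kx; apply: hn => /=; rewrite in_itv /= -ler_norml; apply: hM => //.
by rewrite ltrDl.
Qed.

Notation L1 := (L1b mu box1).
Notation L2 := (L2b mu box1).

Lemma L1_itv f a b : L1 f -> rint mu `[a, b] f.
Proof.
move=> h; have [n hn] := sub_box1 a b.
apply: (L1b_rint _ h _ hn) => //; exact: measurable_box1.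
Qed.

Lemma L1_sub f a b D : measurable D -> D `<=` `[a, b]%classic -> L1 f -> rint mu D f.
Proof.
move=> mD Dab h; have [n hn] := sub_box1 a b.
by apply: (L1b_rint _ h mD (subset_trans Dab hn)) => //; exact: measurable_box1.
Qed.

Lemma mu_itv a b : a <= b -> mu `[a, b] = (b - a)%:E.
Proof.
move=> ab; rewrite lebesgue_measure_itv /= lte_fin.
move: ab; rewrite le_eqVlt => /predU1P[->|->]; last by rewrite EFinB.
by rewrite ltxx subrr.
Qed.

Lemma Rint_cst k a b : a <= b -> \int[mu]_(x in `[a, b]) k = k * (b - a).
Proof.
move=> ab; transitivity (k * fine (mu `[a, b])); first exact: Rintegral_cst.
by rewrite mu_itv.
Qed.

Lemma L2locP f : L2loc f <-> L2 f.
Proof.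
split=> -[mf h]; split => //.
- move=> n; apply/integrableP; split.
    by apply/measurable_EFinP; apply: measurable_funTS; exact: measurable_funX.
  under eq_integral do rewrite /= ger0_norm ?sqr_ge0 //.
  exact/h/segment_compact.
- move=> K cK; have [n hn] := compact_sub_box1 cK.
  have mK : measurable K by exact: compact_measurable.
  have : rint mu K (fun x => f x ^+ 2) by apply: rintS (h n) => //; exact: measurable_box1.
  move=> /integrableP[_]; under eq_integral do rewrite /= ger0_norm ?sqr_ge0 //.
  by [].
Qed.

End Lebesgue1.

Notation L1 := (L1b lebesgue_measure box1).
Notation L2 := (L2b lebesgue_measure box1).

Section LineAliases.
Context {R : realType}.
Local Notation mu := (@lebesgue_measure R).
Local Notation mbox := (@measurable_box1 R).
Local Notation mubox := (@mu_box1 R).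
Implicit Types (f g : R -> R) (F : forall I : Type, I -> R -> R).

(* The generic lemmas at a fixed measure and fixed boxes, which unification does not find. *)
Definition L1D (f g : R -> R) (hf : L1 f) (hg : L1 g) := @L1bD _ _ _ mu box1 mbox f g hf hg.
Definition L1B (f g : R -> R) (hf : L1 f) (hg : L1 g) := @L1bB _ _ _ mu box1 mbox f g hf hg.
Definition L1Z k f (hf : L1 f) := @L1bZ _ _ _ mu box1 mbox k f hf.
Definition L1_cst k := @L1b_cst _ _ _ mu box1 mbox mubox k.
Definition L1_sum (I : Type) (s : seq I) (F : I -> R -> R) (hF : forall i, L1 (F i)) :=
  @L1b_sum _ _ _ mu box1 mbox mubox I s F hF.
Definition L1M_bounded f g M mg gM (hf : L1 f) := @L1bM_bounded _ _ _ mu box1 mbox f g M mg gM hf.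
Definition L2M (f g : R -> R) (hf : L2 f) (hg : L2 g) := @L2bM _ _ _ mu box1 mbox f g hf hg.
Definition L2_cst k := @L2b_cst _ _ _ mu box1 mbox mubox k.
Definition L2_L1 f (hf : L2 f) := @L2b_L1b _ _ _ mu box1 mbox mubox f hf.
Definition L2_dom f g mf fg (hg : L1 g) := @L2b_dom _ _ _ mu box1 mbox f g mf fg hg.
Definition L2Z k f (hf : L2 f) := @L2bZ _ _ _ mu box1 mbox k f hf.
Definition L2D (f g : R -> R) (hf : L2 f) (hg : L2 g) := @L2bD _ _ _ mu box1 mbox f g hf hg.
Definition L2B (f g : R -> R) (hf : L2 f) (hg : L2 g) := @L2bB _ _ _ mu box1 mbox f g hf hg.
Definition L2_sum (I : Type) (s : seq I) (F : I -> R -> R) (hF : forall i, L2 (F i)) :=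
  @L2b_sum _ _ _ mu box1 mbox mubox I s F hF.
Definition L2_eq_ae f g mg fg (hf : L2 f) := @L2b_eq_ae _ _ _ mu box1 mbox f g mg fg hf.

End LineAliases.

(** * Primitives on the line *)

Section Translation.
Context {R : realType}.
Local Notation mu := (@lebesgue_measure R).
Implicit Types (f g : R -> R) (a b c : R).

Lemma measurable_shift c : measurable_fun [set: R] (fun x : R => x + c).
Proof. exact: measurable_funD. Qed.

Lemma shift_preimage_itv c (a b : R) (l r : bool) :
  (fun x => x + c) @^-1` [set` Interval (BSide l a) (BSide r b)] =
  [set` Interval (BSide l (a - c)) (BSide r (b - c))].
Proof.
apply/seteqP; split=> x /=; rewrite !in_itv /= !lteifBlDr ?lteifBrDr //.
Qed.

(** Translation maps intervals to intervals of the same length, and Lebesgue measure is determined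
    by its values on intervals. *)
Lemma lebesgue_measure_shift c (A : set R) : measurable A ->
  pushforward mu ((fun x => x + c) : _ -> measurableTypeR R) A = mu A.
Proof.
move=> mA; apply/esym/lebesgue_measure_unique => //=.
  exact: measurable_shift.
move=> ms _ [[a b]] _ <-; rewrite /pushforward shift_preimage_itv !lebesgue_measure_itv /=.
by rewrite !lte_fin ltrD2r -!EFinB opprB addrA subrK.
Qed.

Lemma ge0_integral_shift c (D : set R) (f : R -> \bar R) : measurable D ->
  measurable_fun [set: R] f -> (forall x, 0 <= f x)%E ->
  (\int[mu]_(x in D) f x = \int[mu]_(x in (fun x => x + c)%R @^-1` D) f (x + c)%R)%E.
Proof.
move=> mD mf f0.
have ms : measurable_fun [set: measurableTypeR R]
  ((fun x => x + c) : _ -> measurableTypeR R) := measurable_shift c.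
rewrite -(@ge0_integral_pushforward _ _ _ _ _ _ ms mu D f) //; last exact: measurable_funTS.
apply: eq_measure_integral => A mA AD.
exact/esym/lebesgue_measure_shift.
Qed.

Lemma integral_shift c (D : set R) (f : R -> \bar R) : measurable D ->
  measurable_fun [set: R] f ->
  (\int[mu]_(x in D) f x = \int[mu]_(x in (fun x => x + c)%R @^-1` D) f (x + c)%R)%E.
Proof.
move=> mD mf; rewrite integralE [RHS]integralE; congr (_ - _)%E.
- transitivity (\int[mu]_(x in (fun x => x + c)%R @^-1` D) f^\+ (x + c)%R)%E.
    by apply: ge0_integral_shift => //; exact: measurable_funepos.
  by apply: eq_integral => x _; rewrite !unlock.
- transitivity (\int[mu]_(x in (fun x => x + c)%R @^-1` D) f^\- (x + c)%R)%E.
    by apply: ge0_integral_shift => //; exact: measurable_funeneg.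
  by apply: eq_integral => x _; rewrite !unlock.
Qed.

Lemma Rintegral_shift c (D : set R) f : measurable D -> measurable_fun [set: R] f ->
  \int[mu]_(x in D) f x = \int[mu]_(x in (fun x => x + c) @^-1` D) f (x + c).
Proof.
by move=> mD mf; rewrite /Rintegral (integral_shift c) //; exact/measurable_EFinP.
Qed.

Lemma Rintegral_shift_itv c a b f : measurable_fun [set: R] f ->
  \int[mu]_(x in `[a, b]) f (x + c) = \int[mu]_(x in `[a + c, b + c]) f x.
Proof.
move=> mf; rewrite (Rintegral_shift c (D := `[a + c, b + c])) //.
by rewrite shift_preimage_itv !addrK.
Qed.

Lemma ae_shift c (P : R -> Prop) :
  {ae mu, forall x, P x} -> {ae mu, forall x, P (x + c)}.
Proof.
move=> [A [mA A0 PA]]; exists ((fun x => x + c) @^-1` A); split.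
- by rewrite -[X in measurable X]setTI; exact: measurable_shift.
- by rewrite -A0 -(lebesgue_measure_shift c mA).
- by move=> x Px; exact: PA.
Qed.

Lemma rint_shift c (D : set R) f : measurable D -> measurable_fun [set: R] f ->
  rint mu D f -> rint mu ((fun x => x + c) @^-1` D) (fun x => f (x + c)).
Proof.
move=> mD mf /integrableP[_ h]; apply/integrableP; split.
- apply/measurable_EFinP/measurable_funTS.
  exact: (measurableT_comp mf (measurable_shift c)).
- rewrite (ge0_integral_shift c) // in h.
  by apply: measurableT_comp => //; exact/measurable_EFinP.
Qed.

Lemma measurable_fun_shift c f : measurable_fun [set: R] f ->
  measurable_fun [set: R] (fun x => f (x + c)).
Proof. by move=> mf; exact: (measurableT_comp mf (measurable_shift c)). Qed.

Lemma L1_shift c f : L1 f -> L1 (fun x => f (x + c)).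
Proof.
move=> h; have mf := h.1; split; first exact: measurable_fun_shift.
move=> n; have := rint_shift c (measurable_itv _) mf (L1_itv (- n%:R + c) (n%:R + c) h).
by rewrite shift_preimage_itv !addrK.
Qed.

Lemma L2_shift c f : L2 f -> L2 (fun x => f (x + c)).
Proof.
move=> h; split; first by apply: measurable_fun_shift; exact: h.1.
exact: (L1_shift c (L2b_sq h)).2.
Qed.

End Translation.

Section Primitive.
Context {R : realType}.
Local Notation mu := (@lebesgue_measure R).
Implicit Types (f g : R -> R) (a b c : R).

(* One of the two integrals is over an empty interval. *)
Definition prim g x := \int[mu]_(s in `[0, x]) g s - \int[mu]_(s in `[x, 0]) g s.

Lemma Rint_split g a b c : L1 g -> a <= b -> b <= c ->
  \int[mu]_(s in `[a, c]) g s = \int[mu]_(s in `[a, b]) g s + \int[mu]_(s in `[b, c]) g s.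
Proof.
move=> hg ab bc.
have := @Rintegral_itvB R g (BLeft a) (BRight c) b (L1_itv a c hg).
rewrite !bnd_simp => /(_ ab bc) /eqP; rewrite subr_eq => /eqP ->.
rewrite addrC; congr (_ + _).
rewrite Rintegral_itv_obnd_cbnd //.
apply: (@L1_sub _ _ b c) hg => //.
by apply: subset_itvr; rewrite bnd_simp.
Qed.

Lemma Rint_empty g a b : b <= a -> \int[mu]_(s in `[a, b]) g s = 0.
Proof.
rewrite le_eqVlt => /predU1P[->|ba]; first by rewrite set_itv1 Rintegral_set1.
by rewrite set_itv_ge ?Rintegral_set0 // bnd_simp -ltNge.
Qed.

Lemma primB g a b : L1 g -> a <= b -> prim g b - prim g a = \int[mu]_(s in `[a, b]) g s.
Proof.
move=> hg ab; rewrite /prim.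
have [a0|a0] := leP 0 a; have [b0|b0] := leP 0 b.
- rewrite !(Rint_empty g (a:=_) (b:=0)) // (Rint_split hg a0 ab).
  ring.
- lra.
- rewrite (Rint_empty g (ltW a0)) (Rint_empty g b0) (Rint_split hg (ltW a0) b0).
  ring.
- rewrite (Rint_empty g (ltW a0)) (Rint_empty g (ltW b0)) (Rint_split hg ab (ltW b0)).
  ring.
Qed.

Lemma prim0 g : prim g 0 = 0.
Proof. by rewrite /prim subrr. Qed.

Lemma eq_prim g h : {ae mu, forall x, g x = h x} -> measurable_fun setT g ->
  measurable_fun setT h -> prim g =1 prim h.
Proof.
move=> gh mg mh x; rewrite /prim.
have H a b : \int[mu]_(s in `[a, b]) g s = \int[mu]_(s in `[a, b]) h s.
  by apply: Rint_eq_ae => //; [exact: measurable_funTS..|apply: aeS gh => y ->].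
by rewrite !H.
Qed.

Lemma primD g h x : L1 g -> L1 h -> prim (fun s => g s + h s) x = prim g x + prim h x.
Proof.
by move=> hg hh; rewrite /prim !RintegralD //; [ring|exact: L1_itv..].
Qed.

Lemma primBf g h x : L1 g -> L1 h -> prim (fun s => g s - h s) x = prim g x - prim h x.
Proof.
by move=> hg hh; rewrite /prim !RintegralB //; [ring|exact: L1_itv..].
Qed.

Lemma primZ k g x : L1 g -> prim (fun s => k * g s) x = k * prim g x.
Proof.
by move=> hg; rewrite /prim !RintegralZl //; [ring|exact: L1_itv..].
Qed.

Lemma prim_cst k x : prim (fun=> k) x = k * x.
Proof.
rewrite /prim; have [x0|x0] := leP 0 x.
  by rewrite (Rint_empty (fun=> k) x0) Rint_cst // !subr0.
rewrite (Rint_empty (fun=> k) (ltW x0)) (Rint_cst _ (ltW x0)); ring.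
Qed.

Lemma within_continuous_prim g a b : L1 g -> {within `[a, b], continuous (prim g)}.
Proof.
move=> hg; have [ab|ba] := leP a b; last first.
  by rewrite set_itv_ge ?bnd_simp -?ltNge //; exact: continuous_subspace0.
have := parameterized_integral_continuous ab (L1_itv a b hg).
set F := parameterized_integral _ _ ^~ _ => cF.
have cG : {within `[a, b], continuous (fun x => F x + prim g a)}.
  move=> x; apply: cvgD; [exact: cF|exact: cvg_cst].
apply: subspace_eq_continuous cG => x; rewrite inE /= in_itv /= => /andP[ax xb].
have : F x = prim g x - prim g a by rewrite (primB hg ax).
by rewrite /from_subspace => ->; rewrite subrK.
Qed.

Lemma continuous_prim g : L1 g -> continuous (prim g).
Proof.
move=> hg x; have /continuous_within_itvP := within_continuous_prim (a:=x - 1) (b:=x + 1) hg.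
have lt : x - 1 < x + 1 by lra.
move=> /(_ lt)[h _ _]; apply: h; rewrite in_itv /=; apply/andP; split; lra.
Qed.

Lemma measurable_prim g : L1 g -> measurable_fun setT (prim g).
Proof. by move=> hg; apply: continuous_measurable_fun; exact: continuous_prim. Qed.

Lemma L1_locally_integrable g : L1 g -> locally_integrable setT g.
Proof.
move=> hg; split => //; [exact: hg.1|exact: openT|].
move=> K _ cK; have [n hn] := compact_sub_box1 cK.
have mK : measurable K by exact: compact_measurable.
by have /integrableP[] : rint mu K g by apply: (L1b_rint _ hg _ hn) => //; exact: measurable_box1.
Qed.

(** Lebesgue differentiation: almost everywhere to the right of -n the function is the derivative of
    its integral from -n, and that integral vanishes identically. Letting n run covers the line. *)
Lemma L1_eq0 g : L1 g -> (forall a b, a <= b -> \int[mu]_(s in `[a, b]) g s = 0) ->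
  {ae mu, forall x, g x = 0}.
Proof.
move=> hg h0.
have H n : {ae mu, forall x, - n%:R < x -> g x = 0}.
  have i y : mu.-integrable [set` Interval (BLeft (- n%:R)) (BRight y)] (EFin \o g).
    exact: (L1_itv _ _ hg).
  have := FTC1 i (L1_locally_integrable hg).
  apply: aeS => x /= + nx.
  have lt : ((- n%:R)%:E < (x : R)%:E)%E by rewrite lte_fin.
  move=> /(_ lt)[_ <-].
  rewrite [X in X^`()%classic](_ : _ = cst 0) ?derive1_cst //.
  apply/funext => y /=; have [ny|yn] := leP (- n%:R) y; first exact: h0.
  by rewrite Rint_empty // ltW.
have := ae_foralln H; apply: aeS => x hx.
apply: (hx (Num.truncn `|x|).+1).
by have := truncnS_gt `|x|; move=> /ltr_normlP[]; rewrite ltrNl.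
Qed.

(** Continuity of [prim g] reduces the test to rational endpoints. The countable form is needed when
    each test holds only outside its own null set, as on the slices in [P1_eq0_tensor]. *)
Lemma L1_eq0_rat g : L1 g ->
  (forall a b : rat, ratr a <= ratr b :> R -> \int[mu]_(s in `[ratr a, ratr b]) g s = 0) ->
  {ae mu, forall x, g x = 0}.
Proof.
move=> hg h0; apply: L1_eq0 => // a b ab; rewrite -primB //.
suff H x : prim g x = 0 by rewrite !H subrr.
apply: contrapT => /eqP nz.
have O : open [set y : R | prim g y != 0].
  rewrite (_ : [set _ | _] = prim g @^-1` [set z | z != 0]) //.
  by apply: open_comp; [move=> ? _; exact: continuous_prim|exact: open_neq].
have [y [/= ny [q _ qy]]] := @dense_rat R _ (ex_intro _ x nz) O.
move: ny; rewrite -qy => /eqP; apply.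
have [q0|q0] := leP 0 (ratr q : R).
  have := h0 0 q; rewrite rmorph0 => /(_ q0); rewrite -primB // prim0 subr0 //.
have := h0 q 0; rewrite rmorph0 => /(_ (ltW q0)); rewrite -primB ?ltW // prim0 sub0r => /eqP.
by rewrite oppr_eq0 => /eqP.
Qed.

End Primitive.

(** * Smooth functions and test functions *)

Section Smooth.
Context {R : realType}.

(** [smooth] quantifies over all finite lists of directions. Instead of an induction on lists, each
    smoothness proof below names a class of functions closed under directional derivatives. *)
Lemma smooth_coind (V : normedModType R) (P : (V -> R) -> Prop) :
  (forall f, P f -> continuous f) ->
  (forall f, P f -> forall x v, derivable f x v) ->
  (forall f, P f -> forall v, P ('D_v f)) ->
  forall f, P f -> smooth f.
Proof.
move=> Pc Pd PD f Pf s.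
have Ps : P (iter_derive s f) by elim: s => //= v s IH; exact: PD.
by split; [exact: Pc|exact: Pd].
Qed.

Lemma smooth_continuous (V : normedModType R) (f : V -> R) : smooth f -> continuous f.
Proof. by move=> /(_ [::]) []. Qed.

Lemma smooth_derivable (V : normedModType R) (f : V -> R) x v : smooth f -> derivable f x v.
Proof. by move=> /(_ [::]) []. Qed.

Lemma smooth_derive (V : normedModType R) (f : V -> R) v : smooth f -> smooth ('D_v f).
Proof.
move=> sf s; rewrite (_ : iter_derive s ('D_v f) = iter_derive (rcons s v) f).
  exact: sf.
by rewrite /iter_derive foldr_rcons.
Qed.

(** The class in which Leibniz's rule keeps all derivatives of a product. *)
Inductive prod_span (V : normedModType R) : (V -> R) -> Prop :=
| prod_span_mul f g : smooth f -> smooth g -> prod_span (fun x => f x * g x)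
| prod_span_add f g : prod_span f -> prod_span g -> prod_span (fun x => f x + g x).

Lemma smoothM (V : normedModType R) (f g : V -> R) : smooth f -> smooth g ->
  smooth (fun x => f x * g x).
Proof.
move=> sf sg; apply: (@smooth_coind V (@prod_span V)); last exact: prod_span_mul.
- move=> h; elim=> [{}f {}g {}sf {}sg|h1 h2 _ c1 _ c2] x.
    by apply: cvgM; exact: smooth_continuous.
  by apply: cvgD; [exact: c1|exact: c2].
- move=> h; elim=> [{}f {}g {}sf {}sg|h1 h2 _ c1 _ c2] x v.
    by apply: derivableM; exact: smooth_derivable.
  by apply: derivableD; [exact: c1|exact: c2].
- move=> h Ph v; suff : (forall x, derivable h x v) /\ prod_span ('D_v h) by case.
  elim: Ph => [{}f {}g {}sf {}sg|h1 h2 _ [d1 p1] _ [d2 p2]]; split.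
  + by move=> x; apply: derivableM; exact: smooth_derivable.
  + rewrite (_ : 'D_v _ = fun x => f x * 'D_v g x + 'D_v f x * g x).
      exact: (prod_span_add (prod_span_mul sf (smooth_derive v sg)) (prod_span_mul (smooth_derive v sf) sg)).
    apply/funext => x; rewrite [LHS]deriveM; [|exact: smooth_derivable..].
    by congr (_ + _); rewrite mulrC.
  + by move=> x; exact: derivableD.
  + rewrite (_ : 'D_v _ = fun x => 'D_v h1 x + 'D_v h2 x); first exact: prod_span_add.
    by apply/funext => x; rewrite [LHS]deriveD.
Qed.

Lemma derive_fst (f : R -> R) (v y : R * R) :
  'D_v (fun u : R * R => f u.1) y = 'D_(v.1) f y.1.
Proof. by []. Qed.

Lemma derive_snd (f : R -> R) (v y : R * R) :
  'D_v (fun u : R * R => f u.2) y = 'D_(v.2) f y.2.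
Proof. by []. Qed.

Lemma derivable_fst (f : R -> R) (v y : R * R) : derivable f y.1 v.1 ->
  derivable (fun u : R * R => f u.1) y v.
Proof. by []. Qed.

Lemma derivable_snd (f : R -> R) (v y : R * R) : derivable f y.2 v.2 ->
  derivable (fun u : R * R => f u.2) y v.
Proof. by []. Qed.

Lemma smooth_fst (f : R -> R) : smooth f -> smooth (fun u : R * R => f u.1).
Proof.
move=> sf; apply: (@smooth_coind _ (fun g => exists2 f : R -> R, smooth f & g = fun u : R * R => f u.1)).
- move=> _ [g sg ->] x; apply: continuous_comp; [exact: cvg_fst|exact: smooth_continuous].
- by move=> _ [g sg ->] x v; apply: derivable_fst; exact: smooth_derivable.
- by move=> _ [g sg ->] v; exists ('D_(v.1) g); [exact: smooth_derive|apply/funext => y; exact: derive_fst].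
by exists f.
Qed.

Lemma smooth_snd (f : R -> R) : smooth f -> smooth (fun u : R * R => f u.2).
Proof.
move=> sf; apply: (@smooth_coind _ (fun g => exists2 f : R -> R, smooth f & g = fun u : R * R => f u.2)).
- move=> _ [g sg ->] x; apply: continuous_comp; [exact: cvg_snd|exact: smooth_continuous].
- by move=> _ [g sg ->] x v; apply: derivable_snd; exact: smooth_derivable.
- by move=> _ [g sg ->] v; exists ('D_(v.2) g); [exact: smooth_derive|apply/funext => y; exact: derive_snd].
by exists f.
Qed.

Lemma derive_dir (f : R -> R) x v : derivable f x 1 ->
  derivable f x v /\ 'D_v f x = v * 'D_1 f x.
Proof.
move=> /derivable1_diffP df; split; first exact: diff_derivable.
by rewrite !deriveE // -{1}(mulr1 v) -[v * 1]/(v *: 1) linearZ.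
Qed.

(** A direction on the line is a scalar v, and the derivative along v is v times the one along 1;
    closure under one derivative and under scaling therefore suffices. *)
Lemma smooth_coind1 (P : (R -> R) -> Prop) :
  (forall f, P f -> forall x, derivable f x 1) ->
  (forall f, P f -> P ('D_1 f)) ->
  (forall k f, P f -> P (fun x => k * f x)) ->
  forall f, P f -> smooth f.
Proof.
move=> Pd PD PZ; apply: smooth_coind.
- by move=> f Pf x; apply: differentiable_continuous; apply/derivable1_diffP; exact: Pd.
- by move=> f Pf x v; have [] := derive_dir v (Pd _ Pf x).
- move=> f Pf v; rewrite (_ : 'D_v f = fun x => v * 'D_1 f x); first exact/PZ/PD.
  by apply/funext => x; have [] := derive_dir v (Pd _ Pf x).
Qed.

Lemma smoothZ k (f : R -> R) : smooth f -> smooth (fun x => k * f x).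
Proof.
move=> sf; apply: (smooth_coind1 (P := fun g => exists k (f : R -> R), smooth f /\ g = fun x => k * f x)); last by exists k, f.
- by move=> _ [l [g [sg ->]]] x; apply: derivableM => //; exact: smooth_derivable.
- move=> _ [l [g [sg ->]]]; exists l, ('D_1 g); split; first exact: smooth_derive.
  apply/funext => x; rewrite (deriveM (f := cst l)) //; last exact: smooth_derivable.
  by rewrite derive_cst scaler0 addr0.
- by move=> l _ [j [g [sg ->]]]; exists (l * j), g; split => //; apply/funext => x; rewrite mulrA.
Qed.

Lemma smooth_affine (f : R -> R) (a b : R) : smooth f -> smooth (fun x => f (a * x + b)).
Proof.
move=> sf; apply: (smooth_coind1 (P := fun g => exists k (f : R -> R), smooth f /\ g = fun x => k * f (a * x + b))).
- move=> _ [l [g [sg ->]]] x; apply: derivableM => //.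
  apply/derivable1_diffP/differentiable_comp; last exact/derivable1_diffP/smooth_derivable.
  by apply: differentiableD => //; exact: differentiableM.
- move=> _ [l [g [sg ->]]]; exists (l * a), ('D_1 g); split; first exact: smooth_derive.
  apply/funext => x.
  have dg : is_derive (a * x + b) (1 : R) g ('D_1 g (a * x + b)).
    by apply: DeriveDef => //; exact: smooth_derivable.
  have da : is_derive x (1 : R) (fun x : R => a * x + b) (a : R).
    have h := is_deriveD (@is_deriveZ R R R id a x 1 1 (is_derive_id x 1)) (is_derive_cst b x 1).
    by apply: (is_derive_eq h); rewrite addr0 /GRing.scale /= mulr1.
  have := is_derive1_comp (g := fun x => a * x + b) dg.
  move=> /(_ a da) h.
  rewrite (deriveM (f := cst l)) //.
  by rewrite derive_cst scaler0 addr0; case: h => _ ->; rewrite /GRing.scale /=; ring.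
- by move=> l _ [j [g [sg ->]]]; exists (l * j), g; split => //; apply/funext => x; rewrite mulrA.
by exists 1, f; split => //; apply/funext => x; rewrite mul1r.
Qed.

Inductive lin_span (V : normedModType R) : (V -> R) -> Prop :=
| lin_span_smooth f : smooth f -> lin_span f
| lin_span_lin a b f g : lin_span f -> lin_span g -> lin_span (fun x => a * f x + b * g x).

Lemma smooth_lincomb (V : normedModType R) a b (f g : V -> R) :
  smooth f -> smooth g -> smooth (fun x => a * f x + b * g x).
Proof.
move=> sf sg; apply: (@smooth_coind V (@lin_span V)); last first.
- by apply: lin_span_lin; exact: lin_span_smooth.
- move=> h Ph v; suff : (forall x, derivable h x v) /\ lin_span ('D_v h) by case.
  elim: Ph => [{}f {}sf|c d h1 h2 _ [d1 p1] _ [d2 p2]]; split.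
  + by move=> x; exact: smooth_derivable.
  + exact/lin_span_smooth/smooth_derive.
  + move=> x; apply: derivableD; apply: derivableM; [exact: derivable_cst|exact: d1|exact: derivable_cst|exact: d2].
  + rewrite (_ : 'D_v _ = fun x => c * 'D_v h1 x + d * 'D_v h2 x); first exact: lin_span_lin.
    apply/funext => x.
    have e1 := deriveM (derivable_cst c x v) (d1 x).
    have e2 := deriveM (derivable_cst d x v) (d2 x).
    rewrite derive_cst scaler0 addr0 in e1; rewrite derive_cst scaler0 addr0 in e2.
    have m1 := derivableM (derivable_cst c x v) (d1 x).
    have m2 := derivableM (derivable_cst d x v) (d2 x).
    by rewrite [LHS](deriveD m1 m2) e1 e2.
- move=> h; elim=> [{}f {}sf|c d h1 h2 _ c1 _ c2] x v; first exact: smooth_derivable.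
  by apply: derivableD; apply: derivableM; [exact: derivable_cst|exact: c1|exact: derivable_cst|exact: c2].
- move=> h; elim=> [{}f {}sf|c d h1 h2 _ c1 _ c2] x; first exact: smooth_continuous.
  by apply: cvgD; apply: cvgM; [exact: cvg_cst|exact: c1|exact: cvg_cst|exact: c2].
Qed.

End Smooth.

Section TestFunctionTheory.
Context {R : realType} {V : normedModType R}.
Implicit Types f : V -> R.

Lemma test_function_eq0 f x : ~ closure [set y | f y != 0] x -> f x = 0.
Proof.
by move=> nx; apply: contrapT => /eqP fx; apply: nx; exact: subset_closure.
Qed.

Lemma test_function_derive f v : test_function f -> test_function ('D_v f).
Proof.
move=> [sf cf]; split; first exact: smooth_derive.
apply: (subclosed_compact _ cf); first exact: closed_closure.
have : closed (closure [set y | f y != 0]) by exact: closed_closure.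
move=> cl; rewrite closureE => x; apply; split => // y /= /eqP Dy.
apply: contrapT => ny; apply: Dy.
rewrite (near_eq_derive (g := cst 0)) ?derive_cst //.
have : nbhs y (~` closure [set y | f y != 0]).
  by apply: open_nbhs_nbhs; split => //; exact: closed_openC.
by apply: filterS => z; exact: test_function_eq0.
Qed.

Lemma test_function_bounded f : test_function f -> exists M, forall x, `|f x| <= M.
Proof.
move=> [sf cf].
have : compact (f @` closure [set y | f y != 0]).
  apply: continuous_compact => //.
  exact/continuous_subspaceT/smooth_continuous.
move=> /compact_bounded [M [_ hM]].
exists (Num.max 0 (M + 1)) => x.
have [cx|nx] := pselect (closure [set y | f y != 0] x).
  by rewrite le_max; apply/orP; right; apply: hM; [rewrite ltrDl|exists x].
by rewrite (test_function_eq0 nx) normr0 le_max lexx.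
Qed.

Lemma test_function_lincomb a b f g : test_function f -> test_function g ->
  test_function (fun x => a * f x + b * g x).
Proof.
move=> [sf cf] [sg cg]; split; first exact: smooth_lincomb.
apply: (subclosed_compact _ (compactU cf cg)); first exact: closed_closure.
rewrite -closureU; apply: closure_subset => x /= h.
have [fx|fx] := eqVneq (f x) 0; last by left.
by right; apply: contra_neq h => gx; rewrite fx gx !mulr0 addr0.
Qed.

End TestFunctionTheory.

(** * Flat functions and bump functions *)

Section Flat.
Context {R : realType}.
Implicit Types p : {poly R}.

(* All derivatives of [exp (- 1 / x)] are of the form [p (1 / x) * exp (- 1 / x)], with [p] a polynomial. *)
Definition flat p (x : R) : R := if 0 < x then p.[x^-1] * expR (- x^-1) else 0.

(** One term of the exponential series, $y^{n+1}/(n+1)!\le e^y$, with one power of y moved to the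
    right. In terms of x = 1/y the bound is linear in x, which is the decay needed at 0. *)
Lemma expRN_exprn_le (n : nat) (y : R) : 0 < y ->
  y ^+ n * expR (- y) <= n.+1`!%:R * y^-1.
Proof.
move=> y0; rewrite expRN ler_pdivrMr ?expR_gt0 // -mulrA.
have := expR_ge1Dxn n (ltW y0).
have f0 : 0 < n.+1`!%:R :> R by rewrite ltr0n fact_gt0.
set E := expR y => h.
have h' : y ^+ n.+1 <= n.+1`!%:R * E.
  by rewrite mulrC -ler_pdivrMr //; apply: le_trans h; rewrite lerDr.
rewrite -(ler_pM2l y0) -exprS (le_trans h') //.
by rewrite mulrCA mulVKf ?gt_eqF.
Qed.

Lemma flat_bound p : exists C, forall x, `|flat p x| <= C * `|x|.
Proof.
exists (\sum_(i < size p) `|p`_i| * i.+1`!%:R) => x; rewrite /flat.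
have C0 : 0 <= \sum_(i < size p) `|p`_i| * i.+1`!%:R.
  by apply: sumr_ge0 => i _; rewrite mulr_ge0.
case: ifPn => x0; last by rewrite normr0 mulr_ge0.
have y0 : 0 < x^-1 by rewrite invr_gt0.
rewrite horner_coef mulr_suml mulr_suml (gtr0_norm x0).
apply: le_trans (ler_norm_sum _ _ _) _; apply: ler_sum => i _.
rewrite -mulrA normrM -mulrA ler_wpM2l // ger0_norm; last first.
  by rewrite mulr_ge0 ?expR_ge0 // exprn_ge0 // ltW.
by have := expRN_exprn_le i y0; rewrite invrK.
Qed.

Lemma flat_cvg0 p : flat p x @[x --> 0^'] --> (0 : R).
Proof.
have [C hC] := flat_bound p.
apply: norm_cvg0; apply: (squeeze_cvgr (f := cst 0) (h := fun x => C * `|x|)).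
- by near=> x; rewrite normr_ge0 hC.
- exact: cvg_cst.
- apply: cvg_within_filter.
  have h : C * `|x| @[x --> (0 : R)] --> C * `|0 : R|.
    by apply: cvgM; [exact: cvg_cst|apply: cvg_norm; exact: cvg_id].
  by rewrite normr0 mulr0 in h.
Unshelve. all: by end_near. Qed.

Lemma is_derive_flat p (x : R) :
  is_derive x (1 : R) (flat p) (flat ('X^2 * (p - p^`())) x).
Proof.
have [x0|x0|<-] := ltgtP 0 x.
- apply: (@near_eq_is_derive R R R (fun y : R => p.[y^-1] * expR (- y^-1)) (flat p)).
    near=> y; rewrite /flat ifT //; near: y; exact: lt_nbhsr.
  rewrite {1}/flat x0.
  have xn : x != 0 by rewrite gt_eqF.
  have d1 : is_derive x (1 : R) (fun y : R => y^-1) (- x ^- 2 : R).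
    have h := @is_deriveV R id x 1 1 xn (is_derive_id x 1).
    by apply: is_derive_eq; rewrite /GRing.scale /= mulr1.
  have dp : is_derive (x^-1) (1 : R) (horner p) (p^`()).[x^-1].
    by apply: DeriveDef; [exact: derivable_horner|rewrite derivE derive1E].
  have d2 := @is_derive1_comp R (horner p) _ x _ _ dp d1.
  have d3 := @is_derive1_comp R expR (fun y : R => - y^-1) x _ _ (is_derive_expR _) (is_deriveN d1).
  have := is_deriveM d2 d3.
  move=> h; apply: (is_derive_eq h) => /=.
  by rewrite /GRing.scale /= !hornerE /=; field.
- apply: (@near_eq_is_derive R R R (cst 0) (flat p)).
    near=> y; rewrite /flat ifF //; apply/negbTE; rewrite -leNgt; apply/ltW.
    near: y; exact: lt_nbhsl.
  rewrite {1}/flat ltNge (ltW x0) /=; exact: is_derive_cst.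
(* At 0 the difference quotient is again a flat function: dividing by h multiplies the polynomial in
   1/h by its variable, so [flat_cvg0] applies to [p * 'X]. *)
- have c : h^-1 *: ((flat p \o shift 0) (h *: (1 : R)) - flat p 0) @[h --> 0^'] --> (0 : R).
    apply: cvg_trans (flat_cvg0 (p * 'X)).
    apply: near_eq_cvg; near=> h.
    have hn : h != 0 by near: h; exact: nbhs_dnbhs_neq.
    rewrite /flat /= addr0 /GRing.scale /= mulr1 ltxx subr0.
    by case: ifP => _; rewrite ?mulr0 // hornerMX; ring.
  have -> : flat ('X^2 * (p - p^`())) 0 = 0 by rewrite /flat ltxx.
  apply: DeriveDef; first by apply/cvg_ex; exists 0.
  exact: cvg_lim c.
Unshelve. all: by end_near. Qed.

Lemma smooth_flat p : smooth (flat p).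
Proof.
apply: (smooth_coind1 (P := fun g => exists p, g = flat p)); last by exists p.
- by move=> _ [r ->] x; have [] := is_derive_flat r x.
- move=> _ [r ->]; exists ('X^2 * (r - r^`())).
  by apply/funext => x; have [] := is_derive_flat r x.
- move=> k _ [r ->]; exists (k *: r); apply/funext => x; rewrite /flat.
  by case: ifP => _; rewrite ?mulr0 // hornerZ mulrA.
Qed.

Lemma flat1_ge0 x : 0 <= flat 1 x.
Proof. by rewrite /flat; case: ifP => // _; rewrite hornerC mul1r expR_ge0. Qed.

Lemma flat1_le1 x : flat 1 x <= 1.
Proof.
rewrite /flat; case: ifP => // x0.
by rewrite hornerC mul1r expR_le1 oppr_le0 invr_ge0 ltW.
Qed.

(** A smooth function that vanishes outside ]a, b[. The index n sharpens it: the bumps converge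
    pointwise to 1 on ]a, b[, so test functions can recover integrals over intervals. *)
Definition bump (n : nat) (a b x : R) : R :=
  flat 1 (n.+1%:R * x + (- (n.+1%:R * a))) * flat 1 ((- n.+1%:R) * x + n.+1%:R * b).

Lemma bump_eq0 n a b x : x \notin `]a, b[ -> bump n a b x = 0.
Proof.
have n0 : 0 < n.+1%:R :> R by rewrite ltr0n.
rewrite in_itv /= negb_and -!leNgt /bump /flat => /orP[xa|bx].
  by rewrite ifF ?mul0r //; apply/negbTE; rewrite -leNgt; nra.
by rewrite [X in _ * X]ifF ?mulr0 //; apply/negbTE; rewrite -leNgt; nra.
Qed.

Lemma bump_bound n a b x : 0 <= bump n a b x <= 1.
Proof.
rewrite /bump mulr_ge0 ?flat1_ge0 //=.
by rewrite -[leRHS]mulr1 ler_pM ?flat1_ge0 ?flat1_le1.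
Qed.

Lemma bump_cvg a b x : x \in `]a, b[ -> bump n a b x @[n --> \oo] --> (1 : R).
Proof.
rewrite in_itv /= => /andP[ax xb].
have H t : 0 < t -> flat 1 (n.+1%:R * t) @[n --> \oo] --> (1 : R).
  move=> t0; rewrite /flat.
  under eq_fun do rewrite mulr_gt0 // hornerC mul1r invfM.
  have h : expR (- (n.+1%:R^-1 / t)) @[n --> \oo] --> expR (- (0 / t)).
    apply: (@cvg_comp _ _ _ (fun n => - (n.+1%:R^-1 / t)) expR _ (nbhs (- (0 / t)))).
      by apply: cvgN; apply: cvgM; [exact: cvg_harmonic|exact: cvg_cst].
    exact: continuous_expR.
  by rewrite mul0r oppr0 expR0 in h.
rewrite -[X in _ --> X](mulr1 1); apply: cvgM.
  have h := H (x - a); rewrite subr_gt0 in h; have {h} := h ax.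
  by under eq_fun do rewrite mulrBr.
have h := H (b - x); rewrite subr_gt0 in h; have {h} := h xb.
by under eq_fun do rewrite mulrBr addrC -mulNr.
Qed.

Lemma bump_gt0 n a b x : x \in `]a, b[ -> 0 < bump n a b x.
Proof.
rewrite in_itv /= => /andP[ax xb]; have n0 : 0 < n.+1%:R :> R by rewrite ltr0n.
by rewrite /bump /flat !ifT ?hornerC ?mul1r ?mulr_gt0 ?expR_gt0 //; nra.
Qed.

Lemma test_function_bump n a b : test_function (bump n a b).
Proof.
split; first by apply: smoothM; exact/smooth_affine/smooth_flat.
apply: (subclosed_compact _ (segment_compact (a:=a) (b:=b))); first exact: closed_closure.
have cl : closed `[a, b]%classic by exact: interval_closed.
rewrite [X in X `<=` _]closureE => x; apply; split => // y /= /eqP.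
move=> h; apply: contrapT => ny; apply: h; apply: bump_eq0; apply/negP => yab; apply: ny.
exact: subset_itv_oo_cc yab.
Qed.

End Flat.

(** * Integration in the plane *)

Section PlaneAliases.
Context {R : realType}.
Local Notation mu2 := (@lebesgue2 R).
Implicit Types f g : R * R -> R.

Definition box2 (n : nat) : set (R * R) := box1 n `*` box1 n.

Lemma measurable_box2 n : measurable (box2 n).
Proof. by apply: measurableX; exact: measurable_box1. Qed.

Lemma mu_box2 n : (mu2 (box2 n) < +oo)%E.
Proof.
rewrite /box2 /lebesgue2 product_measure1E; [|exact: measurable_box1..].
by rewrite lte_mul_pinfty // ?ge0_fin_numE // mu_box1.
Qed.

Notation P1 := (L1b mu2 box2).
Notation P2 := (L2b mu2 box2).

Definition P1D f g (hf : P1 f) (hg : P1 g) := @L1bD _ _ _ mu2 box2 measurable_box2 f g hf hg.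
Definition P1B f g (hf : P1 f) (hg : P1 g) := @L1bB _ _ _ mu2 box2 measurable_box2 f g hf hg.
Definition P1Z k f (hf : P1 f) := @L1bZ _ _ _ mu2 box2 measurable_box2 k f hf.
Definition P1_sum (I : Type) (s : seq I) (F : I -> R * R -> R) (hF : forall i, P1 (F i)) :=
  @L1b_sum _ _ _ mu2 box2 measurable_box2 mu_box2 I s F hF.
Definition P1M_bounded f g M mg gM (hf : P1 f) := @L1bM_bounded _ _ _ mu2 box2 measurable_box2 f g M mg gM hf.
Definition P2M f g (hf : P2 f) (hg : P2 g) := @L2bM _ _ _ mu2 box2 measurable_box2 f g hf hg.
Definition P2_cst k := @L2b_cst _ _ _ mu2 box2 measurable_box2 mu_box2 k.
Definition P2_L1 f (hf : P2 f) := @L2b_L1b _ _ _ mu2 box2 measurable_box2 mu_box2 f hf.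
Definition P2Z k f (hf : P2 f) := @L2bZ _ _ _ mu2 box2 measurable_box2 k f hf.
Definition P2B f g (hf : P2 f) (hg : P2 g) := @L2bB _ _ _ mu2 box2 measurable_box2 f g hf hg.
Definition P2_sum (I : Type) (s : seq I) (F : I -> R * R -> R) (hF : forall i, P2 (F i)) :=
  @L2b_sum _ _ _ mu2 box2 measurable_box2 mu_box2 I s F hF.
Definition P2_eq_ae f g mg fg (hf : P2 f) := @L2b_eq_ae _ _ _ mu2 box2 measurable_box2 f g mg fg hf.

End PlaneAliases.

Notation P1 := (L1b lebesgue2 box2).
Notation P2 := (L2b lebesgue2 box2).

Section RealFubini.
Context {R : realType}.
Local Notation mu := (@lebesgue_measure R).
Local Notation mu2 := (@lebesgue2 R).
Implicit Types (f : R * R -> R) (A B : set R).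

Lemma patch_prod f A B x z : (f \_ (A `*` B)) (x, z) =
  ((fun x => (fun z => f (x, z)) \_ B) \_ A) x z.
Proof.
rewrite !patchE; case: ifPn => [|/negP h].
  by rewrite inE => -[Ax Bz]; rewrite !mem_set //= patchE mem_set.
case: ifPn => // xA; rewrite patchE; case: ifPn => // zB.
by exfalso; apply: h; rewrite inE; split; exact/set_mem.
Qed.

Lemma rint_setX_patch f A B : measurable A -> measurable B ->
  rint mu2 (A `*` B) f -> mu2.-integrable setT (EFin \o (f \_ (A `*` B))).
Proof. by move=> mA mB /rint_restrict h; apply: h; exact: measurableX. Qed.

Lemma rint_fubini_ae f A B : measurable A -> measurable B ->
  rint mu2 (A `*` B) f ->
  {ae mu, forall x, A x -> rint mu B (fun z => f (x, z))}.
Proof.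
move=> mA mB /(rint_setX_patch mA mB) /ae_integrable1.
apply: aeS => x h Ax; apply/rint_restrict => //.
apply: eq_integrable h => // z _ /=.
by rewrite patch_prod patchE mem_set.
Qed.

Lemma Rint_patchE f A B x : \int[mu]_z (f \_ (A `*` B)) (x, z) =
  ((fun x => \int[mu]_(z in B) f (x, z)) \_ A) x.
Proof.
rewrite patchE; case: ifPn => xA; last first.
  rewrite (_ : (fun z => _) = cst 0); first by rewrite Rintegral_cst ?mul0r.
  by apply/funext => z; rewrite patch_prod patchE (negbTE xA).
rewrite [RHS]Rintegral_mkcond; apply: eq_Rintegral => z _.
by rewrite patch_prod patchE xA.
Qed.

Lemma rint_fubini f A B : measurable A -> measurable B ->
  rint mu2 (A `*` B) f -> rint mu A (fun x => \int[mu]_(z in B) f (x, z)).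
Proof.
move=> mA mB h; have h' := rint_setX_patch mA mB h.
have hF := integrable_fubini_F h'.
apply/rint_restrict => //.
have e : (fun x => \int[mu]_(z in B) f (x, z)) \_ A =
    fine \o fubini_F mu (EFin \o (f \_ (A `*` B))).
  by apply/funext => x; rewrite -Rint_patchE.
rewrite e; apply/integrableP; split.
  by apply: measurableT_comp => //; apply: measurableT_comp => //; exact: (measurable_int _ hF).
have /integrableP[_ hlt] := hF.
apply: le_lt_trans hlt; apply: ge0_le_integral => //.
- apply: measurableT_comp => //; apply: measurableT_comp => //.
  by apply: measurableT_comp => //; exact: (measurable_int _ hF).
- by apply: measurableT_comp => //; exact: (measurable_int _ hF).
have fine_le (t : \bar R) : (`|(fine t)%:E| <= `|t|)%E.
  by case: t => [r| |] //=; rewrite ?normr0 // leey.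
by move=> x _; exact: fine_le.
Qed.

Lemma Rfubini f A B : measurable A -> measurable B -> rint mu2 (A `*` B) f ->
  \int[mu2]_(y in A `*` B) f y = \int[mu]_(x in A) \int[mu]_(z in B) f (x, z).
Proof.
move=> mA mB h; have h' := rint_setX_patch mA mB h.
rewrite Rintegral_mkcond [RHS]Rintegral_mkcond.
rewrite {1}/Rintegral -(integral12_prod_meas1 h').
have hF := integrable_fubini_F h'.
rewrite /Rintegral; congr fine; apply: ae_eq_integral => //.
- exact: (measurable_int _ hF).
- apply/measurable_EFinP; have /rint_restrict := rint_fubini mA mB h.
  by move=> /(_ mA) /rint_meas.
have := integrable_ae measurableT hF; apply: aeS => x /(_ I) fin _ /=.
rewrite -[RHS]/((_ \_ A) x)%:E -Rint_patchE /Rintegral fineK //.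
Qed.

Definition swap (y : R * R) : R * R := (y.2, y.1).

Lemma measurable_swap : measurable_fun setT swap.
Proof. by apply: measurable_fun_pair; [exact: measurable_snd|exact: measurable_fst]. Qed.

Lemma ge0_integral_swap (f : R * R -> \bar R) : measurable_fun setT f ->
  (forall y, 0 <= f y)%E -> (\int[mu2]_y f (swap y) = \int[mu2]_y f y)%E.
Proof.
move=> mf f0; have ms := measurableT_comp mf measurable_swap.
have e1 := @fubini_tonelli1 _ _ _ _ R mu mu (f \o swap) ms (fun y => f0 _).
have e2 := @fubini_tonelli2 _ _ _ _ R mu mu f mf f0.
by rewrite [LHS]e1 [RHS]e2.
Qed.

Lemma preimage_swap_setX A B : swap @^-1` (A `*` B) = B `*` A.
Proof. by apply/seteqP; split=> -[x z] [/= ? ?]. Qed.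

Lemma integral_swap (D : set (R * R)) (f : R * R -> \bar R) : measurable D ->
  measurable_fun setT f ->
  (\int[mu2]_(y in swap @^-1` D) f (swap y) = \int[mu2]_(y in D) f y)%E.
Proof.
move=> mD mf; have ms := measurableT_comp mf measurable_swap.
rewrite integral_mkcond [RHS]integral_mkcond.
have mfD : measurable_fun setT (f \_ D).
  by apply/(measurable_restrictT _ mD); exact: measurable_funTS.
rewrite (_ : (fun y => f (swap y)) \_ (swap @^-1` D) = fun y => (f \_ D) (swap y)); last first.
  by apply/funext => y; rewrite !patchE; congr (if _ then _ else _); apply/idP/idP; rewrite !inE.
rewrite integralE [RHS]integralE; congr (_ - _)%E.
- by rewrite -(ge0_integral_swap (f := (f \_ D)^\+%E)) //; [apply: eq_integral => x _; rewrite !unlock|exact: measurable_funepos].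
- by rewrite -(ge0_integral_swap (f := (f \_ D)^\-%E)) //; [apply: eq_integral => x _; rewrite !unlock|exact: measurable_funeneg].
Qed.

Lemma Rintegral_swap (D : set (R * R)) f : measurable D -> measurable_fun setT f ->
  \int[mu2]_(y in swap @^-1` D) f (swap y) = \int[mu2]_(y in D) f y.
Proof.
by move=> mD mf; rewrite /Rintegral -[in RHS]integral_swap //; exact/measurable_EFinP.
Qed.

Lemma measurable_fun_swap f : measurable_fun setT f -> measurable_fun setT (f \o swap).
Proof. by move=> mf; exact: (measurableT_comp mf measurable_swap). Qed.

Lemma rint_swap (D : set (R * R)) f : measurable D -> measurable_fun setT f ->
  rint mu2 D f -> rint mu2 (swap @^-1` D) (f \o swap).
Proof.
move=> mD mf /integrableP[_ h]; apply/integrableP; split.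
  by apply/measurable_EFinP; apply: measurable_funTS; exact: measurable_fun_swap.
rewrite -integral_swap // in h.
by apply: measurableT_comp => //; exact/measurable_EFinP.
Qed.

Lemma ae_fubini (P : R * R -> Prop) : {ae mu2, forall y, P y} ->
  {ae mu, forall x, {ae mu, forall z, P (x, z)}}.
Proof.
move=> [N [mN N0 PN]].
have mI : measurable_fun setT (fun y => (\1_N y)%:E : \bar R).
  by apply/measurable_EFinP; exact: measurable_indic.
have I0 : (\int[mu]_x mu (xsection N x) = 0)%E.
  by rewrite -[RHS]N0.
have mS := @measurable_fun_xsection _ _ _ _ _ mu N mN.
have : ae_eq mu setT (mu \o xsection N) (cst 0).
  apply/ae_eq_integral_abs => //.
  by under eq_integral do rewrite gee0_abs //=.
apply: aeS => x /(_ I) /= h; exists (xsection N x); split => //.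
  exact: measurable_xsection.
move=> z /= nP; rewrite /xsection /= inE; exact: PN.
Qed.

Lemma ae_swap (P : R * R -> Prop) : {ae mu2, forall y, P y} ->
  {ae mu2, forall y, P (swap y)}.
Proof.
move=> [N [mN N0 PN]]; exists (swap @^-1` N); split.
- by rewrite -[X in measurable X]setTI; exact: measurable_swap.
- have mS : measurable (swap @^-1` N).
    by rewrite -[X in measurable X]setTI; exact: measurable_swap.
  have h : (\int[mu2]_(y in swap @^-1` N) cst 1%E y = \int[mu2]_(y in N) cst 1%E y)%E.
    exact: (@integral_swap N (cst 1%E) mN (measurable_cst _)).
  move: h; rewrite !integral_cst // !mul1e => {}h; exact: (eq_trans h N0).
- by move=> y nP; exact: PN.
Qed.

(** Converse of [ae_fubini], by Tonelli. It is stated for a measurable set, because null slices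
    alone do not make a set null; users first exhibit a measurable exceptional set. *)
Lemma ae_prod (N : set (R * R)) : measurable N ->
  {ae mu, forall x, {ae mu, forall z, ~ N (x, z)}} -> mu2 N = 0%E.
Proof.
move=> mN h.
have mS := @measurable_fun_xsection _ _ _ _ _ mu N mN.
have -> : mu2 N = (\int[mu]_x mu (xsection N x))%E by [].
rewrite (ae_eq_integral (cst 0)%E) //; first by rewrite integral0.
apply: aeS h => x [M [mM M0 NM]] _ /=; apply/eqP; rewrite -measure_le0 -M0.
apply: le_measure; rewrite ?inE //; first exact: measurable_xsection.
by move=> z; rewrite /xsection /= inE => Nz; apply: NM => /= h; exact: h.
Qed.

End RealFubini.

Section Support.
Context d (T : measurableType d) (R : realType) (mu : {measure set T -> \bar R}).

Lemma Rint_supp (D : set T) (f : T -> R) : (forall x, ~ D x -> f x = 0) ->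
  \int[mu]_x f x = \int[mu]_(x in D) f x.
Proof.
move=> h; rewrite [RHS]Rintegral_mkcond; apply: eq_Rintegral => x _.
by rewrite patchE; case: ifPn => // /negP; rewrite inE; exact: h.
Qed.

Lemma rint_supp (D : set T) (f : T -> R) : measurable D ->
  (forall x, ~ D x -> f x = 0) -> rint mu D f -> rint mu setT f.
Proof.
move=> mD h hf; have := (rint_restrict mu f mD).1 hf; apply: eq_integrable => // x _.
by rewrite /= patchE; case: ifPn => // /negP; rewrite inE => /h ->.
Qed.

End Support.

(** * Weak derivatives on the line *)

Section Line.
Context {R : realType}.
Local Notation mu := (@lebesgue_measure R).
Local Notation mu2 := (@lebesgue2 R).
Implicit Types (f g k w chi phi rho : R -> R) (a b : R).

Lemma continuous_bounded_box1 f n : continuous f ->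
  exists M, forall x, box1 n x -> `|f x| <= M.
Proof.
move=> cf; have : compact (f @` box1 n).
  by apply: continuous_compact; [exact: continuous_subspaceT|exact: segment_compact].
move=> /compact_bounded [M [_ hM]]; exists (M + 1) => x bx.
by apply: hM; [rewrite ltrDl|exists x].
Qed.

Lemma L1M_continuous f g : continuous g -> L1 f -> L1 (fun x => g x * f x).
Proof.
move=> cg hf; split.
  by apply: measurable_funM; [exact: continuous_measurable_fun|exact: hf.1].
move=> n; have [M hM] := continuous_bounded_box1 n cg.
apply: (@rint_bounded_mul _ _ _ mu (box1 n) f g M _ _ hM (hf.2 n)); first exact: measurable_box1.
by apply: measurable_funTS; exact: continuous_measurable_fun.
Qed.

Lemma L1_continuous f : continuous f -> L1 f.
Proof.
move=> cf; have := L1M_continuous cf (L1_cst (1 : R)).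
by under eq_fun do rewrite mulr1.
Qed.

Lemma L2M_continuous f g : continuous g -> L2 f -> L2 (fun x => g x * f x).
Proof.
move=> cg hf; split.
  by apply: measurable_funM; [exact: continuous_measurable_fun|exact: hf.1].
have h := @L1M_continuous (fun x => f x ^+ 2) (fun x => g x ^+ 2) _ (L2b_sq hf).
move=> n; under eq_fun do rewrite exprMn.
by apply: (h _).2 => x; apply: cvgM; exact: cg.
Qed.

Lemma L2_continuous f : continuous f -> L2 f.
Proof.
move=> cf; have := L2M_continuous cf (L2_cst (1 : R)).
by under eq_fun do rewrite mulr1.
Qed.

Lemma test_function_supp1 chi : test_function chi ->
  exists n, forall x, ~ box1 n x -> chi x = 0.
Proof.
move=> [_ /compact_sub_box1 [n hn]]; exists n => x nx.
by apply: test_function_eq0 => /hn.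
Qed.

Lemma rint_test f chi : L1 f -> test_function chi ->
  rint mu setT (fun x => f x * chi x).
Proof.
move=> hf tchi; have [n hn] := test_function_supp1 tchi.
apply: (@rint_supp _ _ _ mu (box1 n) _ (measurable_box1 n)) => [x nx|]; first by rewrite hn ?mulr0.
under eq_fun do rewrite mulrC.
by apply: (L1M_continuous _ hf).2; exact: smooth_continuous tchi.1.
Qed.

Lemma bump_cvg_Rint w a b : L1 w ->
  \int[mu]_x (w x * bump n a b x) @[n --> \oo] --> \int[mu]_(x in `[a, b]) w x.
Proof.
move=> hw.
have E n : \int[mu]_x (w x * bump n a b x) = \int[mu]_(x in `]a, b[) (w x * bump n a b x).
  by apply: Rint_supp => x /= /negP nx; rewrite bump_eq0 ?mulr0.
have mb n : measurable_fun setT (bump n a b).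
  by apply: continuous_measurable_fun; exact: smooth_continuous (test_function_bump n a b).1.
have iw : rint mu `]a, b[ w by apply: (@L1_sub _ _ a b) hw => //; exact: subset_itv_oo_cc.
have -> : \int[mu]_(x in `[a, b]) w x = \int[mu]_(x in `]a, b[) w x.
  rewrite /Rintegral; congr fine; apply: integral_itv_bndoo.
  by apply/measurable_EFinP; exact: rint_meas iw.
under eq_fun do rewrite E.
have iwb n : rint mu `]a, b[ (fun x => w x * bump n a b x).
  by apply: rintS (rint_test hw (test_function_bump n a b)).
have := @dominated_convergence _ _ _ mu `]a, b[%classic (measurable_itv _)
  (fun n x => (w x * bump n a b x)%:E) (EFin \o w) (fun x => `|(w x)%:E|)%E.
case.
- by move=> n; apply/measurable_EFinP; exact: rint_meas (iwb n).
- by apply/measurable_EFinP; exact: rint_meas iw.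
- apply: aeW => x xab.
  have h : w x * bump n a b x @[n --> \oo] --> w x * 1.
    by apply: cvgM; [exact: cvg_cst|exact: bump_cvg].
  by rewrite mulr1 in h; apply/fine_cvgP; split; [exact: nearW|exact: h].
- exact: integrable_abse.
- apply: aeW => x n _; rewrite lee_fin normrM ler_piMr //.
  by have /andP[b0 b1] := bump_bound n a b x; rewrite ger0_norm.
move=> _ _; rewrite integral_Rint // => h.
exact: (fine_cvg h).
Qed.

(** The fundamental lemma of the calculus of variations. Bumps turn vanishing against test functions
    into vanishing of integrals over intervals. *)
Lemma L1_eq0_test w : L1 w ->
  (forall chi, test_function chi -> \int[mu]_x (w x * chi x) = 0) ->
  {ae mu, forall x, w x = 0}.
Proof.
move=> hw h0; apply: L1_eq0 => // a b ab.
have := @bump_cvg_Rint w a b hw.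
rewrite (_ : (fun n => _) = fun=> 0); last first.
  by apply/funext => n; exact/h0/test_function_bump.
by move=> /(cvg_lim (@Rhausdorff R)) <-; exact: lim_cst.
Qed.

Lemma rint_prod_le (F : R * R -> R) g k a b c d : measurable_fun setT F ->
  L1 g -> L1 k -> (forall x z, `[a, b]%classic x -> `[c, d]%classic z -> `|F (x, z)| <= g x * k z) ->
  (forall x, 0 <= g x) -> (forall z, 0 <= k z) ->
  rint mu2 (`[a, b] `*` `[c, d]) F.
Proof.
move=> mF hg hk FM g0 k0.
apply/rint_restrict; first exact: measurableX.
have mP : measurable_fun setT (F \_ (`[a, b] `*` `[c, d])).
  by apply/(measurable_restrictT _ (measurableX _ _)) => //; exact: measurable_funTS.
have mPE : measurable_fun setT (EFin \o (F \_ (`[a, b] `*` `[c, d]))).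
  exact/measurable_EFinP.
apply: (integrable12ltyP mu mu mPE).2.
have ig : rint mu `[a, b] g by exact: L1_itv.
have ik : rint mu `[c, d] k by exact: L1_itv.
have mgp : measurable_fun setT (g \_ `[a, b]).
  by apply/(measurable_restrictT g (measurable_itv _)); exact: measurable_funTS hg.1.
have mkp : measurable_fun setT (k \_ `[c, d]).
  by apply/(measurable_restrictT k (measurable_itv _)); exact: measurable_funTS hk.1.
have rg : rint mu setT (g \_ `[a, b]) by exact: (rint_restrict mu g (measurable_itv _)).1.
have rk : rint mu setT (k \_ `[c, d]) by exact: (rint_restrict mu k (measurable_itv _)).1.
have gp0 x : 0 <= (g \_ `[a, b]) x by rewrite patchE; case: ifP.
have kp0 x : 0 <= (k \_ `[c, d]) x by rewrite patchE; case: ifP.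
pose K := \int[mu]_z (k \_ `[c, d]) z.
apply: (@le_lt_trans _ _ (\int[mu]_x ((g \_ `[a, b]) x * K)%:E)%E); last first.
  rewrite integral_Rint ?ltry //.
  by under eq_fun do rewrite mulrC; exact: rintZ.
apply: ge0_le_integral => //.
- by move=> x _; apply: integral_ge0.
- apply: (@measurable_fun_fubini_tonelli_F _ _ _ _ R mu
    (fun y => `|(F \_ (`[a, b] `*` `[c, d])) y|%:E)) => //.
  by apply/measurable_EFinP; exact: measurableT_comp.
- by apply/measurable_EFinP; apply: measurable_funM.
- move=> x _.
  rewrite EFinM -integral_Rint // -ge0_integralZl //; last 3 first.
  + exact/measurable_EFinP.
  + by move=> z _; rewrite lee_fin.
  + by rewrite lee_fin.
  apply: ge0_le_integral => //.
  + apply: measurableT_comp => //; apply: measurableT_comp mPE _.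
    exact: measurable_fun_pair.
  + by apply: measurable_funeM; exact/measurable_EFinP.
  + move=> z _ /=; rewrite lee_fin patch_prod !patchE.
    case: ifP => xa; last by rewrite normr0 mul0r.
    rewrite patchE; case: ifP => za; last by rewrite normr0 mulr0.
    by apply: FM; exact: set_mem.
Qed.

Lemma measurable_lower : measurable [set y : R * R | y.2 <= y.1].
Proof.
rewrite (_ : [set _ | _] = (fun y : R * R => y.1 - y.2) @^-1` `[0, +oo[%classic).
  rewrite -[X in measurable X]setTI; apply: measurable_funB => //.
by apply/seteqP; split => y /=; rewrite in_itv /= andbT subr_ge0.
Qed.

(** Fubini on the triangle $a\le s\le x\le b$: both sides integrate $k(x)g(s)$ over it. *)
Lemma prim_ibp0 g k a b : L1 g -> L1 k -> a <= b ->
  \int[mu]_(x in `[a, b]) (k x * (prim g x - prim g a)) =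
  \int[mu]_(s in `[a, b]) (g s * (prim k b - prim k s)).
Proof.
move=> hg hk ab.
pose S := [set y : R * R | y.2 <= y.1].
pose F (y : R * R) := \1_S y * (k y.1 * g y.2).
have mF : measurable_fun setT F.
  apply: measurable_funM; first exact: (measurable_indic measurable_lower).
  apply: measurable_funM.
    exact: (measurableT_comp hk.1 measurable_fst).
  exact: (measurableT_comp hg.1 measurable_snd).
have normL1 (h : R -> R) : L1 h -> L1 (fun x => `|h x|).
  move=> hh; split; first by apply: measurableT_comp => //; exact: hh.1.
  by move=> n; have := integrable_norm (hh.2 n).
have iF : rint mu2 (`[a, b] `*` `[a, b]) F.
  apply: (@rint_prod_le F (fun x => `|k x|) (fun x => `|g x|)); [exact: mF|exact: normL1|exact: normL1|move=> x z _ _|by []|by []].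
  rewrite /F !normrM /= ler_piMl ?mulr_ge0 // indicE.
  by case: (_ \in _); rewrite ?normr1 ?normr0.
have := Rfubini (measurable_itv _) (measurable_itv _) iF.
have iF' : rint mu2 (`[a, b] `*` `[a, b]) (F \o swap).
  by rewrite -preimage_swap_setX; apply: rint_swap => //; exact: measurableX.
have := Rfubini (measurable_itv _) (measurable_itv _) iF'.
rewrite -[X in \int[_]_(y in X) _]preimage_swap_setX /=.
have mD : measurable (`[a, b]%classic `*` `[a, b]%classic : set (R * R)) by exact: measurableX.
rewrite (Rintegral_swap mD mF) => -> h.
transitivity (\int[mu]_(x in `[a, b]) \int[mu]_(z in `[a, b]) F (x, z)).
  apply: eq_Rintegral => x; rewrite inE /= in_itv /= => /andP[ax xb].
  rewrite primB // -RintegralZl //; last exact: L1_itv.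
  rewrite Rintegral_mkcond [RHS]Rintegral_mkcond; apply: eq_Rintegral => s _.
  rewrite !patchE /F /S indicE /=.
  have -> : (s \in `[a, x]%classic) = (s \in `[a, b]%classic) && ((x, s) \in [set y : R * R | y.2 <= y.1]).
    apply/idP/andP => [|[]].
      rewrite inE /= in_itv /= => /andP[a_s sx].
      by split; rewrite inE //= in_itv /= a_s (le_trans sx xb).
    by rewrite !inE /= !in_itv /= => /andP[a_s _] sx; apply/andP.
  by case: (s \in _); case: (_ \in _); rewrite ?mul1r ?mul0r.
rewrite -h; apply: eq_Rintegral => s; rewrite inE /= in_itv /= => /andP[a_s sb].
rewrite primB // -RintegralZl //; last exact: L1_itv.
rewrite [LHS]Rintegral_mkcond [RHS]Rintegral_mkcond; apply: eq_Rintegral => x _.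
rewrite !patchE /F /S /swap indicE /=.
have -> : (x \in `[s, b]%classic) = (x \in `[a, b]%classic) && ((x, s) \in [set y : R * R | y.2 <= y.1]).
  apply/idP/andP => [|[]].
    rewrite inE /= in_itv /= => /andP[sx xb].
    by split; rewrite inE //= in_itv /= (le_trans a_s sx).
  by rewrite !inE /= !in_itv /= => /andP[_ xb] sx; apply/andP.
by case: (x \in _); case: (_ \in _); rewrite ?mul1r ?mul0r // mulrC.
Qed.

(** Integration by parts for absolutely continuous functions whose derivatives are merely
    integrable; c and c' are their values at 0. *)
Lemma prim_ibp (c c' : R) g k a b : L1 g -> L1 k -> a <= b ->
  \int[mu]_(x in `[a, b]) ((c + prim g x) * k x) +
  \int[mu]_(x in `[a, b]) (g x * (c' + prim k x)) =
  (c + prim g b) * (c' + prim k b) - (c + prim g a) * (c' + prim k a).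
Proof.
move=> hg hk ab.
have := prim_ibp0 hg hk ab.
have ig : rint mu `[a, b] g by exact: L1_itv.
have ik : rint mu `[a, b] k by exact: L1_itv.
have pk : L1 (fun x => prim k x * g x) by apply: L1M_continuous => //; exact: continuous_prim.
have pg : L1 (fun x => prim g x * k x) by apply: L1M_continuous => //; exact: continuous_prim.
have igk : rint mu `[a, b] (fun x => prim k x * g x) by exact: L1_itv.
have ikg : rint mu `[a, b] (fun x => prim g x * k x) by exact: L1_itv.
have -> : (fun x => k x * (prim g x - prim g a)) = (fun x => prim g x * k x - prim g a * k x).
  by apply/funext => x; ring.
have -> : (fun x => g x * (prim k b - prim k x)) = (fun x => prim k b * g x - prim k x * g x).
  by apply/funext => x; ring.
have -> : (fun x => (c + prim g x) * k x) = (fun x => c * k x + prim g x * k x).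
  by apply/funext => x; ring.
have -> : (fun x => g x * (c' + prim k x)) = (fun x => c' * g x + prim k x * g x).
  by apply/funext => x; ring.
rewrite !RintegralB ?RintegralD //; try exact: rintZ.
rewrite !RintegralZl // -!primB //.
by move=> h; lra.
Qed.

Lemma smooth_of_derive f : (forall x, derivable f x 1) -> smooth ('D_1 f) -> smooth f.
Proof.
move=> df sf; apply: (smooth_coind1 (P := fun g => (forall x, derivable g x 1) /\ smooth ('D_1 g))); last by split.
- by move=> g [].
- move=> g [dg sg]; split; last exact: smooth_derive.
  by move=> x; exact: smooth_derivable.
- move=> l g [dg sg]; split; first by move=> x; apply: derivableM; [exact: derivable_cst|exact: dg].
  rewrite (_ : 'D_(1 : R) (fun x : R => l * g x) = fun x : R => l * 'D_(1 : R) g x); first exact: smoothZ.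
  apply/funext => x; rewrite (deriveM (f := cst l) (derivable_cst _ _ _) (dg x)).
  by rewrite derive_cst scaler0 addr0.
Qed.

Lemma is_derive_prim g x : continuous g -> is_derive x (1 : R) (prim g) (g x).
Proof.
move=> cg; have hg := L1_continuous cg.
have ltx : x < x + 1 by rewrite ltrDl.
have [] := @continuous_FTC1 R g (BLeft (x - 1)) x (x + 1) ltx (L1_itv _ _ hg) _ (cg x).
  by rewrite lte_fin ltrBlDr ltrDl.
move=> dF Fx.
pose F y := \int[mu]_(t in `[x - 1, y]) g t.
apply: (@near_eq_is_derive R R R (fun y => F y + prim g (x - 1))).
  near=> y; rewrite /F -primB ?subrK //; near: y.
  by apply: lt_le_nbhsr; rewrite ltrBlDr ltrDl.
have Fx' : 'D_1 F x = g x by rewrite -derive1E.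
have d1 : is_derive x (1 : R) F (g x) := DeriveDef dF Fx'.
by have := is_deriveD d1 (is_derive_cst (prim g (x - 1)) x 1); rewrite addr0.
Unshelve. all: by end_near. Qed.

Lemma prim_derive f x : (forall x, derivable f x 1) -> continuous ('D_1 f) ->
  f x = f 0 + prim ('D_1 f) x.
Proof.
move=> df cf.
pose h y := f y - prim ('D_1 f) y.
have dh y : is_derive y (1 : R) h 0.
  have d1 : is_derive y (1 : R) f ('D_1 f y) by exact: DeriveDef.
  have := is_deriveB d1 (is_derive_prim y cf).
  by move=> d; apply: (is_derive_eq d); rewrite subrr.
have : h x = h 0 by apply: is_derive_0_is_cst.
rewrite /h prim0 subr0 => <-; by rewrite subrK.
Qed.

Lemma prim_test (c : R) g phi : L1 g -> test_function phi ->
  \int[mu]_x ((c + prim g x) * 'D_1 phi x) = - \int[mu]_x (g x * phi x).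
Proof.
move=> hg tphi; have tD := test_function_derive (1 : R) tphi.
have [n hn] := test_function_supp1 tphi; have [n' hn'] := test_function_supp1 tD.
have [l [hl hl1]] : exists l : R, (forall x, ~ `[- l, l]%classic x -> phi x = 0 /\ 'D_1 phi x = 0) /\ 0 < l.
  exists (n + n').+1%:R; split; last by rewrite ltr0n.
  move=> x /= nx; split; [apply: hn|apply: hn'] => h1; apply: nx; move: h1;
    rewrite /box1 /= !in_itv /= -!ler_norml => h1; apply: (le_trans h1); rewrite ler_nat; lia.
rewrite (@Rint_supp _ _ _ mu `[- l, l]%classic) => [|x /hl[_ ->]]; last by rewrite mulr0.
rewrite (@Rint_supp _ _ _ mu `[- l, l]%classic (fun x => g x * _)) => [|x /hl[-> _]]; last by rewrite mulr0.
have cD : continuous ('D_1 phi) by exact: smooth_continuous tD.1.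
have dphi x : derivable phi x 1 by apply: smooth_derivable; exact: tphi.1.
have nl : - l <= l by lra.
have := prim_ibp c (phi 0) hg (L1_continuous cD) nl.
rewrite -!prim_derive //.
(* So far [phi] is known to vanish only outside [-l, l]. If it were nonzero at an endpoint, it would
   by continuity be nonzero at nearby points outside. *)
have p0 x : `|x| = l -> phi x = 0.
  move=> xl; have cphi : continuous phi by exact: smooth_continuous tphi.1.
  apply: contrapT => /eqP nz.
  have O : open [set y : R | phi y != 0].
    rewrite (_ : [set _ | _] = phi @^-1` [set z | z != 0]) //.
    by apply: open_comp; [move=> ? _; exact: cphi|exact: open_neq].
  have [e /= e0 he] : nbhs_ball x [set y : R | phi y != 0].
    by apply/nbhs_ballP; apply: open_nbhs_nbhs.
  have [x0|x0] := leP 0 x.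
    have := he (x + e / 2); rewrite /ball /= opprD addrA subrr sub0r normrN gtr0_norm ?divr_gt0 //.
    rewrite ltr_pdivrMr ?ltr_pMr ?ltr1n // => /(_ isT) /eqP; apply.
    apply: (hl _ _).1 => /=; rewrite in_itv /= => /andP[_].
    rewrite -xl ger0_norm //; lra.
  have := he (x - e / 2); rewrite /ball /= opprB addrCA subrr addr0 gtr0_norm ?divr_gt0 //.
  rewrite ltr_pdivrMr ?ltr_pMr ?ltr1n // => /(_ isT) /eqP; apply.
  apply: (hl _ _).1 => /=; rewrite in_itv /= => /andP[+ _].
  rewrite -xl ltr0_norm //; lra.
rewrite (p0 l) ?(p0 (- l)) ?normrN ?gtr0_norm // !mulr0 subrr.
under [X in _ + X]eq_Rintegral do rewrite -prim_derive //.
lra.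
Qed.

(** The primitive starting at -l vanishes to the left of the support; zero mean is what makes it
    vanish again to the right, hence compactly supported. *)
Lemma test_antiderivative rho : test_function rho -> \int[mu]_x rho x = 0 ->
  exists2 phi : R -> R, test_function phi & 'D_(1 : R) phi = rho.
Proof.
move=> trho Irho.
have crho : continuous rho by exact: smooth_continuous trho.1.
have Lrho := L1_continuous crho.
have [n hn] := test_function_supp1 trho.
have [l [hl l0]] : exists l : R, (forall x, ~ `[- l, l]%classic x -> rho x = 0) /\ 0 < l.
  exists n.+1%:R; split; last by rewrite ltr0n.
  move=> x /= nx; apply: hn => h1; apply: nx; move: h1.
  rewrite /box1 /= !in_itv /= -!ler_norml => h1; apply: (le_trans h1); rewrite ler_nat; lia.
pose phi x := prim rho x - prim rho (- l).
have dphi x : is_derive x (1 : R) phi (rho x).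
  have := is_deriveB (is_derive_prim x crho) (is_derive_cst (prim rho (- l)) x 1).
  by rewrite subr0.
have Dphi : 'D_1 phi = rho by apply/funext => x; have [] := dphi x.
have phi0 x : ~ `[- l, l]%classic x -> phi x = 0.
  move=> nx; rewrite /phi.
  have Z a b : a <= b -> (forall y, a < y < b -> rho y = 0) -> \int[mu]_(y in `[a, b]) rho y = 0.
    move=> ab h0; rewrite -[RHS](mul0r (b - a)) -Rint_cst //.
    transitivity (\int[mu]_(y in `]a, b[) rho y).
      rewrite /Rintegral; congr fine; apply: integral_itv_bndoo.
      by apply/measurable_EFinP; exact: measurable_funTS Lrho.1.
    transitivity (\int[mu]_(y in `]a, b[) (0 : R)).
      by apply: eq_Rintegral => y; rewrite inE /= in_itv /= => /h0.
    rewrite /Rintegral; congr fine; apply/esym; apply: integral_itv_bndoo.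
    exact: measurable_cst.
  have [xl|lx] := leP x (- l).
    rewrite -opprB primB // Z ?oppr0 // => y /andP[_ yl].
    by apply: hl => /=; rewrite in_itv /= => /andP[]; lra.
  have lx' : l < x.
    by rewrite ltNge; apply/negP => xl; apply: nx => /=; rewrite in_itv /= xl ltW.
  rewrite primB ?ltW // (@Rint_split _ rho (- l) l x) ?ltW //; last by lra.
  rewrite [X in _ + X]Z ?ltW // ?addr0 => [|y /andP[ly _]]; last first.
    by apply: hl => /=; rewrite in_itv /= => /andP[]; lra.
  by rewrite -(Rint_supp mu hl).
exists phi => //; split.
  apply: smooth_of_derive => [x|]; first by have [] := dphi x.
  by rewrite Dphi; exact: trho.1.
apply: (subclosed_compact _ (segment_compact (a:=- l) (b:=l))); first exact: closed_closure.
have cl : closed `[- l, l]%classic by exact: interval_closed.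
rewrite [X in X `<=` _]closureE => x; apply; split => // y /= /eqP hy.
by apply: contrapT => /phi0.
Qed.

Definition rho0 : R -> R := bump 0 0 1.

Lemma test_rho0 : test_function rho0.
Proof. exact: test_function_bump. Qed.

Lemma rint_test1 chi : test_function chi -> rint mu setT chi.
Proof. by move=> tchi; have := rint_test (L1_cst 1) tchi; under eq_fun do rewrite mul1r. Qed.

Lemma Rint_rho0_neq0 : \int[mu]_x rho0 x != 0.
Proof.
have i0 := rint_test1 test_rho0.
apply/negP => /eqP I00.
have : {ae mu, forall x : R, setT x -> rho0 x = 0}.
  apply: Rint_ge0_eq0 => //; apply: aeW => x _.
  by have /andP[] := bump_bound 0 0 1 x.
move=> [A [mA A0 sA]].
have : (mu `]0%R, 1%R[ <= mu A)%E.
  apply: le_measure; rewrite ?inE // => x /= x01; apply: sA => /= hx.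
  by have := bump_gt0 0 x01; rewrite -/rho0 hx // ltxx.
by rewrite A0 lebesgue_measure_itv /= lte_fin ltr01 -EFinB subr0 lee_fin ler10.
Qed.

(** Removing the multiple of [rho0] with the same integral leaves mean zero, hence a derivative. A
    functional that kills derivatives is thus determined by its value on [rho0]. *)
Lemma test_decomp chi : test_function chi -> exists2 phi : R -> R, test_function phi &
  'D_(1 : R) phi = fun x => chi x - (\int[mu]_x chi x) / (\int[mu]_x rho0 x) * rho0 x.
Proof.
move=> tchi; set J := \int[mu]_x chi x; set I0 := \int[mu]_x rho0 x.
have -> : (fun x => chi x - J / I0 * rho0 x) = (fun x => 1 * chi x + (- (J / I0)) * rho0 x).
  by apply/funext => x; rewrite mul1r mulNr.
apply: test_antiderivative; first exact: test_function_lincomb tchi test_rho0.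
have i1 := rint_test1 tchi; have i0 := rint_test1 test_rho0.
rewrite RintegralD //; [|exact: rintZ..].
by rewrite !RintegralZl // mul1r mulNr divfK ?subrr //; exact: Rint_rho0_neq0.
Qed.

(** The du Bois-Reymond argument: f - prim g annihilates the derivatives of test functions, so by
    [test_decomp] it is a constant, namely its mean against [rho0]. *)
Lemma is_wderiv_prim f g : L1 f -> L1 g ->
  (forall phi, test_function phi ->
    \int[mu]_x (f x * 'D_1 phi x) = - \int[mu]_x (g x * phi x)) ->
  exists C, {ae mu, forall x, f x = C + prim g x}.
Proof.
move=> hf hg H.
pose h x := f x - prim g x.
have hpg : L1 (prim g) by apply: L1_continuous; exact: continuous_prim.
have hh : L1 h by exact: L1B.
have H0 (phi : R -> R) : test_function phi -> \int[mu]_x (h x * 'D_1 phi x) = 0.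
  move=> tphi; have tD := test_function_derive (1 : R) tphi.
  have -> : (fun x => h x * 'D_1 phi x) = (fun x => f x * 'D_1 phi x - prim g x * 'D_1 phi x).
    by apply/funext => x; rewrite mulrBl.
  rewrite RintegralB //; [|exact: rint_test..].
  rewrite H //.
  have := prim_test 0 hg tphi; under eq_Rintegral do rewrite add0r.
  by move=> ->; rewrite subrr.
pose I0 := \int[mu]_x rho0 x.
have t0 := test_rho0.
pose C := (\int[mu]_x (h x * rho0 x)) / I0.
exists C.
suff : {ae mu, forall x, h x - C = 0}.
  apply: aeS => x; rewrite /h => /eqP; rewrite subr_eq0 => /eqP <-; ring.
apply: L1_eq0_test; first exact: L1B hh (L1_cst C).
move=> chi tchi.
have [phi tphi Dphi] := test_decomp tchi.
rewrite -[RHS](H0 phi tphi).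
have Dx x := congr1 (fun f : R -> R => f x) Dphi.
transitivity (\int[mu]_x (h x * (chi x - (\int[mu]_x chi x) / (\int[mu]_x rho0 x) * rho0 x))); last first.
  by apply: eq_Rintegral => x _; rewrite Dx.
have ih := rint_test hh tchi; have ih0 := rint_test hh t0; have ichi := rint_test1 tchi.
set J := \int[mu]_x chi x.
have -> : (fun x => (h x - C) * chi x) = (fun x => h x * chi x - C * chi x).
  by apply/funext => x; rewrite mulrBl.
have -> : (fun x => h x * (chi x - J / \int[mu]_x rho0 x * rho0 x)) =
    (fun x => h x * chi x - J / I0 * (h x * rho0 x)).
  by apply/funext => x; rewrite /I0; ring.
rewrite !RintegralB // ?RintegralZl //; try exact: rintZ.
by rewrite -/J /C; ring.
Qed.

Lemma prim_is_wderiv f g C : measurable_fun setT f -> L1 g ->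
  {ae mu, forall x, f x = C + prim g x} ->
  forall phi, test_function phi ->
    \int[mu]_x (f x * 'D_1 phi x) = - \int[mu]_x (g x * phi x).
Proof.
move=> mf hg fg phi tphi; have tD := test_function_derive (1 : R) tphi.
have mD : measurable_fun setT ('D_1 phi).
  by apply: continuous_measurable_fun; exact: smooth_continuous tD.1.
rewrite -(prim_test C hg tphi); apply: Rint_eq_ae => //.
- exact: measurable_funM.
- apply: measurable_funM => //; apply: measurable_funD => //; exact: measurable_prim.
- by apply: aeS fg => x -> _.
Qed.

End Line.

(** * Weak derivatives and traces in the plane *)

Section PlaneMeasurability.
Context {R : realType}.
Local Notation mu := (@lebesgue_measure R).
Local Notation mu2 := (@lebesgue2 R).

(** The plane carries the product sigma-algebra. An open set belongs to it as the countable union of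
    the rational rectangles that it contains. *)
Lemma open_measurable2 (O : set (R * R)) : open O -> measurable O.
Proof.
move=> oO.
pose rect (q : (rat * rat) * (rat * rat)) : set (R * R) :=
  `]ratr q.1.1, ratr q.1.2[%classic `*` `]ratr q.2.1, ratr q.2.2[%classic.
pose F n := if unpickle n is Some q then
  (if `[< rect q `<=` O >] then rect q else set0) else set0.
have -> : O = \bigcup_n F n.
  apply/seteqP; split => [y Oy|y [n _]]; last first.
    by rewrite /F; case: unpickle => // q; case: asboolP => // + h; exact.
  have [e /= e0 he] : nbhs_ball y O by apply/nbhs_ballP; apply: open_nbhs_nbhs.
  have H (t : R) : exists q : rat * rat, ratr q.1 < t < ratr q.2 /\
      forall s, ratr q.1 < s < ratr q.2 -> `|t - s| < e.
    have lt1 : t - e < t by rewrite ltrBlDr ltrDl.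
    have lt2 : t < t + e by rewrite ltrDl.
    have [a] := rat_in_itvoo lt1; rewrite in_itv /= => /andP[a1 a2].
    have [b] := rat_in_itvoo lt2; rewrite in_itv /= => /andP[b1 b2].
    exists (a, b) => /=; rewrite a2 b1; split => // s /andP[as_ sb].
    by rewrite ltr_norml; apply/andP; split; lra.
  have [q1 [hq1 sq1]] := H y.1; have [q2 [hq2 sq2]] := H y.2.
  have sub : rect (q1, q2) `<=` O.
    move=> z [/=]; rewrite !in_itv /= => z1 z2; apply: he; split => /=.
      exact: sq1.
    exact: sq2.
  exists (pickle (q1, q2)); first by [].
  rewrite /F pickleK; case: asboolP => [_|]; last by move=> h; exfalso; exact: h sub.
  by split; rewrite /= in_itv /=.
apply: bigcupT_measurable => n; rewrite /F; case: unpickle => // q.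
by case: ifP => // _; apply: measurableX.
Qed.

Lemma continuous_measurable2 (f : R * R -> R) : continuous f -> measurable_fun setT f.
Proof.
move=> cf; apply: (measurability _ (RGenOpens.measurableE R)).
move=> _ [_ [a [b ->] <-]]; rewrite setTI; apply: open_measurable2.
apply: open_comp; last exact: interval_open.
by move=> x _; exact: cf.
Qed.

Lemma compact_sub_box2 (K : set (R * R)) : compact K -> exists n, K `<=` box2 n.
Proof.
move=> /compact_bounded -[M [_ hM]].
have [n hn] := sub_box1 (- (M + 1)) (M + 1).
exists n => x Kx; have : `|x| <= M + 1 by apply: hM => //; rewrite ltrDl.
rewrite prod_normE ge_max => /andP[x1 x2].
by split; apply: hn => /=; rewrite in_itv /= -ler_norml.
Qed.

Lemma L2loc2P (u : R * R -> R) : L2loc2 u <-> P2 u.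
Proof.
split=> -[mf h]; split => //.
- move=> n; apply/integrableP; split.
    by apply/measurable_EFinP; apply: measurable_funTS; exact: measurable_funX.
  under eq_integral do rewrite /= ger0_norm ?sqr_ge0 //.
  by apply: h; apply: compact_setX; exact: segment_compact.
- move=> K cK; have [n hn] := compact_sub_box2 cK.
  have mK : measurable K.
    have := compact_closed (@norm_hausdorff _ _) cK.
    by move=> /closed_openC /open_measurable2 /measurableC; rewrite setCK.
  have : rint mu2 K (fun x => u x ^+ 2).
    by apply: rintS (h n) => //; exact: measurable_box2.
  move=> /integrableP[_]; under eq_integral do rewrite /= ger0_norm ?sqr_ge0 //.
  by [].
Qed.

Lemma test_function_supp2 (phi : R * R -> R) : test_function phi ->
  exists n, forall x, ~ box2 n x -> phi x = 0.
Proof.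
move=> [_ /compact_sub_box2 [n hn]]; exists n => x nx.
by apply: test_function_eq0 => /hn.
Qed.

Lemma measurable_test2 (phi : R * R -> R) : test_function phi -> measurable_fun setT phi.
Proof. by move=> tphi; apply: continuous_measurable2; exact: smooth_continuous tphi.1. Qed.

Lemma rint_test2 (u phi : R * R -> R) : P1 u -> test_function phi ->
  rint mu2 setT (fun y => u y * phi y).
Proof.
move=> hu tphi; have [n hn] := test_function_supp2 tphi.
apply: (@rint_supp _ _ _ mu2 (box2 n) _ (measurable_box2 n)) => [x nx|].
  by rewrite hn ?mulr0.
under eq_fun do rewrite mulrC.
have [M hM] := test_function_bounded tphi.
apply: (@rint_bounded_mul _ _ _ mu2 (box2 n) u phi M _ _ _ (hu.2 n)) => //.
- exact: measurable_box2.
- by apply: measurable_funTS; exact: measurable_test2.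
Qed.

Definition tensor (chi rho : R -> R) (y : R * R) : R := chi y.1 * rho y.2.

Lemma test_tensor (chi rho : R -> R) : test_function chi -> test_function rho ->
  test_function (tensor chi rho).
Proof.
move=> [sc cc] [sr cr]; split.
  by apply: smoothM; [exact: smooth_fst|exact: smooth_snd].
apply: (subclosed_compact _ (compact_setX cc cr)); first exact: closed_closure.
have cl : closed (closure [set x | chi x != 0] `*` closure [set x | rho x != 0]).
  apply: compact_closed; first exact: norm_hausdorff.
  exact: compact_setX.
rewrite [X in X `<=` _]closureE => x; apply; split => // -[a b] /= h.
by split; apply: subset_closure => /=; apply: contra_neq h => e; rewrite /tensor /= e ?mulr0 ?mul0r.
Qed.

Lemma derive_tensor (chi rho : R -> R) y v : smooth chi -> smooth rho ->
  'D_v (tensor chi rho) y =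
    chi y.1 * 'D_(v.2) rho y.2 + rho y.2 * 'D_(v.1) chi y.1.
Proof.
move=> sc sr.
have d1 := @smooth_derivable _ _ _ y v (smooth_fst sc).
have d2 := @smooth_derivable _ _ _ y v (smooth_snd sr).
by rewrite [LHS](deriveM d1 d2) derive_fst derive_snd.
Qed.

Lemma derive_tensor_ez (chi rho : R -> R) y : smooth chi -> smooth rho ->
  'D_ez (tensor chi rho) y = chi y.1 * 'D_1 rho y.2.
Proof.
move=> sc sr; rewrite derive_tensor //= [X in _ + _ * X](_ : _ = 0) ?mulr0 ?addr0 //.
exact: derive0.
Qed.

(** The integrals of the positive and negative parts are measurable in the parameter by Tonelli, and
    [fine] of their difference is measurable even at parameters where the slice is not
    integrable. *)
Lemma measurable_Rint_param d (T : measurableType d) (G : T * R -> R) :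
  measurable_fun setT G -> measurable_fun setT (fun y => \int[mu]_s G (y, s)).
Proof.
move=> mG.
have mGE : measurable_fun setT (EFin \o G) by exact/measurable_EFinP.
rewrite /Rintegral; apply: measurableT_comp => //.
rewrite (_ : (fun y => _) = (fun y => fubini_F mu (EFin \o G)^\+%E y - fubini_F mu (EFin \o G)^\-%E y)%E).
  apply: emeasurable_funB; apply: measurable_fun_fubini_tonelli_F => //.
    exact: measurable_funepos.
  exact: measurable_funeneg.
apply/funext => y; rewrite integralE /fubini_F; congr (_ - _)%E;
  by apply: eq_integral => s _; rewrite !unlock.
Qed.

Lemma measurable_Rint_param_itv d (T : measurableType d) (G : T * R -> R) a b :
  measurable_fun setT G -> measurable_fun setT (fun y => \int[mu]_(s in `[a, b]) G (y, s)).
Proof.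
move=> mG.
rewrite (_ : (fun y => _) = (fun y => \int[mu]_s (\1_(`[a, b]%classic) s * G (y, s)))).
  apply: (@measurable_Rint_param _ T (fun p : T * R => \1_(`[a, b]%classic : set R) p.2 * G p)).
  apply: measurable_funM => //.
  apply: (measurableT_comp _ measurable_snd).
  exact: measurable_indic.
apply/funext => y; rewrite Rintegral_mkcond; apply: eq_Rintegral => s _.
by rewrite patchE indicE; case: (s \in _); rewrite ?mul1r ?mul0r.
Qed.

(** Integrate $((b-a)f-m)^2\ge 0$, where m is the integral of f. *)
Lemma cauchy_itv (f : R -> R) a b : a <= b -> rint mu `[a, b] f ->
  rint mu `[a, b] (fun x => f x ^+ 2) ->
  (\int[mu]_(x in `[a, b]) f x) ^+ 2 <= (b - a) * \int[mu]_(x in `[a, b]) (f x ^+ 2).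
Proof.
move=> ab hf hf2; move: ab; rewrite le_eqVlt => /predU1P[->|ab].
  by rewrite !Rint_empty // expr0n mulr0.
set m := \int[mu]_(x in _) f x; set q := \int[mu]_(x in _) (f x ^+ 2).
have i1 : rint mu `[a, b] (fun x => (b - a) ^+ 2 * f x ^+ 2) by exact: rintZ.
have i2 : rint mu `[a, b] (fun x => (2 * (b - a) * m) * f x) by exact: rintZ.
have i3 : rint mu `[a, b] (fun=> m ^+ 2) by apply: L1_itv; exact: L1_cst.
have : 0 <= \int[mu]_(x in `[a, b]) ((b - a) ^+ 2 * f x ^+ 2 - (2 * (b - a) * m) * f x + m ^+ 2).
  by apply: Rintegral_ge0 => x _; have := sqr_ge0 ((b - a) * f x - m); nra.
have e3 : \int[mu]_(x in `[a, b]) (m ^+ 2) = m ^+ 2 * (b - a) := Rint_cst _ (ltW ab).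
rewrite RintegralD //; last exact: rintB.
rewrite e3 RintegralB // !RintegralZl // -/m -/q => h.
have d0 : 0 < b - a by rewrite subr_gt0.
have : 0 <= (b - a) * ((b - a) * q - m ^+ 2) by nra.
by rewrite pmulr_rge0 // subr_ge0.
Qed.

End PlaneMeasurability.

Section Slices.
Context {R : realType}.
Local Notation mu := (@lebesgue_measure R).
Local Notation mu2 := (@lebesgue2 R).
Implicit Types (u v w : R * R -> R) (a b c d : R).

Lemma P1_rect u a b c d : P1 u -> rint mu2 (`[a, b] `*` `[c, d]) u.
Proof.
move=> hu; have [n hn] := sub_box1 a b; have [n' hn'] := sub_box1 c d.
apply: (@L1b_rint _ _ _ mu2 box2 measurable_box2 u (n + n') _ hu); first exact: measurableX.
move=> y [y1 y2]; split; [move: (hn _ y1)|move: (hn' _ y2)];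
  rewrite /box1 /= !in_itv /= -!ler_norml => h; apply: (le_trans h); rewrite ler_nat; lia.
Qed.

Lemma P1_slice u : P1 u -> {ae mu, forall x, L1 (fun z => u (x, z))}.
Proof.
move=> hu.
have H n : {ae mu, forall x, box1 n x -> rint mu (box1 n) (fun z => u (x, z))}.
  apply: rint_fubini_ae (hu.2 n); exact: measurable_box1.
have := ae_foralln H; apply: aeS => x hx; split.
  by apply: measurable_fun_pair2; exact: hu.1.
move=> k; have [n hn] := sub_box1 x x.
have bx : box1 (n + k) x.
  have := hn x; rewrite /= in_itv /= lexx => /(_ isT); rewrite /box1 /= !in_itv /= -!ler_norml.
  by move=> h; apply: (le_trans h); rewrite ler_nat; lia.
apply: rintS (hx _ bx); [exact: measurable_box1|exact: measurable_box1|].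
by move=> z; rewrite /box1 /= !in_itv /= -!ler_norml => h; apply: (le_trans h); rewrite ler_nat; lia.
Qed.

Lemma P2_slice u : P2 u -> {ae mu, forall x, L2 (fun z => u (x, z))}.
Proof.
move=> hu; have := P1_slice (L2b_sq hu); apply: aeS => x hx; split; last exact: hx.2.
by apply: measurable_fun_pair2; exact: hu.1.
Qed.

Lemma P1_Rint u c d : P1 u -> L1 (fun x => \int[mu]_(z in `[c, d]) u (x, z)).
Proof.
move=> hu; split; first exact: measurable_Rint_param_itv hu.1.
by move=> n; apply: (rint_fubini _ _ (P1_rect _ _ _ _ hu)); exact: measurable_itv.
Qed.

Lemma P2_Rint u c d : P2 u -> L2 (fun x => \int[mu]_(z in `[c, d]) u (x, z)).
Proof.
move=> hu; have [dc|cd] := ltP d c.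
  under eq_fun do rewrite (Rint_empty _ (ltW dc)).
  exact: L2_cst.
have h1 := P1_Rint c d (L2b_sq hu).
split; first by exact: (P1_Rint c d (P2_L1 hu)).1.
move=> n; have := L1Z (d - c) h1 => -[_ /(_ n)].
apply: rint_le_ae; first exact: measurable_box1.
  by apply: measurable_funTS; apply: measurable_funX; exact: (P1_Rint c d (P2_L1 hu)).1.
have := aeI (P1_slice (P2_L1 hu)) (P1_slice (L2b_sq hu)); apply: aeS => x [s1 s2] _.
rewrite ger0_norm ?sqr_ge0 //; apply: cauchy_itv => //; exact: L1_itv.
Qed.

Lemma P1_test_snd u (rho : R -> R) : P1 u -> test_function rho ->
  P1 (fun y => u y * rho y.2).
Proof.
move=> hu trho; have [M hM] := test_function_bounded trho.
have mrho : measurable_fun setT (fun y : R * R => rho y.2).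
  apply: (measurableT_comp _ measurable_snd); apply: continuous_measurable_fun.
  exact: smooth_continuous trho.1.
have := P1M_bounded mrho (fun y => hM y.2) hu.
by under eq_fun do rewrite mulrC.
Qed.

Lemma L1_Rint_test u (rho : R -> R) : P1 u -> test_function rho ->
  L1 (fun x => \int[mu]_z (u (x, z) * rho z)).
Proof.
move=> hu trho; have [n hn] := test_function_supp1 trho.
rewrite (_ : (fun x => _) = (fun x => \int[mu]_(z in `[- n%:R, n%:R]) (u (x, z) * rho z))).
  exact: (P1_Rint _ _ (P1_test_snd hu trho)).
apply/funext => x; apply: (@Rint_supp _ _ _ mu (box1 n)) => z nz.
by rewrite hn ?mulr0.
Qed.

Lemma Rfubini_tensor u (chi rho : R -> R) : P1 u -> test_function chi ->
  test_function rho ->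
  \int[mu2]_y (u y * tensor chi rho y) =
  \int[mu]_x ((\int[mu]_z (u (x, z) * rho z)) * chi x).
Proof.
move=> hu tc tr; have i := rint_test2 hu (test_tensor tc tr).
rewrite -setXTT in i *; rewrite Rfubini //; apply: Rint_eq_ae => //.
- by have := rint_meas (rint_fubini measurableT measurableT i).
- apply: measurable_funM; first exact: (L1_Rint_test hu tr).1.
  by apply: continuous_measurable_fun; exact: smooth_continuous tc.1.
have := P1_slice hu; apply: aeS => x hx _.
have ir := rint_test hx tr.
rewrite mulrC -RintegralZl //; apply: eq_Rintegral => z _; rewrite /tensor /=; ring.
Qed.

(** For a fixed second factor, Fubini and [L1_eq0_test] settle almost every x. Tensor products are
    enough because their derivatives and integrals reduce to the line. *)
Lemma P1_eq0_tensor w : P1 w ->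
  (forall chi rho, test_function chi -> test_function rho ->
    \int[mu2]_y (w y * tensor chi rho y) = 0) ->
  {ae mu2, forall y, w y = 0}.
Proof.
move=> hw h0.
have H1 (rho : R -> R) : test_function rho ->
    {ae mu, forall x, \int[mu]_z (w (x, z) * rho z) = 0}.
  move=> trho; apply: L1_eq0_test; first exact: L1_Rint_test.
  by move=> chi tchi; rewrite -Rfubini_tensor // h0.
(* The null set depends on the second factor. Only countably many factors are kept, the bumps with
   rational endpoints, enumerated through [unpickle], so that one null set serves all of them. *)
have H2 : {ae mu, forall x, forall k : nat,
    if unpickle k is Some (n, (a, b)) then
      \int[mu]_z (w (x, z) * bump n (ratr a) (ratr b) z) = 0 else True}.
  apply: ae_foralln => k; case: (unpickle k) => [[n [a b]]|]; last exact: aeW.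
  exact/H1/test_function_bump.
have H3 : {ae mu, forall x, {ae mu, forall z, w (x, z) = 0}}.
  have := aeI H2 (P1_slice hw); apply: aeS => x [hx sx].
  apply: L1_eq0_rat => // a b ab.
  have := @bump_cvg_Rint R (fun z => w (x, z)) (ratr a) (ratr b) sx.
  rewrite (_ : (fun n => _) = fun=> 0); last first.
    by apply/funext => n; have := hx (pickle (n, (a, b))); rewrite pickleK.
  by move=> /(cvg_lim (@Rhausdorff R)) <-; exact: lim_cst.
have mN : measurable [set y | w y != 0].
  rewrite (_ : [set _ | _] = w @^-1` [set~ 0]).
    by rewrite -[X in measurable X]setTI; apply: hw.1 => //; exact: measurableC.
  by apply/seteqP; split => y /= /eqP.
exists [set y | w y != 0]; split => //; last by move=> y /= /eqP.
apply: ae_prod => //; apply: aeS H3 => x; apply: aeS => z e /=.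
by rewrite e eqxx.
Qed.

End Slices.

Section PlanePrimitive.
Context {R : realType}.
Local Notation mu := (@lebesgue_measure R).
Local Notation mu2 := (@lebesgue2 R).
Implicit Types (u v w : R * R -> R) (a b c d : R).

Definition primz v (y : R * R) := prim (fun s => v (y.1, s)) y.2.

Lemma measurable_primz v : measurable_fun setT v -> measurable_fun setT (primz v).
Proof.
move=> mv.
have H (S : set ((R * R) * R)) : measurable S ->
    measurable_fun setT (fun y : R * R => \int[mu]_s (\1_S (y, s) * v (y.1, s))).
  move=> mS; apply: (@measurable_Rint_param _ _ _ (fun p : (R * R) * R => \1_S p * v (p.1.1, p.2))).
  apply: measurable_funM; first exact: measurable_indic.
  apply: measurableT_comp => //; apply: measurable_fun_pair => //.
  exact: measurableT_comp.
pose S1 := [set p : (R * R) * R | 0 <= p.2 <= p.1.2].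
pose S2 := [set p : (R * R) * R | p.1.2 <= p.2 <= 0].
have mS1 : measurable S1.
  rewrite (_ : S1 = (fun p : (R * R) * R => p.2) @^-1` `[0, +oo[%classic `&`
    (fun p : (R * R) * R => p.1.2 - p.2) @^-1` `[0, +oo[%classic).
    apply: measurableI; rewrite -[X in measurable X]setTI.
      exact: measurable_snd.
    apply: measurable_funB => //; exact: measurableT_comp.
  apply/seteqP; split => p /=; rewrite !in_itv /= !andbT subr_ge0.
    by move=> /andP.
  by move=> [a1 a2]; apply/andP.
have mS2 : measurable S2.
  rewrite (_ : S2 = (fun p : (R * R) * R => p.2) @^-1` `]-oo, 0]%classic `&`
    (fun p : (R * R) * R => p.2 - p.1.2) @^-1` `[0, +oo[%classic).
    apply: measurableI; rewrite -[X in measurable X]setTI.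
      exact: measurable_snd.
    apply: measurable_funB => //; exact: measurableT_comp.
  apply/seteqP; split => p /=; rewrite !in_itv /= ?andbT subr_ge0.
    by move=> /andP[].
  by move=> [a1 a2]; apply/andP.
rewrite (_ : primz v = fun y => \int[mu]_s (\1_S1 (y, s) * v (y.1, s)) -
    \int[mu]_s (\1_S2 (y, s) * v (y.1, s))); first by apply: measurable_funB; exact: H.
apply/funext => y; rewrite /primz /prim; congr (_ - _);
  rewrite Rintegral_mkcond; apply: eq_Rintegral => s _; rewrite patchE indicE.
- have -> : (s \in `[0, y.2]%classic) = ((y, s) \in S1).
    by apply/idP/idP; rewrite !inE /= ?in_itv.
  by case: (_ \in _); rewrite ?mul1r ?mul0r.
- have -> : (s \in `[y.2, 0]%classic) = ((y, s) \in S2).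
    by apply/idP/idP; rewrite !inE /= ?in_itv.
  by case: (_ \in _); rewrite ?mul1r ?mul0r.
Qed.

Lemma ae_fst (P : R -> Prop) : {ae mu, forall x, P x} -> {ae mu2, forall y, P y.1}.
Proof.
move=> [N [mN N0 PN]]; exists (N `*` setT); split.
- exact: measurableX.
- apply: ae_prod; first exact: measurableX.
  exists N; split => // x /= h; apply: contrapT => nx; apply: h.
  by apply: aeW => z [].
- by move=> y /= h; split => //; exact: PN.
Qed.

Lemma P1_fst (g : R -> R) : L1 g -> P1 (fun y => g y.1).
Proof.
move=> hg; have mg : measurable_fun setT (fun y : R * R => g y.1).
  by apply: (measurableT_comp hg.1 measurable_fst).
split=> // n; apply: (@rint_prod_le _ _ (fun x => `|g x|) (fun=> 1)) => //.
- split; first by apply: measurableT_comp => //; exact: hg.1.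
  by move=> k; have := integrable_norm (hg.2 k).
- exact: L1_cst.
- by move=> x z _ _ /=; rewrite mulr1.
Qed.

Lemma P2_fst (g : R -> R) : L2 g -> P2 (fun y => g y.1).
Proof.
move=> hg; split; last exact: (P1_fst (L2b_sq hg)).2.
by apply: (measurableT_comp hg.1 measurable_fst).
Qed.

Lemma prim_le (f : R -> R) n z : L1 f -> box1 n z ->
  `|prim f z| <= \int[mu]_(s in `[- n%:R, n%:R]) `|f s|.
Proof.
move=> hf; have n0 : 0 <= n%:R :> R by rewrite ler0n.
have H a b : `[a, b]%classic `<=` box1 n ->
    `|\int[mu]_(s in `[a, b]) f s| <= \int[mu]_(s in `[- n%:R, n%:R]) `|f s|.
  move=> sub; apply: le_trans (le_normr_Rintegral _ (L1_itv a b hf)) _ => //.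
  have i : rint mu (box1 n) (fun s => `|f s|) := integrable_norm (hf.2 n).
  rewrite Rintegral_mkcond [leRHS]Rintegral_mkcond.
  apply: le_Rintegral => //.
  - apply: (rint_restrict mu (fun s => `|f s|) (measurable_itv `[a, b])).1.
    by apply: rintS i => //; exact: measurable_box1.
  - exact: (rint_restrict mu (fun s => `|f s|) (measurable_box1 n)).1.
  move=> s _; rewrite !patchE; case: ifPn => sa; last by case: ifP => _ //; exact: normr_ge0.
  by rewrite mem_set //; apply: sub; exact: set_mem.
rewrite /box1 /= in_itv /= => /andP[z1 z2].
rewrite /prim; have [z0|z0] := leP 0 z.
  rewrite (Rint_empty f z0) subr0; apply: H => s /=; rewrite /box1 /= !in_itv /= => /andP[]; lra.
rewrite (Rint_empty f (ltW z0)) sub0r normrN.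
by apply: H => s /=; rewrite /box1 /= !in_itv /= => /andP[]; lra.
Qed.

Lemma P1_primz v : P1 v -> P1 (primz v).
Proof.
move=> hv; have mv := hv.1; split; first exact: measurable_primz.
move=> n.
have hn : P1 (fun y => `|v y|).
  split; first exact: measurableT_comp.
  by move=> k; have := integrable_norm (hv.2 k).
have hK := P1_fst (P1_Rint (- n%:R) n%:R hn).
move: (hK.2 n); apply: rint_le_ae; first exact: measurable_box2.
  by apply: measurable_funTS; exact: measurable_primz.
have := ae_fst (P1_slice hv); apply: aeS => y hy [_ by2].
exact: prim_le.
Qed.

Lemma P2_primz v : P2 v -> P2 (primz v).
Proof.
move=> hv; have mv := hv.1; have hv1 := P2_L1 hv; split; first exact: measurable_primz.
move=> n.
have hK := P1Z (2 * n%:R) (P1_fst (P1_Rint (- n%:R) n%:R (L2b_sq hv))).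
move: (hK.2 n); apply: rint_le_ae; first exact: measurable_box2.
  by apply: measurable_funTS; apply: measurable_funX; exact: measurable_primz.
have := ae_fst (aeI (P1_slice hv1) (P2_slice hv)); apply: aeS => y [hy hy2] [_ by2].
rewrite ger0_norm ?sqr_ge0 //.
have h1 := prim_le hy by2.
have n0 : 0 <= n%:R :> R by rewrite ler0n.
have nn : - n%:R <= n%:R :> R by lra.
have habs : rint mu `[- n%:R, n%:R] (fun s => `|v (y.1, s)|) := integrable_norm (hy.2 n).
have habs2 : rint mu `[- n%:R, n%:R] (fun s => `|v (y.1, s)| ^+ 2).
  have := hy2.2 n; apply: eq_integrable; first exact: measurable_box1.
  by move=> s _; rewrite /= real_normK ?num_real.
have e : \int[mu]_(s in `[- n%:R, n%:R]) (`|v (y.1, s)| ^+ 2) =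
    \int[mu]_(s in `[- n%:R, n%:R]) (v (y.1, s) ^+ 2).
  by apply: eq_Rintegral => s _; rewrite real_normK ?num_real.
have := cauchy_itv nn habs habs2; rewrite e.
rewrite opprK -mulr2n -[_ *+ 2]mulr_natl => h2.
apply: le_trans h2; rewrite -[leLHS]real_normK ?num_real //.
apply: lerXn2r h1; rewrite nnegrE //; apply: Rintegral_ge0 => s _; exact: normr_ge0.
Qed.

Lemma Rint_primz_tensor v (chi rho : R -> R) : P1 v -> test_function chi ->
  test_function rho ->
  \int[mu2]_y (primz v y * tensor chi ('D_1 rho) y) = - \int[mu2]_y (v y * tensor chi rho y).
Proof.
move=> hv tc tr; have tD := test_function_derive (1 : R) tr.
have hp := P1_primz hv.
rewrite !Rfubini_tensor // -mulN1r -RintegralZl //; last first.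
  by apply: (rint_test _ tc); exact: L1_Rint_test.
apply: Rint_eq_ae => //.
- exact: rint_meas (rint_test (L1_Rint_test hp tD) tc).
- exact: rint_meas (rintZ _ measurableT (rint_test (L1_Rint_test hv tr) tc)).
have := P1_slice hv; apply: aeS => x hx _.
have := prim_test 0 hx tr; under eq_Rintegral do rewrite add0r.
by rewrite /primz /= => ->; rewrite mulN1r mulNr.
Qed.

(* Absolute continuity on almost every vertical line. *)
Lemma acl u v : P2 u -> P2 v ->
  (forall chi rho : R -> R, test_function chi -> test_function rho ->
    \int[mu2]_y (u y * tensor chi ('D_1 rho) y) = - \int[mu2]_y (v y * tensor chi rho y)) ->
  exists2 g, L2 g & {ae mu2, forall y, u y = g y.1 + primz v y}.
Proof.
move=> hu2 hv2 W; have hu := P2_L1 hu2; have hv := P2_L1 hv2.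
have hp := P1_primz hv.
pose h y := u y - primz v y.
have hh : P1 h := P1B hu hp.
have hh2 : P2 h := P2B hu2 (P2_primz hv2).
have H0 (chi rho : R -> R) : test_function chi -> test_function rho ->
    \int[mu2]_y (h y * tensor chi ('D_1 rho) y) = 0.
  move=> tc tr; have tD := test_tensor tc (test_function_derive (1 : R) tr).
  have -> : (fun y => h y * tensor chi ('D_1 rho) y) =
      (fun y => u y * tensor chi ('D_1 rho) y - primz v y * tensor chi ('D_1 rho) y).
    by apply/funext => y; rewrite mulrBl.
  rewrite RintegralB //; [|exact: rint_test2..].
  by rewrite W // Rint_primz_tensor // subrr.
pose I0 := \int[mu]_z (rho0 z : R).
have I0n : I0 != 0 := Rint_rho0_neq0.
have t0 := @test_rho0 R.
(* If u - primz v depends on x only, its value is recovered on each vertical line as the mean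
   against [rho0]. *)
pose g x := I0^-1 * \int[mu]_z (h (x, z) * rho0 z).
have hg : L1 g by apply: L1Z; exact: L1_Rint_test.
have gf := P1_fst hg.
have E : {ae mu2, forall y, h y - g y.1 = 0}.
  apply: P1_eq0_tensor; first exact: P1B.
  move=> chi rho tc tr.
  have [sig ts Ds] := test_decomp tr.
  set J := \int[mu]_x rho x in Ds.
  have := H0 chi sig tc ts.
  have i1 := rint_test2 hh (test_tensor tc tr).
  have i0 := rint_test2 hh (test_tensor tc t0).
  have ig := rint_test2 gf (test_tensor tc tr).
  have -> : \int[mu2]_y (h y * tensor chi ('D_1 sig) y) =
      \int[mu2]_y (h y * tensor chi rho y - J / I0 * (h y * tensor chi rho0 y)).
    have Dx x := congr1 (fun f : R -> R => f x) Ds.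
    by apply: eq_Rintegral => y _; rewrite /tensor Dx -/I0; ring.
  have -> : (fun y => (h y - g y.1) * tensor chi rho y) =
      (fun y => h y * tensor chi rho y - g y.1 * tensor chi rho y).
    by apply/funext => y; rewrite mulrBl.
  rewrite !RintegralB //; last exact: rintZ.
  rewrite RintegralZl //; move=> /eqP; rewrite subr_eq0 => /eqP ->.
  rewrite !Rfubini_tensor //.
  rewrite -RintegralZl //; last by apply: (rint_test _ tc); exact: L1_Rint_test.
  apply/eqP; rewrite subr_eq0; apply/eqP; apply: eq_Rintegral => x _ /=.
  have -> : \int[mu]_z (g x * rho z) = g x * J by apply: RintegralZl => //; exact: rint_test1.
  by rewrite /g; ring.
have E' : {ae mu2, forall y, h y = g y.1}.
  by apply: aeS E => y /eqP; rewrite subr_eq0 => /eqP.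
exists g; last by apply: aeS E' => y <-; rewrite /h; ring.
(* Seen as a function on the plane, g agrees almost everywhere with the square-integrable h.
   Integrating its square over the strip 0 <= z <= 1 brings this back to the line. *)
have hg2 : P2 (fun y => g y.1) by apply: (P2_eq_ae gf.1 E').
have := P1_Rint 0 1 (L2b_sq hg2) => /= -[m i]; split; first exact: hg.1.
move=> n; have := i n; apply: eq_integrable; first exact: measurable_box1.
by move=> x _ /=; rewrite Rint_cst // subr0 mulr1.
Qed.

Lemma derivable_slice (phi : R * R -> R) x z : smooth phi ->
  derivable (fun s => phi (x, s)) z 1 /\ 'D_1 (fun s => phi (x, s)) z = 'D_ez phi (x, z).
Proof.
move=> sp.
have e : (fun h : R => h^-1 *: (((fun s => phi (x, s)) \o shift z) (h *: (1 : R)) - phi (x, z))) =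
    (fun h : R => h^-1 *: ((phi \o shift (x, z)) (h *: ez) - phi (x, z))).
  apply/funext => h /=; congr (_ *: (phi _ - _)).
  by rewrite /ez; congr pair; rewrite /= ?scaler0 ?add0r.
have := @smooth_derivable _ _ _ (x, z) ez sp; rewrite /derivable /derive => d.
by rewrite e.
Qed.

Lemma continuous_slice (phi : R * R -> R) (x : R) : smooth phi ->
  continuous (fun z : R => phi (x, z)).
Proof.
move=> sp z; apply: differentiable_continuous; apply/derivable1_diffP.
by have [] := derivable_slice x z sp.
Qed.

Lemma test_slice_prim (phi : R * R -> R) x : smooth phi ->
  let k z := 'D_ez phi (x, z) in
  continuous k /\ forall z, phi (x, z) = phi (x, 0) + prim k z.
Proof.
move=> sp k.
have ck : continuous k by exact: continuous_slice (smooth_derive ez sp).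
have Dk : 'D_1 (fun s => phi (x, s)) = k.
  by apply/funext => z; have [_] := derivable_slice x z sp.
have dp s : derivable (fun s => phi (x, s)) s 1 by have [] := derivable_slice x s sp.
have ck' : continuous ('D_1 (fun s => phi (x, s))) by rewrite Dk.
by split => // z; have := prim_derive z dp ck'; rewrite Dk.
Qed.

(** Integration by parts on almost every vertical half-line. The boundary value is that of the
    representative absolutely continuous in z, which identifies the trace. *)
Lemma green_half_plane u v g c (phi : R * R -> R) : P1 u -> P1 v -> L1 g ->
  {ae mu2, forall y, u y = g y.1 + primz v y} -> test_function phi ->
  \int[mu]_x ((g x + primz v (x, c)) * phi (x, c)) =
  - \int[mu2]_(y in [set y : R * R | c < y.2]) (u y * 'D_ez phi y + v y * phi y).
Proof.
move=> hu hv hg E tphi; have tD := test_function_derive ez tphi.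
have S : [set y : R * R | c < y.2] = setT `*` `]c, +oo[%classic.
  by apply/seteqP; split => y /=; rewrite in_itv /= andbT => // -[].
have i1 := rintD measurableT (rint_test2 hu tD) (rint_test2 hv tphi).
have mS : measurable (setT `*` `]c, +oo[%classic : set (R * R)) by exact: measurableX.
have iS : rint mu2 (setT `*` `]c, +oo[%classic) (fun y => u y * 'D_ez phi y + v y * phi y).
  by apply: rintS i1.
rewrite S Rfubini //.
have iF := rint_fubini measurableT (measurable_itv _) iS.
rewrite -mulN1r -RintegralZl //; apply: Rint_eq_ae => //.
- apply: measurable_funM.
    apply: measurable_funD; first exact: hg.1.
    by apply: measurable_fun_pair1; exact: measurable_primz hv.1.
  by apply: measurable_fun_pair1; exact: measurable_test2.
- exact: rint_meas (rintZ _ measurableT iF).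
have := aeI (P1_slice hv) (ae_fubini E); apply: aeS => x [sx ux] _.
have [ck kP] := test_slice_prim x tphi.1.
set k := fun z => 'D_ez phi (x, z) in ck kP.
have [n hn] := test_function_supp2 tphi; have [n' hn'] := test_function_supp2 tD.
pose l := `|c| + (n + n').+1%:R.
have cl : c <= l.
  by rewrite /l; have := ler_norm c; have : 0 <= (n + n').+1%:R :> R by []; lra.
have out z : l <= z -> phi (x, z) = 0 /\ 'D_ez phi (x, z) = 0.
  move=> lz; have nz j : (j <= n + n')%N -> ~ box2 j (x, z).
    move=> jn [_] /=; rewrite /box1 /= in_itv /= => /andP[_ zj].
    have : (j%:R : R) <= (n + n')%:R by rewrite ler_nat.
    by move: lz zj; rewrite /l -natr1; have := normr_ge0 c; lra.
  by split; [apply: hn|apply: hn']; apply: nz; lia.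
have -> : \int[mu]_(z in `]c, +oo[) (u (x, z) * 'D_ez phi (x, z) + v (x, z) * phi (x, z)) =
    \int[mu]_(z in `[c, l]) ((g x + prim (fun s => v (x, s)) z) * k z + v (x, z) * (phi (x, 0) + prim k z)).
  transitivity (\int[mu]_(z in `]c, l]) (u (x, z) * 'D_ez phi (x, z) + v (x, z) * phi (x, z))).
    rewrite Rintegral_mkcond [RHS]Rintegral_mkcond; apply: eq_Rintegral => z _.
    rewrite !patchE.
    have [zc|zc] := boolP (z \in `]c, +oo[%classic).
      case: ifPn => // zl.
      have lz : l <= z.
        move: zc zl; rewrite inE /= in_itv /= andbT => zc /negP zl.
        rewrite leNgt; apply/negP => zl'; apply: zl.
        by rewrite inE /= in_itv /= zc ltW.
      by have [-> ->] := out z lz; rewrite !mulr0 addr0.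
    case: ifPn => // zl; exfalso; move: zc => /negP; apply.
    by move: zl; rewrite !inE /= !in_itv /= andbT => /andP[].
  have ms : measurable_fun setT (fun z => u (x, z) * 'D_ez phi (x, z) + v (x, z) * phi (x, z)).
    have mp (w : R * R -> R) : measurable_fun setT w -> measurable_fun setT (fun z => w (x, z)).
      by move=> mw; apply: measurable_fun_pair2.
    apply: measurable_funD; apply: measurable_funM.
    - exact: mp hu.1.
    - exact: mp (measurable_test2 tD).
    - exact: mp hv.1.
    - exact: mp (measurable_test2 tphi).
  transitivity (\int[mu]_(z in `[c, l]) (u (x, z) * 'D_ez phi (x, z) + v (x, z) * phi (x, z))).
    rewrite /Rintegral; congr fine; apply: integral_itv_obnd_cbnd.
    by apply/measurable_EFinP; exact: measurable_funTS.
  have mk : measurable_fun setT k by exact: continuous_measurable_fun.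
  apply: Rint_eq_ae => //.
  - exact: measurable_funTS.
  - apply: measurable_funTS; apply: measurable_funD; apply: measurable_funM => //.
    + by apply: measurable_funD => //; exact: measurable_prim.
    + exact: sx.1.
    + by apply: measurable_funD => //; apply: measurable_prim; exact: L1_continuous.
  by apply: aeS ux => z uz _; rewrite uz kP.
have Lk := L1_continuous ck.
have c1 : continuous (fun z => g x + prim (fun s => v (x, s)) z).
  by move=> z; apply: cvgD; [exact: cvg_cst|exact: continuous_prim].
have c2 : continuous (fun z => phi (x, 0) + prim k z).
  by move=> z; apply: cvgD; [exact: cvg_cst|exact: continuous_prim].
rewrite RintegralD //; last 2 first.
- by apply: L1_itv; exact: L1M_continuous.
- apply: L1_itv; rewrite (_ : (fun z => _) = fun z => (phi (x, 0) + prim k z) * v (x, z)).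
    exact: L1M_continuous.
  by apply/funext => z; rewrite mulrC.
rewrite prim_ibp // -!kP (out l _).1 // mulr0 sub0r mulN1r opprK.
by rewrite /primz.
Qed.

Lemma is_wpartial_tensor u v : is_wpartial ez u v ->
  forall chi rho : R -> R, test_function chi -> test_function rho ->
    \int[mu2]_y (u y * tensor chi ('D_1 rho) y) = - \int[mu2]_y (v y * tensor chi rho y).
Proof.
move=> [_ h] chi rho tc tr; rewrite -(h _ (test_tensor tc tr)).
by apply: eq_Rintegral => y _; rewrite (derive_tensor_ez y tc.1 tr.1).
Qed.

Lemma is_wpartial_acl u v : P2 u -> is_wpartial ez u v ->
  exists2 g, L2 g & {ae mu2, forall y, u y = g y.1 + primz v y}.
Proof.
move=> hu wp; have hv : P2 v by apply/L2loc2P; exact: wp.1.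
exact: acl hu hv (is_wpartial_tensor wp).
Qed.

(** Green's formula on a half-plane whose boundary lies below the support of the test function, so
    that the boundary term disappears. *)
Lemma acl_is_wpartial u v g : P1 u -> P2 v -> L1 g ->
  {ae mu2, forall y, u y = g y.1 + primz v y} -> is_wpartial ez u v.
Proof.
move=> hu hv2 hg E; have hv := P2_L1 hv2; split; first exact/L2loc2P.
move=> phi tphi; have tD := test_function_derive ez tphi.
have [n hn] := test_function_supp2 tphi; have [n' hn'] := test_function_supp2 tD.
pose c : R := - (n + n').+1%:R.
have out x z : z <= c -> phi (x, z) = 0 /\ 'D_ez phi (x, z) = 0.
  move=> lz; have nz j : (j <= n + n')%N -> ~ box2 j (x, z).
    move=> jn [_] /=; rewrite /box1 /= in_itv /= => /andP[zj _].
    have : (j%:R : R) <= (n + n')%:R by rewrite ler_nat.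
    by move: lz zj; rewrite /c -natr1; lra.
  by split; [apply: hn|apply: hn']; apply: nz; lia.
have := green_half_plane c hu hv hg E tphi.
have -> : \int[mu]_x ((g x + primz v (x, c)) * phi (x, c)) = 0.
  rewrite -[RHS](mul0r (fine (mu setT))) -Rintegral_cst //; apply: eq_Rintegral => x _.
  by rewrite (out x c (lexx _)).1 mulr0.
rewrite -Rint_supp => [|y /= yc]; last first.
  case: y yc => x z /= yc; have zc : z <= c by rewrite leNgt; apply/negP.
  by have [-> ->] := out x z zc; rewrite !mulr0 addr0.
rewrite RintegralD //; [|exact: rint_test2..].
by move=> /eqP; rewrite eq_sym oppr_eq0 addr_eq0 => /eqP.
Qed.

Lemma is_wpartial_unique dir u v v' : is_wpartial dir u v -> is_wpartial dir u v' ->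
  {ae mu2, forall y, v y = v' y}.
Proof.
move=> [/L2loc2P hv h] [/L2loc2P hv' h'].
have hv1 := P2_L1 hv; have hv1' := P2_L1 hv'.
have : {ae mu2, forall y, v y - v' y = 0}.
  apply: P1_eq0_tensor; first exact: P1B.
  move=> chi rho tc tr; have tt := test_tensor tc tr.
  have -> : (fun y => (v y - v' y) * tensor chi rho y) =
      (fun y => v y * tensor chi rho y - v' y * tensor chi rho y).
    by apply/funext => y; rewrite mulrBl.
  rewrite RintegralB //; [|exact: rint_test2..].
  by apply/eqP; rewrite subr_eq0 -[X in X == _]opprK -[X in _ == X]opprK eqr_opp -h // -h'.
by apply: aeS => y /eqP; rewrite subr_eq0 => /eqP.
Qed.

Lemma is_trace_unique u c (g g' : R -> R) : is_trace u c g -> is_trace u c g' ->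
  {ae mu, forall x, g x = g' x}.
Proof.
move=> [/L2locP hg h] [/L2locP hg' h'].
have hg1 := L2_L1 hg; have hg1' := L2_L1 hg'.
have : {ae mu, forall x, g x - g' x = 0}.
  apply: L1_eq0_test; first exact: L1B.
  (* A bump in z that is nonzero at c extends a test function on the line to one on the plane
     without losing its restriction to z = c. *)
  move=> chi tchi; pose b : R -> R := bump 0 (c - 1) (c + 1).
  have tb : test_function b by exact: test_function_bump.
  have bc : b c != 0.
    by rewrite gt_eqF // bump_gt0 // in_itv /=; apply/andP; split; lra.
  have tt := test_tensor tchi tb.
  have := h' _ tt; rewrite -h // => e.
  have ig := rint_test hg1 tchi; have ig' := rint_test hg1' tchi.
  have T (w : R -> R) : rint mu setT (fun x => w x * chi x) ->
      \int[mu]_x (w x * tensor chi b (x, c)) = b c * \int[mu]_x (w x * chi x).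
    by move=> iw; rewrite -RintegralZl //; apply: eq_Rintegral => x _; rewrite /tensor /=; ring.
  rewrite !T // in e; have {}e := mulfI bc e.
  have -> : (fun x => (g x - g' x) * chi x) = (fun x => g x * chi x - g' x * chi x).
    by apply/funext => x; rewrite mulrBl.
  by rewrite RintegralB // e subrr.
by apply: aeS => x /eqP; rewrite subr_eq0 => /eqP.
Qed.

Lemma L2_prim_slice v c : P2 v -> L2 (fun x => primz v (x, c)).
Proof.
move=> hv; rewrite /primz /prim /=.
by apply: L2B; exact: P2_Rint.
Qed.

Lemma wpartialP dir u : (exists g, is_wpartial dir u g) -> is_wpartial dir u (wpartial dir u).
Proof. by move=> [g hg]; exact: xgetPex (ex_intro _ g hg). Qed.

(** The working description of traces: the trace on z = c is the value at c of the representative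
    absolutely continuous in z. The definition by Green's formula enters later arguments only
    through it. *)
Lemma trace_acl u g v c : P1 u -> P2 v -> L2 g ->
  {ae mu2, forall y, u y = g y.1 + primz v y} ->
  {ae mu, forall x, trace u c x = g x + primz v (x, c)} /\ L2 (trace u c).
Proof.
move=> hu hv hg E; have hg1 := L2_L1 hg.
have wp := acl_is_wpartial hu hv hg1 E.
have wp' := wpartialP (ex_intro _ v wp).
have hv' : P2 (wpartial ez u) by apply/L2loc2P; exact: wp'.1.
have tr : is_trace u c (fun x => g x + primz v (x, c)).
  split; first by apply/L2locP; apply: L2D => //; exact: L2_prim_slice.
  move=> phi tphi; rewrite (green_half_plane c hu (P2_L1 hv) hg1 E tphi).
  have tD := test_function_derive ez tphi.
  have mS : measurable [set y : R * R | c < y.2].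
    rewrite (_ : [set _ | _] = setT `*` `]c, +oo[%classic); first exact: measurableX.
    by apply/seteqP; split => y /=; rewrite in_itv /= andbT => // -[].
  have m (w : R * R -> R) : P2 w -> measurable_fun [set y : R * R | c < y.2]
      (fun y => u y * 'D_ez phi y + w y * phi y).
    move=> hw; apply: measurable_funTS; apply: measurable_funD; apply: measurable_funM.
    - exact: hu.1.
    - exact: measurable_test2.
    - exact: hw.1.
    - exact: measurable_test2.
  congr (- _); apply: Rint_eq_ae => //; [exact: m|exact: m|].
  by have := is_wpartial_unique wp wp'; apply: aeS => y ->.
have tr' : is_trace u c (trace u c) := xgetPex (fun=> 0) (ex_intro _ _ tr).
split; last by apply/L2locP; exact: tr'.1.
exact: is_trace_unique tr' tr.
Qed.

End PlanePrimitive.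

(** * Exchange of the two coordinates *)

Section SwapDirection.
Context {R : realType}.
Local Notation mu := (@lebesgue_measure R).
Local Notation mu2 := (@lebesgue2 R).
Implicit Types (u v w : R * R -> R) (a b c d : R).

Lemma P1_swap u : P1 u -> P1 (u \o swap).
Proof.
move=> [mu_ hu]; split; first exact: measurable_fun_swap.
move=> n; have -> : box2 n = swap @^-1` box2 n := esym (preimage_swap_setX (box1 n) (box1 n)).
by apply: rint_swap => //; exact: measurable_box2.
Qed.

Lemma P2_swap u : P2 u -> P2 (u \o swap).
Proof.
move=> hu; split; first by apply: measurable_fun_swap; exact: hu.1.
exact: (P1_swap (L2b_sq hu)).2.
Qed.

Lemma Rint_swapT w : measurable_fun setT w -> \int[mu2]_y w (swap y) = \int[mu2]_y w y.
Proof.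
by move=> mw; have := Rintegral_swap measurableT mw; rewrite preimage_setT.
Qed.

Lemma derive_swap (phi : R * R -> R) (v y : R * R) :
  'D_v (phi \o swap) y = 'D_(swap v) phi (swap y).
Proof. by []. Qed.

Lemma derivable_swap (phi : R * R -> R) (v y : R * R) :
  derivable phi (swap y) (swap v) -> derivable (phi \o swap) y v.
Proof. by []. Qed.

Lemma continuous_swap : continuous (@swap R).
Proof.
move=> y; apply/cvg_ballP => e e0; have := nbhsx_ballx y e e0.
by apply: filterS => z [].
Qed.

Lemma test_function_swap (phi : R * R -> R) : test_function phi -> test_function (phi \o swap).
Proof.
move=> [sp cp]; split.
  apply: (@smooth_coind _ _ (fun g => exists2 f : R * R -> R, smooth f & g = f \o swap)).
  - move=> _ [g sg ->] x; apply: continuous_comp; [exact: continuous_swap|exact: smooth_continuous].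
  - by move=> _ [g sg ->] x v; apply: derivable_swap; exact: smooth_derivable.
  - by move=> _ [g sg ->] v; exists ('D_(swap v) g); [exact: smooth_derive|apply/funext => y; exact: derive_swap].
  by exists phi.
have cK : compact (swap @` closure [set y | phi y != 0]).
  by apply: continuous_compact => //; apply: continuous_subspaceT; exact: continuous_swap.
apply: (subclosed_compact _ cK); first exact: closed_closure.
have cl : closed (swap @^-1` closure [set y | phi y != 0]).
  by apply: closed_comp; [move=> x _; exact: continuous_swap|exact: closed_closure].
have sub : swap @^-1` closure [set y | phi y != 0] `<=` swap @` closure [set y | phi y != 0].
  by move=> -[x z] h; exists (z, x).
apply: subset_trans sub.
rewrite [X in X `<=` _]closureE => x; apply; split => // y /= h.
exact: (@subset_closure _ [set y | phi y != 0]).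
Qed.

Lemma is_wpartial_swap_ez u v : measurable_fun setT u ->
  is_wpartial ex u v -> is_wpartial ez (u \o swap) (v \o swap).
Proof.
move=> mu_ [/L2loc2P hv h]; split; first by apply/L2loc2P; exact: P2_swap.
move=> phi tphi; have ts := test_function_swap tphi.
have mD : measurable_fun setT ('D_ex (phi \o swap) : R * R -> R).
  by apply: measurable_test2; exact: test_function_derive.
have E1 := Rint_swapT (measurable_funM mu_ mD).
have E2 := Rint_swapT (measurable_funM hv.1 (measurable_test2 ts)).
transitivity (\int[mu2]_y (u y * 'D_ex (phi \o swap) y)).
  rewrite -[RHS]E1; apply: eq_Rintegral => -[x z] _; exact: erefl.
rewrite h // -[in LHS]E2; congr (- _); apply: eq_Rintegral => -[x z] _; exact: erefl.
Qed.

Lemma is_wpartial_swap_ex u v : measurable_fun setT u ->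
  is_wpartial ez u v -> is_wpartial ex (u \o swap) (v \o swap).
Proof.
move=> mu_ [/L2loc2P hv h]; split; first by apply/L2loc2P; exact: P2_swap.
move=> phi tphi; have ts := test_function_swap tphi.
have mD : measurable_fun setT ('D_ez (phi \o swap) : R * R -> R).
  by apply: measurable_test2; exact: test_function_derive.
have E1 := Rint_swapT (measurable_funM mu_ mD).
have E2 := Rint_swapT (measurable_funM hv.1 (measurable_test2 ts)).
transitivity (\int[mu2]_y (u y * 'D_ez (phi \o swap) y)).
  rewrite -[RHS]E1; apply: eq_Rintegral => -[x z] _; exact: erefl.
rewrite h // -[in LHS]E2; congr (- _); apply: eq_Rintegral => -[x z] _; exact: erefl.
Qed.

Definition primx v (y : R * R) := prim (fun s => v (s, y.2)) y.1.

Lemma is_wpartial_acl_x u v : P2 u -> is_wpartial ex u v ->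
  exists2 g, L2 g & {ae mu2, forall y, u y = g y.2 + primx v y}.
Proof.
move=> hu wp.
have [g hg E] := is_wpartial_acl (P2_swap hu) (is_wpartial_swap_ez hu.1 wp).
by exists g => //; have := ae_swap E; apply: aeS => -[x z].
Qed.

Lemma acl_is_wpartial_x u v g : P1 u -> P2 v -> L1 g ->
  {ae mu2, forall y, u y = g y.2 + primx v y} -> is_wpartial ex u v.
Proof.
move=> hu hv hg E.
have E' : {ae mu2, forall y, (u \o swap) y = g y.1 + primz (v \o swap) y}.
  by have := ae_swap E; apply: aeS => -[x z].
have wp := acl_is_wpartial (P1_swap hu) (P2_swap hv) hg E'.
have := is_wpartial_swap_ex (measurable_fun_swap hu.1) wp.
rewrite (_ : (u \o swap) \o swap = u); last by apply/funext => -[].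
by rewrite (_ : (v \o swap) \o swap = v) //; apply/funext => -[].
Qed.

Lemma P1_slice_x u : P1 u -> {ae mu, forall z, L1 (fun x => u (x, z))}.
Proof. by move=> /P1_swap /P1_slice. Qed.

Lemma P2_slice_x u : P2 u -> {ae mu, forall z, L2 (fun x => u (x, z))}.
Proof. by move=> /P2_swap /P2_slice. Qed.

Lemma ae_fubini_x (P : R * R -> Prop) : {ae mu2, forall y, P y} ->
  {ae mu, forall z, {ae mu, forall x, P (x, z)}}.
Proof. by move=> /ae_swap /ae_fubini. Qed.

Lemma ae_snd (P : R -> Prop) : {ae mu, forall x, P x} -> {ae mu2, forall y, P y.2}.
Proof. by move=> /ae_fst /ae_swap. Qed.

Lemma Rint_rect_swap u a b c d : P1 u ->
  \int[mu]_(x in `[a, b]) \int[mu]_(z in `[c, d]) u (x, z) =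
  \int[mu]_(z in `[c, d]) \int[mu]_(x in `[a, b]) u (x, z).
Proof.
move=> hu.
rewrite -Rfubini //; last exact: P1_rect.
have := @Rfubini R (u \o swap) `[c, d] `[a, b] (measurable_itv _) (measurable_itv _) (P1_rect _ _ _ _ (P1_swap hu)).
have mD : measurable (`[a, b]%classic `*` `[c, d]%classic : set (R * R)) by exact: measurableX.
have := Rintegral_swap mD hu.1; rewrite preimage_swap_setX => -> ->.
by [].
Qed.

Lemma Rint_primx u c d x : P1 u -> c <= d ->
  \int[mu]_(z in `[c, d]) primx u (x, z) = prim (fun s => \int[mu]_(z in `[c, d]) u (s, z)) x.
Proof.
move=> hu cd; rewrite /primx /prim /=.
have i a b : rint mu `[c, d] (fun z => \int[mu]_(s in `[a, b]) u (s, z)).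
  by apply: L1_itv; exact: (P1_Rint a b (P1_swap hu)).
have e1 := Rint_rect_swap 0 x c d hu; have e2 := Rint_rect_swap x 0 c d hu.
transitivity (\int[mu]_(z in `[c, d]) \int[mu]_(s in `[0, x]) u (s, z) -
    \int[mu]_(z in `[c, d]) \int[mu]_(s in `[x, 0]) u (s, z)).
  by apply: RintegralB => //; exact: i.
by congr (_ - _); [exact: esym e1|exact: esym e2].
Qed.

Lemma prim_shift (g : R -> R) a x : L1 g ->
  prim (fun s => g (s + a)) x = prim g (x + a) - prim g a.
Proof.
move=> hg; rewrite {1}/prim !Rintegral_shift_itv ?add0r; [|exact: hg.1..].
have [x0|x0] := leP 0 x.
  by rewrite (@Rint_empty _ g (x + a) a) ?lerDr // subr0 primB ?lerDr.
by rewrite (@Rint_empty _ g a (x + a)) ?gerDr ?ltW // sub0r -primB ?gerDr ?ltW // opprB.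
Qed.

End SwapDirection.

(** * Translation averages *)

Section Combination.
Context {R : realType}.
Local Notation mu := (@lebesgue_measure R).
Local Notation mu2 := (@lebesgue2 R).
Variables (m : nat) (k : R) (t : nat -> R).
Implicit Types (u v w : R * R -> R) (f g : R -> R).

(** Scaled sums of translates cover two uses at once: the average over m cells, with k = 1/m and t i
    = 2 q i, and a single translate, with m = k = 1, by which periodicity passes to derivatives and
    traces. *)
Definition comb f x := k * \sum_(i < m) f (x + t i).
Definition comb2 u (y : R * R) := k * \sum_(i < m) u (y.1 + t i, y.2).

Lemma ae_shift2 a (P : R * R -> Prop) : {ae mu2, forall y, P y} ->
  {ae mu2, forall y, P (y.1 + a, y.2)}.
Proof.
move=> h; have /ae_fubini_x h' := h; case: h => N [mN N0 PN].
have mT : measurable_fun setT (fun y : R * R => (y.1 + a, y.2)).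
  apply: measurable_fun_pair => //; apply: measurable_funD => //.
exists ((fun y : R * R => (y.1 + a, y.2)) @^-1` N); split.
- by rewrite -[X in measurable X]setTI; exact: mT.
- apply: ae_prod; first by rewrite -[X in measurable X]setTI; exact: mT.
  have N' : {ae mu2, forall y, ~ N y}.
    by exists N; split => // y /= /contrapT.
  by have := ae_shift a (ae_fubini N').
- by move=> y /= h; exact: PN.
Qed.

Lemma rint_tonelli (F : R * R -> R) a b c d : measurable_fun setT F ->
  {ae mu, forall x, rint mu `[c, d] (fun z => F (x, z))} ->
  rint mu `[a, b] (fun x => \int[mu]_(z in `[c, d]) `|F (x, z)|) ->
  rint mu2 (`[a, b] `*` `[c, d]) F.
Proof.
move=> mF sl iK; apply/rint_restrict; first exact: measurableX.
set A := `[a, b]%classic in iK *; set B := `[c, d]%classic in sl iK *.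
have mA : measurable A by exact: measurable_itv.
have mB : measurable B by exact: measurable_itv.
have mP : measurable_fun setT (F \_ (A `*` B)).
  by apply/(measurable_restrictT _ (measurableX mA mB)); exact: measurable_funTS.
have mPE : measurable_fun setT (EFin \o (F \_ (A `*` B))) by exact/measurable_EFinP.
have mPN : measurable_fun setT (fun y => `|(EFin \o (F \_ (A `*` B))) y|%E).
  exact: measurableT_comp.
apply: (integrable12ltyP mu mu mPE).2.
pose K x := \int[mu]_(z in B) `|F (x, z)|.
have iKr : rint mu setT (K \_ A) by exact: (rint_restrict mu K mA).1.
have -> : (\int[mu]_x \int[mu]_y `|(EFin \o (F \_ (A `*` B))) (x, y)| =
    \int[mu]_x ((K \_ A) x)%:E)%E.
  apply: ge0_ae_eq_integral => //.
  - by have := @measurable_fun_fubini_tonelli_F _ _ _ _ R mu _ mPN; apply.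
  - exact/measurable_EFinP/rint_meas/iKr.
  - by move=> x _; exact: integral_ge0.
  - by move=> x _; rewrite lee_fin patchE; case: ifP => // _; apply: Rintegral_ge0.
  apply: aeS sl => x slx _ /=; rewrite patchE; case: ifPn => xA; last first.
    rewrite (eq_integral (cst 0%E)) ?integral0 // => z _.
    by rewrite patch_prod patchE (negbTE xA) normr0.
  rewrite -integral_Rint //; last exact: (integrable_norm slx).
  rewrite [RHS]integral_mkcond; apply: eq_integral => z _.
  rewrite patch_prod patchE xA !patchE; case: ifP => // _.
  by rewrite normr0.
by rewrite integral_Rint // ltry.
Qed.

Lemma P1_shift a u : P1 u -> P1 (fun y => u (y.1 + a, y.2)).
Proof.
move=> hu; have mT : measurable_fun setT (fun y : R * R => (y.1 + a, y.2)).
  by apply: measurable_fun_pair => //; apply: measurable_funD.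
have mua := measurableT_comp hu.1 mT; split => // n.
have hn : P1 (fun y => `|u y|).
  split; first by apply: measurableT_comp => //; exact: hu.1.
  by move=> j; have := integrable_norm (hu.2 j).
apply: rint_tonelli => //.
  have := ae_shift a (P1_slice hu); apply: aeS => x; exact: L1_itv.
exact: (L1_shift a (P1_Rint (- n%:R) n%:R hn)).2.
Qed.

Lemma P2_shift a u : P2 u -> P2 (fun y => u (y.1 + a, y.2)).
Proof.
move=> hu; split; first exact: (P1_shift a (P2_L1 hu)).1.
exact: (P1_shift a (L2b_sq hu)).2.
Qed.

Lemma L1_comb f : L1 f -> L1 (comb f).
Proof. by move=> hf; apply: L1Z; apply: L1_sum => i; exact: L1_shift. Qed.

Lemma L2_comb f : L2 f -> L2 (comb f).
Proof. by move=> hf; apply: L2Z; apply: L2_sum => i; exact: L2_shift. Qed.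

Lemma P1_comb2 u : P1 u -> P1 (comb2 u).
Proof.
move=> hu; apply: P1Z.
by apply: (@P1_sum R _ _ (fun (i : 'I_m) y => u (y.1 + t i, y.2))) => i; exact: P1_shift.
Qed.

Lemma P2_comb2 u : P2 u -> P2 (comb2 u).
Proof.
move=> hu; apply: P2Z.
by apply: (@P2_sum R _ _ (fun (i : 'I_m) y => u (y.1 + t i, y.2))) => i; exact: P2_shift.
Qed.

Lemma ae_shifts (P : R -> Prop) : {ae mu, forall x, P x} ->
  {ae mu, forall x, forall i, P (x + t i)}.
Proof. by move=> h; apply: ae_foralln => i; exact: ae_shift. Qed.

Lemma ae_shifts2 (P : R * R -> Prop) : {ae mu2, forall y, P y} ->
  {ae mu2, forall y, forall i, P (y.1 + t i, y.2)}.
Proof. by move=> h; apply: ae_foralln => i; exact: ae_shift2. Qed.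

Lemma prim_sum (I : Type) (s : seq I) (F : I -> R -> R) x : (forall i, L1 (F i)) ->
  prim (fun z => \sum_(i <- s) F i z) x = \sum_(i <- s) prim (F i) x.
Proof.
move=> h; rewrite /prim !Rint_sum // -?sumrB // => i; exact: L1_itv.
Qed.

Lemma prim_comb g x : L1 g ->
  prim (comb g) x = k * \sum_(i < m) (prim g (x + t i) - prim g (t i)).
Proof.
move=> hg; rewrite /comb primZ; last by apply: L1_sum => i; exact: L1_shift.
rewrite prim_sum; last by move=> i; exact: L1_shift.
by congr (_ * _); apply: eq_bigr => i _; rewrite prim_shift.
Qed.

Lemma comb_prim f g C : L1 g -> {ae mu, forall x, f x = C + prim g x} ->
  exists C', {ae mu, forall x, comb f x = C' + prim (comb g) x}.
Proof.
move=> hg /ae_shifts h.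
exists (k * \sum_(i < m) (C + prim g (t i))).
apply: aeS h => x h; rewrite prim_comb // -mulrDr -big_split /=; congr (_ * _).
by apply: eq_bigr => i _; rewrite h; ring.
Qed.

Lemma primz_comb2 u : P1 u ->
  {ae mu2, forall y, primz (comb2 u) y = comb2 (primz u) y}.
Proof.
move=> hu; have := ae_fst (ae_shifts (P1_slice hu)); apply: aeS => y h.
rewrite /primz /comb2 /= primZ; last by apply: L1_sum => i; exact: h.
by rewrite prim_sum.
Qed.

Lemma comb2_acl u v g : P1 v -> {ae mu2, forall y, u y = g y.1 + primz v y} ->
  {ae mu2, forall y, comb2 u y = comb g y.1 + primz (comb2 v) y}.
Proof.
move=> hv /ae_shifts2 h; have := aeI h (primz_comb2 hv); apply: aeS => y [{}h ->].
by rewrite /comb2 /comb -mulrDr -big_split /=; congr (_ * _); apply: eq_bigr => i _; rewrite h.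
Qed.

(** A horizontal translation moves the base point of the horizontal primitive. The correction
    [primx v (t i, z)] depends on z only and is absorbed by the first term; a vertical primitive
    needs no such correction. *)
Lemma comb2_acl_x u v g : P1 v -> {ae mu2, forall y, u y = g y.2 + primx v y} ->
  {ae mu2, forall y, comb2 u y =
    k * (\sum_(i < m) (g y.2 + primx v (t i, y.2))) + primx (comb2 v) y}.
Proof.
move=> hv /ae_shifts2 h; have := aeI h (ae_snd (P1_slice_x hv)); apply: aeS => y [{}h hs].
rewrite /primx /comb2 /= -/(comb (fun s => v (s, y.2))) prim_comb //.
rewrite -mulrDr -big_split /=; congr (_ * _); apply: eq_bigr => i _; rewrite h /primx /=; ring.
Qed.

Lemma is_wpartial_comb_ez u v : P2 u -> is_wpartial ez u v ->
  is_wpartial ez (comb2 u) (comb2 v).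
Proof.
move=> hu wp; have hv : P2 v by apply/L2loc2P; exact: wp.1.
have [g hg E] := is_wpartial_acl hu wp.
apply: (acl_is_wpartial (P1_comb2 (P2_L1 hu)) (P2_comb2 hv) (L1_comb (L2_L1 hg))).
exact: comb2_acl (P2_L1 hv) E.
Qed.

Lemma is_wpartial_comb_ex u v : P2 u -> is_wpartial ex u v ->
  is_wpartial ex (comb2 u) (comb2 v).
Proof.
move=> hu wp; have hv : P2 v by apply/L2loc2P; exact: wp.1.
have [g hg E] := is_wpartial_acl_x hu wp.
apply: (@acl_is_wpartial_x _ _ _ (fun z => k * (\sum_(i < m) (g z + primx v (t i, z))))
  (P1_comb2 (P2_L1 hu)) (P2_comb2 hv) _ (comb2_acl_x (P2_L1 hv) E)).
apply: L1Z; apply: L1_sum => i; apply: L1D; first exact: L2_L1.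
exact: L2_L1 (L2_prim_slice (t i) (P2_swap hv)).
Qed.

Lemma trace_comb u c : H1loc2 u ->
  {ae mu, forall x, trace (comb2 u) c x = comb (trace u c) x}.
Proof.
move=> [/L2loc2P hu _ /wpartialP wp].
have hv : P2 (wpartial ez u) by apply/L2loc2P; exact: wp.1.
have [g hg E] := is_wpartial_acl hu wp.
have [T _] := trace_acl c (P2_L1 hu) hv hg E.
have E' := comb2_acl (P2_L1 hv) E.
have [T' _] := trace_acl c (P1_comb2 (P2_L1 hu)) (P2_comb2 hv) (L2_comb hg) E'.
have := aeI T' (aeI (ae_shifts T) (ae_shifts (P1_slice (P2_L1 hv)))).
apply: aeS => x [-> [hT hs]].
rewrite /primz /comb2 /= primZ; last by apply: L1_sum => i; exact: hs.
rewrite prim_sum // /comb -mulrDr -big_split /=; congr (_ * _).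
by apply: eq_bigr => i _; rewrite hT.
Qed.

End Combination.

Section AlmostEverywhere.
Context {R : realType}.
Local Notation mu := (@lebesgue_measure R).
Local Notation mu2 := (@lebesgue2 R).
Implicit Types (u : R * R -> R).

Lemma measurable_derive2 (phi : R * R -> R) dir : test_function phi -> measurable_fun setT ('D_dir phi).
Proof. by move=> h; apply: measurable_test2; exact: test_function_derive. Qed.

(** The two predicates are equal, not just equivalent: [wpartial] chooses from the predicate, so
    functions that agree almost everywhere receive literally the same derivative. *)
Lemma is_wpartial_ae dir u u' : measurable_fun setT u -> measurable_fun setT u' ->
  {ae mu2, forall y, u y = u' y} -> is_wpartial dir u = is_wpartial dir u'.
Proof.
move=> mu_ mu'_ E.
have e phi : test_function phi ->
    \int[mu2]_y (u y * 'D_dir phi y) = \int[mu2]_y (u' y * 'D_dir phi y).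
  move=> hphi; apply: Rint_eq_ae => //.
  - by apply: measurable_funM => //; exact: measurable_derive2.
  - by apply: measurable_funM => //; exact: measurable_derive2.
  - by apply: aeS E => y -> _.
apply/funext => g; apply/propext; split=> -[hg h]; split=> // phi hphi.
  by rewrite -e // h.
by rewrite e // h.
Qed.

Lemma wpartial_ae dir u u' : measurable_fun setT u -> measurable_fun setT u' ->
  {ae mu2, forall y, u y = u' y} -> wpartial dir u = wpartial dir u'.
Proof. by move=> h1 h2 E; rewrite /wpartial (is_wpartial_ae dir h1 h2 E). Qed.

Lemma trace_ae u u' c : measurable_fun setT u -> measurable_fun setT u' ->
  measurable_fun setT (wpartial ez u) ->
  {ae mu2, forall y, u y = u' y} -> trace u c = trace u' c.
Proof.
move=> h1 h2 h3 E; rewrite /trace.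
suff -> : is_trace u c = is_trace u' c by [].
apply/funext => g; apply/propext; rewrite /is_trace -(wpartial_ae ez h1 h2 E).
have mD : measurable [set y : R * R | c < y.2].
  rewrite (_ : [set _ | _] = setT `*` `]c, +oo[%classic); first exact: measurableX.
  by apply/seteqP; split => y /=; rewrite in_itv /= andbT => // -[].
have e phi : test_function phi ->
    \int[mu2]_(y in [set y : R * R | c < y.2]) (u y * 'D_ez phi y + wpartial ez u y * phi y) =
    \int[mu2]_(y in [set y : R * R | c < y.2]) (u' y * 'D_ez phi y + wpartial ez u y * phi y).
  move=> hphi; have md := measurable_derive2 ez hphi; have mt := measurable_test2 hphi.
  apply: Rint_eq_ae => //.
  - by apply: measurable_funTS; apply: measurable_funD; exact: measurable_funM.
  - by apply: measurable_funTS; apply: measurable_funD; exact: measurable_funM.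
  - by apply: aeS E => y -> _.
by split=> -[hg h]; split=> // phi hphi; rewrite h ?e.
Qed.

End AlmostEverywhere.

Local Opaque wderiv wpartial trace prim.

(** * Gauge-invariant fields *)

Section Fields.
Context {R : realType}.
Local Notation mu := (@lebesgue_measure R).
Local Notation mu2 := (@lebesgue2 R).
Implicit Types (f g : R -> R) (u v w : R * R -> R).

Lemma Rint_itvD f g a b : L1 f -> L1 g ->
  \int[mu]_(x in `[a, b]) (f x + g x) = \int[mu]_(x in `[a, b]) f x + \int[mu]_(x in `[a, b]) g x.
Proof. by move=> hf hg; apply: RintegralD => //; exact: L1_itv. Qed.

Lemma Rint_itvB f g a b : L1 f -> L1 g ->
  \int[mu]_(x in `[a, b]) (f x - g x) = \int[mu]_(x in `[a, b]) f x - \int[mu]_(x in `[a, b]) g x.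
Proof. by move=> hf hg; apply: RintegralB => //; exact: L1_itv. Qed.

Lemma Rint_itvZ k f a b : L1 f ->
  \int[mu]_(x in `[a, b]) (k * f x) = k * \int[mu]_(x in `[a, b]) f x.
Proof. by move=> hf; apply: RintegralZl => //; exact: L1_itv. Qed.

Lemma Rint_itv_sum (I : Type) (s : seq I) (F : I -> R -> R) a b : (forall i, L1 (F i)) ->
  \int[mu]_(x in `[a, b]) (\sum_(i <- s) F i x) = \sum_(i <- s) \int[mu]_(x in `[a, b]) F i x.
Proof. by move=> hF; apply: Rint_sum => // i; exact: L1_itv. Qed.

Lemma wderivP f : H1loc f -> is_wderiv f (wderiv f) /\ L2 (wderiv f).
Proof.
move=> [_ [g hg]]; have := xgetPex (fun=> 0) (ex_intro _ g hg : exists g, [set g | is_wderiv f g] g).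
by move=> h; split => //; apply/L2locP; exact: h.1.
Qed.

Lemma H1loc_prim f : H1loc f ->
  exists C, {ae mu, forall x, f x = C + prim (wderiv f) x}.
Proof.
move=> hf; have [[_ h] hw] := wderivP hf.
by apply: is_wderiv_prim => //; apply: L2_L1 => //; apply/L2locP; exact: hf.1.
Qed.

(** Primitives are continuous, so the relation between them holds everywhere; then g and h have the
    same integral over every interval. *)
Lemma L1_prim_eq_ae g h C : L1 g -> L1 h ->
  {ae mu, forall x, prim g x = C + prim h x} -> {ae mu, forall x, g x = h x}.
Proof.
move=> hg hh E.
have cg := continuous_prim hg; have ch := continuous_prim hh.
have {}E x : prim g x = C + prim h x.
  apply: contrapT => nx.
  have O : open [set y : R | prim g y - prim h y != C].
    rewrite (_ : [set _ | _] = (fun y => prim g y - prim h y) @^-1` [set z | z != C]) //.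
    by apply: open_comp; [move=> ? _; apply: cvgB; [exact: cg|exact: ch]|exact: open_neq].
  have Ox : prim g x - prim h x != C.
    by apply/eqP => e; apply: nx; rewrite -e subrK.
  have [e /= e0 he] : nbhs_ball x [set y : R | prim g y - prim h y != C].
    by apply/nbhs_ballP; apply: open_nbhs_nbhs.
  case: E => N [mN N0 PN].
  have : (mu (`]x - e, x + e[%classic)%R <= mu N)%E.
    apply: le_measure; rewrite ?inE // => y /=; rewrite in_itv /= => /andP[y1 y2].
    apply: PN => /= ey.
    have by_ : ball x e y by rewrite /ball /= ltr_norml; apply/andP; split; lra.
    by have := he _ by_; rewrite /= ey addrK eqxx.
  rewrite N0 lebesgue_measure_itv /= lte_fin ifT; last by lra.
  by rewrite -EFinB lee_fin; lra.
have : {ae mu, forall x, g x - h x = 0}.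
  apply: L1_eq0; first exact: L1B.
  move=> a b ab; rewrite RintegralB //; [|exact: L1_itv..].
  by rewrite -!primB // !E; ring.
by apply: aeS => x /eqP; rewrite subr_eq0 => /eqP.
Qed.

(** The rule by which weak derivatives are computed below: exhibit the function as a primitive of
    something square integrable. *)
Lemma wderiv_unique f g C : measurable_fun setT f -> L2 g ->
  {ae mu, forall x, f x = C + prim g x} ->
  [/\ H1loc f, is_wderiv f g & {ae mu, forall x, wderiv f x = g x}].
Proof.
move=> mf hg E.
have wg : is_wderiv f g.
  by split; [exact/L2locP|exact: prim_is_wderiv mf (L2_L1 hg) E].
have H1 : H1loc f.
  split; last by exists g.
  apply/L2locP; apply: (L2_eq_ae mf (f := fun x => C + prim g x)).
    by apply: aeS E => x ->.
  apply: L2_continuous => x; apply: cvgD; first exact: cvg_cst.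
  exact: continuous_prim (L2_L1 hg) x.
split => //.
have [C' E'] := H1loc_prim H1; have [_ hw] := wderivP H1.
apply: (L1_prim_eq_ae (C := C - C')); [exact: L2_L1..|].
by have := aeI E E'; apply: aeS => x [-> e]; rewrite -[LHS](addKr C') -e; ring.
Qed.

Lemma wderiv_comb m k t f : H1loc f ->
  H1loc (comb m k t f) /\
  {ae mu, forall x, wderiv (comb m k t f) x = comb m k t (wderiv f) x}.
Proof.
move=> hf; have [_ hw] := wderivP hf.
have [C E] := H1loc_prim hf.
have [C' E'] := comb_prim m k t (L2_L1 hw) E.
have mf : measurable_fun setT (comb m k t f).
  by apply: (L1_comb m k t _).1; apply: L2_L1; apply/L2locP; exact: hf.1.
by have [? _ ?] := wderiv_unique mf (L2_comb m k t hw) E'.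
Qed.

Lemma trace_diff u c d : H1loc2 u -> c <= d ->
  {ae mu, forall x, trace u d x - trace u c x = \int[mu]_(z in `[c, d]) wpartial ez u (x, z)}
  /\ (L2 (trace u c) /\ L2 (trace u d)).
Proof.
move=> [/L2loc2P hu _ /wpartialP wp] cd.
have hv : P2 (wpartial ez u) by apply/L2loc2P; exact: wp.1.
have [g hg E] := is_wpartial_acl hu wp.
have [T1 L21] := trace_acl c (P2_L1 hu) hv hg E.
have [T2 L22] := trace_acl d (P2_L1 hu) hv hg E.
split=> //; have := aeI (aeI T1 T2) (P1_slice (P2_L1 hv)).
apply: aeS => x [[-> ->] s]; rewrite -primB // /primz /=; ring.
Qed.

(** Differentiation under the integral sign in primitive form. It supplies the derivative of the A_z
    term in the phase difference. *)
Lemma Rint_slice_prim u (c d : R) : P2 u -> (exists g : R * R -> R, is_wpartial ex u g) -> c <= d ->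
  exists C, {ae mu, forall x, \int[mu]_(z in `[c, d]) u (x, z) =
    C + prim (fun x => \int[mu]_(z in `[c, d]) wpartial ex u (x, z)) x}.
Proof.
move=> hu /wpartialP wp cd.
have hv : P2 (wpartial ex u) by apply/L2loc2P; exact: wp.1.
have [g hg E] := is_wpartial_acl_x hu wp.
exists (\int[mu]_(z in `[c, d]) g z).
have hp : P1 (primx (wpartial ex u)).
  by have := P1_swap (P1_primz (P1_swap (P2_L1 hv))).
have := aeI (ae_fubini E) (aeI (P1_slice (P2_L1 hu)) (P1_slice hp)).
apply: aeS => x [e [su sp]].
rewrite -Rint_primx //; last exact: P2_L1.
rewrite -RintegralD //; [|by apply: L1_itv; exact: L2_L1|exact: L1_itv].
apply: Rint_eq_ae => //.
- exact: measurable_funTS su.1.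
- by apply: measurable_funTS; apply: measurable_funD; [exact: hg.1|exact: sp.1].
- by apply: aeS e => z -> _.
Qed.

End Fields.

Section ConfigFields.
Context {R : realType}.
Local Notation mu := (@lebesgue_measure R).
Local Notation mu2 := (@lebesgue2 R).
Variables (p : R) (N : nat) (H : R).
Hypothesis hp : 0 < p.
Implicit Types c : @config R N.

Definition velocity (c : @config R N) (n : 'I_N.+1) (x : R) : R :=
  wderiv (phase c n) x - trace (potx c) (n%:R * p) x.

Definition excess (c : @config R N) (y : R * R) : R :=
  wpartial ez (potx c) y - wpartial ex (potz c) y - H.

Definition flux (h : R * R -> R) (n : 'I_N) (x : R) : R :=
  \int[mu]_(z in `[n%:R * p, n.+1%:R * p]) h (x, z).

(** The conditions on a configuration that mention no period; the identity for the phase difference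
    and the finiteness of the energy rest on these. *)
Definition regular (c : @config R N) : Prop :=
  [/\ H1loc2 (potx c), H1loc2 (potz c),
      forall n, H1loc (modulus c n) & forall n, H1loc (phase c n)].

Lemma P2_excess c : regular c -> P2 (excess c).
Proof.
move=> [[_ _ /wpartialP h1] [_ /wpartialP h2 _] _ _].
apply: P2B; last exact: P2_cst.
by apply: P2B; apply/L2loc2P; [exact: h1.1|exact: h2.1].
Qed.

Lemma np_le (n : nat) : n%:R * p <= n.+1%:R * p.
Proof. by rewrite ler_pM2r // ler_nat. Qed.

Lemma natrS_mul (n : nat) : n.+1%:R * p = p + n%:R * p.
Proof. by rewrite -natr1; ring. Qed.

Lemma L2_velocity c n : regular c -> L2 (velocity c n).
Proof.
move=> [h1 _ _ h4]; apply: L2B; first by have [] := wderivP (h4 n).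
by have [_ []] := trace_diff h1 (np_le n).
Qed.

(** Stokes' theorem on one gap. [trace_diff] writes the jump of A_x between the planes as the
    integral of d_z A_x, and [Rint_slice_prim] writes the derivative of the A_z term as the integral
    of d_x A_z. Their difference is the integral of h + H over a gap of height p, which accounts for
    Hp. *)
Lemma phase_diff_prim c (n : 'I_N) : regular c ->
  exists C, {ae mu, forall x, phase_diff p c n x = C + prim (fun x =>
    velocity c (lift ord0 n) x - velocity c (widen_ord (leqnSn N) n) x
    + flux (excess c) n x + H * p) x}.
Proof.
move=> rc; have [h1 h2 h3 h4] := rc.
set n1 := lift ord0 n; set n0 := widen_ord (leqnSn N) n.
have [C1 E1] := H1loc_prim (h4 n1); have [C0 E0] := H1loc_prim (h4 n0).
have pz : P2 (potz c) by apply/L2loc2P; case: h2.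
have wx : exists g : R * R -> R, is_wpartial ex (potz c) g by case: h2.
have [C2 E2] := Rint_slice_prim pz wx (np_le n).
have [T [T0 T1]] := trace_diff h1 (np_le n).
have [_ L1w] := wderivP (h4 n1); have [_ L0w] := wderivP (h4 n0).
have Pz : P2 (wpartial ez (potx c)).
  by case: h1 => _ _ /wpartialP []; move=> /L2loc2P.
have Px : P2 (wpartial ex (potz c)) by have [/L2loc2P] := wpartialP wx.
exists (C1 - C0 - C2).
have LB : L1 (fun x => \int[mu]_(z in `[n%:R * p, n.+1%:R * p]) wpartial ex (potz c) (x, z)).
  by apply: P1_Rint; exact: P2_L1.
have Lall : L1 (fun x => velocity c n1 x - velocity c n0 x + flux (excess c) n x + H * p).
  apply: L1D; last exact: L1_cst.
  apply: L1D; first by apply: L1B; apply: L2_L1; exact: L2_velocity.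
  by apply: P1_Rint; apply: P2_L1; exact: P2_excess.
have Ee : {ae mu, forall x,
    wderiv (phase c n1) x - wderiv (phase c n0) x -
      \int[mu]_(z in `[n%:R * p, n.+1%:R * p]) wpartial ex (potz c) (x, z) =
    velocity c n1 x - velocity c n0 x + flux (excess c) n x + H * p}.
  have := aeI T (aeI (P1_slice (P2_L1 Pz)) (P1_slice (P2_L1 Px))).
  apply: aeS => x [t [sz sx]].
  have e1 : flux (excess c) n x = \int[mu]_(z in `[n%:R * p, n.+1%:R * p]) wpartial ez (potx c) (x, z)
      - \int[mu]_(z in `[n%:R * p, n.+1%:R * p]) wpartial ex (potz c) (x, z)
      - \int[mu]_(z in `[n%:R * p, n.+1%:R * p]) H.
    have d := Rint_itvB (n%:R * p) (n.+1%:R * p) sz sx.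
    have d' := Rint_itvB (n%:R * p) (n.+1%:R * p) (L1B sz sx) (@L1_cst R H).
    exact: etrans d' (f_equal (fun t => t - _) d).
  have ec := etrans (Rint_cst H (np_le n)) (f_equal (fun t => H * (t - n%:R * p)) (natrS_mul n)).
  have key (a b k W1 W0 t1 t0 F : R) : F = a - b - k -> t1 - t0 = a ->
      k = H * (p + n%:R * p - n%:R * p) ->
      W1 - W0 - b = (W1 - t1) - (W0 - t0) + F + H * p.
    by move=> -> <- ->; ring.
  exact: (key _ _ _ _ _ _ _ _ e1 t ec).
have e := eq_prim Ee.
have := aeI E1 (aeI E0 E2); apply: aeS => x [e1 [e0 e2]].
rewrite -e; [|by have [] : L1 (fun x => wderiv (phase c n1) x - wderiv (phase c n0) x - \int[mu]_(z in `[n%:R * p, n.+1%:R * p]) wpartial ex (potz c) (x, z)) by apply: L1B => //; apply: L1B; exact: L2_L1|exact: Lall.1].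
rewrite primBf; [|by apply: L1B; exact: L2_L1|by []].
rewrite primBf; [|exact: L2_L1|exact: L2_L1].
have key (a b c' A B D F G I : R) : F = A + a -> G = B + b -> I = D + c' ->
    F - G - I = A - B - D + (a - b - c') by move=> -> -> ->; ring.
exact: (key _ _ _ _ _ _ _ _ _ e1 e0 e2).
Qed.

End ConfigFields.

(** * Periodic functions on the line *)

Section Periodic.
Context {R : realType}.
Local Notation mu := (@lebesgue_measure R).
Implicit Types (f g u w : R -> R) (a b T : R).

(** The endpoints are included: a neighbourhood of an endpoint still meets [a, b] in positive
    measure. This is what gives equality of traces on the outer planes. *)
Lemma continuous_ae_eq0 u a b : continuous u -> a < b ->
  {ae mu, forall x, a <= x <= b -> u x = 0} -> forall x, a <= x <= b -> u x = 0.
Proof.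
move=> cu ab E x /andP[ax xb]; apply: contrapT => /eqP nx.
have O : open [set y : R | u y != 0].
  by apply: (@open_comp _ _ u [set z | z != 0]); [move=> ? _; exact: cu|exact: open_neq].
have [e /= e0 he] : nbhs_ball x [set y : R | u y != 0].
  by apply/nbhs_ballP; apply: open_nbhs_nbhs.
pose l := Num.max a (x - e / 2); pose r := Num.min b (x + e / 2).
have lr : l < r by rewrite lt_min !gt_max; apply/andP; split; apply/andP; split; lra.
case: E => A [mA A0 PA].
have : (mu (`[l, r]%classic)%R <= mu A)%E.
  apply: le_measure; rewrite ?inE // => y /=; rewrite in_itv /= => /andP[y1 y2].
  have [[ay xy] [yb yx]] : (a <= y /\ x - e / 2 <= y) /\ (y <= b /\ y <= x + e / 2).
    by move: y1 y2; rewrite ge_max le_min => /andP[? ?] /andP[? ?].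
  apply: PA => /= ey.
  have by_ : ball x e y by rewrite /ball /= ltr_norml; apply/andP; split; lra.
  by have := he _ by_; rewrite /= ey ?eqxx // ay.
rewrite A0 mu_itv; last exact: ltW.
by rewrite lee_fin; lra.
Qed.

Lemma continuous_ae_eq u w : continuous u -> continuous w ->
  {ae mu, forall x, u x = w x} -> u =1 w.
Proof.
move=> cu cw E x; apply/eqP; rewrite -subr_eq0; apply/eqP.
apply: (@continuous_ae_eq0 (fun y => u y - w y) (x - 1) (x + 1)); last by apply/andP; split; lra.
- by move=> y; apply: cvgB; [exact: cu|exact: cw].
- lra.
- by apply: aeS E => y -> _; rewrite subrr.
Qed.

Definition periodic T f := {ae mu, forall x, f (x + T) = f x}.

Lemma periodic_natmul T f (i : nat) : periodic T f -> periodic (T * i%:R) f.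
Proof.
move=> h; elim: i => [|i IH]; first by apply: aeW => x; rewrite mulr0 addr0.
have := aeI (ae_shift (T * i%:R) h) IH; apply: aeS => x [e1 e2].
by rewrite -e2 -e1 -addrA -natr1; congr (f (_ + _)); ring.
Qed.

(** A constant jump disappears under differentiation. Phases have such a jump, so their derivatives
    are genuinely periodic. *)
Lemma periodic_prim f g C T J : L1 g -> {ae mu, forall x, f x = C + prim g x} ->
  {ae mu, forall x, f (x + T) = f x + J} -> periodic T g.
Proof.
move=> hg E P.
apply: (@L1_prim_eq_ae R _ _ (J - prim g T)) => //; first exact: L1_shift.
have := aeI (aeI E (ae_shift T E)) P; apply: aeS => x [[e1 e2] e3].
rewrite prim_shift //.
have -> : prim g (x + T) = C + prim g x + J - C by rewrite -e1 -e3 e2; ring.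
ring.
Qed.

Lemma prim_periodic g T x : L1 g -> periodic T g -> prim g (x + T) - prim g x = prim g T.
Proof.
move=> hg P.
have e : prim (fun s => g (s + T)) =1 prim g.
  by apply: eq_prim => //; [exact: (L1_shift T hg).1|exact: hg.1].
by have := e x; rewrite prim_shift // => <-; ring.
Qed.

Lemma Rint_periodic g T a b : 0 <= T -> L1 g -> periodic T g ->
  \int[mu]_(x in `[a, a + T]) g x = \int[mu]_(x in `[b, b + T]) g x.
Proof. by move=> T0 hg P; rewrite -!primB ?lerDl // !prim_periodic. Qed.

Lemma ae_cell (Q : R -> Prop) q : 0 < q ->
  {ae mu, forall x, Q (x + 2 * q) <-> Q x} ->
  {ae mu, forall x, `[- q, q]%classic x -> Q x} -> {ae mu, forall x, Q x}.
Proof.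
move=> q0 per cell.
have per' (i : nat) : {ae mu, forall x, Q (x + 2 * q * i%:R) <-> Q x}.
  elim: i => [|i IH]; first by apply: aeW => x; rewrite mulr0 addr0.
  have := aeI (ae_shift (2 * q * i%:R) per) IH; apply: aeS => x [e1 e2].
  rewrite -e2 -e1 (_ : x + 2 * q * i%:R + 2 * q = x + 2 * q * i.+1%:R) //.
  by rewrite -natr1; ring.
have up (i : nat) : {ae mu, forall x, `[- q, q]%classic (x + 2 * q * i%:R) -> Q x}.
  have := aeI (per' i) (ae_shift (2 * q * i%:R) cell).
  by apply: aeS => x [e1 e2] /e2 /e1.
have down (i : nat) : {ae mu, forall x, `[- q, q]%classic (x - 2 * q * i%:R) -> Q x}.
  have := aeI (ae_shift (- (2 * q * i%:R)) (per' i)) (ae_shift (- (2 * q * i%:R)) cell).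
  by apply: aeS => x [e1 e2] /e2 /e1; rewrite subrK.
have up' : {ae mu, forall x, forall i : nat, `[- q, q]%classic (x + 2 * q * i%:R) -> Q x}.
  exact: (@ae_foralln _ _ _ mu (fun i x => `[- q, q]%classic (x + 2 * q * i%:R) -> Q x)).
have down' : {ae mu, forall x, forall i : nat, `[- q, q]%classic (x - 2 * q * i%:R) -> Q x}.
  exact: (@ae_foralln _ _ _ mu (fun i x => `[- q, q]%classic (x - 2 * q * i%:R) -> Q x)).
have := aeI up' down'; apply: aeS => x [h1 h2].
have q2 : 0 < 2 * q by lra.
(* The index of the cell containing x: x - 2 q j lies in [-q, q]. *)
pose j := Num.floor ((x + q) / (2 * q)).
have /andP[] := floor_itv ((x + q) / (2 * q)).
rewrite -/j ler_pdivlMr // ltr_pdivrMr // intrD mulrDl mul1r => j1 j2.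
case: (j) j1 j2 => i; rewrite ?NegzE ?mulrNz -?pmulrn => j1 j2.
  by apply: (h2 i); rewrite /= in_itv /=; apply/andP; split; lra.
by apply: (h1 i.+1); rewrite /= in_itv /=; apply/andP; split; lra.
Qed.

Lemma Rint_odd k a : 0 <= a -> \int[mu]_(x in `[- a, a]) (k * x) = 0.
Proof.
move=> a0.
have L : L1 (fun x : R => x) by apply: L1_continuous => x; exact: cvg_id.
rewrite Rint_itvZ //.
have := @prim_ibp R 0 0 (fun=> 1) (fun=> 1) (- a) a (L1_cst 1) (L1_cst 1).
rewrite !prim_cst !mul1r !add0r mulrNN subrr => /(_ _) e.
have {}e : \int[mu]_(x in `[- a, a]) x + \int[mu]_(x in `[- a, a]) x = 0.
  rewrite -[RHS]e; last lra.
  by congr (_ + _); apply: eq_Rintegral => x _; rewrite ?prim_cst; ring.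
by rewrite (_ : \int[mu]_(x in `[- a, a]) x = 0) ?mulr0 //; lra.
Qed.

End Periodic.

(** * Averages over the m cells of a long period *)

Section Average.
Context {R : realType}.
Local Notation mu := (@lebesgue_measure R).
Local Notation mu2 := (@lebesgue2 R).
Variables (m : nat) (q : R).
Hypothesis (m0 : (0 < m)%N) (q0 : 0 < q).
Implicit Types (f g u w : R -> R) (v : R * R -> R).

Definition cells (i : nat) : R := 2 * q * i%:R.
Definition avg f := comb m m%:R^-1 cells f.
Definition avg2 v := comb2 m m%:R^-1 cells v.

Lemma mulVm : m%:R^-1 * m%:R = 1 :> R.
Proof. by rewrite mulVf // pnatr_eq0 -lt0n. Qed.

Lemma opp_le_cell : - q <= q.
Proof. by move: q0; lra. Qed.

Lemma cell_le (a s : R) : a + s <= a + 2 * q + s.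
Proof. by move: q0; lra. Qed.

Lemma Rint_cells g (n : nat) a : L1 g ->
  \sum_(i < n) \int[mu]_(x in `[a, a + 2 * q]) g (x + cells i) =
  \int[mu]_(x in `[a, a + cells n]) g x.
Proof.
move=> hg; rewrite -primB //; last by rewrite lerDl !mulr_ge0 //; exact: ltW.
elim: n => [|n IH]; first by rewrite big_ord0 /cells mulr0 addr0 subrr.
rewrite big_ord_recr /= {}IH Rintegral_shift_itv; last exact: hg.1.
rewrite -primB //; last first.
  exact: cell_le.
have -> : a + 2 * q + cells n = a + cells n.+1 by rewrite /cells -natr1; ring.
ring.
Qed.

(** The long period, moved by periodicity so that it starts at -q, is tiled by m cells, and the
    integral over it is the sum of the integrals of m translates over one cell. *)
Lemma Rint_avg g : L1 g -> periodic (2 * (m%:R * q)) g ->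
  \int[mu]_(x in `[- (m%:R * q), m%:R * q]) g x = m%:R * \int[mu]_(x in `[- q, q]) avg g x.
Proof.
move=> hg P.
have sh i : L1 (fun x => g (x + cells i)) by exact: L1_shift.
rewrite /avg /comb Rint_itvZ; last exact: (@L1_sum R _ _ (fun (i : 'I_m) x => g (x + cells i))).
rewrite mulrA divff ?pnatr_eq0 -?lt0n // mul1r.
rewrite (@Rint_itv_sum R 'I_m _ (fun i x => g (x + cells i))) //.
have -> : \int[mu]_(x in `[- (m%:R * q), m%:R * q]) g x =
    \int[mu]_(x in `[- q, - q + 2 * (m%:R * q)]) g x.
  rewrite -(@Rint_periodic R g _ (- (m%:R * q))) //; last by rewrite !mulr_ge0 // ltW.
  have e : - (m%:R * q) + 2 * (m%:R * q) = m%:R * q by ring.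
  by rewrite e.
have -> : 2 * (m%:R * q) = cells m by rewrite /cells; ring.
rewrite -(Rint_cells _ _ hg); apply: eq_bigr => i _.
have e : - q + 2 * q = q by ring.
by rewrite e.
Qed.

Lemma avg_periodic f : periodic (2 * (m%:R * q)) f -> periodic (2 * q) (avg f).
Proof.
move=> P; apply: aeS P => x e; rewrite /avg /comb; congr (_ * _).
case: m m0 e => // k _ e.
(* A shift by one cell permutes the summands cyclically; the last one returns to the first through
   the long period. *)
rewrite big_ord_recr big_ord_recl /= addrC; congr (_ + _).
  rewrite /cells mulr0 addr0 -e; congr f; rewrite -natr1; ring.
by apply: eq_bigr => i _; congr f; rewrite /cells (_ : fintype.bump 0 i = i.+1) // -natr1; ring.
Qed.

Lemma periodic_cells f : periodic (2 * q) f -> {ae mu, forall x, forall i, f (x + cells i) = f x}.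
Proof.
move=> P; apply: (@ae_foralln _ _ _ mu (fun i x => f (x + cells i) = f x)) => i.
exact: periodic_natmul.
Qed.

Lemma avg_id f : periodic (2 * q) f -> {ae mu, forall x, avg f x = f x}.
Proof.
move=> /periodic_cells; apply: aeS => x e; rewrite /avg /comb.
rewrite (eq_bigr (fun=> f x)); last by move=> i _.
by rewrite sumr_const card_ord -[f x *+ m]mulr_natl mulrA mulVm mul1r.
Qed.

Lemma avgM w f : periodic (2 * q) w -> {ae mu, forall x, avg (fun y => w y * f y) x = w x * avg f x}.
Proof.
move=> /periodic_cells; apply: aeS => x e; rewrite /avg /comb mulrCA; congr (_ * _).
by rewrite mulr_sumr; apply: eq_bigr => i _; rewrite e.
Qed.

Lemma avgB f g x : avg (fun y => f y - g y) x = avg f x - avg g x.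
Proof. by rewrite /avg /comb sumrB mulrBr. Qed.

Lemma avgD f g x : avg (fun y => f y + g y) x = avg f x + avg g x.
Proof. by rewrite /avg /comb big_split mulrDr. Qed.

Lemma periodic_q f : periodic (2 * q) f -> periodic (2 * (m%:R * q)) f.
Proof.
by move=> /(periodic_natmul m); rewrite (_ : 2 * q * m%:R = 2 * (m%:R * q)) //; ring.
Qed.

Lemma periodicB T f g : periodic T f -> periodic T g -> periodic T (fun x => f x - g x).
Proof. by move=> h1 h2; have := aeI h1 h2; apply: aeS => x [-> ->]. Qed.

Lemma periodicM T f g : periodic T f -> periodic T g -> periodic T (fun x => f x * g x).
Proof. by move=> h1 h2; have := aeI h1 h2; apply: aeS => x [-> ->]. Qed.

Lemma avg_dev f : periodic (2 * (m%:R * q)) f -> {ae mu, forall x, avg (fun y => f y - avg f y) x = 0}.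
Proof.
move=> P; apply: aeS (avg_id (avg_periodic P)) => x e.
by rewrite avgB e subrr.
Qed.

(** The mechanism behind averaging: deviations from the average are orthogonal to every weight of
    the short period. All first-order terms of expansions at the average are removed by it. *)
Lemma Rint_orth w f : periodic (2 * q) w -> periodic (2 * (m%:R * q)) f ->
  L1 (fun x => w x * (f x - avg f x)) ->
  \int[mu]_(x in `[- (m%:R * q), m%:R * q]) (w x * (f x - avg f x)) = 0.
Proof.
move=> Pw Pf L; rewrite Rint_avg //; last first.
  apply: periodicM; first exact: periodic_q.
  by apply: periodicB => //; apply: periodic_q; exact: avg_periodic.
have E : {ae mu, forall x, avg (fun y => w y * (f y - avg f y)) x = 0}.
  by have := aeI (avgM (fun y => f y - avg f y) Pw) (avg_dev Pf); apply: aeS => x [-> ->]; rewrite mulr0.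
rewrite (@Rint_eq_ae _ _ _ mu _ _ (fun=> 0)) //.
- rewrite Rint_cst ?mul0r ?mulr0 //; exact: opp_le_cell.
- by apply: measurable_funTS; exact: (L1_comb _ _ _ L).1.
- by apply: aeS E => x -> _.
Qed.

Lemma avg_bounds f a b : {ae mu, forall x, a <= f x <= b} -> {ae mu, forall x, a <= avg f x <= b}.
Proof.
move=> h; apply: aeS (ae_shifts cells h) => x e.
have cst (s : R) : m%:R^-1 * (\sum_(i < m) s) = s.
  by rewrite sumr_const card_ord -[s *+ m]mulr_natl mulrA mulVm mul1r.
have mp : 0 <= m%:R^-1 :> R by rewrite invr_ge0.
apply/andP; split; [rewrite -[leLHS]cst|rewrite -[leRHS]cst]; apply: ler_wpM2l => //;
  by apply: ler_sum => i _; have /andP[] := e i.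
Qed.

End Average.

Section Sobolev2.
Context {R : realType}.
Local Notation mu := (@lebesgue_measure R).
Local Notation mu2 := (@lebesgue2 R).
Implicit Types (f g : R -> R) (u v w : R * R -> R).

Lemma H1loc2_P2 u : H1loc2 u -> [/\ P2 u, P2 (wpartial ex u) & P2 (wpartial ez u)].
Proof.
by move=> [h /wpartialP h1 /wpartialP h2]; split; apply/L2loc2P => //; [exact: h1.1|exact: h2.1].
Qed.

Lemma H1loc2_ae u u' : measurable_fun setT u' -> {ae mu2, forall y, u y = u' y} ->
  H1loc2 u -> H1loc2 u'.
Proof.
move=> mu' E hu; have [hu2 _ _] := H1loc2_P2 hu; case: hu => [_ h1 h2].
split; first by apply/L2loc2P; apply: P2_eq_ae mu' E hu2.
- by rewrite -(is_wpartial_ae ex hu2.1 mu' E).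
- by rewrite -(is_wpartial_ae ez hu2.1 mu' E).
Qed.

Lemma H1loc2_comb m k t u : H1loc2 u ->
  [/\ H1loc2 (comb2 m k t u),
      {ae mu2, forall y, wpartial ex (comb2 m k t u) y = comb2 m k t (wpartial ex u) y} &
      {ae mu2, forall y, wpartial ez (comb2 m k t u) y = comb2 m k t (wpartial ez u) y}].
Proof.
move=> [/L2loc2P hu /wpartialP h1 /wpartialP h2].
have d1 := is_wpartial_comb_ex m k t hu h1; have d2 := is_wpartial_comb_ez m k t hu h2.
have e1 := wpartialP (ex_intro (fun g : R * R -> R => is_wpartial ex (comb2 m k t u) g) _ d1).
have e2 := wpartialP (ex_intro (fun g : R * R -> R => is_wpartial ez (comb2 m k t u) g) _ d2).
split; [split|exact: is_wpartial_unique e1 d1|exact: is_wpartial_unique e2 d2].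
- by apply/L2loc2P; exact: P2_comb2.
- by exists (comb2 m k t (wpartial ex u)).
- by exists (comb2 m k t (wpartial ez u)).
Qed.

Definition periodic2 T u := {ae mu2, forall y, u (y.1 + T, y.2) = u y}.

Lemma comb2_1 T u y : comb2 1 1 (fun=> T) u y = u (y.1 + T, y.2).
Proof. by rewrite /comb2 big_ord1 mul1r. Qed.

Lemma wpartial_periodic T u : H1loc2 u -> periodic2 T u ->
  periodic2 T (wpartial ex u) /\ periodic2 T (wpartial ez u).
Proof.
move=> hu P; have [h1 h2 h3] := H1loc2_comb 1 1 (fun=> T) hu.
have [pu _ _] := H1loc2_P2 hu.
have E : {ae mu2, forall y, comb2 1 1 (fun=> T) u y = u y}.
  by apply: aeS P => y <-; rewrite comb2_1.
have mc := (P2_comb2 1 1 (fun=> T) pu).1.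
rewrite (wpartial_ae ex mc pu.1 E) in h2; rewrite (wpartial_ae ez mc pu.1 E) in h3.
by split; [apply: aeS h2|apply: aeS h3] => y ->; rewrite comb2_1.
Qed.

Lemma trace_periodic T u c : H1loc2 u -> periodic2 T u -> periodic T (trace u c).
Proof.
move=> hu P; have := trace_comb 1 1 (fun=> T) c hu.
have [h1 _ _] := H1loc2_comb 1 1 (fun=> T) hu.
have [pu _ _] := H1loc2_P2 hu; have [pc _ pz] := H1loc2_P2 h1.
rewrite (trace_ae c pc.1 pu.1 pz.1); last by apply: aeS P => y <-; rewrite comb2_1.
by apply: aeS => x ->; rewrite /comb big_ord1 mul1r.
Qed.

Lemma wderiv_periodic T f J : H1loc f -> {ae mu, forall x, f (x + T) = f x + J} ->
  periodic T (wderiv f).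
Proof.
move=> hf P; have [_ hw] := wderivP hf; have [C E] := H1loc_prim hf.
exact: periodic_prim (L2_L1 hw) E P.
Qed.

Lemma periodic2_Rint T u c d : P1 u -> periodic2 T u ->
  periodic T (fun x => \int[mu]_(z in `[c, d]) u (x, z)).
Proof.
move=> hu P.
have := aeI (ae_fubini P) (aeI (P1_slice hu) (ae_shift T (P1_slice hu))).
apply: aeS => x [e [s1 s2]]; apply: Rint_eq_ae => //.
- exact: measurable_funTS s2.1.
- exact: measurable_funTS s1.1.
- by apply: aeS e => z -> _.
Qed.

End Sobolev2.

(** * Periodicity of the fields of an admissible configuration *)

Section Admissible.
Context {R : realType}.
Local Notation mu := (@lebesgue_measure R).
Local Notation mu2 := (@lebesgue2 R).
Variables (p : R) (N : nat) (H q : R) (k : 'I_N.+1 -> int).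
Hypothesis hp : 0 < p.
Variable c : @config R N.
Hypothesis adm : admissible p H q k c.

Lemma adm_regular : regular c.
Proof. by case: adm => -[h1 h2] h3 [h4 _] _ _; split => // n; case: (h3 n). Qed.

Lemma adm_pot_periodic : periodic2 (2 * q) (potx c) /\ periodic2 (2 * q) (potz c).
Proof.
case: adm => _ _ _ _ [xi [[hxi _ _] per _ _ E]].
have [p1 p2] := wpartial_periodic hxi per.
by split; [have := aeI (aeI E (ae_shift2 (2 * q) E)) p2|have := aeI (aeI E (ae_shift2 (2 * q) E)) p1];
  apply: aeS => y [[[e1 e2] [e3 e4]] e5] /=; [rewrite e1 e3 e5|rewrite e2 e4 e5].
Qed.

Lemma adm_excess_periodic : periodic2 (2 * q) (excess H c).
Proof.
have [h1 h2 _ _] := adm_regular; have [p1 p2] := adm_pot_periodic.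
have [_ q1] := wpartial_periodic h1 p1; have [q2 _] := wpartial_periodic h2 p2.
by have := aeI q1 q2; apply: aeS => y [e1 e2]; rewrite /excess e1 e2.
Qed.

Lemma adm_modulus_periodic n : periodic (2 * q) (modulus c n).
Proof. by case: adm => _ h3 _ _ _; case: (h3 n). Qed.

Lemma adm_modulus_deriv_periodic n : periodic (2 * q) (wderiv (modulus c n)).
Proof.
have [_ _ h3 _] := adm_regular; apply: (wderiv_periodic (J := 0) (h3 n)).
by apply: aeS (adm_modulus_periodic n) => x ->; rewrite addr0.
Qed.

Lemma adm_velocity_periodic n : periodic (2 * q) (velocity p c n).
Proof.
have [h1 h2 _ h4] := adm_regular; have [p1 _] := adm_pot_periodic.
apply: periodicB; last exact: trace_periodic.
case: adm => _ _ [_ [omega E]] _ _.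
apply: (wderiv_periodic (J := omega + 2 * pi * (k n)%:~R) (h4 n)).
by apply: aeS (E n) => x ->; rewrite addrA.
Qed.

(** The constant omega is common to all planes and cancels between neighbours, leaving a multiple of
    2 pi. *)
Lemma adm_phase_diff_jump n : {ae mu, forall x, phase_diff p c n (x + 2 * q) =
  phase_diff p c n x + 2 * pi * (k (lift ord0 n) - k (widen_ord (leqnSn N) n))%:~R}.
Proof.
have [_ h2 _ _] := adm_regular; have [_ p2] := adm_pot_periodic.
have [pz _ _] := H1loc2_P2 h2.
have e := periodic2_Rint (n%:R * p) (n.+1%:R * p) (P2_L1 pz) p2.
case: adm => _ _ [_ [omega E]] _ _.
have key (a b A B d I w t : R) : a = A + w + t -> b = B + w + d ->
  a - b - I = A - B - I + (t - d) by move=> -> ->; ring.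
have := aeI e (aeI (E (lift ord0 n)) (E (widen_ord (leqnSn N) n))).
apply: aeS => x [e0 [e1 e2]].
by rewrite /phase_diff e0 intrB mulrBr; exact: key e1 e2.
Qed.

Lemma adm_modulus_ge0 n : {ae mu, forall x, 0 <= modulus c n x}.
Proof. by case: adm => _ h3 _ _ _; case: (h3 n). Qed.

End Admissible.

Section EnergyDensity.
Context {R : realType}.
Local Notation mu := (@lebesgue_measure R).
Local Notation mu2 := (@lebesgue2 R).
Variables (p : R) (N : nat) (kappa r : R).
Implicit Types (F G V : 'I_N.+1 -> R -> R) (T : 'I_N -> R -> R) (h : R * R -> R).

Definition plane_density F G V x : R :=
  p * \sum_(n < N.+1) (2^-1 * ((F n x) ^+ 2 - 1) ^+ 2
     + (kappa ^+ 2)^-1 * (G n x) ^+ 2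
     + (kappa ^+ 2)^-1 * (V n x) ^+ 2 * (F n x) ^+ 2).

Definition coupling_density F T x : R :=
  p * \sum_(n < N) ((F (lift ord0 n) x) ^+ 2 + (F (widen_ord (leqnSn N) n) x) ^+ 2
     - 2 * F (lift ord0 n) x * F (widen_ord (leqnSn N) n) x * cos (T n x)).

Definition field_density h x : R := \int[mu]_(z in `[0, N%:R * p]) (h (x, z)) ^+ 2.

(** One density in x for the whole energy, the field term being integrated over the height first;
    comparison of energies then takes place on the line. It takes the fields as free arguments, so
    it also applies to averaged fields. *)
Definition density F G V T h x : R :=
  plane_density F G V x + r / 2 * coupling_density F T x
  + (kappa ^+ 2)^-1 * field_density h x.

(** Local H^1 with the derivative carried along in the primitive form, instead of the representative
    chosen by [wderiv]. It gives a continuous representative and is stable under [comb]. *)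
Definition sobolev (f g : R -> R) := [/\ L2 g, measurable_fun setT f &
  exists C, {ae mu, forall x, f x = C + prim g x}].

Lemma L1_eq_ae (f g : R -> R) : measurable_fun setT g -> {ae mu, forall x, f x = g x} -> L1 f -> L1 g.
Proof.
move=> mg E [_ hf]; split=> // n; apply: rint_eq_ae (hf n) => //.
- exact: measurable_box1.
- exact: measurable_funTS.
- by apply: aeS E => x -> _.
Qed.

Lemma sobolev_cont f g : sobolev f g -> exists2 f' : R -> R, continuous f' & {ae mu, forall x, f x = f' x}.
Proof.
move=> [hg _ [C E]]; exists (fun x => C + prim g x) => // x.
by apply: cvgD; [exact: cvg_cst|exact: continuous_prim (L2_L1 hg) x].
Qed.

Lemma L1_ext (f g : R -> R) : (forall x, f x = g x) -> L1 f -> L1 g.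
Proof. by move=> /funext ->. Qed.

Lemma continuous_sqr (f : R -> R) : continuous f -> continuous (fun x => f x ^+ 2).
Proof. by move=> cf x; apply: (@continuousM _ _ f f); exact: cf. Qed.

Lemma L1_quartic f g : sobolev f g -> L1 (fun x => (f x ^+ 2 - 1) ^+ 2).
Proof.
move=> sf; have [f' cf' E] := sobolev_cont sf; have [_ mf _] := sf.
apply: (@L1_eq_ae (fun x => (f' x ^+ 2 - 1) ^+ 2)).
- apply: measurable_funX; apply: measurable_funB => //; exact: measurable_funX.
- by apply: aeS E => x ->.
- apply: L1_continuous; apply: continuous_sqr => x.
  by apply: (@continuousB _ _ _ (fun x => f' x ^+ 2)); [exact: continuous_sqr|exact: cst_continuous].
Qed.

Lemma L1_kinetic f g v : sobolev f g -> L2 v -> L1 (fun x => v x ^+ 2 * f x ^+ 2).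
Proof.
move=> sf hv; have [f' cf' E] := sobolev_cont sf; have [_ mf _] := sf.
apply: (@L1_eq_ae (fun x => f' x ^+ 2 * v x ^+ 2)).
- by apply: measurable_funM; apply: measurable_funX => //; exact: hv.1.
- by apply: aeS E => x ->; rewrite mulrC.
- apply: L1M_continuous; first exact: continuous_sqr.
  exact: L2b_sq.
Qed.

Lemma L1_sobolevM f g f2 g2 : sobolev f g -> sobolev f2 g2 -> L1 (fun x => f x * f2 x).
Proof.
move=> sf sf2; have [f' cf' E] := sobolev_cont sf; have [_ mf _] := sf.
have [f2' cf2' E2] := sobolev_cont sf2; have [_ mf2 _] := sf2.
apply: (@L1_eq_ae (fun x => f' x * f2' x)).
- exact: measurable_funM.
- by have := aeI E E2; apply: aeS => x [-> ->].
- by apply: L1M_continuous => //; exact: L1_continuous.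
Qed.

Variables (F G V : 'I_N.+1 -> R -> R) (T : 'I_N -> R -> R) (h : R * R -> R).
Hypotheses (sF : forall n, sobolev (F n) (G n)) (hV : forall n, L2 (V n))
  (mT : forall n, measurable_fun setT (T n)) (hh : P2 h).

Lemma L1_plane_density : L1 (plane_density F G V).
Proof.
apply: L1Z; apply: (@L1_sum R _ _ (fun n x => 2^-1 * ((F n x) ^+ 2 - 1) ^+ 2
     + (kappa ^+ 2)^-1 * (G n x) ^+ 2
     + (kappa ^+ 2)^-1 * (V n x) ^+ 2 * (F n x) ^+ 2)) => n.
apply: L1D; first apply: L1D.
- by apply: L1Z; exact: L1_quartic (sF n).
- by apply: L1Z; apply: L2b_sq; case: (sF n).
- apply: (@L1_ext (fun x => (kappa ^+ 2)^-1 * ((V n x) ^+ 2 * (F n x) ^+ 2))).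
    by move=> x; rewrite mulrA.
  by apply: L1Z; exact: L1_kinetic (sF n) (hV n).
Qed.

Lemma L1_coupling_density : L1 (coupling_density F T).
Proof.
apply: L1Z; apply: (@L1_sum R _ _ (fun n x => (F (lift ord0 n) x) ^+ 2 + (F (widen_ord (leqnSn N) n) x) ^+ 2
     - 2 * F (lift ord0 n) x * F (widen_ord (leqnSn N) n) x * cos (T n x))) => n.
apply: L1B; first by apply: L1D; apply: L1_sobolevM; exact: sF.
apply: (@L1_ext (fun x => 2 * (cos (T n x) * (F (lift ord0 n) x * F (widen_ord (leqnSn N) n) x)))).
  by move=> x; ring.
apply: L1Z; apply: (@L1M_bounded R _ _ 1).
- apply: (@measurableT_comp _ _ _ _ _ _ (@cos R)); last exact: mT.
  by apply: continuous_measurable_fun; exact: continuous_cos.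
- by move=> x; rewrite ler_norml cos_geN1 cos_le1.
- by apply: L1_sobolevM; exact: sF.
Qed.

Lemma L1_field_density : L1 (field_density h).
Proof.
have P : P1 (fun y => h y ^+ 2) by exact: L2b_sq.
exact: P1_Rint _ _ P.
Qed.

Lemma L1_density : L1 (density F G V T h).
Proof.
apply: L1D; last by apply: L1Z; exact: L1_field_density.
by apply: L1D; [exact: L1_plane_density|apply: L1Z; exact: L1_coupling_density].
Qed.

End EnergyDensity.

Section Energy.
Context {R : realType}.
Local Notation mu := (@lebesgue_measure R).
Local Notation mu2 := (@lebesgue2 R).
Variables (p : R) (N : nat) (H kappa : R).
Hypothesis hp : 0 < p.

Lemma integral_itv_Rint (f : R -> R) a b : L1 f ->
  (\int[mu]_(x in `[a, b]) (f x)%:E)%E = (\int[mu]_(x in `[a, b]) f x)%:E.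
Proof. by move=> hf; apply: integral_Rint => //; exact: L1_itv. Qed.

Lemma integral_rect_Rint (u : R * R -> R) a b c d : P1 u ->
  (\int[mu2]_(y in `[a, b] `*` `[c, d]) (u y)%:E)%E =
  (\int[mu]_(x in `[a, b]) \int[mu]_(z in `[c, d]) u (x, z))%:E.
Proof.
move=> hu; rewrite -Rfubini //; last exact: P1_rect.
by apply: integral_Rint; [exact: measurableX|exact: P1_rect].
Qed.

Definition cdensity (r : R) (c : @config R N) : R -> R :=
  density p kappa r (modulus c) (fun n => wderiv (modulus c n)) (velocity p c)
    (phase_diff p c) (excess H c).

Lemma regular_sobolev c n : @regular R N c -> sobolev (modulus c n) (wderiv (modulus c n)).
Proof.
move=> [_ _ h3 _]; have [_ hw] := wderivP (h3 n); split => //; last exact: H1loc_prim.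
by have [/L2locP []] := h3 n.
Qed.

Lemma measurable_phase_diff c n : @regular R N c -> measurable_fun setT (phase_diff p c n).
Proof.
move=> [_ h2 _ h4]; have [pz _ _] := H1loc2_P2 h2.
apply: measurable_funB; last by exact: (P1_Rint _ _ (P2_L1 pz)).1.
by apply: measurable_funB; [have [/L2locP []] := h4 (lift ord0 n)|have [/L2locP []] := h4 (widen_ord (leqnSn N) n)].
Qed.

Lemma L1_cdensity r c : @regular R N c -> L1 (cdensity r c).
Proof.
move=> rc; apply: L1_density; first by move=> n; exact: regular_sobolev rc.
- by move=> n; exact: L2_velocity.
- by move=> n; exact: measurable_phase_diff rc.
- exact: P2_excess.
Qed.

(** All three integrals are finite: moduli have continuous representatives, the cosine is bounded,
    and the other fields are locally square integrable. Energies can therefore be compared as real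
    numbers. *)
Lemma energyE r q c : @regular R N c ->
  energy p H kappa r q c = (\int[mu]_(x in `[- q, q]) cdensity r c x)%:E.
Proof.
move=> rc.
have sF n := regular_sobolev n rc; have hV n := @L2_velocity R p N hp c n rc.
have mT n := measurable_phase_diff n rc; have hh := P2_excess H rc.
have l1 := @L1_plane_density R p N kappa _ _ _ sF hV; have l2 := @L1_coupling_density R p N _ _ _ sF mT.
have l3 := @L1_field_density R p N _ hh.
rewrite /cdensity /density Rint_itvD; [|exact: L1D l1 (L1Z _ l2)|exact: L1Z].
rewrite Rint_itvD; [|exact: l1|exact: L1Z].
rewrite (Rint_itvZ (r / 2) (- q) q l2) (Rint_itvZ ((kappa ^+ 2)^-1) (- q) q l3) /energy.
have P : P1 (fun y => (excess H c y) ^+ 2) by apply: L2b_sq.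
exact: (f_equal2 adde (f_equal2 adde (integral_itv_Rint (- q) q l1)
    (f_equal (fun t => (r / 2)%:E * t)%E (integral_itv_Rint (- q) q l2)))
  (f_equal (fun t => ((kappa ^+ 2)^-1)%:E * t)%E (integral_rect_Rint (- q) q 0 (N%:R * p) P))).
Qed.

End Energy.

(** * Consequences of small energy *)

Section SobolevSup.
Context {R : realType}.
Local Notation mu := (@lebesgue_measure R).
Implicit Types (f g u : R -> R) (a b x y : R).

Lemma Rint_itv_le f g a b : L1 f -> L1 g -> {ae mu, forall x, `[a, b]%classic x -> f x <= g x} ->
  \int[mu]_(x in `[a, b]) f x <= \int[mu]_(x in `[a, b]) g x.
Proof. by move=> hf hg; apply: Rint_ae_le => //; exact: L1_itv. Qed.

Lemma Rint_itv_ge0 f a b : L1 f -> {ae mu, forall x, `[a, b]%classic x -> 0 <= f x} ->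
  0 <= \int[mu]_(x in `[a, b]) f x.
Proof.
move=> hf h; have [ab|/ltW ab] := leP a b; last by rewrite Rint_empty.
have := Rint_itv_le (@L1_cst R 0) hf h.
by rewrite Rint_cst // mul0r.
Qed.

Lemma Rint_itv_eq f g a b : L1 f -> L1 g -> {ae mu, forall x, `[a, b]%classic x -> f x = g x} ->
  \int[mu]_(x in `[a, b]) f x = \int[mu]_(x in `[a, b]) g x.
Proof. by move=> hf hg; apply: Rint_eq_ae => //; apply: measurable_funTS; [exact: hf.1|exact: hg.1]. Qed.

Lemma Rint_sub_le f a b c d : L1 f -> (forall x, 0 <= f x) -> a <= c -> c <= d -> d <= b ->
  \int[mu]_(x in `[c, d]) f x <= \int[mu]_(x in `[a, b]) f x.
Proof.
move=> hf f0 ac cd db.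
rewrite (@Rint_split _ f a c b) ?(@Rint_split _ f c d b) //; last exact: le_trans db.
have i0 s t : 0 <= \int[mu]_(x in `[s, t]) f x.
  by apply: Rint_itv_ge0 => //; apply: aeW => x _; exact: f0.
have h1 := i0 a c; have h2 := i0 d b.
by rewrite addrCA lerDl addr_ge0.
Qed.

Lemma prim_osc g a b x y : L2 g -> a <= x <= b -> a <= y <= b ->
  (prim g x - prim g y) ^+ 2 <= (b - a) * \int[mu]_(s in `[a, b]) (g s ^+ 2).
Proof.
move=> hg; have hg2 : L1 (fun s => g s ^+ 2) by apply: L2b_sq.
wlog yx : x y / y <= x.
  move=> wl hx hy; have [yx|/ltW xy] := leP y x; first exact: wl.
  by rewrite -sqrrN opprB; exact: wl.
move=> /andP[ax xb] /andP[ay yb].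
rewrite primB //; last exact: L2_L1.
apply: le_trans (cauchy_itv yx (L1_itv y x (L2_L1 hg)) (L1_itv y x hg2)) _.
have i0 : 0 <= \int[mu]_(s in `[y, x]) (g s ^+ 2).
  by apply: Rint_itv_ge0 => //; apply: aeW => s _; exact: sqr_ge0.
apply: ler_pM => //; first by rewrite subr_ge0.
  by apply: lerB.
by apply: Rint_sub_le => // s; exact: sqr_ge0.
Qed.

Lemma L1_sobolev f g : sobolev f g -> L1 f.
Proof.
move=> sf; have [f' cf' E] := sobolev_cont sf; have [_ mf _] := sf.
by apply: L1_eq_ae mf _ (L1_continuous cf'); apply: aeS E => x ->.
Qed.

(** The left side is $\int (f(x)-f(y))^2\,dy$ expanded; [prim_osc] bounds the integrand
    uniformly. *)
Lemma sobolev_var f g a b : a < b -> sobolev f g -> {ae mu, forall x, a <= x <= b ->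
  (b - a) * f x ^+ 2 - 2 * f x * (\int[mu]_(y in `[a, b]) f y) + \int[mu]_(y in `[a, b]) (f y ^+ 2)
    <= (b - a) ^+ 2 * \int[mu]_(s in `[a, b]) (g s ^+ 2)}.
Proof.
move=> ab sf; have l1 := L1_sobolev sf; have [hg mf [C E]] := sf.
have l2 : L1 (fun x => f x ^+ 2) by apply: L1_ext (L1_sobolevM sf sf) => x; rewrite expr2.
apply: aeS (E) => x ex hx.
pose I := \int[mu]_(s in `[a, b]) (g s ^+ 2).
have lin : L1 (fun y => f x ^+ 2 - 2 * f x * f y + f y ^+ 2).
  by apply: L1D => //; apply: L1B; [exact: L1_cst|exact: L1Z].
have -> : (b - a) * f x ^+ 2 - 2 * f x * (\int[mu]_(y in `[a, b]) f y) + \int[mu]_(y in `[a, b]) (f y ^+ 2)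
    = \int[mu]_(y in `[a, b]) (f x ^+ 2 - 2 * f x * f y + f y ^+ 2).
  rewrite (Rint_itvD a b (L1B (@L1_cst R (f x ^+ 2)) (L1Z (2 * f x) l1)) l2).
  rewrite (Rint_itvB a b (@L1_cst R (f x ^+ 2)) (L1Z (2 * f x) l1)).
  by rewrite (Rint_itvZ (2 * f x) a b l1) Rint_cst 1?ltW // (mulrC (f x ^+ 2)).
have -> : (b - a) ^+ 2 * I = \int[mu]_(y in `[a, b]) ((b - a) * I).
  by rewrite Rint_cst 1?ltW //; ring.
apply: Rint_itv_le => //; first exact: L1_cst.
apply: aeS E => y ey; rewrite /= in_itv /= => hy.
have -> : f x ^+ 2 - 2 * f x * f y + f y ^+ 2 = (prim g x - prim g y) ^+ 2.
  by rewrite ex ey; ring.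
exact: prim_osc.
Qed.

Lemma sobolev_sup f g a b : a < b -> sobolev f g -> {ae mu, forall x, a <= x <= b ->
  f x ^+ 2 <= 2 * (b - a) * \int[mu]_(s in `[a, b]) (g s ^+ 2)
    + 2 / (b - a) * \int[mu]_(s in `[a, b]) (f s ^+ 2)}.
Proof.
move=> ab sf; have l1 := L1_sobolev sf.
have l2 : L1 (fun x => f x ^+ 2) by apply: L1_ext (L1_sobolevM sf sf) => x; rewrite expr2.
have ba : 0 < b - a by rewrite subr_gt0.
have cs := cauchy_itv (ltW ab) (L1_itv a b l1) (L1_itv a b l2).
apply: aeS (sobolev_var ab sf) => x h /h.
move: cs; set I := \int[mu]_(y in `[a, b]) f y; set J := \int[mu]_(y in `[a, b]) (f y ^+ 2).
set K := \int[mu]_(y in `[a, b]) (g y ^+ 2) => cs.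
set t := f x; set l := b - a; rewrite -/l in ba cs => {}h.
(* Young's inequality, weighted so that half of $l t^2$ is absorbed on the left; Cauchy-Schwarz then
   turns $I^2$ into $lJ$. *)
have am : 2 * t * I <= 2^-1 * l * t ^+ 2 + 2 * l^-1 * I ^+ 2.
  have : 0 <= 2 * l^-1 * (2^-1 * l * t - I) ^+ 2.
    by rewrite mulr_ge0 ?sqr_ge0 // mulr_ge0 // invr_ge0 ltW.
  have -> : 2 * l^-1 * (2^-1 * l * t - I) ^+ 2 = 2^-1 * l * t ^+ 2 - 2 * t * I + 2 * l^-1 * I ^+ 2.
    by field; rewrite gt_eqF.
  lra.
have i2 : 2 * l^-1 * I ^+ 2 <= 2 * J.
  have -> : 2 * J = 2 * l^-1 * (l * J) by field; rewrite gt_eqF.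
  by apply: ler_wpM2l => //; rewrite mulr_ge0 // invr_ge0 ltW.
have e : t ^+ 2 = (2 / l) * (2^-1 * l * t ^+ 2) by field; rewrite gt_eqF.
have e2 : 2 * l * K + 2 / l * J = (2 / l) * (l ^+ 2 * K + J) by field; rewrite gt_eqF.
rewrite e e2 ler_wpM2l //; first by rewrite divr_ge0 // ltW.
lra.
Qed.

(** With zero mean the cross term of [sobolev_var] vanishes and the remaining integral is
    nonnegative, so the derivative alone controls the supremum. It is applied to deviations from
    averages. *)
Lemma sobolev_sup0 f g a b : a < b -> sobolev f g -> \int[mu]_(y in `[a, b]) f y = 0 ->
  {ae mu, forall x, a <= x <= b -> f x ^+ 2 <= (b - a) * \int[mu]_(s in `[a, b]) (g s ^+ 2)}.
Proof.
move=> ab sf i0; have ba : 0 < b - a by rewrite subr_gt0.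
have l2 : L1 (fun x => f x ^+ 2) by apply: L1_ext (L1_sobolevM sf sf) => x; rewrite expr2.
have J0 : 0 <= \int[mu]_(y in `[a, b]) (f y ^+ 2).
  by apply: Rint_itv_ge0 => //; apply: aeW => s _; exact: sqr_ge0.
apply: aeS (sobolev_var ab sf) => x h /h; rewrite i0 mulr0 subr0 => {}h.
rewrite -(ler_pM2l ba) [leRHS]mulrA -expr2; apply: le_trans h.
by rewrite lerDl.
Qed.

End SobolevSup.

Section SmallEnergy.
Context {R : realType}.
Local Notation mu := (@lebesgue_measure R).
Variables (p : R) (N : nat) (kappa r Q : R).
Hypotheses (hp : 0 < p) (hk : 0 < kappa) (hr : 0 <= r) (hQ : 0 < Q).
Variables (F G V : 'I_N.+1 -> R -> R) (T : 'I_N -> R -> R) (h : R * R -> R).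
Hypotheses (sF : forall n, sobolev (F n) (G n)) (hV : forall n, L2 (V n))
  (mT : forall n, measurable_fun setT (T n)) (hh : P2 h)
  (F0 : forall n, {ae mu, forall x, 0 <= F n x}).

Lemma coupling_term_ge0 (f g s : R) : 0 <= f ^+ 2 + g ^+ 2 - 2 * f * g * cos s.
Proof.
have := cos_le1 s; have := cos_geN1 s; set t := cos s => t1 t2.
have -> : f ^+ 2 + g ^+ 2 - 2 * f * g * t = (1 + t) / 2 * (f - g) ^+ 2 + (1 - t) / 2 * (f + g) ^+ 2 by field.
by rewrite addr_ge0 // mulr_ge0 ?sqr_ge0 //; lra.
Qed.

Lemma coupling_density_ge0 x : 0 <= coupling_density p F T x.
Proof. by rewrite mulr_ge0 ?(ltW hp) // sumr_ge0 // => n _; exact: coupling_term_ge0. Qed.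

Lemma field_density_ge0 x : 0 <= field_density p N h x.
Proof. by apply: Rintegral_ge0 => z _; exact: sqr_ge0. Qed.

Lemma inv_kappa2_ge0 : 0 <= (kappa ^+ 2)^-1.
Proof. by rewrite invr_ge0 sqr_ge0. Qed.

Definition plane_term n x := 2^-1 * ((F n x) ^+ 2 - 1) ^+ 2
     + (kappa ^+ 2)^-1 * (G n x) ^+ 2 + (kappa ^+ 2)^-1 * (V n x) ^+ 2 * (F n x) ^+ 2.

Lemma plane_term_ge0 n x :
  [/\ 0 <= 2^-1 * ((F n x) ^+ 2 - 1) ^+ 2, 0 <= (kappa ^+ 2)^-1 * (G n x) ^+ 2 &
      0 <= (kappa ^+ 2)^-1 * (V n x) ^+ 2 * (F n x) ^+ 2].
Proof. have k0 := inv_kappa2_ge0; split.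
- by apply: mulr_ge0; [rewrite invr_ge0|exact: sqr_ge0].
- by apply: mulr_ge0 => //; exact: sqr_ge0.
- by apply: mulr_ge0; [apply: mulr_ge0 => //|]; exact: sqr_ge0. Qed.

Lemma plane_density_ge n x : p * plane_term n x <= plane_density p kappa F G V x.
Proof.
rewrite ler_pM2l // (bigD1 n) //= lerDl; apply: sumr_ge0 => i _.
by have [? ? ?] := plane_term_ge0 i x; rewrite !addr_ge0.
Qed.

Lemma plane_density_ge0 x : 0 <= plane_density p kappa F G V x.
Proof.
rewrite mulr_ge0 ?(ltW hp) // sumr_ge0 // => i _.
by have [? ? ?] := plane_term_ge0 i x; rewrite !addr_ge0.
Qed.

Lemma density_ge n x : p * plane_term n x <= density p kappa r F G V T h x /\
  (kappa ^+ 2)^-1 * field_density p N h x <= density p kappa r F G V T h x.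
Proof.
have h1 := plane_density_ge n x; have h2 := plane_density_ge0 x.
have h3 : 0 <= r / 2 * coupling_density p F T x.
  by rewrite mulr_ge0 ?coupling_density_ge0 // divr_ge0.
have h4 : 0 <= (kappa ^+ 2)^-1 * field_density p N h x by rewrite mulr_ge0 ?inv_kappa2_ge0 ?field_density_ge0.
by rewrite /density; split; lra.
Qed.

Variable e : R.
Hypothesis he : \int[mu]_(x in `[- Q, Q]) density p kappa r F G V T h x <= e.

Let Ld : L1 (density p kappa r F G V T h).
Proof. exact: L1_density. Qed.

Lemma energy_part_le (g : R -> R) (K : R) : L1 g -> 0 <= K ->
  (forall x, g x <= K * density p kappa r F G V T h x) ->
  \int[mu]_(x in `[- Q, Q]) g x <= K * e.
Proof.
move=> hg K0 gK; apply: le_trans (ler_wpM2l K0 he).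
rewrite -(Rint_itvZ K (- Q) Q Ld); apply: Rint_itv_le => //; first exact: L1Z.
by apply: aeW => x _; exact: gK.
Qed.

Lemma part_le (s A B C D : R) : 0 < s -> [/\ 0 <= A, 0 <= B & 0 <= C] -> s * (A + B + C) <= D ->
  [/\ A <= D / s, B <= D / s & C <= D / s].
Proof.
move=> s0 [A0 B0 C0]; rewrite mulrC -ler_pdivlMr //; set d := D / s; split; lra.
Qed.

Lemma plane_term_le n x : [/\ 2^-1 * ((F n x) ^+ 2 - 1) ^+ 2 <= density p kappa r F G V T h x / p,
  (kappa ^+ 2)^-1 * (G n x) ^+ 2 <= density p kappa r F G V T h x / p &
  (kappa ^+ 2)^-1 * (V n x) ^+ 2 * (F n x) ^+ 2 <= density p kappa r F G V T h x / p].
Proof. by apply: (part_le hp (plane_term_ge0 n x)); case: (density_ge n x). Qed.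

Lemma small_quartic n : \int[mu]_(x in `[- Q, Q]) ((F n x ^+ 2 - 1) ^+ 2) <= 2 / p * e.
Proof.
apply: energy_part_le; [exact: L1_quartic (sF n)|by rewrite divr_ge0 // ltW|move=> x].
have [h1 _ _] := plane_term_le n x; rewrite mulrAC -[leRHS]mulrA.
by move: h1; set d := _ / p; set t := _ ^+ 2; lra.
Qed.

Lemma kappa_cancel (t : R) : t = kappa ^+ 2 * ((kappa ^+ 2)^-1 * t).
Proof. by rewrite mulrA divff ?mul1r // expf_neq0 // gt_eqF. Qed.

Lemma kappa2p_ge0 : 0 <= kappa ^+ 2 / p.
Proof. by rewrite divr_ge0 ?sqr_ge0 // ltW. Qed.

Lemma small_gradient n : \int[mu]_(x in `[- Q, Q]) (G n x ^+ 2) <= kappa ^+ 2 / p * e.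
Proof.
apply: energy_part_le; [by apply: L2b_sq; case: (sF n)|exact: kappa2p_ge0|move=> x].
have [_ h1 _] := plane_term_le n x.
by rewrite [leLHS]kappa_cancel -mulrA ler_wpM2l ?sqr_ge0 // [leRHS]mulrC.
Qed.

Lemma small_kinetic n : \int[mu]_(x in `[- Q, Q]) (V n x ^+ 2 * F n x ^+ 2) <= kappa ^+ 2 / p * e.
Proof.
apply: energy_part_le; [exact: L1_kinetic (sF n) (hV n)|exact: kappa2p_ge0|move=> x].
have [_ _ h1] := plane_term_le n x.
by rewrite [leLHS]kappa_cancel -mulrA ler_wpM2l ?sqr_ge0 // [leRHS]mulrC mulrA.
Qed.

Lemma small_field : \int[mu]_(x in `[- Q, Q]) field_density p N h x <= kappa ^+ 2 * e.
Proof.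
apply: energy_part_le; [exact: L1_field_density|exact: sqr_ge0|move=> x].
by have [_ h1] := density_ge ord0 x; rewrite [leLHS]kappa_cancel ler_wpM2l ?sqr_ge0.
Qed.

(* [supK * e] is the bound that the Sobolev inequality gives for [sup (f_n - 1)^2] at energy [e]. *)
Definition supK : R := 4 * Q * kappa ^+ 2 / p + 2 / (Q * p).

Hypothesis small : supK * e <= 16^-1.

(** Because f >= 0, $(f^2-1)^2=(f-1)^2(f+1)^2$ dominates $(f-1)^2$, which excludes values near -1.
    The Sobolev inequality then bounds $(f-1)^2$ by 1/16, the square of 1/4. *)
Lemma small_modulus n : {ae mu, forall x, `[- Q, Q]%classic x -> 3 / 4 <= F n x <= 5 / 4}.
Proof.
have QQ : - Q < Q by move: hQ; lra.
have [hG mF [C E]] := sF n.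
have sF1 : sobolev (fun x => F n x - 1) (G n).
  split=> //; first exact: measurable_funB.
  by exists (C - 1); apply: aeS E => x ->; ring.
have h1 : \int[mu]_(x in `[- Q, Q]) ((F n x - 1) ^+ 2) <= 2 / p * e.
  apply: le_trans (small_quartic n); apply: Rint_itv_le; last 2 [exact: L1_quartic (sF n)].
    by apply: L1_ext (L1_sobolevM sF1 sF1) => x; rewrite expr2.
  apply: aeS (F0 n) => x f0 _; rewrite -subr_ge0.
  have -> : (F n x ^+ 2 - 1) ^+ 2 - (F n x - 1) ^+ 2 = (F n x - 1) ^+ 2 * (F n x * (F n x + 2)) by ring.
  by rewrite mulr_ge0 ?sqr_ge0 // mulr_ge0 // addr_ge0.
have := sobolev_sup QQ sF1; apply: aeS => x b; rewrite /= in_itv /= => /b {}b.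
have {}b : (F n x - 1) ^+ 2 <= 16^-1.
  apply: le_trans small; apply: le_trans b _.
  have -> : supK * e = 2 * (Q - - Q) * (kappa ^+ 2 / p * e) + 2 / (Q - - Q) * (2 / p * e).
    by rewrite /supK; field; rewrite !gt_eqF //; move: hQ; lra.
  apply: lerD; apply: ler_wpM2l; [|exact: small_gradient| |exact: h1].
    by move: hQ; lra.
  by rewrite divr_ge0 //; move: hQ; lra.
have : `|F n x - 1| <= 4^-1.
  rewrite -(@ler_pXn2r _ 2) ?nnegrE // ?invr_ge0 // real_normK ?num_real //.
  by apply: le_trans b _; lra.
by rewrite ler_norml => /andP[? ?]; apply/andP; split; lra.
Qed.

(** The kinetic term only controls $V^2f^2$; from f >= 3/4 one has $1\le 2f^2$, whence the factor
    2. *)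
Lemma small_velocity n : \int[mu]_(x in `[- Q, Q]) (V n x ^+ 2) <= 2 * kappa ^+ 2 / p * e.
Proof.
have L := L1_kinetic (sF n) (hV n).
apply: (@le_trans _ _ (2 * (kappa ^+ 2 / p * e))); last by rewrite !mulrA.
apply: le_trans (ler_wpM2l _ (small_kinetic n)) => //.
rewrite -Rint_itvZ //; apply: Rint_itv_le; [by apply: L2b_sq|exact: L1Z|].
apply: aeS (small_modulus n) => x b /b /andP[b1 b2].
have : 0 <= V n x ^+ 2 by exact: sqr_ge0.
have : 1 <= 2 * F n x ^+ 2 by nra.
by set v := V n x ^+ 2; set f := F n x ^+ 2; nra.
Qed.

Lemma flux_sq_le (n : 'I_N) : {ae mu, forall x, flux p h n x ^+ 2 <= p * field_density p N h x}.
Proof.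
have P : P1 (fun y => h y ^+ 2) by apply: L2b_sq.
have := aeI (P1_slice (P2_L1 hh)) (P1_slice P); apply: aeS => x [s1 s2].
apply: le_trans (cauchy_itv (np_le hp n) (L1_itv _ _ s1) (L1_itv _ _ s2)) _.
have -> : n.+1%:R * p - n%:R * p = p by rewrite natrS_mul; ring.
rewrite ler_pM2l //; apply: Rint_sub_le => //.
- by move=> z; exact: sqr_ge0.
- by rewrite mulr_ge0 // ltW.
- exact: np_le.
- by rewrite ler_pM2r // ler_nat.
Qed.

(** The velocities are free arguments because the bound is used twice: for the velocities
    themselves, and in [phase_dev] for their deviations from the average. *)
Lemma rate_le (v1 v0 : R -> R) (n : 'I_N) : L2 v1 -> L2 v0 ->
  \int[mu]_(x in `[- Q, Q]) ((v1 x - v0 x + flux p h n x) ^+ 2) <=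
  3 * (\int[mu]_(x in `[- Q, Q]) (v1 x ^+ 2) + \int[mu]_(x in `[- Q, Q]) (v0 x ^+ 2)
    + p * \int[mu]_(x in `[- Q, Q]) field_density p N h x).
Proof.
move=> h1 h0; have hf : L2 (flux p h n) by exact: P2_Rint.
have L := L1_field_density p N hh.
have l1 : L1 (fun x => v1 x ^+ 2) by apply: L2b_sq.
have l0 : L1 (fun x => v0 x ^+ 2) by apply: L2b_sq.
rewrite -(Rint_itvZ p (- Q) Q L) -(Rint_itvD (- Q) Q l1 l0) -(Rint_itvD (- Q) Q (L1D l1 l0) (L1Z p L)).
rewrite -(Rint_itvZ 3 (- Q) Q (L1D (L1D l1 l0) (L1Z p L))).
apply: Rint_itv_le.
- by apply: L2b_sq; apply: L2D => //; apply: L2B.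
- by apply: L1Z; apply: L1D; [exact: L1D|exact: L1Z].
- apply: aeS (flux_sq_le n) => x; set a := v1 x; set b := v0 x; set c := flux p h n x.
  set d := field_density _ _ _ _ => cd _.
  have : (a - b + c) ^+ 2 <= 3 * (a ^+ 2 + b ^+ 2 + c ^+ 2).
    rewrite -subr_ge0 (_ : _ - _ = (a + b) ^+ 2 + (a - c) ^+ 2 + (b + c) ^+ 2); last by ring.
    by rewrite !addr_ge0 ?sqr_ge0.
  move/le_trans; apply; rewrite ler_pM2l //; lra.
Qed.

Lemma small_phase_rate (n : 'I_N) :
  \int[mu]_(x in `[- Q, Q]) ((V (lift ord0 n) x - V (widen_ord (leqnSn N) n) x + flux p h n x) ^+ 2)
   <= 3 * (4 * kappa ^+ 2 / p + p * kappa ^+ 2) * e.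
Proof.
apply: le_trans (rate_le n (hV _) (hV _)) _.
have i1 := small_velocity (lift ord0 n); have i0 := small_velocity (widen_ord (leqnSn N) n).
have := ler_wpM2l (ltW hp) small_field; move: i1 i0.
have -> : 3 * (4 * kappa ^+ 2 / p + p * kappa ^+ 2) * e =
  3 * (2 * kappa ^+ 2 / p * e + 2 * kappa ^+ 2 / p * e + p * (kappa ^+ 2 * e)) by ring.
by move=> i1 i0 i2; rewrite ler_pM2l // !lerD.
Qed.

End SmallEnergy.

(** * Lower bound when period, winding and field do not match *)

Section PartB.
Context {R : realType}.
Local Notation mu := (@lebesgue_measure R).
Variables (p : R) (N : nat) (H kappa : R).
Hypotheses (hp : 0 < p) (hH : 0 < H) (hk : 0 < kappa).

Lemma flux_defect (q : R) k (r e : R) (c : @config R N) (n : 'I_N) : 0 < q -> 0 <= r ->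
  admissible p H q k c -> \int[mu]_(x in `[- q, q]) cdensity p H kappa r c x <= e ->
  supK p kappa q * e <= 16^-1 ->
  (2 * pi * (k (lift ord0 n) - k (widen_ord (leqnSn N) n))%:~R - 2 * q * (H * p)) ^+ 2 <=
  2 * q * (3 * (4 * kappa ^+ 2 / p + p * kappa ^+ 2) * e).
Proof.
move=> q0 r0 adm he small; have rc := adm_regular adm.
have qq : - q <= q by lra.
have sF n := regular_sobolev n rc; have hV n := @L2_velocity R p N hp c n rc.
have mT n := @measurable_phase_diff R p N c n rc; have hh := P2_excess H rc.
have rate := @small_phase_rate R p N kappa r q hp hk r0 q0 _ _ _ _ _ sF hV mT hh
  (adm_modulus_ge0 adm) e he small n.
set v1 := velocity p c (lift ord0 n) in rate; set v0 := velocity p c (widen_ord (leqnSn N) n) in rate.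
set fl := flux p (excess H c) n in rate.
have lfl : L2 fl by exact: P2_Rint.
have lW : L2 (fun x => v1 x - v0 x + fl x) by apply: L2D => //; apply: L2B; exact: hV.
have lW' : L1 (fun x => v1 x - v0 x + fl x + H * p).
  by apply: L1D; [exact: L2_L1|exact: L1_cst].
have [C E] := phase_diff_prim H hp n rc.
set J := _%:~R.
have jump : {ae mu, forall x, prim (fun x => v1 x - v0 x + fl x + H * p) (x + 2 * q) =
    prim (fun x => v1 x - v0 x + fl x + H * p) x + 2 * pi * J}.
  have := aeI (adm_phase_diff_jump adm n) (aeI E (ae_shift (2 * q) E)).
  apply: aeS => x [e1 [e2 e3]].
  have key (a b A B D t : R) : a = b + t -> b = D + B -> a = D + A -> A = B + t.
    by move=> -> -> e'; apply: (@addrI _ D); rewrite -e' addrA.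
  exact: key e1 e2 e3.
have cP := continuous_prim lW'.
(* The jump relation holds almost everywhere; continuity of the primitive makes it pointwise, so
   that it may be evaluated at x = -q. *)
have {}jump := @continuous_ae_eq _ (fun x => prim (fun x => v1 x - v0 x + fl x + H * p) (x + 2 * q))
  (fun x => prim (fun x => v1 x - v0 x + fl x + H * p) x + 2 * pi * J) _ _ jump.
have {}jump x : prim (fun x => v1 x - v0 x + fl x + H * p) (x + 2 * q) =
    prim (fun x => v1 x - v0 x + fl x + H * p) x + 2 * pi * J.
  apply: jump => y; last by apply: cvgD; [exact: cP|exact: cvg_cst].
  apply: (@continuous_comp _ _ _ (fun x : R => x + 2 * q)); last exact: cP.
  by apply: cvgD; [exact: cvg_id|exact: cvg_cst].
have {}jump : prim (fun x => v1 x - v0 x + fl x + H * p) q - prim (fun x => v1 x - v0 x + fl x + H * p) (- q) = 2 * pi * J.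
  have := jump (- q); have -> : - q + 2 * q = q by ring.
  by move=> ->; rewrite addrAC subrr add0r.
rewrite primB // in jump.
have Lc := @L1_cst R (H * p).
rewrite (Rint_itvD (- q) q (L2_L1 lW) Lc) Rint_cst // in jump.
have -> : 2 * pi * J - 2 * q * (H * p) = \int[mu]_(x in `[- q, q]) (v1 x - v0 x + fl x).
  by rewrite -jump; ring.
have lW2 : L1 (fun x => (v1 x - v0 x + fl x) ^+ 2) by apply: L2b_sq.
apply: le_trans (cauchy_itv qq (L1_itv (- q) q (L2_L1 lW)) (L1_itv (- q) q lW2)) _.
have -> : q - - q = 2 * q by ring.
by rewrite ler_pM2l //; lra.
Qed.

Lemma min_energy_density_ge (q : R) k (r e : R) : (0 < N)%N -> 0 < q ->
  (forall c, @admissible R p N H q k c -> (e%:E <= energy p H kappa r q c)%E) ->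
  (((2 * q * N%:R * p)^-1 * e)%:E <= min_energy_density p H kappa r q k)%E.
Proof.
move=> N0 q0 h; rewrite /min_energy_density EFinM; apply: lee_wpmul2l.
  by rewrite lee_fin invr_ge0 !mulr_ge0 // ltW.
by apply: le_ereal_inf_tmp => _ [c adm <-]; exact: h.
Qed.

Lemma part_b (q : R) (k : 'I_N.+1 -> int) : (0 < N)%N -> 0 < q -> k ord0 = 0 ->
    ~ (exists2 m : nat, (0 < m)%N &
         q = m%:R * pi / (H * p) /\ forall n, k n = multZ m n) ->
    exists r1 omega1 : R, [/\ 0 < r1, 0 < omega1 &
      forall r : R, 0 < r < r1 ->
        (omega1%:E <= min_energy_density p H kappa r q k)%E].
Proof.
move=> N0 q0 k0 nm.
have Hp : 0 < H * p by rewrite mulr_gt0.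
pose D (n : 'I_N) := 2 * pi * (k (lift ord0 n) - k (widen_ord (leqnSn N) n))%:~R - 2 * q * (H * p).
(* If every gap were free of defect, all increments of k would equal the same integer d = q H p /
   pi. It is positive and k_0 = 0, so d is a natural number m with k_n = m n and q = m pi / (H p),
   the excluded case. *)
have [n Dn] : exists n, D n != 0.
  apply: contrapT => h; apply: nm.
  have D0 n : pi * (k (lift ord0 n) - k (widen_ord (leqnSn N) n))%:~R = q * (H * p).
    apply/eqP; rewrite -subr_eq0; apply: contrapT => /negP h'; apply: h; exists n.
    by rewrite /D -!mulrA -mulrBr mulf_neq0.
  pose d := k (lift ord0 (Ordinal N0)).
  have dE : pi * d%:~R = q * (H * p).
    rewrite -(D0 (Ordinal N0)) (_ : widen_ord _ _ = ord0) ?k0 ?subr0 //.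
    exact: val_inj.
  have d0 : (0 < d)%R.
    by rewrite -(ltr0z R) -(pmulr_rgt0 _ (pi_gt0 R)) dE mulr_gt0.
  have dn : d = `|d|%N by rewrite gtz0_abs.
  exists `|d|%N; first by rewrite absz_gt0 gt_eqF.
  split.
    have -> : (`|d|%N)%:R = d%:~R :> R by rewrite {2}dn.
    by rewrite [_ * pi]mulrC dE mulfK // gt_eqF.
  have kS (i : nat) : forall hi : (i < N.+1)%N, k (Ordinal hi) = d *+ i.
    elim: i => [|i IH] hi; first by rewrite mulr0n -k0; congr k; exact: val_inj.
    have hi' : (i < N)%N by [].
    have := D0 (Ordinal hi').
    have -> : lift ord0 (Ordinal hi') = Ordinal hi by exact: val_inj.
    have -> : widen_ord (leqnSn N) (Ordinal hi') = Ordinal (ltnW hi) by exact: val_inj.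
    rewrite -dE IH => /(mulfI (lt0r_neq0 (pi_gt0 R))) /intr_inj /eqP.
    by rewrite subr_eq -mulrS => /eqP.
  move=> [i hi]; rewrite kS /multZ /= dn PoszM -mulr_natr.
  by rewrite absz_id natz.
pose C2 := 2 * q * (3 * (4 * kappa ^+ 2 / p + p * kappa ^+ 2)).
have C20 : 0 < C2.
  have k2 : 0 < kappa ^+ 2 by rewrite exprn_gt0.
  by rewrite !mulr_gt0 // addr_gt0 ?divr_gt0 ?mulr_gt0.
have K0 : 0 < supK p kappa q.
  by rewrite addr_gt0 // divr_gt0 ?mulr_gt0 // exprn_gt0.
have D20 : 0 < D n ^+ 2 by rewrite lt_def sqrf_eq0 Dn sqr_ge0.
(* The first bound keeps the moduli near 1. The second makes [C2 * e] at most half of the squared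
   defect, contradicting [flux_defect] for a configuration of energy below e. *)
pose e := Num.min (16^-1 / supK p kappa q) (2^-1 * (D n ^+ 2 / C2)).
have e0 : 0 < e.
  rewrite lt_min; apply/andP; split; first by apply: divr_gt0 => //; rewrite invr_gt0.
  by apply: mulr_gt0; [rewrite invr_gt0|exact: divr_gt0].
(* The threshold e is independent of r, because the coupling energy is nonnegative and was only
   dropped; so r1 = 1 serves. *)
exists 1, ((2 * q * N%:R * p)^-1 * e); split => //.
  by rewrite mulr_gt0 // invr_gt0 !mulr_gt0 // ltr0n.
move=> r /andP[r0 _]; apply: min_energy_density_ge => // c adm.
rewrite energyE //; last exact: adm_regular adm.
rewrite lee_fin leNgt; apply/negP => lt.
have := @flux_defect q k r e c n q0 (ltW r0) adm (ltW lt).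
rewrite -ler_pdivlMl // mulrC ge_min lexx => /(_ isT).
apply/negP; rewrite -ltNge -/(D n).
have -> : 2 * q * (3 * (4 * kappa ^+ 2 / p + p * kappa ^+ 2) * e) = C2 * e by rewrite /C2; ring.
rewrite mulrC -ltr_pdivlMr //; apply: (@le_lt_trans _ _ (2^-1 * (D n ^+ 2 / C2))).
  by rewrite ge_min lexx orbT.
have : 0 < D n ^+ 2 / C2 by rewrite divr_gt0.
by set t := _ / C2; lra.
Qed.

End PartB.

(** * Convexity under averaging *)

Section Scalar.
Context {R : realType}.
Implicit Types a b d f g s t v w x y : R.

Lemma mean_value_le (f df : R -> R) (M x y : R) : (forall z, is_derive z (1 : R) f (df z)) ->
  (forall z, `|z - y| <= `|x - y| -> `|df z| <= M) -> `|f x - f y| <= M * `|x - y|.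
Proof.
move=> fd.
have cf : continuous f.
  by move=> z; apply/differentiable_continuous/derivable1_diffP; have [] := fd z.
have [xy|/ltW yx] := leP x y => h.
- have [z] := @MVT_segment R f df x y xy (fun z _ => fd z) (continuous_subspaceT cf).
  rewrite in_itv /= => /andP[z1 z2] e; rewrite distrC e normrM (distrC x y).
  apply: ler_wpM2r => //; apply: h; rewrite !(distrC _ y) !ger0_norm ?subr_ge0 //; lra.
- have [z] := @MVT_segment R f df y x yx (fun z _ => fd z) (continuous_subspaceT cf).
  rewrite in_itv /= => /andP[z1 z2] e; rewrite e normrM.
  by apply: ler_wpM2r => //; apply: h; rewrite !ger0_norm ?subr_ge0 //; lra.
Qed.

Lemma sin_norm_le1 t : `|sin t| <= 1.
Proof. by rewrite ler_norml sin_geN1 sin_le1. Qed.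

Lemma cos_norm_le1 t : `|cos t| <= 1.
Proof. by rewrite ler_norml cos_geN1 cos_le1. Qed.

Lemma cos_lipschitz x y : `|cos x - cos y| <= `|x - y|.
Proof.
rewrite -[leRHS]mul1r; apply: (@mean_value_le cos (fun z => - sin z)) => z.
by move=> _; rewrite normrN sin_norm_le1.
Qed.

Lemma sin_norm_le t : `|sin t| <= `|t|.
Proof.
have := @mean_value_le sin cos 1 t 0 (@is_derive_sin R) (fun z _ => cos_norm_le1 z).
by rewrite sin0 !subr0 mul1r.
Qed.

Lemma one_sub_cos_le d : `|cos d - 1| <= d ^+ 2.
Proof.
have := @mean_value_le cos (fun z => - sin z) `|d| d 0 (@is_derive_cos R).
rewrite cos0 subr0 -expr2 real_normK ?num_real //; apply=> z; rewrite subr0 normrN => h.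
exact: le_trans (sin_norm_le z) h.
Qed.

Lemma sub_sin_le d : `|d - sin d| <= d ^+ 2.
Proof.
have D z : is_derive z (1 : R) (fun z : R => z - sin z) (1 - cos z).
  by apply: is_deriveB; exact: is_derive_sin.
have := @mean_value_le _ _ `|d| d 0 D.
rewrite sin0 !subr0 -expr2 real_normK ?num_real //; apply=> z; rewrite subr0 distrC => h.
by apply: le_trans h; have := cos_lipschitz z 0; rewrite cos0 subr0.
Qed.

(** With s = t + d the addition formula reduces the remainder to cos d - 1 and d - sin d, each at
    most $d^2$ in absolute value. *)
Lemma cos_taylor s t : `|cos s - cos t + sin t * (s - t)| <= 2 * (s - t) ^+ 2.
Proof.
set d := s - t; have -> : s = t + d by rewrite /d; ring.
rewrite cosD.
have -> : cos t * cos d - sin t * sin d - cos t + sin t * d = cos t * (cos d - 1) + sin t * (d - sin d) by ring.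
apply: le_trans (ler_normD _ _) _; rewrite !normrM.
have := ler_pM (normr_ge0 _) (normr_ge0 _) (cos_norm_le1 t) (one_sub_cos_le d).
have := ler_pM (normr_ge0 _) (normr_ge0 _) (sin_norm_le1 t) (sub_sin_le d).
lra.
Qed.

(** On [3/4, 5/4] the quartic is uniformly convex. After its first-order part and $\frac12(f-g)^2$
    are removed, $(f-g)^2$ keeps the factor $\frac12(f+g)^2+g^2-\frac32\ge\frac3{16}$. *)
Lemma quartic_convex f g : 3 / 4 <= f <= 5 / 4 -> 3 / 4 <= g <= 5 / 4 ->
  2^-1 * (g ^+ 2 - 1) ^+ 2 + 2 * g * (g ^+ 2 - 1) * (f - g) + 2^-1 * (f - g) ^+ 2
    <= 2^-1 * (f ^+ 2 - 1) ^+ 2.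
Proof.
move=> /andP[f1 f2] /andP[g1 g2]; rewrite -subr_ge0.
have -> : 2^-1 * (f ^+ 2 - 1) ^+ 2 - (2^-1 * (g ^+ 2 - 1) ^+ 2 + 2 * g * (g ^+ 2 - 1) * (f - g) + 2^-1 * (f - g) ^+ 2)
  = (f - g) ^+ 2 * (2^-1 * (f + g) ^+ 2 + g ^+ 2 - 3 / 2) by field.
by rewrite mulr_ge0 ?sqr_ge0 //; nra.
Qed.

(** $v^2f^2$ is not jointly convex. With d = v - w and e = w(f - g), the second-order remainder at
    (w, g) is $f^2d^2+2(f+g)de+e^2$. Of the coefficient $f^2\ge 9/16$, a quarter is kept and 5/16
    completes the square; this costs $\frac{16}5(f+g)^2e^2\le 20e^2$, so 23 suffices. *)
Lemma kinetic_convex f g v w : 3 / 4 <= f <= 5 / 4 -> 3 / 4 <= g <= 5 / 4 ->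
  w ^+ 2 * g ^+ 2 + (2 * w * g ^+ 2 * (v - w) + 2 * w ^+ 2 * g * (f - g))
    + (4^-1 * (v - w) ^+ 2 - 23 * (w ^+ 2 * (f - g) ^+ 2)) <= v ^+ 2 * f ^+ 2.
Proof.
move=> /andP[f1 f2] /andP[g1 g2]; rewrite -subr_ge0.
set d := v - w; set e := w * (f - g); set s := f + g.
have -> : v ^+ 2 * f ^+ 2 - (w ^+ 2 * g ^+ 2 + (2 * w * g ^+ 2 * d + 2 * w ^+ 2 * g * (f - g))
    + (4^-1 * d ^+ 2 - 23 * (w ^+ 2 * (f - g) ^+ 2))) =
  (f ^+ 2 - 9 / 16) * d ^+ 2 + 5 / 16 * (d + 16 / 5 * (s * e)) ^+ 2 + (24 - 16 / 5 * s ^+ 2) * e ^+ 2.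
  by rewrite /d /e /s; field.
rewrite !addr_ge0 // mulr_ge0 ?sqr_ge0 //; first by nra.
by rewrite /s; nra.
Qed.

(** Here there is no convexity to use: the expression is expanded to first order in all three
    variables at (a, b, t) and the remainder is bounded crudely. The constant 10 is harmless, since
    the coupling enters the energy with the factor r/2. *)
Lemma coupling_convex f g a b s t : 3 / 4 <= a <= 5 / 4 -> 3 / 4 <= b <= 5 / 4 ->
  a ^+ 2 + b ^+ 2 - 2 * a * b * cos t
    + ((2 * a - 2 * b * cos t) * (f - a) + (2 * b - 2 * a * cos t) * (g - b) + 2 * a * b * sin t * (s - t))
    - 10 * ((f - a) ^+ 2 + (g - b) ^+ 2 + (s - t) ^+ 2)
  <= f ^+ 2 + g ^+ 2 - 2 * f * g * cos s.
Proof.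
move=> /andP[a1 a2] /andP[b1 b2].
set x := f - a; set y := g - b; set d := s - t.
set X := cos s - cos t + sin t * d; set Y := cos s - cos t.
have hX : a * b * X <= 25 / 8 * d ^+ 2.
  have := cos_taylor s t; rewrite -/d -/X ler_norml => /andP[_ h].
  have ab : 0 <= a * b <= 25 / 16 by apply/andP; split; nra.
  move: ab => /andP[ab1 ab2]; have := sqr_ge0 d.
  have := ler_wpM2l ab1 h; nra.
have hYx c z : 3 / 4 <= c -> c <= 5 / 4 -> c * z * Y <= 5 / 8 * (z ^+ 2 + d ^+ 2).
  move=> c1 c2; apply: le_trans (ler_norm _) _; rewrite !normrM.
  have hy := cos_lipschitz s t; rewrite -/d -/Y in hy.
  rewrite (@ger0_norm _ c); last by lra.
  rewrite -(real_normK (num_real z)) -(real_normK (num_real d)).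
  move: (normr_ge0 z) (normr_ge0 d) (normr_ge0 Y) hy.
  set Z := `|z|; set D := `|d|; set Y' := `|Y| => z0 d0 y0 hy.
  have : c * Z * Y' <= 5 / 4 * Z * D.
    by apply: ler_pM => //; [rewrite mulr_ge0 //; lra|rewrite ler_wpM2r].
  have := sqr_ge0 (Z - D); nra.
have hxy : x * y * cos s <= 2^-1 * (x ^+ 2 + y ^+ 2).
  have := cos_le1 s; have := cos_geN1 s; have := sqr_ge0 (x - y); have := sqr_ge0 (x + y); nra.
have h1 := hYx a y a1 a2; have h2 := hYx b x b1 b2.
rewrite -subr_ge0.
have -> : f ^+ 2 + g ^+ 2 - 2 * f * g * cos s - (a ^+ 2 + b ^+ 2 - 2 * a * b * cos t
    + ((2 * a - 2 * b * cos t) * x + (2 * b - 2 * a * cos t) * y + 2 * a * b * sin t * d)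
    - 10 * (x ^+ 2 + y ^+ 2 + d ^+ 2)) =
  11 * x ^+ 2 + 11 * y ^+ 2 + 10 * d ^+ 2 - 2 * (a * b * X + a * y * Y + b * x * Y + x * y * cos s).
  by rewrite /X /Y /x /y; ring.
have := sqr_ge0 x; have := sqr_ge0 y; have := sqr_ge0 d; lra.
Qed.

End Scalar.

Section AlmostContinuous.
Context {R : realType}.
Local Notation mu := (@lebesgue_measure R).
Implicit Types (f g w : R -> R).

(** A class closed under sums, products and composition with continuous functions, in which local
    integrability is automatic; it serves the weights built from averages and cosines. *)
Definition acont f := measurable_fun setT f /\
  exists2 f' : R -> R, continuous f' & {ae mu, forall x, f x = f' x}.

Lemma acont_continuous f : continuous f -> acont f.
Proof. by move=> cf; split; [exact: continuous_measurable_fun|exists f => //; apply: aeW]. Qed.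

Lemma acont_cst (k : R) : acont (fun=> k).
Proof. by apply: acont_continuous => x; exact: cvg_cst. Qed.

Lemma acont_sobolev f g : sobolev f g -> acont f.
Proof. by move=> sf; have [_ mf _] := sf; split => //; exact: sobolev_cont sf. Qed.

Lemma acontD f g : acont f -> acont g -> acont (fun x => f x + g x).
Proof.
move=> [mf [f' cf Ef]] [mg [g' cg Eg]]; split; first exact: measurable_funD.
exists (fun x => f' x + g' x); first by move=> x; apply: cvgD; [exact: cf|exact: cg].
by have := aeI Ef Eg; apply: aeS => x [-> ->].
Qed.

Lemma acontB f g : acont f -> acont g -> acont (fun x => f x - g x).
Proof.
move=> [mf [f' cf Ef]] [mg [g' cg Eg]]; split; first exact: measurable_funB.
exists (fun x => f' x - g' x); first by move=> x; apply: cvgB; [exact: cf|exact: cg].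
by have := aeI Ef Eg; apply: aeS => x [-> ->].
Qed.

Lemma acontM f g : acont f -> acont g -> acont (fun x => f x * g x).
Proof.
move=> [mf [f' cf Ef]] [mg [g' cg Eg]]; split; first exact: measurable_funM.
exists (fun x => f' x * g' x); first by move=> x; apply: cvgM; [exact: cf|exact: cg].
by have := aeI Ef Eg; apply: aeS => x [-> ->].
Qed.

Lemma acont_comp (k : R -> R) f : continuous k -> acont f -> acont (fun x => k (f x)).
Proof.
move=> ck [mf [f' cf Ef]]; split.
  by apply: (@measurableT_comp _ _ _ _ _ _ k); [exact: continuous_measurable_fun|].
exists (fun x => k (f' x)); last by apply: aeS Ef => x ->.
by move=> x; apply: continuous_comp; [exact: cf|exact: ck].
Qed.

Lemma acont_sqr f : acont f -> acont (fun x => f x ^+ 2).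
Proof. by move=> hf; have := acontM hf hf. Qed.

Lemma L1_acont f : acont f -> L1 f.
Proof.
move=> [mf [f' cf E]]; apply: L1_eq_ae mf _ (L1_continuous cf).
by apply: aeS E => x ->.
Qed.

Lemma L1M_acont w f : acont w -> L1 f -> L1 (fun x => w x * f x).
Proof.
move=> [mw [w' cw E]] hf; apply: (@L1_eq_ae R (fun x => w' x * f x)).
- by apply: measurable_funM => //; exact: hf.1.
- by apply: aeS E => x ->.
- exact: L1M_continuous.
Qed.

Lemma sobolevB f g f2 g2 : sobolev f g -> sobolev f2 g2 ->
  sobolev (fun x => f x - f2 x) (fun x => g x - g2 x).
Proof.
move=> [hg mf [C E]] [hg2 mf2 [C2 E2]]; split; [exact: L2B|exact: measurable_funB|].
exists (C - C2); have := aeI E E2; apply: aeS => x [-> ->].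
by rewrite primBf; [ring|exact: L2_L1|exact: L2_L1].
Qed.

Lemma sobolev_comb m k t f g : sobolev f g -> sobolev (comb m k t f) (comb m k t g).
Proof.
move=> sf; have l1 := L1_sobolev sf; have [hg mf [C E]] := sf; split.
- exact: L2_comb.
- exact: (L1_comb m k t l1).1.
- exact: comb_prim (L2_L1 hg) E.
Qed.

End AlmostContinuous.

Section Convexity.
Context {R : realType}.
Local Notation mu := (@lebesgue_measure R).
Local Notation mu2 := (@lebesgue2 R).
Variables (m : nat) (q : R).
Hypotheses (m0 : (0 < m)%N) (q0 : 0 < q).
Let Q := m%:R * q.
Local Notation av f := (avg m q f).
Implicit Types (f g w : R -> R).

Lemma period_gt0 : 0 < Q.
Proof. by rewrite mulr_gt0 // ltr0n. Qed.

Lemma period_cell_lt : - Q < Q.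
Proof. by move: period_gt0; lra. Qed.

(** A is the original term, B its value at the average, l the first-order part, removed by
    [Rint_orth], and C the signed second-order remainder. *)
Lemma jensen (A B C l : R -> R) : L1 A -> L1 B -> L1 C -> L1 l ->
  \int[mu]_(x in `[- Q, Q]) l x = 0 ->
  {ae mu, forall x, B x + l x + C x <= A x} ->
  \int[mu]_(x in `[- Q, Q]) B x + \int[mu]_(x in `[- Q, Q]) C x <= \int[mu]_(x in `[- Q, Q]) A x.
Proof.
move=> hA hB hC hl l0 h.
have -> : \int[mu]_(x in `[- Q, Q]) B x + \int[mu]_(x in `[- Q, Q]) C x =
   \int[mu]_(x in `[- Q, Q]) (B x + l x + C x).
  by rewrite (Rint_itvD (- Q) Q (L1D hB hl) hC) (Rint_itvD (- Q) Q hB hl) l0 addr0.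
by apply: Rint_itv_le => //; [exact: L1D (L1D hB hl) hC|apply: aeS h => x].
Qed.

(** Pythagoras for the orthogonal splitting into average and deviation. *)
Lemma Rint_dev_sq f : L2 f -> periodic (2 * Q) f ->
  \int[mu]_(x in `[- Q, Q]) (f x ^+ 2) =
  \int[mu]_(x in `[- Q, Q]) (av f x ^+ 2) + \int[mu]_(x in `[- Q, Q]) ((f x - av f x) ^+ 2).
Proof.
move=> hf P; have ha : L2 (av f) by exact: L2_comb.
have hd : L2 (fun x => f x - av f x) by exact: L2B.
have a2 : L1 (fun x => av f x ^+ 2) by apply: L2b_sq.
have d2 : L1 (fun x => (f x - av f x) ^+ 2) by apply: L2b_sq.
have ad : L1 (fun x => av f x * (f x - av f x)) by apply: L2M.
have o := Rint_orth m0 q0 (avg_periodic m0 P) P ad.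
have -> : \int[mu]_(x in `[- Q, Q]) (f x ^+ 2) =
   \int[mu]_(x in `[- Q, Q]) (av f x ^+ 2 + 2 * (av f x * (f x - av f x)) + (f x - av f x) ^+ 2).
  by apply: eq_Rintegral => x _; ring.
rewrite (Rint_itvD (- Q) Q (L1D a2 (L1Z 2 ad)) d2) (Rint_itvD (- Q) Q a2 (L1Z 2 ad)).
by rewrite (Rint_itvZ 2 (- Q) Q ad) o mulr0 addr0.
Qed.

Lemma Rint_dev f : L1 f -> periodic (2 * Q) f -> \int[mu]_(x in `[- Q, Q]) (f x - av f x) = 0.
Proof.
move=> hf P.
have L : L1 (fun x => 1 * (f x - av f x)).
  by apply: L1Z; apply: L1B => //; exact: L1_comb.
have := Rint_orth m0 q0 (aeW _ (fun x => erefl (1 : R))) P L.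
by under eq_Rintegral do rewrite mul1r.
Qed.

Section Quartic.
Variables f g : R -> R.
Hypotheses (sf : sobolev f g) (Pf : periodic (2 * Q) f)
  (bf : {ae mu, forall x, 3 / 4 <= f x <= 5 / 4}).

Let sa : sobolev (av f) (av g). Proof. exact: sobolev_comb. Qed.
Let ba : {ae mu, forall x, 3 / 4 <= av f x <= 5 / 4}. Proof. exact: avg_bounds. Qed.
Let af : acont f. Proof. exact: acont_sobolev sf. Qed.
Let aa : acont (av f). Proof. exact: acont_sobolev sa. Qed.
Let ad : acont (fun x => f x - av f x). Proof. exact: acontB. Qed.
Let Pa : periodic (2 * q) (av f). Proof. exact: avg_periodic. Qed.

Lemma jensen_quartic :
  2^-1 * \int[mu]_(x in `[- Q, Q]) ((av f x ^+ 2 - 1) ^+ 2) +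
  2^-1 * \int[mu]_(x in `[- Q, Q]) ((f x - av f x) ^+ 2) <=
  2^-1 * \int[mu]_(x in `[- Q, Q]) ((f x ^+ 2 - 1) ^+ 2).
Proof.
have q1 (k : R -> R) : acont k -> acont (fun x => (k x ^+ 2 - 1) ^+ 2).
  by move=> hk; apply: acont_sqr; apply: acontB; [exact: acont_sqr|exact: acont_cst].
have lf := L1_acont (q1 _ af); have la := L1_acont (q1 _ aa); have ld := L1_acont (acont_sqr ad).
have w1 : acont (fun x => 2 * av f x * (av f x ^+ 2 - 1)).
  apply: acontM; last by apply: acontB; [exact: acont_sqr|exact: acont_cst].
  by apply: acontM => //; exact: acont_cst.
have wd := L1_acont (acontM w1 ad).
rewrite -(Rint_itvZ 2^-1 (- Q) Q lf) -(Rint_itvZ 2^-1 (- Q) Q la) -(Rint_itvZ 2^-1 (- Q) Q ld).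
apply: (jensen (L1Z 2^-1 lf) (L1Z 2^-1 la) (L1Z 2^-1 ld) wd).
  by apply: Rint_orth => //; apply: aeS Pa => x ->.
by have := aeI bf ba; apply: aeS => x [h1 h2]; exact: quartic_convex.
Qed.

Variable v : R -> R.
Hypotheses (hv : L2 v) (Pv : periodic (2 * Q) v).

Let hav : L2 (av v). Proof. exact: L2_comb. Qed.
Let Pav : periodic (2 * q) (av v). Proof. exact: avg_periodic. Qed.

Lemma jensen_kinetic (Pg : periodic (2 * Q) g) :
  \int[mu]_(x in `[- Q, Q]) (av v x ^+ 2 * av f x ^+ 2) +
  (4^-1 * \int[mu]_(x in `[- Q, Q]) ((v x - av v x) ^+ 2)
   - 23 * (2 * Q * \int[mu]_(x in `[- Q, Q]) (v x ^+ 2))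
      * \int[mu]_(x in `[- Q, Q]) ((g x - av g x) ^+ 2)) <=
  \int[mu]_(x in `[- Q, Q]) (v x ^+ 2 * f x ^+ 2).
Proof.
have l1 := L1_kinetic sf hv; have l2 := L1_kinetic sa hav.
have hd : L2 (fun x => v x - av v x) by exact: L2B.
have ld : L1 (fun x => (v x - av v x) ^+ 2) by apply: L2b_sq.
have lw : L1 (fun x => av v x ^+ 2) by apply: L2b_sq.
have sd := sobolevB sf sa.
have l3 : L1 (fun x => av v x ^+ 2 * (f x - av f x) ^+ 2).
  exact: L1_kinetic sd hav.
have lvd : L1 (fun x => av v x * (v x - av v x)) by exact: L2M.
have m1 : L1 (fun x => 2 * av v x * av f x ^+ 2 * (v x - av v x)).
  apply: (@L1_ext R (fun x => (2 * av f x ^+ 2) * (av v x * (v x - av v x)))).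
    by move=> x; ring.
  by apply: L1M_acont => //; apply: acontM; [exact: acont_cst|exact: acont_sqr].
have m2 : L1 (fun x => 2 * av v x ^+ 2 * av f x * (f x - av f x)).
  apply: (@L1_ext R (fun x => (2 * av f x * (f x - av f x)) * av v x ^+ 2)).
    by move=> x; ring.
  by apply: L1M_acont => //; apply: acontM => //; apply: acontM => //; exact: acont_cst.
have Pw1 : periodic (2 * q) (fun x => 2 * av v x * av f x ^+ 2).
  by have := aeI Pa Pav; apply: aeS => x [-> ->].
have Pw2 : periodic (2 * q) (fun x => 2 * av v x ^+ 2 * av f x).
  by have := aeI Pa Pav; apply: aeS => x [-> ->].
have o1 := Rint_orth m0 q0 Pw1 Pv m1.
have o2 := Rint_orth m0 q0 Pw2 Pf m2.
have lC := L1B (L1Z 4^-1 ld) (L1Z 23 l3).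
have key := jensen l1 l2 lC (L1D m1 m2).
have {}key : \int[mu]_(x in `[- Q, Q]) (av v x ^+ 2 * av f x ^+ 2) +
   \int[mu]_(x in `[- Q, Q]) (4^-1 * (v x - av v x) ^+ 2 - 23 * (av v x ^+ 2 * (f x - av f x) ^+ 2)) <=
   \int[mu]_(x in `[- Q, Q]) (v x ^+ 2 * f x ^+ 2).
  apply: key; first by rewrite (Rint_itvD (- Q) Q m1 m2) o1 o2 addr0.
  by have := aeI bf ba; apply: aeS => x [h1 h2]; exact: kinetic_convex.
apply: le_trans key; rewrite lerD2l.
rewrite (Rint_itvB (- Q) Q (L1Z 4^-1 ld) (L1Z 23 l3)) (Rint_itvZ 4^-1 (- Q) Q ld) (Rint_itvZ 23 (- Q) Q l3).
rewrite lerD2l lerN2 -mulrA ler_pM2l //.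
(* The loss $w^2(f-\bar f)^2$ is charged to the gradient: the deviation of f has mean zero, so its
   supremum is controlled by the deviation of f', while $\int w^2\le\int v^2$. The resulting
   coefficient is small because the velocity is. *)
have sup := sobolev_sup0 period_cell_lt sd (Rint_dev (L1_sobolev sf) Pf).
set b := \int[mu]_(x in `[- Q, Q]) ((g x - av g x) ^+ 2) in sup *.
apply: (@le_trans _ _ (\int[mu]_(x in `[- Q, Q]) (2 * Q * b * av v x ^+ 2))).
  apply: Rint_itv_le => //; first exact: L1Z.
  apply: aeS sup => x hx; rewrite /= in_itv /= => /hx {}hx.
  rewrite mulrC ler_wpM2r ?sqr_ge0 //; apply: le_trans hx _.
  by rewrite (_ : Q - - Q = 2 * Q) //; ring.
rewrite (Rint_itvZ (2 * Q * b) (- Q) Q lw).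
have b0 : 0 <= b.
  have hgd : L2 (fun x => g x - av g x) by case: sd.
  by apply: Rint_itv_ge0; [apply: L2b_sq|apply: aeW => x _; exact: sqr_ge0].
rewrite mulrAC ler_wpM2r // ler_wpM2l //; first by rewrite mulr_ge0 // ltW // period_gt0.
rewrite (Rint_dev_sq hv Pv) lerDl; apply: Rint_itv_ge0 => //.
by apply: aeW => x _; exact: sqr_ge0.
Qed.

End Quartic.

(** The phase difference is [al * x + s x] with s periodic. As al times 2q is 2 pi, the sine and
    cosine of the averaged phase difference have the short period, and the first-order weights are
    orthogonal to the deviations. *)
Lemma jensen_coupling f f' g g' s w (al : R) : sobolev f f' -> sobolev g g' -> sobolev s w ->
  periodic (2 * Q) f -> periodic (2 * Q) g -> periodic (2 * Q) s ->
  {ae mu, forall x, 3 / 4 <= f x <= 5 / 4} -> {ae mu, forall x, 3 / 4 <= g x <= 5 / 4} ->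
  al * (2 * q) = pi *+ 2 ->
  \int[mu]_(x in `[- Q, Q]) (av f x ^+ 2 + av g x ^+ 2 - 2 * av f x * av g x * cos (al * x + av s x))
  - 10 * (\int[mu]_(x in `[- Q, Q]) ((f x - av f x) ^+ 2) + \int[mu]_(x in `[- Q, Q]) ((g x - av g x) ^+ 2)
     + \int[mu]_(x in `[- Q, Q]) ((s x - av s x) ^+ 2)) <=
  \int[mu]_(x in `[- Q, Q]) (f x ^+ 2 + g x ^+ 2 - 2 * f x * g x * cos (al * x + s x)).
Proof.
move=> sf sg ss Pf Pg Ps bf bg hal.
have af := acont_sobolev sf; have ag := acont_sobolev sg; have as_ := acont_sobolev ss.
have aaf := acont_sobolev (sobolev_comb m m%:R^-1 (cells q) sf).
have aag := acont_sobolev (sobolev_comb m m%:R^-1 (cells q) sg).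
have aas := acont_sobolev (sobolev_comb m m%:R^-1 (cells q) ss).
rewrite -/(av f) -/(av g) -/(av s) in aaf aag aas.
have df := acontB af aaf; have dg := acontB ag aag; have ds := acontB as_ aas.
have Paf := avg_periodic m0 Pf; have Pag := avg_periodic m0 Pg; have Pas := avg_periodic m0 Ps.
have lin : acont (fun x : R => al * x).
  apply: acont_continuous => x; apply: (@continuousM _ _ (fun=> al) (fun y : R => y)).
    exact: cvg_cst.
  exact: cvg_id.
have two : acont (fun=> 2 : R) by exact: acont_cst.
have ccos := acont_comp (@continuous_cos R) (acontD lin aas).
have csin := acont_comp (@continuous_sin R) (acontD lin aas).
have cpl (a b t : R -> R) : acont a -> acont b -> acont t ->
    acont (fun x => a x ^+ 2 + b x ^+ 2 - 2 * a x * b x * cos (al * x + t x)).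
  move=> ha hb ht; apply: acontB; first by apply: acontD; exact: acont_sqr.
  apply: acontM; first by apply: acontM => //; exact: acontM.
  by apply: acont_comp; [exact: continuous_cos|exact: acontD].
have lA := L1_acont (cpl _ _ _ af ag as_); have lB := L1_acont (cpl _ _ _ aaf aag aas).
have l1 := L1_acont (acont_sqr df); have l2 := L1_acont (acont_sqr dg); have l3 := L1_acont (acont_sqr ds).
have w1 := acontB (acontM two aaf) (acontM (acontM two aag) ccos).
have w2 := acontB (acontM two aag) (acontM (acontM two aaf) ccos).
have w3 := acontM (acontM (acontM two aaf) aag) csin.
have e x (a : R) : al * (x + 2 * q) + a = al * x + a + pi *+ 2 by rewrite -hal; ring.
have m1 := L1_acont (acontM w1 df); have m2 := L1_acont (acontM w2 dg); have m3 := L1_acont (acontM w3 ds).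
have PP := aeI Paf (aeI Pag Pas).
have Pw1 : periodic (2 * q) (fun x => 2 * av f x - 2 * av g x * cos (al * x + av s x)).
  by apply: aeS PP => x [-> [-> ->]]; rewrite e cosD2pi.
have Pw2 : periodic (2 * q) (fun x => 2 * av g x - 2 * av f x * cos (al * x + av s x)).
  by apply: aeS PP => x [-> [-> ->]]; rewrite e cosD2pi.
have Pw3 : periodic (2 * q) (fun x => 2 * av f x * av g x * sin (al * x + av s x)).
  by apply: aeS PP => x [-> [-> ->]]; rewrite e sinD2pi.
have o1 := Rint_orth m0 q0 Pw1 Pf m1; have o2 := Rint_orth m0 q0 Pw2 Pg m2; have o3 := Rint_orth m0 q0 Pw3 Ps m3.
have lC := L1Z (- 10) (L1D (L1D l1 l2) l3).
have key := jensen lA lB lC (L1D (L1D m1 m2) m3).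
have -> : - (10 * (\int[mu]_(x in `[- Q, Q]) ((f x - av f x) ^+ 2) + \int[mu]_(x in `[- Q, Q]) ((g x - av g x) ^+ 2)
     + \int[mu]_(x in `[- Q, Q]) ((s x - av s x) ^+ 2))) =
   \int[mu]_(x in `[- Q, Q]) (- 10 * ((f x - av f x) ^+ 2 + (g x - av g x) ^+ 2 + (s x - av s x) ^+ 2)).
  rewrite (Rint_itvZ (- 10) (- Q) Q (L1D (L1D l1 l2) l3)) (Rint_itvD (- Q) Q (L1D l1 l2) l3).
  by rewrite (Rint_itvD (- Q) Q l1 l2) mulNr.
apply: key.
  rewrite (Rint_itvD (- Q) Q (L1D m1 m2) m3) (Rint_itvD (- Q) Q m1 m2).
  by rewrite o1 o2 o3 !addr0.
have := aeI (avg_bounds q m0 bf) (avg_bounds q m0 bg).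
apply: aeS => x [h1 h2]; rewrite mulNr.
have := coupling_convex (f x) (g x) (al * x + s x) (al * x + av s x) h1 h2.
by rewrite (_ : al * x + s x - (al * x + av s x) = s x - av s x) //; ring.
Qed.

End Convexity.

Section DensityIntegral.
Context {R : realType}.
Local Notation mu := (@lebesgue_measure R).
Local Notation mu2 := (@lebesgue2 R).
Variables (p : R) (N : nat) (kappa r Q : R).
Variables (F G V : 'I_N.+1 -> R -> R) (T : 'I_N -> R -> R) (h : R * R -> R).
Hypotheses (sF : forall n, sobolev (F n) (G n)) (hV : forall n, L2 (V n))
  (mT : forall n, measurable_fun setT (T n)) (hh : P2 h).

Lemma Rint_density : \int[mu]_(x in `[- Q, Q]) density p kappa r F G V T h x =
  p * (\sum_(n < N.+1) (2^-1 * \int[mu]_(x in `[- Q, Q]) ((F n x ^+ 2 - 1) ^+ 2)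
     + (kappa ^+ 2)^-1 * \int[mu]_(x in `[- Q, Q]) (G n x ^+ 2)
     + (kappa ^+ 2)^-1 * \int[mu]_(x in `[- Q, Q]) (V n x ^+ 2 * F n x ^+ 2)))
  + r / 2 * (p * \sum_(n < N) \int[mu]_(x in `[- Q, Q])
      ((F (lift ord0 n) x) ^+ 2 + (F (widen_ord (leqnSn N) n) x) ^+ 2
       - 2 * F (lift ord0 n) x * F (widen_ord (leqnSn N) n) x * cos (T n x)))
  + (kappa ^+ 2)^-1 * \int[mu]_(x in `[- Q, Q]) field_density p N h x.
Proof.
set kv := (kappa ^+ 2)^-1.
have l1 := @L1_plane_density R p N kappa _ _ _ sF hV.
have l2 := @L1_coupling_density R p N _ _ _ sF mT; have l3 := @L1_field_density R p N _ hh.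
rewrite (Rint_itvD (- Q) Q (L1D l1 (L1Z (r / 2) l2)) (L1Z kv l3)).
rewrite (Rint_itvD (- Q) Q l1 (L1Z (r / 2) l2)) (Rint_itvZ (r / 2) (- Q) Q l2) (Rint_itvZ kv (- Q) Q l3).
have c1 n : L1 (fun x => (F (lift ord0 n) x) ^+ 2 + (F (widen_ord (leqnSn N) n) x) ^+ 2
     - 2 * F (lift ord0 n) x * F (widen_ord (leqnSn N) n) x * cos (T n x)).
  apply: L1B; first by apply: L1D; apply: L1_acont; apply: acont_sqr; exact: acont_sobolev (sF _).
  apply: (@L1_ext R (fun x => cos (T n x) * (2 * F (lift ord0 n) x * F (widen_ord (leqnSn N) n) x))).
    by move=> x; rewrite mulrC.
  apply: (@L1M_bounded R _ _ 1).
  - apply: (@measurableT_comp _ _ _ _ _ _ (@cos R)); last exact: mT.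
    by apply: continuous_measurable_fun; exact: continuous_cos.
  - by move=> x; exact: cos_norm_le1.
  - apply: L1_acont; apply: acontM; last exact: acont_sobolev (sF _).
    by apply: acontM; [exact: acont_cst|exact: acont_sobolev (sF _)].
congr (_ + _ * _ + _).
- have q1 n := L1_quartic (sF n); have k1 n := L1_kinetic (sF n) (hV n).
  have g1 n : L1 (fun x => G n x ^+ 2) by apply: L2b_sq; case: (sF n).
  have L n := L1D (L1D (L1Z 2^-1 (q1 n)) (L1Z kv (g1 n))) (L1Z kv (k1 n)).
  have LS := L1_sum (index_enum 'I_N.+1) L.
  transitivity (\int[mu]_(x in `[- Q, Q]) (p * \sum_(n < N.+1)
     (2^-1 * (F n x ^+ 2 - 1) ^+ 2 + kv * G n x ^+ 2 + kv * (V n x ^+ 2 * F n x ^+ 2)))).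
    apply: eq_Rintegral => x _; rewrite /plane_density; congr (_ * _).
    by apply: eq_bigr => n _; congr (_ + _); exact/esym/mulrA.
  rewrite (Rint_itvZ p (- Q) Q LS) (Rint_itv_sum _ _ _ L); congr (_ * _).
  apply: eq_bigr => n _.
  rewrite (Rint_itvD (- Q) Q (L1D (L1Z 2^-1 (q1 n)) (L1Z kv (g1 n))) (L1Z kv (k1 n))).
  rewrite (Rint_itvD (- Q) Q (L1Z 2^-1 (q1 n)) (L1Z kv (g1 n))).
  by rewrite (Rint_itvZ 2^-1 (- Q) Q (q1 n)) (Rint_itvZ kv (- Q) Q (g1 n)) (Rint_itvZ kv (- Q) Q (k1 n)).
- have LS := L1_sum (index_enum 'I_N) c1.
  by rewrite (Rint_itvZ p (- Q) Q LS) (Rint_itv_sum _ _ _ c1).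
Qed.

End DensityIntegral.

Section FieldAverage.
Context {R : realType}.
Local Notation mu := (@lebesgue_measure R).
Local Notation mu2 := (@lebesgue2 R).
Variables (m : nat) (q : R).
Hypotheses (m0 : (0 < m)%N) (q0 : 0 < q).
Let Q := m%:R * q.
Implicit Types h : R * R -> R.

Lemma Rint_slice_comb2 k (t : nat -> R) h c d : P1 h ->
  {ae mu, forall x, \int[mu]_(z in `[c, d]) comb2 m k t h (x, z) =
    comb m k t (fun x => \int[mu]_(z in `[c, d]) h (x, z)) x}.
Proof.
move=> hh; apply: aeS (ae_shifts t (P1_slice hh)) => x s.
rewrite /comb2 /comb /=.
have L (i : 'I_m) : L1 (fun z => h (x + t i, z)) by exact: s.
rewrite (Rint_itvZ k c d (L1_sum (index_enum 'I_m) L)).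
by rewrite (Rint_itv_sum _ _ _ L).
Qed.

Lemma L1_Rint_x h a b : P1 h -> L1 (fun z => \int[mu]_(x in `[a, b]) h (x, z)).
Proof. by move=> /P1_swap hs; exact: (P1_Rint a b hs). Qed.

(** [Rint_dev_sq] on almost every horizontal line, after the order of integration has been
    exchanged. *)
Lemma Rint_field_dev (p : R) (N : nat) h : P2 h -> periodic2 (2 * Q) h ->
  \int[mu]_(x in `[- Q, Q]) field_density p N h x =
  \int[mu]_(x in `[- Q, Q]) field_density p N (avg2 m q h) x +
  \int[mu]_(x in `[- Q, Q]) field_density p N (fun y => h y - avg2 m q h y) x.
Proof.
move=> hh P; have ha : P2 (avg2 m q h) by exact: P2_comb2.
have hd : P2 (fun y => h y - avg2 m q h y) by exact: P2B.
have s1 : P1 (fun y => h y ^+ 2) by apply: L2b_sq.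
have s2 : P1 (fun y => avg2 m q h y ^+ 2) by apply: L2b_sq.
have s3 : P1 (fun y => (h y - avg2 m q h y) ^+ 2) by apply: L2b_sq.
have e1 := Rint_rect_swap (- Q) Q 0 (N%:R * p) s1.
have e2 := Rint_rect_swap (- Q) Q 0 (N%:R * p) s2.
have e3 := Rint_rect_swap (- Q) Q 0 (N%:R * p) s3.
have i1 := L1_Rint_x (- Q) Q s1; have i2 := L1_Rint_x (- Q) Q s2; have i3 := L1_Rint_x (- Q) Q s3.
apply: (etrans e1); rewrite -[RHS](f_equal2 (fun a b => a + b) (esym e2) (esym e3)).
rewrite -(Rint_itvD 0 (N%:R * p) i2 i3).
apply: (Rint_itv_eq i1 (L1D i2 i3)).
have := aeI (P2_slice_x hh) (ae_fubini_x P); apply: aeS => z [s per] _.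
exact: (Rint_dev_sq m0 q0 s per).
Qed.

End FieldAverage.

Section Combine.
Context {R : realType}.
Implicit Types k r p : R.

(** c stands for the coefficient of the kinetic loss. With c at most 1/2, the gradient deviation B
    pays for it and keeps one half. *)
Lemma plane_combine k (a A b B g v D c w : R) : 0 <= k -> 0 <= B -> c <= 2^-1 ->
  2^-1 * a + 2^-1 * A <= 2^-1 * b -> v + (4^-1 * D - c * B) <= w ->
  2^-1 * a + k * g + k * v + (2^-1 * A + 2^-1 * k * B + 4^-1 * k * D) <=
  2^-1 * b + k * (g + B) + k * w.
Proof.
move=> k0 B0 hc h1 h2; have h3 := ler_wpM2l k0 (ler_wpM2r B0 hc).
have := ler_wpM2l k0 h2; rewrite !mulrDr mulrN.
have -> : k * (4^-1 * D) = 4^-1 * (k * D) by ring.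
have e3 : k * (2^-1 * B) = 2^-1 * (k * B) by ring.
rewrite {}e3 in h3.
rewrite -!mulrA; move: h1 h3; lra.
Qed.

Lemma sum_affine n (u w : 'I_n -> R) k (z : R) :
  \sum_i (u i + k * (w i + z)) = \sum_i u i + k * (\sum_i w i + n%:R * z).
Proof. by rewrite big_split -mulr_sumr big_split /= sumr_const card_ord mulr_natl. Qed.

(** With the factor r/2 the coupling loses 10 r SA, 120 r Q^2 SD and 60 r Q^2 n p X. The three
    thresholds on r make each loss at most half of the corresponding gain: SA/2 from the quartic, k
    SD/4 from the kinetic and k X from the field term. The other halves are what the conclusion
    retains. *)
Lemma energy_combine k r p (Q n P P' C C' SA SB SD X Y : R) : 0 <= r -> 0 <= p ->
  0 <= SA -> 0 <= SD -> 0 <= X ->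
  10 * r <= 4^-1 -> 120 * r * Q ^+ 2 <= 8^-1 * k -> 60 * p ^+ 2 * r * Q ^+ 2 * n <= 2^-1 * k ->
  P + (2^-1 * SA + 2^-1 * k * SB + 4^-1 * k * SD) <= P' ->
  C - 10 * (2 * SA + 12 * Q ^+ 2 * (2 * SD + n * (p * X))) <= C' ->
  p * P + r / 2 * (p * C) + k * Y
    + (p * (4^-1 * SA + 2^-1 * k * SB + 8^-1 * k * SD) + 2^-1 * k * X) <=
  p * P' + r / 2 * (p * C') + k * (Y + X).
Proof.
move=> r0 p0 SA0 SD0 X0 s3 s4 s5 hP hC.
have rp : 0 <= r / 2 * p by rewrite mulr_ge0 ?divr_ge0.
have e1 := ler_wpM2l p0 hP; have e2 := ler_wpM2l rp hC.
have b1 := ler_wpM2r (mulr_ge0 p0 SA0) s3; have b2 := ler_wpM2r (mulr_ge0 p0 SD0) s4.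
have b3 := ler_wpM2r X0 s5.
rewrite -subr_ge0 in e1; rewrite -subr_ge0 in e2; rewrite -subr_ge0 in b1.
rewrite -subr_ge0 in b2; rewrite -subr_ge0 in b3; rewrite -subr_ge0.
have := addr_ge0 (addr_ge0 (addr_ge0 (addr_ge0 e1 e2) b1) b2) b3.
by congr (0 <= _); field.
Qed.

End Combine.

(** * Convexity of the full energy along averages *)

Section Convexity.
Context {R : realType}.
Local Notation mu := (@lebesgue_measure R).
Variables (m N : nat) (q p kappa r e al : R).
Hypotheses (m0 : (0 < m)%N) (q0 : 0 < q) (hp : 0 < p) (hk : 0 < kappa) (hr : 0 <= r).
Let Q := m%:R * q.
Let kv := (kappa ^+ 2)^-1.
Variables (F G V : 'I_N.+1 -> R -> R) (S : 'I_N -> R -> R) (h : R * R -> R).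
Let W (n : 'I_N) x := V (lift ord0 n) x - V (widen_ord (leqnSn N) n) x + flux p h n x.
Let T (n : 'I_N) x := al * x + S n x.
Hypotheses (sF : forall n, sobolev (F n) (G n)) (hV : forall n, L2 (V n))
  (sS : forall n, sobolev (S n) (W n)) (hh : P2 h)
  (PF : forall n, periodic (2 * Q) (F n)) (PG : forall n, periodic (2 * Q) (G n))
  (PV : forall n, periodic (2 * Q) (V n)) (PS : forall n, periodic (2 * Q) (S n))
  (Ph : periodic2 (2 * Q) h) (F0 : forall n, {ae mu, forall x, 0 <= F n x})
  (hal : al * (2 * q) = pi *+ 2).
Hypothesis he : \int[mu]_(x in `[- Q, Q]) density p kappa r F G V T h x <= e.
Hypotheses (small1 : supK p kappa Q * e <= 16^-1)
  (small2 : 23 * (2 * Q * (2 * kappa ^+ 2 / p * e)) <= 2^-1)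
  (small3 : 10 * r <= 4^-1) (small4 : 120 * r * Q ^+ 2 <= 8^-1 * kv)
  (small5 : 60 * p ^+ 2 * r * Q ^+ 2 * N%:R <= 2^-1 * kv).

Let aF n := avg m q (F n).
Let aG n := avg m q (G n).
Let aV n := avg m q (V n).
Let aS n := avg m q (S n).
Let aT (n : 'I_N) x := al * x + aS n x.
Let ah := avg2 m q h.

Definition dev_sq (f : R -> R) : R := \int[mu]_(x in `[- Q, Q]) ((f x - avg m q f x) ^+ 2).
Definition field_dev : R := \int[mu]_(x in `[- Q, Q]) field_density p N (fun y => h y - ah y) x.

Let Q_gt0 : 0 < Q. Proof. exact: period_gt0. Qed.

Let mT n : measurable_fun setT (T n).
Proof.
apply: measurable_funD; last by case: (sS n).
by apply: measurable_funM => //; exact: measurable_cst.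
Qed.

Lemma dev_sq_ge0 f : L2 f -> 0 <= dev_sq f.
Proof.
move=> hf; apply: Rint_itv_ge0; last by apply: aeW => x _; exact: sqr_ge0.
by apply: L2b_sq; apply: L2B => //; exact: L2_comb.
Qed.

Let hdh : P2 (fun y => h y - ah y).
Proof. by apply: P2B => //; exact: P2_comb2. Qed.

Lemma field_dev_ge0 : 0 <= field_dev.
Proof.
apply: Rint_itv_ge0; first exact: L1_field_density.
by apply: aeW => x _; exact: field_density_ge0.
Qed.

Lemma modulus_bounds n : {ae mu, forall x, 3 / 4 <= F n x <= 5 / 4}.
Proof.
apply: (ae_cell Q_gt0); last exact: (small_modulus hp hk hr Q_gt0 sF hV mT hh F0 he small1).
by apply: aeS (PF n) => x ->.
Qed.

(** The constant: [sobolev_sup0] contributes a factor 2Q, integration over the period another 2Q,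
    and [rate_le] a factor 3. *)
Lemma phase_dev (n : 'I_N) : dev_sq (S n) <=
  12 * Q ^+ 2 * (dev_sq (V (lift ord0 n)) + dev_sq (V (widen_ord (leqnSn N) n)) + p * field_dev).
Proof.
have sd := sobolevB (sS n) (sobolev_comb m m%:R^-1 (cells q) (sS n)).
have [hW _ _] := sd.
have i0 := Rint_dev m0 q0 (L1_sobolev (sS n)) (PS n).
have sup := sobolev_sup0 (period_cell_lt m0 q0) sd i0.
set v1 := V (lift ord0 n); set v0 := V (widen_ord (leqnSn N) n).
set J := \int[mu]_(x in `[- Q, Q]) ((W n x - comb m m%:R^-1 (cells q) (W n) x) ^+ 2) in sup.
have hd1 : L2 (fun x => v1 x - avg m q v1 x) by apply: L2B; [exact: hV|apply: L2_comb; exact: hV].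
have hd0 : L2 (fun x => v0 x - avg m q v0 x) by apply: L2B; [exact: hV|apply: L2_comb; exact: hV].
have rate := @rate_le R p N Q hp _ hdh _ _ n hd1 hd0.
have {}rate : J <= 3 * (dev_sq v1 + dev_sq v0 + p * field_dev).
  apply: le_trans rate; apply: Rint_itv_le; first by apply: L2b_sq.
    by apply: L2b_sq; apply: L2D; [exact: L2B|exact: P2_Rint].
  have := aeI (P1_slice (P2_L1 hh)) (aeI (P1_slice (P2_L1 (P2_comb2 m m%:R^-1 (cells q) hh)))
    (Rint_slice_comb2 m m%:R^-1 (cells q) (n%:R * p) (n.+1%:R * p) (P2_L1 hh))).
  apply: aeS => x [s1 [s2 s3]] _.
  have -> : flux p (fun y => h y - ah y) n x = flux p h n x - comb m m%:R^-1 (cells q) (flux p h n) x.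
    by rewrite /flux (Rint_itvB _ _ s1 s2) s3.
  rewrite le_eqVlt; apply/orP; left; apply/eqP; congr (_ ^+ 2).
  rewrite -[comb _ _ _ (W n) x]/(avg m q (fun x => v1 x - v0 x + flux p h n x) x) avgD avgB.
  by rewrite /W -/v1 -/v0 /avg; ring.
have QQ : Q - - Q = 2 * Q by ring.
apply: (@le_trans _ _ (\int[mu]_(x in `[- Q, Q]) (2 * Q * J))).
  apply: Rint_itv_le; last 2 [exact: L1_cst].
    by apply: L1_acont; apply: acont_sqr; exact: acont_sobolev sd.
  by apply: aeS sup => x hx; rewrite /= in_itv /= => /hx; rewrite QQ.
rewrite Rint_cst ?(ltW (period_cell_lt m0 q0)) // QQ.
have -> : 12 * Q ^+ 2 * (dev_sq v1 + dev_sq v0 + p * field_dev) =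
  (2 * Q) * (2 * Q) * (3 * (dev_sq v1 + dev_sq v0 + p * field_dev)) by ring.
have -> : 2 * Q * J * (2 * Q) = 2 * Q * (2 * Q) * J by ring.
by rewrite ler_wpM2l // mulr_ge0 // mulr_ge0 // ltW.
Qed.

(** Every plane borders at most two gaps. *)
Lemma sum_neighbours (a : 'I_N.+1 -> R) : (forall n, 0 <= a n) ->
  \sum_(n < N) (a (lift ord0 n) + a (widen_ord (leqnSn N) n)) <= 2 * \sum_(n < N.+1) a n.
Proof.
move=> a0; rewrite big_split /= mulr2n mulrDl mul1r; apply: lerD.
  by rewrite [leRHS]big_ord_recl /= lerDr.
by rewrite [leRHS]big_ord_recr /= lerDl.
Qed.

Lemma convexity : \int[mu]_(x in `[- Q, Q]) density p kappa r aF aG aV aT ah x +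
  (p * \sum_(n < N.+1) (4^-1 * dev_sq (F n) + 2^-1 * kv * dev_sq (G n) + 8^-1 * kv * dev_sq (V n))
   + 2^-1 * kv * field_dev)
  <= \int[mu]_(x in `[- Q, Q]) density p kappa r F G V T h x.
Proof.
have kv0 : 0 <= kv by rewrite invr_ge0 sqr_ge0.
have saF n : sobolev (aF n) (aG n) by exact: sobolev_comb.
have haV n : L2 (aV n) by exact: L2_comb.
have maT n : measurable_fun setT (aT n).
  apply: measurable_funD; last by case: (sobolev_comb m m%:R^-1 (cells q) (sS n)).
  by apply: measurable_funM => //; exact: measurable_cst.
have hah : P2 ah by exact: P2_comb2.
have LF n : L2 (F n).
  have l := acont_sobolev (sF n).
  by apply: (L2_dom (g := fun x => F n x ^+ 2)) => //; [case: l|apply: L1_acont; exact: acont_sqr].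
have hG n : L2 (G n) by case: (sF n).
rewrite (Rint_density _ _ _ _ saF haV maT hah) (Rint_density _ _ _ _ sF hV mT hh).
rewrite (Rint_field_dev m0 q0 p N hh Ph) -/kv -/ah -/field_dev.
pose SA := \sum_(n < N.+1) dev_sq (F n); pose SB := \sum_(n < N.+1) dev_sq (G n).
pose SD := \sum_(n < N.+1) dev_sq (V n).
have SA0 : 0 <= SA by apply: sumr_ge0 => n _; exact: dev_sq_ge0.
have SB0 : 0 <= SB by apply: sumr_ge0 => n _; exact: dev_sq_ge0.
have SD0 : 0 <= SD by apply: sumr_ge0 => n _; exact: dev_sq_ge0.
have X0 := field_dev_ge0.
have -> : \sum_(n < N.+1) (4^-1 * dev_sq (F n) + 2^-1 * kv * dev_sq (G n) + 8^-1 * kv * dev_sq (V n)) =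
   4^-1 * SA + 2^-1 * kv * SB + 8^-1 * kv * SD.
  by rewrite !big_split -!mulr_sumr.
set P := \sum_(n < N.+1) _; set P' := \sum_(n < N.+1) _.
set Cc := \sum_(n < N) _; set Cc' := \sum_(n < N) _.
have hP : P + (2^-1 * SA + 2^-1 * kv * SB + 4^-1 * kv * SD) <= P'.
  rewrite /SA /SB /SD !mulr_sumr -!big_split /=; apply: ler_sum => n _.
  have h1 := jensen_quartic m0 q0 (sF n) (PF n) (modulus_bounds n).
  have h2 := Rint_dev_sq m0 q0 (hG n) (PG n).
  have h3 := jensen_kinetic m0 q0 (sF n) (PF n) (modulus_bounds n) (hV n) (PV n) (PG n).
  have h4 : 23 * (2 * Q * \int[mu]_(x in `[- Q, Q]) (V n x ^+ 2)) <= 2^-1.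
    apply: le_trans small2; rewrite ler_pM2l // ler_pM2l; last by rewrite mulr_gt0.
    exact: (small_velocity hp hk hr Q_gt0 sF hV mT hh F0 he small1).
  have d0 := dev_sq_ge0 (hG n).
  rewrite h2; exact: (plane_combine _ kv0 d0 h4 h1 h3).
have hC : Cc - 10 * (2 * SA + 12 * Q ^+ 2 * (2 * SD + N%:R * (p * field_dev))) <= Cc'.
  have n1 := sum_neighbours (fun n => dev_sq_ge0 (LF n)).
  have n2 := sum_neighbours (fun n => dev_sq_ge0 (hV n)).
  rewrite -/SA -/SD in n1 n2.
  apply: (@le_trans _ _ (\sum_(n < N) (\int[mu]_(x in `[- Q, Q])
      ((aF (lift ord0 n) x) ^+ 2 + (aF (widen_ord (leqnSn N) n) x) ^+ 2
       - 2 * aF (lift ord0 n) x * aF (widen_ord (leqnSn N) n) x * cos (aT n x))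
     - 10 * (dev_sq (F (lift ord0 n)) + dev_sq (F (widen_ord (leqnSn N) n)) +
        12 * Q ^+ 2 * (dev_sq (V (lift ord0 n)) + dev_sq (V (widen_ord (leqnSn N) n)) + p * field_dev))))).
    rewrite sumrB -/Cc lerD2l lerN2 -mulr_sumr ler_pM2l //.
    rewrite (sum_affine (fun n => dev_sq (F (lift ord0 n)) + dev_sq (F (widen_ord (leqnSn N) n)))
      (fun n => dev_sq (V (lift ord0 n)) + dev_sq (V (widen_ord (leqnSn N) n)))).
    apply: lerD => //; rewrite ler_wpM2l ?lerD2r //.
    by rewrite mulr_ge0 // sqr_ge0.
  apply: ler_sum => n _.
  have := jensen_coupling m0 q0 (sF (lift ord0 n)) (sF (widen_ord (leqnSn N) n)) (sS n)
    (PF _) (PF _) (PS n) (modulus_bounds _) (modulus_bounds _) hal.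
  apply: le_trans; rewrite lerD2l lerN2 ler_pM2l // lerD2l; exact: phase_dev.
exact: (energy_combine _ hr (ltW hp) SA0 SD0 X0 small3 small4 small5 hP hC).
Qed.

End Convexity.

(** * The ground and averaged configurations *)

Section Elementary.
Context {R : realType}.
Local Notation mu := (@lebesgue_measure R).
Local Notation mu2 := (@lebesgue2 R).
Implicit Types (f g : R -> R) (u v : R * R -> R) (a b : R).

Lemma ae_ord n (P : 'I_n -> R -> Prop) : (forall i, {ae mu, forall x, P i x}) ->
  {ae mu, forall x, forall i, P i x}.
Proof.
move=> h; have {}h (j : nat) : {ae mu, forall x, forall i : 'I_n, i = j :> nat -> P i x}.
  case: (ltnP j n) => jn; first by apply: aeS (h (Ordinal jn)) => x hx i ij; rewrite (_ : i = Ordinal jn) //; exact: val_inj.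
  by apply: aeW => x i ij; have := ltn_ord i; rewrite ij ltnNge jn.
have := @ae_foralln _ _ _ mu (fun j x => forall i : 'I_n, i = j :> nat -> P i x) h.
by apply: aeS => x hx i; exact: (hx i i).
Qed.

Lemma continuous_affine a b : continuous (fun x : R => b + a * x).
Proof.
move=> x; apply: cvgD; first exact: cvg_cst.
by apply: (@continuousM _ _ (fun=> a) (fun y : R => y)); [exact: cvg_cst|exact: cvg_id].
Qed.

Lemma wderiv_affine a b : H1loc (fun x : R => b + a * x) /\
  {ae mu, forall x, wderiv (fun x : R => b + a * x) x = a}.
Proof.
have [] := @wderiv_unique R (fun x : R => b + a * x) (fun=> a) b => //.
- by apply: continuous_measurable_fun; exact: continuous_affine.
- exact: L2_cst.
- by apply: aeW => x; rewrite prim_cst.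
Qed.

Lemma H1loc_eq f g : (forall x, f x = g x) -> H1loc f -> H1loc g.
Proof. by move=> /funext ->. Qed.

Lemma H1locD f g : H1loc f -> H1loc g -> H1loc (fun x => f x + g x) /\
  {ae mu, forall x, wderiv (fun x => f x + g x) x = wderiv f x + wderiv g x}.
Proof.
move=> hf hg; have [_ wf] := wderivP hf; have [_ wg] := wderivP hg.
have [C E] := H1loc_prim hf; have [D F] := H1loc_prim hg.
have /L2locP [mf _] := hf.1; have /L2locP [mg _] := hg.1.
have [] := @wderiv_unique R (fun x => f x + g x) (fun x => wderiv f x + wderiv g x) (C + D) => //.
- exact: measurable_funD.
- exact: L2D.
- have := aeI E F; apply: aeS => x [-> ->].
  by rewrite (primD x (L2_L1 wf) (L2_L1 wg)) addrACA.
Qed.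

Lemma primz_cst a (y : R * R) : primz (fun=> a) y = a * y.2.
Proof. exact: prim_cst. Qed.

Lemma primx_cst a (y : R * R) : primx (fun=> a) y = a * y.1.
Proof. exact: prim_cst. Qed.

Lemma P2_snd g : L2 g -> P2 (fun y => g y.2).
Proof. by move=> /P2_fst /P2_swap. Qed.

(** With a = H this is the potential of [ground]; with a = 0 it yields the derivatives and traces of
    the zero function, which are chosen objects and have to be computed too. *)
Lemma wpartial_linear_z a (u := fun y : R * R => a * y.2) :
  [/\ H1loc2 u, {ae mu2, forall y, wpartial ex u y = 0}, {ae mu2, forall y, wpartial ez u y = a} &
      forall c, {ae mu, forall x, trace u c x = a * c}].
Proof.
have lg : L2 (fun z : R => a * z).
  by apply: L2_continuous => x; have := @continuous_affine a 0 x; under eq_fun do rewrite add0r.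
have hu : P2 u by exact: P2_snd lg.
have wz : is_wpartial ez u (fun=> a).
  apply: (@acl_is_wpartial R u (fun=> a) (fun=> 0)); [exact: P2_L1|exact: P2_cst|exact: L1_cst|].
  by apply: aeW => y; rewrite primz_cst add0r.
have wx : is_wpartial ex u (fun=> 0).
  apply: (@acl_is_wpartial_x R u (fun=> 0) (fun z => a * z)); [exact: P2_L1|exact: P2_cst|exact: L2_L1|].
  by apply: aeW => y; rewrite primx_cst mul0r addr0.
have ez' := wpartialP (ex_intro (fun g : R * R -> R => is_wpartial ez u g) _ wz).
have ex' := wpartialP (ex_intro (fun g : R * R -> R => is_wpartial ex u g) _ wx).
split; [split|exact: is_wpartial_unique ex' wx|exact: is_wpartial_unique ez' wz|].
- exact/L2loc2P.
- by exists (fun=> 0).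
- by exists (fun=> a).
- move=> c; have [] := @trace_acl R u (fun=> 0) (fun=> a) c (P2_L1 hu) (P2_cst a) (L2_cst 0).
    by apply: aeW => y; rewrite primz_cst add0r.
  by move=> E _; apply: aeS E => x ->; rewrite primz_cst add0r.
Qed.

Lemma H2loc2_0 : H2loc2 (fun=> 0 : R).
Proof.
have [h hx hz _] := wpartial_linear_z 0.
have e : (fun y : R * R => 0 * y.2) = (fun=> 0) by apply/funext => y; rewrite mul0r.
rewrite e in h hx hz; have [_ [mx _] [mz _]] := H1loc2_P2 h.
split; [exact: h|apply: (H1loc2_ae mx _ h)|apply: (H1loc2_ae mz _ h)].
  by apply: aeS hx => y ->.
by apply: aeS hz => y ->.
Qed.

Lemma trace_0 c : {ae mu, forall x, trace (fun=> 0) c x = 0 :> R}.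
Proof.
have [_ _ _ h] := wpartial_linear_z 0.
have e : (fun y : R * R => 0 * y.2) = (fun=> 0) by apply/funext => y; rewrite mul0r.
by have := h c; rewrite e; apply: aeS => x ->; rewrite mul0r.
Qed.

Lemma periodic2_natmul T u (i : nat) : periodic2 T u -> periodic2 (T * i%:R) u.
Proof.
move=> h; elim: i => [|i IH]; first by apply: aeW => -[x z]; rewrite mulr0 addr0.
have := aeI (ae_shift2 (T * i%:R) h) IH; apply: aeS => y /= [e1 e2].
by rewrite -e2 -e1 -natr1; congr (u (_, _)); ring.
Qed.

Lemma H2loc2_comb m k t u : H2loc2 u ->
  H2loc2 (comb2 m k t u).
Proof.
move=> [h hx hz]; have [hc ex' ez'] := H1loc2_comb m k t h.
have [_ [mx _] [mz _]] := H1loc2_P2 hc.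
have [hx' _ _] := H1loc2_comb m k t hx; have [hz' _ _] := H1loc2_comb m k t hz.
split; [exact: hc|apply: (H1loc2_ae mx _ hx')|apply: (H1loc2_ae mz _ hz')].
  by apply: aeS ex' => y ->.
by apply: aeS ez' => y ->.
Qed.

End Elementary.

Section Configurations.
Context {R : realType}.
Local Notation mu := (@lebesgue_measure R).
Local Notation mu2 := (@lebesgue2 R).
Variables (p : R) (N : nat) (H kappa : R).
Hypotheses (hp : 0 < p) (hH : 0 < H) (hk : 0 < kappa).
Implicit Types c : @config R N.

Let q := pi / (H * p).
Let Hp_gt0 : 0 < H * p. Proof. exact: mulr_gt0. Qed.
Lemma cell_gt0 : 0 < q. Proof. by rewrite divr_gt0 // pi_gt0. Qed.
Let q0 := cell_gt0.
Lemma cell_flux : H * p * (2 * q) = pi *+ 2.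
Proof. by rewrite mulr2n /q; field; rewrite !gt_eqF. Qed.

(* The phase differences are its only nonzero field, so its energy is the coupling energy, which is O(r). *)
Definition ground : @config R N :=
  Config (fun _ _ => 1) (fun n x => H * (n%:R * p) * x) (fun y => H * y.2) (fun=> 0).

Lemma ground_admissible : admissible p H q (multZ 1) ground.
Proof.
have [hx hxx hxz _] := wpartial_linear_z H; have [hz _ _ _] := wpartial_linear_z (0 : R).
have e : (fun y : R * R => 0 * y.2) = (fun=> 0) by apply/funext => y; rewrite mul0r.
rewrite e in hz.
split.
- by split.
- move=> n; split; last 2 [by apply: aeW].
    by have [h _] := @wderiv_affine R 0 1; apply: H1loc_eq h => x; rewrite mul0r addr0.
  by apply: aeW => x; exact: ler01.
- split.
    by move=> n; have [h _] := @wderiv_affine R (H * (n%:R * p)) 0; apply: H1loc_eq h => x; rewrite add0r.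
  exists 0 => n; apply: aeW => x /=; rewrite addr0 mulrDr; congr (_ + _).
  have -> : H * (n%:R * p) * (2 * q) = n%:R * (H * p * (2 * q)) by ring.
  by rewrite cell_flux /multZ mul1n -pmulrn mulr2n; ring.
- by move=> _ n _ /=; rewrite Rint_odd // ltW.
- exists (fun=> 0); split; [exact: H2loc2_0|by apply: aeW|exact: trace_0|exact: trace_0|].
  have [_ zx zz _] := wpartial_linear_z (0 : R); rewrite e in zx zz.
  by have := aeI zx zz; apply: aeS => y [-> ->] /=; rewrite addr0 oppr0.
Qed.

(** Each of the N coupling terms is at most $4=(1+1)^2$; with the factors p and r/2 and the length
    2q of the interval this gives the bound. *)
Lemma ground_density r : 0 <= r ->
  \int[mu]_(x in `[- q, q]) cdensity p H kappa r ground x <= 4 * q * p * N%:R * r.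
Proof.
move=> r0; have rc := adm_regular ground_admissible.
have [_ hxx hxz tr] := wpartial_linear_z H; have [_ zx _ _] := wpartial_linear_z (0 : R).
have e : (fun y : R * R => 0 * y.2) = (fun=> 0) by apply/funext => y; rewrite mul0r.
rewrite e in zx.
have w1 n : {ae mu, forall x, wderiv (modulus ground n) x = 0}.
  have [_ h] := @wderiv_affine R 0 1.
  have e1 : (fun x : R => 1 + 0 * x) = modulus ground n by apply/funext => x /=; rewrite mul0r addr0.
  by rewrite e1 in h.
have v1 n : {ae mu, forall x, velocity p ground n x = 0}.
  have [_ h] := @wderiv_affine R (H * (n%:R * p)) 0.
  have e1 : (fun x : R => 0 + H * (n%:R * p) * x) = phase ground n by apply/funext => x /=; rewrite add0r.
  rewrite e1 in h; have := aeI h (tr (n%:R * p)).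
  by apply: aeS => x [h1 h2]; rewrite /velocity h1 h2 subrr.
have ex0 : {ae mu2, forall y, excess H ground y = 0}.
  by have := aeI hxz zx; apply: aeS => y [h1 h2]; rewrite /excess h1 h2 subr0 subrr.
have w1' : {ae mu, forall x, forall n, wderiv (modulus ground n) x = 0} by exact: ae_ord.
have v1' : {ae mu, forall x, forall n, velocity p ground n x = 0} by exact: ae_ord.
have -> : 4 * q * p * N%:R * r = \int[mu]_(x in `[- q, q]) (r / 2 * (p * (4 * N%:R))).
  by rewrite Rint_cst ?opp_le_cell //; field.
apply: Rint_itv_le; [exact: L1_cdensity|exact: L1_cst|].
have := aeI w1' (aeI v1' (aeI (ae_fubini ex0) (P1_slice (P2_L1 (P2_excess H rc))))).
apply: aeS => x [h1 [h2 [h3 sx]]] _; rewrite /cdensity /density.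
have -> : plane_density p kappa (modulus ground) (fun n => wderiv (modulus ground n)) (velocity p ground) x = 0.
  rewrite /plane_density big1 ?mulr0 // => n _; rewrite h1 h2 /=.
  by rewrite !expr0n /= !mulr0 mul0r !addr0 expr1n subrr expr0n /= mulr0.
have -> : field_density p N (excess H ground) x = 0.
  rewrite /field_density (@Rint_eq_ae _ _ _ mu _ _ (fun=> 0)) //.
  - by rewrite Rint_cst ?mul0r // mulr_ge0 // ltW.
  - by apply: measurable_funTS; apply: measurable_funX; exact: sx.1.
  - by apply: aeS h3 => z -> _; rewrite expr0n.
rewrite mulr0 addr0 add0r ler_wpM2l ?divr_ge0 // ler_pM2l //.
have -> : 4 * N%:R = \sum_(n < N) (4 : R) by rewrite sumr_const card_ord mulr_natr.
apply: ler_sum => n _ /=; rewrite !expr1n !mulr1.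
by have := cos_geN1 (phase_diff p ground n x); set t := cos _; lra.
Qed.

End Configurations.

Section AverageConfig.
Context {R : realType}.
Local Notation mu := (@lebesgue_measure R).
Local Notation mu2 := (@lebesgue2 R).
Variables (p : R) (N : nat) (H kappa q : R) (m : nat).
Hypotheses (hp : 0 < p) (q0 : 0 < q) (m0 : (0 < m)%N).
Hypothesis hal : H * p * (2 * q) = pi *+ 2.
Let Q := m%:R * q.
Implicit Types c : @config R N.
Local Notation av f := (avg m q f).

Lemma number_cells_gt0 : 0 < m%:R :> R.
Proof. by rewrite ltr0n. Qed.

Lemma avg_sum_cst (a : R) : m%:R^-1 * \sum_(i < m) a = a.
Proof. by rewrite sumr_const card_ord -[a *+ m]mulr_natl mulrA mulVm ?mul1r. Qed.

Lemma avg_cst (a x : R) : av (fun=> a) x = a.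
Proof. exact: avg_sum_cst. Qed.

Lemma eq_avg (f g : R -> R) x : (forall y, f y = g y) -> av f x = av g x.
Proof. by move=> e; rewrite /avg /comb; congr (_ * _); apply: eq_bigr => i _; exact: e. Qed.

Lemma avg_ae_eq (f g : R -> R) : {ae mu, forall x, f x = g x} -> {ae mu, forall x, av f x = av g x}.
Proof.
move=> E; apply: aeS (ae_shifts (cells q) E) => x e.
by rewrite /avg /comb; congr (_ * _); apply: eq_bigr => i _; exact: e.
Qed.

(* Subtracting the mean slope makes a phase periodic. *)
Definition tilt (a : R) (f : R -> R) (x : R) : R := f x - a * x.

Lemma H1loc_tilt a f : H1loc f -> H1loc (tilt a f) /\
  {ae mu, forall x, wderiv (tilt a f) x = wderiv f x - a}.
Proof.
move=> hf; have [h1 e1] := @wderiv_affine R (- a) 0; have [h2 e2] := H1locD hf h1.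
have e : (fun x => f x + (0 + - a * x)) = tilt a f by apply/funext => x; rewrite /tilt add0r mulNr.
rewrite e in h2 e2; split=> //; have := aeI e1 e2; apply: aeS => x [h3 ->].
by rewrite h3.
Qed.

Lemma L1_H1loc (f : R -> R) : H1loc f -> L1 f.
Proof. by move=> hf; apply: L2_L1; apply/L2locP; exact: hf.1. Qed.

Lemma Rint_tilt a (f : R -> R) b : 0 <= b -> L1 f ->
  \int[mu]_(x in `[- b, b]) tilt a f x = \int[mu]_(x in `[- b, b]) f x.
Proof.
move=> b0 hf.
have l : L1 (fun x : R => a * x).
  by apply: L1_ext (L1_continuous (@continuous_affine R a 0)) => x; rewrite add0r.
by rewrite (Rint_itvB (- b) b hf l) Rint_odd // subr0.
Qed.

(** Only the tilted, hence periodic, part of a phase is averaged, and the slope is put back.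
    Velocities, excess field and tilted phase differences of the result are then the averages of the
    original ones. *)
Definition avg_config (al : 'I_N.+1 -> R) (c : @config R N) : @config R N :=
  Config (fun n => av (modulus c n)) (fun n x => al n * x + av (tilt (al n) (phase c n)) x)
    (avg2 m q (potx c)) (avg2 m q (potz c)).

Variables (c : @config R N) (omega : R).
Hypothesis adm : admissible p H Q (multZ m) c.
Hypothesis jump : forall n, {ae mu, forall x : R,
  phase c n (x + 2 * Q) = phase c n x + omega + 2 * pi * (multZ m n)%:~R}.

Let al (n : 'I_N.+1) : R := (omega + 2 * pi * (m * n)%:R) / (2 * Q).
Let cb := avg_config al c.
Let Q_gt0 : 0 < Q. Proof. by rewrite mulr_gt0 // number_cells_gt0. Qed.
Let rc : regular c := adm_regular adm.

(** Here the winding m n matters: omega cancels, and the winding numbers of neighbouring planes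
    differ by m, so the slopes differ by 2 pi m / (2Q) = 2 pi / (2q) = Hp. *)
Lemma slope_step (n : 'I_N) : al (lift ord0 n) - al (widen_ord (leqnSn N) n) = H * p.
Proof.
have -> : H * p = pi *+ 2 / (2 * q) by rewrite -hal mulfK // mulf_neq0 // gt_eqF.
rewrite /al lift0 /= -mulrBl /Q !natrM -natr1 mulr2n; field.
by rewrite !gt_eqF // number_cells_gt0.
Qed.

Lemma slope_period (n : 'I_N.+1) : al n * (2 * Q) = omega + 2 * pi * (m * n)%:R.
Proof. by rewrite /al divfK // mulf_neq0 // gt_eqF. Qed.

Lemma slope_cell (n : 'I_N.+1) : al n * (2 * q) = omega / m%:R + 2 * pi * n%:R.
Proof.
have m00 : m%:R != 0 :> R by rewrite gt_eqF // number_cells_gt0.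
have -> : al n * (2 * q) = al n * (2 * Q) / m%:R by rewrite /Q; field.
by rewrite slope_period natrM; field.
Qed.

Lemma tilt_periodic n : periodic (2 * Q) (tilt (al n) (phase c n)).
Proof.
apply: aeS (jump n) => x; rewrite /tilt => ->.
have -> : al n * (x + 2 * Q) = al n * x + al n * (2 * Q) by ring.
by rewrite slope_period /multZ -pmulrn; ring.
Qed.

Let H1t n : H1loc (tilt (al n) (phase c n)).
Proof. by have [_ _ _ h4] := rc; have [] := H1loc_tilt (al n) (h4 n). Qed.

Lemma avg_phase n : H1loc (phase cb n) /\
  {ae mu, forall x, wderiv (phase cb n) x = av (wderiv (phase c n)) x}.
Proof.
have [_ _ _ h4] := rc; have [_ e1] := H1loc_tilt (al n) (h4 n).
have [h2 e2] := wderiv_comb m m%:R^-1 (cells q) (H1t n).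
have [h3 e3] := @wderiv_affine R (al n) 0; have [h5 e5] := H1locD h3 h2.
have e : (fun x => (0 + al n * x) + comb m m%:R^-1 (cells q) (tilt (al n) (phase c n)) x) = phase cb n.
  by apply/funext => x; rewrite add0r.
rewrite e in h5 e5; split=> //.
have := aeI (aeI e5 e3) (aeI e2 (avg_ae_eq e1)); apply: aeS => x [[e5' e3'] [e2' e1']].
rewrite e5' e3' e2' [X in _ + X]e1' avgB avg_cst; ring.
Qed.

Lemma avg_velocity n : {ae mu, forall x, velocity p cb n x = av (velocity p c n) x}.
Proof.
have [h1 _ _ _] := rc; have [_ e1] := avg_phase n.
have e2 := trace_comb m m%:R^-1 (cells q) (n%:R * p) h1.
have := aeI e1 e2; apply: aeS => x [e1' e2'].
by rewrite /velocity e1' [X in _ - X]e2' avgB.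
Qed.

Lemma avg_excess : {ae mu2, forall y, excess H cb y = avg2 m q (excess H c) y}.
Proof.
have [h1 h2 _ _] := rc.
have [_ _ e1] := H1loc2_comb m m%:R^-1 (cells q) h1.
have [_ e2 _] := H1loc2_comb m m%:R^-1 (cells q) h2.
have := aeI e1 e2; apply: aeS => y [e1' e2'].
rewrite /excess [X in X - _ - _]e1' [X in _ - X - _]e2' /avg2 /comb2 !sumrB !mulrBr.
by congr (_ - _); rewrite avg_sum_cst.
Qed.

Lemma avg_phase_diff (n : 'I_N) : {ae mu, forall x, phase_diff p cb n x =
  H * p * x + av (tilt (H * p) (phase_diff p c n)) x}.
Proof.
have [_ h2 _ _] := rc; have [pz _ _] := H1loc2_P2 h2.
apply: aeS (Rint_slice_comb2 m m%:R^-1 (cells q) (n%:R * p) (n.+1%:R * p) (P2_L1 pz)) => x e.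
rewrite /phase_diff /= [X in _ - X]e -(slope_step n).
rewrite (@eq_avg (tilt (al (lift ord0 n) - al (widen_ord (leqnSn N) n)) _) (fun y => tilt (al (lift ord0 n)) (phase c (lift ord0 n)) y -
  tilt (al (widen_ord (leqnSn N) n)) (phase c (widen_ord (leqnSn N) n)) y -
  \int[mu]_(z in `[n%:R * p, n.+1%:R * p]) potz c (y, z))); last first.
  by move=> y; rewrite /tilt /phase_diff; ring.
by rewrite !avgB /avg; ring.
Qed.

Lemma avg_modulus_deriv n : {ae mu, forall x, wderiv (modulus cb n) x = av (wderiv (modulus c n)) x}.
Proof. by have [_ _ h3 _] := rc; have [] := wderiv_comb m m%:R^-1 (cells q) (h3 n). Qed.

Lemma avg_admissible : admissible p H q (multZ 1) cb.
Proof.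
have [h1 h2 h3 h4] := rc; have [_ ha hb hd [xi [hxi per t0 tN E]]] := adm.
split.
- by have [? _ _] := H1loc2_comb m m%:R^-1 (cells q) h1; have [? _ _] := H1loc2_comb m m%:R^-1 (cells q) h2.
- move=> n; split.
  + by have [] := wderiv_comb m m%:R^-1 (cells q) (h3 n).
  + by apply: avg_periodic => //; exact: adm_modulus_periodic adm n.
  + apply: aeS (ae_shifts (cells q) (adm_modulus_ge0 adm n)) => x e.
    by rewrite /= mulr_ge0 ?invr_ge0 // sumr_ge0.
- split; first by move=> n; have [] := avg_phase n.
  (* Over one short period the linear part grows by [al n * (2 * q)] = omega / m + 2 pi n, so the
     common constant is divided by m and the winding drops from m n to n. *)
  exists (omega / m%:R) => n.
  apply: aeS (avg_periodic m0 (tilt_periodic n)) => x e.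
  rewrite /= e mulrDr slope_cell /multZ mul1n -pmulrn; ring.
(* The zero-mean normalization survives: the linear part is odd, and the integral of the average
   over the short period is 1/m of the integral of the tilted phase over the long one. *)
- move=> [n0 hn0] n n1.
  have hm : exists n : 'I_N.+1, multZ m n != 0.
    by exists n0; move: hn0; rewrite /multZ mul1n !eqz_nat muln_eq0 negb_or (gtn_eqF m0).
  have i0 := hd hm n n1.
  have lt := L1_H1loc (H1t n).
  have la : L1 (av (tilt (al n) (phase c n))) by exact: L1_comb.
  have ll : L1 (fun x : R => al n * x).
    by apply: L1_ext (L1_continuous (@continuous_affine R (al n) 0)) => x; rewrite add0r.
  rewrite /= (Rint_itvD (- q) q ll la) Rint_odd ?(ltW q0) // add0r.
  have := Rint_avg m0 q0 lt (tilt_periodic n).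
  rewrite Rint_tilt ?(ltW Q_gt0) //; last exact: L1_H1loc.
  by rewrite i0 => /esym/eqP; rewrite mulf_eq0 gt_eqF ?number_cells_gt0 //= => /eqP.
- exists (avg2 m q xi); have [hxi1 _ _] := hxi.
  have [hc e1 e2] := H1loc2_comb m m%:R^-1 (cells q) hxi1.
  split.
  + exact: H2loc2_comb.
  + apply: aeS per => y; rewrite /avg2 /comb2 /Q /= => e; congr (_ * _).
    case: m m0 e => // k _ e.
    rewrite big_ord_recr big_ord_recl /= addrC; congr (_ + _).
      rewrite /cells mulr0 addr0 -[xi (y.1, y.2)]/(xi (y.1, y.2)).
      have -> : xi (y.1, y.2) = xi y by case: (y).
      rewrite -e; congr (xi (_, _)); rewrite -natr1; ring.
    by apply: eq_bigr => i _; congr (xi (_, _)); rewrite /cells (_ : fintype.bump 0 i = i.+1) // -natr1; ring.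
  + have := aeI (trace_comb m m%:R^-1 (cells q) 0 hxi1) (ae_shifts (cells q) t0).
    apply: aeS => x [e e0]; rewrite [LHS]e /comb big1 ?mulr0 // => i _; exact: e0.
  + have := aeI (trace_comb m m%:R^-1 (cells q) (N%:R * p) hxi1) (ae_shifts (cells q) tN).
    apply: aeS => x [e e0]; rewrite [LHS]e /comb big1 ?mulr0 // => i _; exact: e0.
  + have := aeI (aeI e1 e2) (ae_shifts2 (cells q) E); apply: aeS => y [[e1' e2'] e].
    rewrite [X in _ = _ + X /\ _]e2' [X in _ /\ _ = - X]e1' /= /avg2 /comb2; split.
      rewrite (eq_bigr (fun i : 'I_m => H * y.2 + wpartial ez xi (y.1 + cells q i, y.2))); last first.
        by move=> i _; have [] := e i.
      by rewrite big_split mulrDr /= avg_sum_cst.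
    rewrite (eq_bigr (fun i : 'I_m => - wpartial ex xi (y.1 + cells q i, y.2))); last first.
      by move=> i _; have [] := e i.
    by rewrite sumrN mulrN.
Qed.

End AverageConfig.

Section Inclusion.
Context {R : realType}.
Local Notation mu := (@lebesgue_measure R).
Local Notation mu2 := (@lebesgue2 R).
Variables (p : R) (N : nat) (H kappa q : R) (m : nat).
Hypotheses (hp : 0 < p) (q0 : 0 < q) (m0 : (0 < m)%N).
Let Q := m%:R * q.
Variable c : @config R N.
Hypothesis adm : admissible p H q (multZ 1) c.

(** The class for the short period is contained in the one for the long period. This gives one
    inequality between the infima and also places the averaged configuration beside the original
    one, as the uniqueness argument for potentials requires. *)
Lemma admissible_mult : admissible p H Q (multZ m) c.
Proof.
have rc := adm_regular adm; have [_ _ _ h4] := rc.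
have [ha hb [_ [omega jump]] hd [xi [hxi per t0 tN E]]] := adm.
have jumpi (i : nat) n : {ae mu, forall x : R,
   phase c n (x + 2 * q * i%:R) = phase c n x + (omega + 2 * pi * n%:R) * i%:R}.
  elim: i => [|i IH]; first by apply: aeW => x; rewrite !mulr0 !addr0.
  have := aeI (ae_shift (2 * q * i%:R) (jump n)) IH; apply: aeS => x [e1 e2].
  have -> : x + 2 * q * i.+1%:R = x + 2 * q * i%:R + 2 * q by rewrite -natr1; ring.
  by rewrite e1 e2 /multZ mul1n -pmulrn -natr1; ring.
have QE : 2 * Q = 2 * q * m%:R by rewrite /Q; ring.
split => //.
- by move=> n; have [? P ?] := hb n; split => //; exact: periodic_q P.
- split => //; exists (m%:R * omega) => n; apply: aeS (jumpi m n) => x.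
  by rewrite QE => ->; rewrite /multZ -pmulrn natrM; ring.
- move=> [n0 hn0] n n1.
  have h1 : exists n : 'I_N.+1, multZ 1 n != 0.
    by exists n0; move: hn0; rewrite /multZ mul1n !eqz_nat muln_eq0 negb_or => /andP[].
  have i0 := hd h1 n n1.
  (* The slope over a short period. Without it the phase is periodic, so its integral over the long
     period is m times the one over the short period; the linear part contributes nothing to
     either. *)
  pose a := (omega + 2 * pi * n%:R) / (2 * q).
  have [ht _] := H1loc_tilt a (h4 n); have lt := L1_H1loc ht.
  have lp := L1_H1loc (h4 n).
  have Pt : periodic (2 * q) (tilt a (phase c n)).
    apply: aeS (jump n) => x; rewrite /tilt => ->.
    have -> : a * (x + 2 * q) = a * x + (omega + 2 * pi * n%:R).
      by rewrite mulrDr divfK // mulf_neq0 // gt_eqF.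
    by rewrite /multZ mul1n -pmulrn; ring.
  have Q_gt0 : 0 <= Q by rewrite mulr_ge0 // ltW.
  rewrite -(Rint_tilt a Q_gt0 lp).
  rewrite (Rint_avg m0 q0 lt (periodic_q m Pt)).
  rewrite (Rint_itv_eq (L1_comb _ _ _ lt) lt); last first.
    by apply: aeS (avg_id m0 Pt) => x e _; exact: e.
  by rewrite Rint_tilt ?(ltW q0) // i0 mulr0.
- exists xi; split => //.
  by have := periodic2_natmul m per; rewrite -QE.
Qed.

End Inclusion.

Section EnergyPeriod.
Context {R : realType}.
Local Notation mu := (@lebesgue_measure R).
Local Notation mu2 := (@lebesgue2 R).
Variables (p : R) (N : nat) (H kappa q : R).
Hypotheses (hp : 0 < p).

Lemma cdensity_periodic r k (c : @config R N) : admissible p H q k c ->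
  periodic (2 * q) (cdensity p H kappa r c).
Proof.
move=> adm; have rc := adm_regular adm.
have e1 := ae_ord (adm_modulus_periodic adm).
have e2 := ae_ord (adm_modulus_deriv_periodic adm).
have e3 := ae_ord (adm_velocity_periodic adm).
have e4 := ae_ord (adm_phase_diff_jump adm).
have P : P1 (fun y => (excess H c y) ^+ 2) by apply: L2b_sq; exact: P2_excess.
have P' : periodic2 (2 * q) (fun y => (excess H c y) ^+ 2).
  by apply: aeS (adm_excess_periodic adm) => y ->.
have e5 := periodic2_Rint 0 (N%:R * p) P P'.
have := aeI (aeI e1 e2) (aeI e3 (aeI e4 e5)).
apply: aeS => x [[f1 f2] [f3 [f4 f5]]].
rewrite /cdensity /density; congr (_ + _ + _).
- by rewrite /plane_density; congr (_ * _); apply: eq_bigr => n _; rewrite f1 f2 f3.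
- rewrite /coupling_density; congr (_ * (_ * _)); apply: eq_bigr => n _; rewrite !f1 f4.
  set j := k _ - k _; congr (_ - _ * _).
  have cz (i : int) t : cos (t + 2 * pi * i%:~R) = cos t :> R.
    have cn (i' : nat) s : cos (s + 2 * pi * i'%:R) = cos s :> R.
      elim: i' => [|i' IH]; first by rewrite mulr0 addr0.
      have -> : s + 2 * pi * i'.+1%:R = s + 2 * pi * i'%:R + pi *+ 2 by rewrite -natr1 mulr2n; ring.
      by rewrite cosD2pi.
    case: i => i; first exact: cn.
    by rewrite NegzE mulrNz -pmulrn -[LHS](cn i.+1) mulrN subrK.
  exact: cz.
- by rewrite /field_density f5.
Qed.

Lemma Rint_cdensity_mult (m : nat) r k (c : @config R N) : (0 < m)%N -> 0 < q -> admissible p H q k c ->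
  \int[mu]_(x in `[- (m%:R * q), m%:R * q]) cdensity p H kappa r c x =
  m%:R * \int[mu]_(x in `[- q, q]) cdensity p H kappa r c x.
Proof.
move=> m0 q0 adm; have P := cdensity_periodic r adm.
have L := L1_cdensity H kappa hp r (adm_regular adm).
rewrite (Rint_avg m0 q0 L (periodic_q m P)); congr (_ * _).
apply: (Rint_itv_eq (L1_comb _ _ _ L) L).
by apply: aeS (avg_id m0 P) => x e _; exact: e.
Qed.

End EnergyPeriod.

(** * Uniqueness of the potential *)

Section Harmonic.
Context {R : realType}.
Local Notation mu := (@lebesgue_measure R).
Local Notation mu2 := (@lebesgue2 R).
Implicit Types (f g : R -> R) (u v w : R * R -> R).

Lemma primzB v w : P1 v -> P1 w ->
  {ae mu, forall x, forall z, primz (fun y => v y - w y) (x, z) = primz v (x, z) - primz w (x, z)}.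
Proof.
move=> hv hw; have := aeI (P1_slice hv) (P1_slice hw).
by apply: aeS => x [sv sw] z; exact: primBf.
Qed.

Lemma primxB v w : P1 v -> P1 w ->
  {ae mu, forall z, forall x, primx (fun y => v y - w y) (x, z) = primx v (x, z) - primx w (x, z)}.
Proof.
move=> hv hw; have := aeI (P1_slice_x hv) (P1_slice_x hw).
by apply: aeS => z [sv sw] x; exact: primBf.
Qed.

Lemma periodic_primitive f g C T x : L1 g -> {ae mu, forall x, f x = C + prim g x} ->
  periodic T f -> prim g (x + T) = prim g x.
Proof.
move=> hg E P; have cg := continuous_prim hg.
apply: (@continuous_ae_eq R (fun x => prim g (x + T)) (prim g)) => //.
  move=> y; apply: (@continuous_comp _ _ _ (fun x : R => x + T)); last exact: cg.
  by apply: cvgD; [exact: cvg_id|exact: cvg_cst].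
have key (a b A B D : R) : a = b -> a = D + A -> b = D + B -> A = B.
  by move=> -> -> /addrI.
have := aeI P (aeI E (ae_shift T E)); apply: aeS => y [e1 [e2 e3]].
exact: key e1 e3 e2.
Qed.

Variables (L Q : R) (u A B Az Bx : R * R -> R) (ga g gb : R -> R).
Hypotheses (L0 : 0 < L) (Q0 : 0 < Q).
Hypotheses (hu : P2 u) (hA : P2 A) (hB : P2 B) (hAz : P2 Az) (hBx : P2 Bx).
Hypotheses (uz : {ae mu2, forall y, u y = primz A y})
  (u0 : {ae mu, forall x, primz A (x, L) = 0})
  (ux : {ae mu2, forall y, u y = g y.2 + primx B y})
  (Az_ : {ae mu2, forall y, A y = ga y.1 + primz Az y})
  (Bx_ : {ae mu2, forall y, B y = gb y.2 + primx Bx y})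
  (div0 : {ae mu, forall x, {ae mu, forall z, `[0, L]%classic z -> Az (x, z) + Bx (x, z) = 0}})
  (Pu : periodic2 (2 * Q) u) (PA : periodic2 (2 * Q) A) (PB : periodic2 (2 * Q) B).

Let hE : P1 (fun y => u y * Az y + A y ^+ 2).
Proof. by apply: P1D; [exact: P2M|apply: L2b_sq]. Qed.
Let hF : P1 (fun y => u y * Bx y + B y ^+ 2).
Proof. by apply: P1D; [exact: P2M|apply: L2b_sq]. Qed.

(** A and B are the z- and x-derivatives of u, Az and Bx the corresponding second derivatives.
    Integrating by parts on a vertical line, the boundary terms vanish with u: at 0 because u is a
    primitive starting there, at L by hypothesis. *)
Lemma dirichlet_z : {ae mu, forall x, \int[mu]_(z in `[0, L]) (u (x, z) * Az (x, z) + A (x, z) ^+ 2) = 0}.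
Proof.
have := aeI (aeI (ae_fubini uz) u0) (aeI (ae_fubini Az_) (aeI (P1_slice hE) (aeI (P2_slice hA) (P2_slice hAz)))).
apply: aeS => x [[e1 e0] [e2 [sE [sA sAz]]]].
have lA := L2_L1 sA; have lAz := L2_L1 sAz.
have c1 : continuous (fun z => 0 + prim (fun s => A (x, s)) z).
  by move=> z; apply: cvgD; [exact: cvg_cst|exact: continuous_prim].
have c2 : continuous (fun z => ga x + prim (fun s => Az (x, s)) z).
  by move=> z; apply: cvgD; [exact: cvg_cst|exact: continuous_prim].
have l1 := L1M_continuous c1 lAz.
have l2 : L1 (fun z => A (x, z) * (ga x + prim (fun s => Az (x, s)) z)).
  by apply: L1_ext (L1M_continuous c2 lA) => z; rewrite mulrC.
have := prim_ibp 0 (ga x) lA lAz (ltW L0).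
rewrite -(Rint_itvD 0 L l1 l2).
have -> : prim (fun s => A (x, s)) L = 0 by exact: e0.
rewrite prim0 !addr0 !mul0r subrr => e3; apply: etrans e3.
apply: (Rint_itv_eq sE (L1D l1 l2)).
have := aeI e1 e2; apply: aeS => z [f1 f2] _.
rewrite add0r -[X in _ = X * Az _ + _]/(primz A (x, z)) -f1.
by rewrite -[ga x + _]/(ga (x, z).1 + primz Az (x, z)) -f2 -expr2.
Qed.

(** On horizontal lines the boundary terms do not vanish but cancel, by periodicity of u and B. *)
Lemma dirichlet_x : {ae mu, forall z, \int[mu]_(x in `[- Q, Q]) (u (x, z) * Bx (x, z) + B (x, z) ^+ 2) = 0}.
Proof.
have := aeI (aeI (ae_fubini_x ux) (ae_fubini_x Bx_))
  (aeI (aeI (P1_slice_x hF) (aeI (P2_slice_x hB) (P2_slice_x hBx))) (aeI (ae_fubini_x Pu) (ae_fubini_x PB))).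
apply: aeS => z [[e1 e2] [[sF [sB sBx]] [pu pB]]].
have lB := L2_L1 sB; have lBx := L2_L1 sBx.
have c1 : continuous (fun x => g z + prim (fun s => B (s, z)) x).
  by move=> x; apply: cvgD; [exact: cvg_cst|exact: continuous_prim].
have c2 : continuous (fun x => gb z + prim (fun s => Bx (s, z)) x).
  by move=> x; apply: cvgD; [exact: cvg_cst|exact: continuous_prim].
have l1 := L1M_continuous c1 lBx.
have l2 : L1 (fun x => B (x, z) * (gb z + prim (fun s => Bx (s, z)) x)).
  by apply: L1_ext (L1M_continuous c2 lB) => x; rewrite mulrC.
have QQ : - Q <= Q by move: Q0; lra.
have := prim_ibp (g z) (gb z) lB lBx QQ.
have e3 := @periodic_primitive (fun x => u (x, z)) (fun x => B (x, z)) (g z) (2 * Q) (- Q) lB e1 pu.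
have e4 := @periodic_primitive (fun x => B (x, z)) (fun x => Bx (x, z)) (gb z) (2 * Q) (- Q) lBx e2 pB.
have eQ : - Q + 2 * Q = Q by ring.
rewrite eQ in e3 e4.
rewrite -(Rint_itvD (- Q) Q l1 l2) e3 e4 subrr => e5; apply: etrans e5.
apply: (Rint_itv_eq sF (L1D l1 l2)).
have := aeI e1 e2; apply: aeS => x [f1 f2] _.
rewrite -[g z + _]/(g (x, z).2 + primx B (x, z)) -f1.
by rewrite -[gb z + _]/(gb (x, z).2 + primx Bx (x, z)) -f2 -expr2.
Qed.

(** Adding the two identities, the products of u with Az and Bx cancel by [div0], which is Laplace's
    equation, and $\int(A^2+B^2)=0$ remains. *)
Lemma harmonic_zero : {ae mu, forall x, {ae mu, forall z, `[0, L]%classic z -> A (x, z) = 0 /\ B (x, z) = 0}}.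
Proof.
pose K := fun y => A y ^+ 2 + B y ^+ 2.
have hK : P1 K by apply: P1D; apply: L2b_sq.
have LE := P1_Rint 0 L hE; have LF := P1_Rint 0 L hF; have LK := P1_Rint 0 L hK.
have i1 : \int[mu]_(x in `[- Q, Q]) \int[mu]_(z in `[0, L]) (u (x, z) * Az (x, z) + A (x, z) ^+ 2) = 0.
  rewrite (@Rint_itv_eq R _ (fun=> 0) (- Q) Q LE (@L1_cst R 0)).
    by rewrite Rint_cst ?mul0r //; move: Q0; lra.
  by apply: aeS dirichlet_z => x e _.
have i2 : \int[mu]_(x in `[- Q, Q]) \int[mu]_(z in `[0, L]) (u (x, z) * Bx (x, z) + B (x, z) ^+ 2) = 0.
  have e := Rint_rect_swap (- Q) Q 0 L hF; rewrite /= in e; rewrite e.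
  have LX := L1_Rint_x (- Q) Q hF.
  rewrite (@Rint_itv_eq R _ (fun=> 0) 0 L LX (@L1_cst R 0)).
    by rewrite Rint_cst ?mul0r // ltW.
  by apply: aeS dirichlet_x => z e' _.
have iK : \int[mu]_(x in `[- Q, Q]) \int[mu]_(z in `[0, L]) K (x, z) = 0.
  transitivity (\int[mu]_(x in `[- Q, Q]) ((\int[mu]_(z in `[0, L]) (u (x, z) * Az (x, z) + A (x, z) ^+ 2))
     + (\int[mu]_(z in `[0, L]) (u (x, z) * Bx (x, z) + B (x, z) ^+ 2)))).
    apply: (Rint_itv_eq LK (L1D LE LF)).
    have := aeI div0 (aeI (P1_slice hK) (aeI (P1_slice hE) (P1_slice hF))).
    apply: aeS => x [d [sK [sE sF]]] _.
    rewrite -(Rint_itvD 0 L sE sF); apply: (Rint_itv_eq sK (L1D sE sF)).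
    apply: aeS d => z e /e {}e; rewrite /K.
    have key (s a b x1 x2 : R) : x1 + x2 = 0 -> a + b = s * x1 + a + (s * x2 + b).
      by move=> h; transitivity (s * (x1 + x2) + a + b); [rewrite h; ring|ring].
    exact: key e.
  by rewrite (Rint_itvD (- Q) Q LE LF) i1 i2 addr0.
have K0 x : 0 <= \int[mu]_(z in `[0, L]) K (x, z).
  by apply: Rintegral_ge0 => z _; rewrite addr_ge0 ?sqr_ge0.
have PK : periodic2 (2 * Q) K.
  by have := aeI PA PB; apply: aeS => y [e1 e2]; rewrite /K e1 e2.
have PI := periodic2_Rint 0 L hK PK.
have z0 : {ae mu, forall x, \int[mu]_(z in `[0, L]) K (x, z) = 0}.
  apply: (ae_cell Q0); first by apply: aeS PI => x ->.
  apply: Rint_ge0_eq0 => //; first exact: L1_itv.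
  by apply: aeW => x _; exact: K0.
have := aeI z0 (P1_slice hK); apply: aeS => x [e s].
have hz : {ae mu, forall z, `[0, L]%classic z -> K (x, z) = 0}.
  apply: Rint_ge0_eq0 => //; first exact: L1_itv.
  by apply: aeW => z _; rewrite addr_ge0 ?sqr_ge0.
apply: aeS hz => z h /h /eqP; rewrite paddr_eq0 ?sqr_ge0 // !sqrf_eq0 => /andP[/eqP ? /eqP ?].
by split.
Qed.

End Harmonic.

Section StripUniqueness.
Context {R : realType}.
Local Notation mu := (@lebesgue_measure R).
Local Notation mu2 := (@lebesgue2 R).
Implicit Types (u v w : R * R -> R) (f g : R -> R).

Lemma eq_primz v w : P1 v -> P1 w -> {ae mu2, forall y, v y = w y} ->
  {ae mu, forall x, forall z, primz v (x, z) = primz w (x, z)}.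
Proof.
move=> hv hw E; have := aeI (ae_fubini E) (aeI (P1_slice hv) (P1_slice hw)).
by apply: aeS => x [e [sv sw]] z; apply: eq_prim => //; [exact: sv.1|exact: sw.1].
Qed.

Lemma eq_primx v w : P1 v -> P1 w -> {ae mu2, forall y, v y = w y} ->
  {ae mu, forall z, forall x, primx v (x, z) = primx w (x, z)}.
Proof.
move=> hv hw E; have := aeI (ae_fubini_x E) (aeI (P1_slice_x hv) (P1_slice_x hw)).
by apply: aeS => z [e [sv sw]] x; apply: eq_prim => //; [exact: sv.1|exact: sw.1].
Qed.

Lemma ae_columns (P : R * R -> Prop) : {ae mu, forall x, forall z, P (x, z)} -> {ae mu2, forall y, P y}.
Proof. by move=> h; apply: aeS (ae_fst h) => -[x z]; exact. Qed.

Lemma ae_rows (P : R * R -> Prop) : {ae mu, forall z, forall x, P (x, z)} -> {ae mu2, forall y, P y}.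
Proof. by move=> h; apply: aeS (ae_snd h) => -[x z]; exact. Qed.

Lemma H1loc2_primz u : H1loc2 u ->
  exists2 g, L2 g & {ae mu2, forall y, u y = g y.1 + primz (wpartial ez u) y}.
Proof.
by move=> hu; have [pu _ _] := H1loc2_P2 hu; case: hu => _ _ /wpartialP; exact: is_wpartial_acl.
Qed.

Lemma H1loc2_primx u : H1loc2 u ->
  exists2 g, L2 g & {ae mu2, forall y, u y = g y.2 + primx (wpartial ex u) y}.
Proof.
by move=> hu; have [pu _ _] := H1loc2_P2 hu; case: hu => _ /wpartialP hx _; exact: is_wpartial_acl_x.
Qed.

(** The vertical primitive starts at z = 0, so the additive function of x is the trace there, and it
    vanishes. *)
Lemma zero_trace_primz u (L : R) : H1loc2 u -> {ae mu, forall x, trace u 0 x = 0} ->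
  {ae mu, forall x, trace u L x = 0} ->
  {ae mu2, forall y, u y = primz (wpartial ez u) y} /\
  {ae mu, forall x, primz (wpartial ez u) (x, L) = 0}.
Proof.
move=> hu t0 tL; have [g hg E] := H1loc2_primz hu; have [pu _ pz] := H1loc2_P2 hu.
have [e0 _] := trace_acl 0 (P2_L1 pu) pz hg E; have [eL _] := trace_acl L (P2_L1 pu) pz hg E.
have g0 : {ae mu, forall x, g x = 0}.
  by have := aeI t0 e0; apply: aeS => x [-> ->]; rewrite /primz /= prim0 addr0.
split.
  by have := aeI E (ae_fst g0); apply: aeS => y [-> ->]; rewrite add0r.
by have := aeI g0 (aeI tL eL); apply: aeS => x [e1 [-> ->]]; rewrite e1 add0r.
Qed.

(** A trace is defined through values above the line, which for the top plane lie outside the strip.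
    The representatives continuous in z show that values inside the closed strip determine it as
    well. *)
Lemma trace_strip u u' (L t : R) : 0 < L -> 0 <= t <= L -> H1loc2 u -> H1loc2 u' ->
  {ae mu, forall x, {ae mu, forall z, `[0, L]%classic z -> u (x, z) = u' (x, z)}} ->
  {ae mu, forall x, trace u t x = trace u' t x}.
Proof.
move=> L0 tL hu hu' e.
have [g hg E] := H1loc2_primz hu; have [pu _ pz] := H1loc2_P2 hu.
have [g' hg' E'] := H1loc2_primz hu'; have [pu' _ pz'] := H1loc2_P2 hu'.
have [e1 _] := trace_acl t (P2_L1 pu) pz hg E; have [e2 _] := trace_acl t (P2_L1 pu') pz' hg' E'.
have := aeI (aeI e (aeI e1 e2)) (aeI (aeI (ae_fubini E) (ae_fubini E')) (aeI (P1_slice (P2_L1 pz)) (P1_slice (P2_L1 pz')))).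
apply: aeS => x [[ex [-> ->]] [[E1 E2] [s1 s2]]].
apply/eqP; rewrite -subr_eq0; apply/eqP.
apply: (@continuous_ae_eq0 R (fun z => (g x + prim (fun s => wpartial ez u (x, s)) z) -
  (g' x + prim (fun s => wpartial ez u' (x, s)) z)) 0 L) => //.
  by move=> z; apply: cvgB; (apply: cvgD; [exact: cvg_cst|exact: continuous_prim]).
have := aeI ex (aeI E1 E2); apply: aeS => z [h [h1 h2]] hz.
have {}h : u (x, z) = u' (x, z) by apply: h; rewrite /= in_itv.
have key (a b c d : R) : a = c -> b = d -> a = b -> c - d = 0 by move=> <- <- ->; rewrite subrr.
exact: key h1 h2 h.
Qed.

(** The property is encoded as the vanishing of a measurable f, which makes the exceptional set
    measurable, so that [ae_prod] can assemble the slices. *)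
Lemma ae_strip (P : R * R -> Prop) (f : R * R -> R) (L : R) : measurable_fun setT f -> (forall y, f y = 0 -> P y) ->
  {ae mu, forall x, {ae mu, forall z, `[0, L]%classic z -> f (x, z) = 0}} ->
  {ae mu2, forall y, 0 <= y.2 <= L -> P y}.
Proof.
move=> mf fP E.
pose A := (setT `*` `[0, L]%classic) `&` f @^-1` (~` [set 0]).
have mA : measurable A.
  apply: measurableI; first exact: measurableX.
  by rewrite -[X in measurable X]setTI; apply: mf => //; exact: measurableC.
exists A; split => //.
  apply: ae_prod => //; apply: aeS E => x; apply: aeS => z h [[_ /= hz] n]; exact/n/h.
move=> [x z] /= n; split; first by split => //=; apply: contrapT => h; apply: n => h'; case: h; rewrite in_itv.
by move=> h; apply: n => _; exact: fP.
Qed.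

End StripUniqueness.

Section PotentialUniqueness.
Context {R : realType}.
Local Notation mu := (@lebesgue_measure R).
Local Notation mu2 := (@lebesgue2 R).
Variables (p : R) (N : nat) (H Q : R) (k k' : 'I_N.+1 -> int).
Hypotheses (hp : 0 < p) (N0 : (0 < N)%N) (Q0 : 0 < Q).
Variables c c' : @config R N.
Hypotheses (adm : admissible p H Q k c) (adm' : admissible p H Q k' c').

Let L := N%:R * p.

Lemma potential_unique :
  {ae mu, forall x, {ae mu, forall z, `[0, L]%classic z -> excess H c (x, z) = excess H c' (x, z)}} ->
  {ae mu, forall x, {ae mu, forall z, `[0, L]%classic z ->
    potx c (x, z) - potx c' (x, z) = 0 /\ potz c' (x, z) - potz c (x, z) = 0}}.
Proof.
move=> eh.
have L0 : 0 < L by rewrite mulr_gt0 // ltr0n.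
have [hx hz _ _] := adm_regular adm; have [hx' hz' _ _] := adm_regular adm'.
have [pcx pcz] := adm_pot_periodic adm; have [pcx' pcz'] := adm_pot_periodic adm'.
have [_ _ _ _ [xi [[hxi _ _] per t0 tL E]]] := adm.
have [_ _ _ _ [xi' [[hxi' _ _] per' t0' tL' E']]] := adm'.
have [v0 v1] := zero_trace_primz hxi t0 tL; have [v0' v1'] := zero_trace_primz hxi' t0' tL'.
have [pxi pxix pxiz] := H1loc2_P2 hxi; have [pxi' pxix' pxiz'] := H1loc2_P2 hxi'.
have [px pxx pxz] := H1loc2_P2 hx; have [px' pxx' pxz'] := H1loc2_P2 hx'.
have [pz pzx pzz] := H1loc2_P2 hz; have [pz' pzx' pzz'] := H1loc2_P2 hz'.
pose u y := xi y - xi' y.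
pose A y := potx c y - potx c' y.
(* The order is reversed because A_z = -d_x xi. Thus A and B are the z- and x-derivatives of u, the
   term Hz having cancelled, and equality of the excess fields says that u is harmonic in the
   strip. *)
pose B y := potz c' y - potz c y.
pose Az y := wpartial ez (potx c) y - wpartial ez (potx c') y.
pose Bx y := wpartial ex (potz c') y - wpartial ex (potz c) y.
have pu : P2 u := P2B pxi pxi'.
have pA : P2 A := P2B px px'.
have pB : P2 B := P2B pz' pz.
have pAz : P2 Az := P2B pxz pxz'.
have pBx : P2 Bx := P2B pzx' pzx.
have EA : {ae mu2, forall y, wpartial ez xi y - wpartial ez xi' y = A y}.
  by have := aeI E E'; apply: aeS => y [[e1 _] [e2 _]]; rewrite /A e1 e2; ring.
have EB : {ae mu2, forall y, wpartial ex xi y - wpartial ex xi' y = B y}.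
  by have := aeI E E'; apply: aeS => y [[_ e1] [_ e2]]; rewrite /B e1 e2; ring.
have pd : P1 (fun y => wpartial ez xi y - wpartial ez xi' y) by apply: P2_L1; exact: (P2B pxiz pxiz').
have pdx : P1 (fun y => wpartial ex xi y - wpartial ex xi' y) by apply: P2_L1; exact: (P2B pxix pxix').
have PA_ := aeI (eq_primz pd (P2_L1 pA) EA) (primzB (P2_L1 pxiz) (P2_L1 pxiz')).
have PB_ := aeI (eq_primx pdx (P2_L1 pB) EB) (primxB (P2_L1 pxix) (P2_L1 pxix')).
have key (a b a' b' s t : R) : a = a' -> b = b' -> s = t -> s = a' - b' -> a - b = t.
  by move=> -> -> <- ->.
have uz : {ae mu2, forall y, u y = primz A y}.
  have PA2 : {ae mu2, forall y, primz (fun y => wpartial ez xi y - wpartial ez xi' y) y = primz A y /\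
      primz (fun y => wpartial ez xi y - wpartial ez xi' y) y = primz (wpartial ez xi) y - primz (wpartial ez xi') y}.
    by apply: ae_columns; apply: aeS PA_ => x [h1 h2] z; split.
  have := aeI PA2 (aeI v0 v0'); apply: aeS => y [[e1 e2] [e3 e4]].
  exact: key e3 e4 e1 e2.
have u0 : {ae mu, forall x, primz A (x, L) = 0}.
  have := aeI PA_ (aeI v1 v1'); apply: aeS => x [[e1 e2] [e3 e4]].
  by rewrite -e1 e2 e3 e4 subrr.
have [g hg Eg] := H1loc2_primx hxi; have [g' hg' Eg'] := H1loc2_primx hxi'.
have key2 (a b s s' w w' t t' : R) : a = s + w -> b = s' + w' -> t' = t -> t' = w - w' -> a - b = (s - s') + t.
  by move=> -> -> <- ->; ring.
have ux : {ae mu2, forall y, u y = (fun z => g z - g' z) y.2 + primx B y}.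
  have PB2 : {ae mu2, forall y, primx (fun y => wpartial ex xi y - wpartial ex xi' y) y = primx B y /\
      primx (fun y => wpartial ex xi y - wpartial ex xi' y) y = primx (wpartial ex xi) y - primx (wpartial ex xi') y}.
    by apply: ae_rows; apply: aeS PB_ => z [h1 h2] x; split.
  have := aeI PB2 (aeI Eg Eg'); apply: aeS => y [[e1 e2] [e3 e4]].
  exact: key2 e3 e4 e1 e2.
have [a ha Ea] := H1loc2_primz hx; have [a' ha' Ea'] := H1loc2_primz hx'.
have [b hb Eb] := H1loc2_primx hz; have [b' hb' Eb'] := H1loc2_primx hz'.
have key3 (x1 x2 s s' w w' t : R) : x1 = s + w -> x2 = s' + w' -> t = w - w' -> x1 - x2 = (s - s') + t.
  by move=> -> -> ->; ring.
have AzE : {ae mu2, forall y, A y = (fun x => a x - a' x) y.1 + primz Az y}.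
  have h := ae_columns (P := fun y => primz Az y = primz (wpartial ez (potx c)) y - primz (wpartial ez (potx c')) y)
    (primzB (P2_L1 pxz) (P2_L1 pxz')).
  have := aeI h (aeI Ea Ea'); apply: aeS => y [e1 [e2 e3]]; exact: key3 e2 e3 e1.
have BxE : {ae mu2, forall y, B y = (fun z => b' z - b z) y.2 + primx Bx y}.
  have h := ae_rows (P := fun y => primx Bx y = primx (wpartial ex (potz c')) y - primx (wpartial ex (potz c)) y)
    (primxB (P2_L1 pzx') (P2_L1 pzx)).
  have := aeI h (aeI Eb Eb'); apply: aeS => y [e1 [e2 e3]]; exact: key3 e3 e2 e1.
have div0 : {ae mu, forall x, {ae mu, forall z, `[0, L]%classic z -> Az (x, z) + Bx (x, z) = 0}}.
  have key4 (a1 a2 b1 b2 : R) : a1 - b1 - H = a2 - b2 - H -> a1 - a2 + (b2 - b1) = 0 by lra.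
  by apply: aeS eh => x; apply: aeS => z h /h; exact: key4.
have Pu : periodic2 (2 * Q) u.
  by have := aeI per per'; apply: aeS => y [e1 e2]; rewrite /u e1 e2.
have PA : periodic2 (2 * Q) A.
  by have := aeI pcx pcx'; apply: aeS => y [e1 e2]; rewrite /A e1 e2.
have PB : periodic2 (2 * Q) B.
  by have := aeI pcz pcz'; apply: aeS => y [e1 e2]; rewrite /B e1 e2.
exact: (@harmonic_zero R L Q u A B Az Bx (fun x => a x - a' x) (fun z => g z - g' z) (fun z => b' z - b z) L0 Q0 pu pA pB pAz pBx uz u0 ux AzE BxE div0 Pu PA PB).
Qed.

End PotentialUniqueness.

(** * Comparison and the equality case *)

Section Comparison.
Context {R : realType}.
Local Notation mu := (@lebesgue_measure R).
Local Notation mu2 := (@lebesgue2 R).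
Variables (p : R) (N : nat) (H kappa q : R) (m : nat).
Hypotheses (hp : 0 < p) (N0 : (0 < N)%N) (hk : 0 < kappa) (q0 : 0 < q) (m0 : (0 < m)%N).
Hypothesis hal : H * p * (2 * q) = pi *+ 2.
Let Q := m%:R * q.
Let kv := (kappa ^+ 2)^-1.
Let Q_gt0 : 0 < Q. Proof. by rewrite mulr_gt0 // ltr0n. Qed.
Local Notation av f := (avg m q f).

(* The first two conditions keep the moduli in [3/4, 5/4] and let the deviations of f_n'
   absorb the negative kinetic remainder; the last three let the deviations of f_n, V_n and h
   absorb the coupling remainder. *)
Definition small (e r : R) : Prop := [/\ supK p kappa Q * e <= 16^-1,
  23 * (2 * Q * (2 * kappa ^+ 2 / p * e)) <= 2^-1,
  10 * r <= 4^-1, 120 * r * Q ^+ 2 <= 8^-1 * kv & 60 * p ^+ 2 * r * Q ^+ 2 * N%:R <= 2^-1 * kv].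

Variables (r e : R).
Hypotheses (r0 : 0 <= r) (sm : small e r).
Variables (c : @config R N) (omega : R).
Hypothesis adm : admissible p H Q (multZ m) c.
Hypothesis jump : forall n, {ae mu, forall x : R,
  phase c n (x + 2 * Q) = phase c n x + omega + 2 * pi * (multZ m n)%:~R}.
Hypothesis he : \int[mu]_(x in `[- Q, Q]) cdensity p H kappa r c x <= e.

Let al (n : 'I_N.+1) : R := (omega + 2 * pi * (m * n)%:R) / (2 * Q).
Let cb := avg_config q m al c.
Let rc : regular c := adm_regular adm.
Let admb : admissible p H q (multZ 1) cb := avg_admissible q0 m0 adm jump.
Let admb' : admissible p H Q (multZ m) cb := admissible_mult q0 m0 admb.
Let S (n : 'I_N) := tilt (H * p) (phase_diff p c n).

Lemma sobolev_tilt_diff n : sobolev (S n) (fun x => velocity p c (lift ord0 n) x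
  - velocity p c (widen_ord (leqnSn N) n) x + flux p (excess H c) n x).
Proof.
have hV n := @L2_velocity R p N hp c n rc.
have lW : L2 (fun x => velocity p c (lift ord0 n) x
  - velocity p c (widen_ord (leqnSn N) n) x + flux p (excess H c) n x).
  by apply: L2D; [apply: L2B; exact: hV|apply: P2_Rint; exact: P2_excess].
split=> //.
  apply: measurable_funB; first exact: measurable_phase_diff.
  by apply: measurable_funM => //; exact: measurable_cst.
have [C E] := phase_diff_prim H hp n rc; exists C; apply: aeS E => x.
rewrite primD; [|exact: L2_L1|exact: L1_cst]; rewrite prim_cst /S /tilt => ->.
by rewrite addrA addrK.
Qed.

(** Over the long period the phase difference grows by 2 pi m, exactly as [H * p * x] does. *)
Lemma tilt_diff_periodic n : periodic (2 * Q) (S n).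
Proof.
apply: aeS (adm_phase_diff_jump adm n) => x; rewrite /S /tilt => ->.
have -> : multZ m (lift ord0 n) - multZ m (widen_ord (leqnSn N) n) = m%:Z.
  by rewrite /multZ lift0 /= mulnS PoszD addrK.
have -> : H * p * (x + 2 * Q) = H * p * x + m%:R * (H * p * (2 * q)) by rewrite /Q; ring.
by rewrite hal -pmulrn mulr2n; ring.
Qed.

Let eT : (fun (n : 'I_N) x => H * p * x + S n x) = phase_diff p c.
Proof. by apply/funext => n; apply/funext => x; rewrite /S /tilt addrC subrK. Qed.

Lemma avg_cdensity : {ae mu, forall x, cdensity p H kappa r cb x =
  density p kappa r (fun n => av (modulus c n)) (fun n => av (wderiv (modulus c n)))
    (fun n => av (velocity p c n)) (fun n x => H * p * x + av (S n) x) (avg2 m q (excess H c)) x}.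
Proof.
have e1 := ae_ord (avg_modulus_deriv omega adm).
have e2 := ae_ord (avg_velocity m0 omega adm).
have e3 := ae_ord (avg_phase_diff q0 m0 hal omega adm).
have e4 := avg_excess m0 omega adm.
have P := P2_L1 (P2_excess H (adm_regular admb)).
have P' := P2_L1 (P2_comb2 m m%:R^-1 (cells q) (P2_excess H rc)).
have := aeI (aeI e1 e2) (aeI e3 (aeI (ae_fubini e4) (aeI (P1_slice P) (P1_slice P')))).
apply: aeS => x [[f1 f2] [f3 [f4 [s1 s2]]]].
rewrite /cdensity /density; congr (_ + _ + _).
- by rewrite /plane_density; congr (_ * _); apply: eq_bigr => n _; rewrite f1 f2.
- by rewrite /coupling_density; congr (_ * (_ * _)); apply: eq_bigr => n _; rewrite f3.
- congr (_ * _); apply: Rint_eq_ae => //.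
  + by apply: measurable_funTS; apply: measurable_funX; exact: s1.1.
  + by apply: measurable_funTS; apply: measurable_funX; exact: s2.1.
  + by apply: aeS f4 => z f _; rewrite f.
Qed.

Definition config_dev : R :=
  p * \sum_(n < N.+1) (4^-1 * dev_sq m q (modulus c n) + 2^-1 * kv * dev_sq m q (wderiv (modulus c n))
    + 8^-1 * kv * dev_sq m q (velocity p c n)) + 2^-1 * kv * field_dev m N q p (excess H c).

Lemma compare_config :
  m%:R * \int[mu]_(x in `[- q, q]) cdensity p H kappa r cb x + config_dev <=
  \int[mu]_(x in `[- Q, Q]) cdensity p H kappa r c x.
Proof.
have [s1 s2 s3 s4 s5] := sm.
have hV n := @L2_velocity R p N hp c n rc.
rewrite -(Rint_cdensity_mult kappa hp r m0 q0 admb).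
have Ec : cdensity p H kappa r c = density p kappa r (modulus c) (fun n => wderiv (modulus c n))
    (velocity p c) (fun n x => H * p * x + S n x) (excess H c) by rewrite eT.
have he' := he; rewrite Ec in he'.
have key := convexity m0 q0 hp hk r0 (fun n => regular_sobolev n rc) hV sobolev_tilt_diff (P2_excess H rc)
  (adm_modulus_periodic adm) (adm_modulus_deriv_periodic adm) (adm_velocity_periodic adm)
  tilt_diff_periodic (adm_excess_periodic adm) (adm_modulus_ge0 adm) hal he' s1 s2 s3 s4 s5.
rewrite Ec; apply: le_trans key.
rewrite lerD2r le_eqVlt; apply/orP; left; apply/eqP.
apply: Rint_eq_ae => //; last by apply: aeS avg_cdensity => x f _.
- by apply: measurable_funTS; exact: (L1_cdensity H kappa hp r (adm_regular admb)).1.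
- apply: measurable_funTS.
  have L : L1 (density p kappa r (fun n => av (modulus c n)) (fun n => av (wderiv (modulus c n)))
    (fun n => av (velocity p c n)) (fun n x => H * p * x + av (S n) x) (avg2 m q (excess H c))).
    apply: L1_density.
    + by move=> n; apply: sobolev_comb; exact: regular_sobolev rc.
    + by move=> n; apply: L2_comb; exact: hV.
    + move=> n; apply: measurable_funD; first by apply: measurable_funM => //; exact: measurable_cst.
      by have [_ h _] := sobolev_comb m m%:R^-1 (cells q) (sobolev_tilt_diff n).
    + by apply: P2_comb2; exact: P2_excess.
  exact: L.1.
Qed.

Lemma dev_sq_eq0 f : L2 f -> periodic (2 * Q) f -> dev_sq m q f = 0 -> {ae mu, forall x, f x = av f x}.
Proof.
move=> hf P d0; apply: (ae_cell Q_gt0).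
  by have := aeI P (periodic_q m (avg_periodic m0 P)); apply: aeS => x [-> ->].
have hd : L2 (fun x => f x - av f x) by apply: L2B => //; exact: L2_comb.
have l : L1 (fun x => (f x - av f x) ^+ 2) by apply: L2b_sq.
have : {ae mu, forall x, `[- Q, Q]%classic x -> (f x - av f x) ^+ 2 = 0}.
  by apply: Rint_ge0_eq0 => //; [exact: L1_itv|apply: aeW => x _; exact: sqr_ge0].
apply: aeS => x h /h /eqP; rewrite sqrf_eq0 subr_eq0 => /eqP; exact.
Qed.

Lemma config_dev_eq0 : config_dev <= 0 ->
  [/\ forall n, dev_sq m q (modulus c n) = 0, forall n, dev_sq m q (velocity p c n) = 0 &
      field_dev m N q p (excess H c) = 0].
Proof.
have kv0 : 0 < kv by rewrite invr_gt0 exprn_gt0.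
have hF n : 0 <= dev_sq m q (modulus c n).
  by apply: dev_sq_ge0; have [_ _ h3 _] := rc; apply/L2locP; exact: (h3 n).1.
have hG n : 0 <= dev_sq m q (wderiv (modulus c n)).
  by apply: dev_sq_ge0; have [_ _ h3 _] := rc; have [] := wderivP (h3 n).
have hV n : 0 <= dev_sq m q (velocity p c n) by apply: dev_sq_ge0; exact: L2_velocity.
have hX : 0 <= field_dev m N q p (excess H c) by apply: field_dev_ge0; exact: P2_excess.
pose s n := 4^-1 * dev_sq m q (modulus c n) + 2^-1 * kv * dev_sq m q (wderiv (modulus c n))
    + 8^-1 * kv * dev_sq m q (velocity p c n).
have s1 n : 0 <= 4^-1 * dev_sq m q (modulus c n) by rewrite mulr_ge0.
have s2 n : 0 <= 2^-1 * kv * dev_sq m q (wderiv (modulus c n)) by rewrite !mulr_ge0 // ltW.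
have s3 n : 0 <= 8^-1 * kv * dev_sq m q (velocity p c n) by rewrite !mulr_ge0 // ltW.
have s0 n : 0 <= s n by rewrite !addr_ge0.
have t1 : 0 <= p * \sum_(n < N.+1) s n by rewrite mulr_ge0 ?(ltW hp) // sumr_ge0.
have t2 : 0 <= 2^-1 * kv * field_dev m N q p (excess H c) by rewrite !mulr_ge0 // ltW.
move=> le0; have : config_dev == 0 by rewrite eq_le le0 addr_ge0.
rewrite /config_dev paddr_eq0 // => /andP[d1 d2].
have {}d2 : field_dev m N q p (excess H c) = 0.
  by move: d2; rewrite !mulf_eq0 invr_eq0 pnatr_eq0 (gt_eqF kv0) /= => /eqP.
move: d1; rewrite mulf_eq0 (gt_eqF hp) /= => /eqP d1.
have {}d1 n : s n = 0 by apply: (psumr_eq0P (fun i _ => s0 i) d1).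
split=> // n; have := d1 n; move: (s1 n) (s2 n) (s3 n); rewrite /s.
  set a := dev_sq m q (modulus c n); lra.
set a := _ * dev_sq m q (modulus c n); set b := _ * dev_sq m q (wderiv _) => a0 b0 c0 abc.
have : 8^-1 * kv * dev_sq m q (velocity p c n) = 0 by lra.
by move/eqP; rewrite !mulf_eq0 invr_eq0 pnatr_eq0 (gt_eqF kv0) /= => /eqP.
Qed.

(** Vanishing deviations make moduli, velocities and excess field equal to their averages. The
    excess field determines the potential in the strip; its traces and the velocities then determine
    the derivatives of the phases. *)
Lemma equality_case : config_dev <= 0 -> same_config p c cb.
Proof.
move=> /config_dev_eq0 [dF dV dX].
have [hx hz h3 h4] := rc; have [hxb hzb _ h4b] := adm_regular admb.
have hh := P2_excess H rc.
have ha : P2 (avg2 m q (excess H c)) by exact: P2_comb2.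
have hd : P2 (fun y => excess H c y - avg2 m q (excess H c) y) := P2B hh ha.
have L0 : 0 < N%:R * p by rewrite mulr_gt0 // ltr0n.
have Pa : periodic2 (2 * Q) (excess H cb) by exact: adm_excess_periodic admb'.
have eh : {ae mu, forall x, {ae mu, forall z, `[0, N%:R * p]%classic z -> excess H c (x, z) = excess H cb (x, z)}}.
  pose D := fun y => (excess H c y - avg2 m q (excess H c) y) ^+ 2.
  have hD : P1 D by apply: L2b_sq.
  have lf := L1_field_density p N hd.
  have f0 : {ae mu, forall x, field_density p N (fun y => excess H c y - avg2 m q (excess H c) y) x = 0}.
    have PD : periodic2 (2 * Q) D.
      have e4 := avg_excess m0 omega adm.
      have := aeI (aeI (adm_excess_periodic adm) Pa) (aeI e4 (ae_shift2 (2 * Q) e4)).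
      by apply: aeS => y [[f1 f2] [f3 f4]]; rewrite /D f1 -f3 -f2 f4.
    apply: (ae_cell Q_gt0); first by apply: aeS (periodic2_Rint 0 (N%:R * p) hD PD) => x; rewrite /field_density => ->.
    apply: Rint_ge0_eq0 => //; first exact: L1_itv.
    by apply: aeW => x _; exact: field_density_ge0.
  have := aeI f0 (aeI (P1_slice hD) (ae_fubini (avg_excess m0 omega adm))); apply: aeS => x [f1 [s f2]].
  have z0 : {ae mu, forall z, `[0, N%:R * p]%classic z -> D (x, z) = 0}.
    apply: Rint_ge0_eq0 => //; first exact: L1_itv.
    by apply: aeW => z _; exact: sqr_ge0.
  have := aeI z0 f2; apply: aeS => z [g1 g2] /g1 /eqP.
  by rewrite /D sqrf_eq0 subr_eq0 => /eqP ->; rewrite -g2.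
have pu := potential_unique hp N0 Q_gt0 adm admb' eh.
split.
- move=> n; apply: dev_sq_eq0 (dF n); last exact: adm_modulus_periodic adm n.
  by apply/L2locP; exact: (h3 n).1.
(* No multiple of 2 pi is needed. The two phases differ by a constant, and their difference is the
   tilted phase minus its average, which integrates to zero over the long period. *)
- exists (fun=> 0) => n.
  have eV := dev_sq_eq0 (@L2_velocity R p N hp c n rc) (adm_velocity_periodic adm n) (dV n).
  have eT' : {ae mu, forall x, trace (potx c) (n%:R * p) x = trace (potx cb) (n%:R * p) x}.
    apply: (trace_strip L0 _ hx hxb).
      by rewrite mulr_ge0 ?(ltW hp) //= ler_pM2r // ler_nat -ltnS.
    by apply: aeS pu => x; apply: aeS => z h /h [/eqP]; rewrite subr_eq0 => /eqP.
  have eW : {ae mu, forall x, wderiv (phase c n) x = wderiv (phase cb n) x}.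
    have key (a b s t u w : R) : u = a - s -> w = b - t -> u = w -> s = t -> a = b.
      by move=> -> -> h st; move: h; rewrite st => /addIr.
    have := aeI (aeI eV (avg_velocity m0 omega adm n)) eT'; apply: aeS => x [[f1 f2] f3].
    exact: (key _ _ _ _ _ _ erefl erefl (etrans f1 (esym f2)) f3).
  have [C E] := H1loc_prim (h4 n); have [C' E'] := H1loc_prim (h4b n).
  have [_ w1] := wderivP (h4 n); have [_ w2] := wderivP (h4b n).
  have ep := eq_prim eW w1.1 w2.1.
  have dE : {ae mu, forall x, phase c n x - phase cb n x = C - C'}.
    have key (a b s t u w : R) : a = s + u -> b = t + w -> u = w -> a - b = s - t.
      by move=> -> -> ->; rewrite opprD addrACA subrr addr0.
    have := aeI E E'; apply: aeS => x [f1 f2]; exact: key f1 f2 (ep x).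
  have lp := L1_H1loc (h4 n); have lpb := L1_H1loc (h4b n).
  have [ht _] := H1loc_tilt (al n) (h4 n); have lt := L1_H1loc ht.
  have i0 : \int[mu]_(x in `[- Q, Q]) (phase c n x - phase cb n x) = 0.
    rewrite -[RHS](Rint_dev m0 q0 lt (tilt_periodic q0 m0 jump n)).
    by apply: eq_Rintegral => x _ /=; rewrite /tilt; ring.
  have : (C - C') * (Q - - Q) = 0.
    rewrite -(@Rint_cst R (C - C') (- Q) Q (ltW (period_cell_lt m0 q0))) -[RHS]i0.
    by apply: (Rint_itv_eq (@L1_cst R (C - C')) (L1B lp lpb)); apply: aeS dE => x -> _.
  move=> /eqP; rewrite mulf_eq0 => /orP[/eqP C0|]; last first.
    by move=> /eqP h; have := period_cell_lt m0 q0; rewrite -/Q; lra.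
  by apply: aeS dE => x /eqP; rewrite C0 subr_eq0 mulr0 addr0 => /eqP.
- have [px _ _] := H1loc2_P2 hx; have [pz _ _] := H1loc2_P2 hz.
  have [pxb _ _] := H1loc2_P2 hxb; have [pzb _ _] := H1loc2_P2 hzb.
  apply: (@ae_strip R _ (fun y => (potx c y - potx cb y) ^+ 2 + (potz cb y - potz c y) ^+ 2)).
  + apply: measurable_funD; apply: measurable_funX; apply: measurable_funB;
      [exact: px.1|exact: pxb.1|exact: pzb.1|exact: pz.1].
  + move=> y /eqP; rewrite paddr_eq0 ?sqr_ge0 // !sqrf_eq0 !subr_eq0 => /andP[/eqP ? /eqP ?].
    by split.
  + by apply: aeS pu => x; apply: aeS => z h /h [f1 f2]; rewrite f1 f2 expr0n addr0.
Qed.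

End Comparison.

(** * Equality of minimal energies and coincidence of minimizers *)

Section PartA.
Context {R : realType}.
Local Notation mu := (@lebesgue_measure R).
Variables (p : R) (N : nat) (H kappa q : R) (m : nat).
Hypotheses (hp : 0 < p) (N0 : (0 < N)%N) (hH : 0 < H) (hk : 0 < kappa) (m0 : (0 < m)%N).
Hypothesis qE : q = pi / (H * p).
Local Notation Q := (m%:R * q).
Let q0 : 0 < q. Proof. by rewrite qE; exact: cell_gt0. Qed.
Let hal : H * p * (2 * q) = pi *+ 2. Proof. by rewrite qE; exact: cell_flux. Qed.
Let mR0 : 0 < m%:R :> R. Proof. by rewrite ltr0n. Qed.
Let gadm : admissible p H q (multZ 1) (@ground R p N H). Proof. by rewrite qE; exact: ground_admissible. Qed.
Let Q_gt0 : 0 < Q. Proof. exact: mulr_gt0. Qed.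
Local Notation ground := (@ground R p N H).
Local Notation E1 r c := (\int[mu]_(x in `[- q, q]) @cdensity R p N H kappa r c x).
Local Notation EQ r c := (\int[mu]_(x in `[- Q, Q]) @cdensity R p N H kappa r c x).

(** The energy threshold e comes first, from the two conditions that do not involve r. Then r is
    restricted so that the coupling losses are absorbed and the competitor [ground], repeated over
    the m cells, has energy at most e. *)
Lemma exists_threshold : exists2 r0 : R, 0 < r0 & forall r, 0 < r < r0 ->
  exists2 e, small p N kappa q m e r & m%:R * E1 r ground <= e.
Proof.
have kv0 : 0 < (kappa ^+ 2)^-1 by rewrite invr_gt0 exprn_gt0.
have k0 : 0 < kappa ^+ 2 by rewrite exprn_gt0.
have NR : 0 < N%:R :> R by rewrite ltr0n.
have K0 : 0 < supK p kappa Q.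
  by apply: addr_gt0; apply: divr_gt0 => //; apply: mulr_gt0 => //; apply: mulr_gt0.
pose K1 := 23 * (2 * Q * (2 * kappa ^+ 2 / p)).
have K10 : 0 < K1 by rewrite !mulr_gt0 ?invr_gt0.
pose e := Num.min (16^-1 / supK p kappa Q) (2^-1 / K1).
have e0 : 0 < e by rewrite lt_min !divr_gt0 ?invr_gt0.
have a1 : 0 < m%:R * (4 * q * p * N%:R) by rewrite !mulr_gt0.
have a3 : 0 < 120 * Q ^+ 2 by rewrite mulr_gt0 // exprn_gt0.
have a4 : 0 < 60 * p ^+ 2 * Q ^+ 2 * N%:R by rewrite !mulr_gt0 // exprn_gt0.
exists (Num.min (Num.min (e / (m%:R * (4 * q * p * N%:R))) (4^-1 / 10))
  (Num.min (8^-1 / kappa ^+ 2 / (120 * Q ^+ 2)) (2^-1 / kappa ^+ 2 / (60 * p ^+ 2 * Q ^+ 2 * N%:R)))).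
  rewrite !lt_min; apply/andP; split; apply/andP; split.
  - exact: divr_gt0.
  - by rewrite divr_gt0 // invr_gt0.
  - by apply: divr_gt0 => //; rewrite divr_gt0 // invr_gt0.
  - by apply: divr_gt0 => //; rewrite divr_gt0 // invr_gt0.
move=> r /andP[r0]; rewrite !lt_min => /andP[/andP[h1 h2] /andP[h3 h4]]; exists e.
  split.
  - have : e <= 16^-1 / supK p kappa Q by rewrite ge_min lexx.
    by rewrite ler_pdivlMr // mulrC.
  - have : e <= 2^-1 / K1 by rewrite ge_min lexx orbT.
    by rewrite ler_pdivlMr // /K1; congr (_ <= _); ring.
  - by move: h2; rewrite ltr_pdivlMr // mulrC => /ltW.
  - move: h3; rewrite ltr_pdivlMr // => /ltW; congr (_ <= _); ring.
  - move: h4; rewrite ltr_pdivlMr // => /ltW; congr (_ <= _); ring.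
move: h1; rewrite ltr_pdivlMr // => /ltW; apply: le_trans.
have -> : r * (m%:R * (4 * q * p * N%:R)) = m%:R * (4 * q * p * N%:R * r) by ring.
rewrite ler_wpM2l ?(ltW mR0) //.
by rewrite {2}qE; have := @ground_density R p N H kappa hp hH r (ltW r0); rewrite -qE.
Qed.

Lemma fin_le (x y : \bar R) (a b : R) : x = a%:E -> y = b%:E -> (x <= y)%E -> a <= b.
Proof. by move=> -> ->; rewrite lee_fin. Qed.

Lemma le_fin (x y : \bar R) (a b : R) : x = a%:E -> y = b%:E -> a <= b -> (x <= y)%E.
Proof. by move=> -> ->; rewrite lee_fin. Qed.

Lemma le_eqr (a b d : R) : a <= b -> b = d -> a <= d.
Proof. by move=> ab <-. Qed.

Section FixedCoupling.
Variables (r e : R).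
Hypotheses (r0 : 0 < r) (sm : small p N kappa q m e r) (ge : m%:R * E1 r ground <= e).

Let EQ_mult k c : @admissible R p N H q k c -> EQ r c = m%:R * E1 r c.
Proof. by move=> adm; exact: (Rint_cdensity_mult kappa hp r m0 q0 adm). Qed.

(** Since [config_dev] is nonnegative, [compare_config] gives the improvement; if there is none, it
    forces [config_dev] to vanish, and [equality_case] applies. *)
Lemma better_config (c : @config R N) : admissible p H Q (multZ m) c ->
  EQ r c <= e -> exists2 c' : @config R N, admissible p H q (multZ 1) c' &
    m%:R * E1 r c' <= EQ r c /\ (EQ r c <= m%:R * E1 r c' -> same_config p c c').
Proof.
move=> adm he; have [_ _ [_ [omega jump]] _ _] := adm.
have cmp := compare_config hp hk q0 m0 hal (ltW r0) sm adm jump he.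
set c' := avg_config _ _ _ _ in cmp; exists c'; first exact: (avg_admissible q0 m0 adm jump).
have d0 : 0 <= config_dev p H kappa q m c.
  have rc := adm_regular adm; have kv0 : 0 <= (kappa ^+ 2)^-1 by rewrite invr_ge0 sqr_ge0.
  have [_ _ h3 _] := rc.
  rewrite addr_ge0 ?mulr_ge0 ?(ltW hp) ?invr_ge0 ?sqr_ge0 //.
    apply: sumr_ge0 => n _; rewrite !addr_ge0 // mulr_ge0 ?mulr_ge0 ?invr_ge0 ?sqr_ge0 //;
      apply: dev_sq_ge0.
    - by apply/L2locP; exact: (h3 n).1.
    - by have [] := wderivP (h3 n).
    - exact: L2_velocity.
  by apply: field_dev_ge0; exact: P2_excess.
split; first by apply: le_trans cmp; rewrite lerDl.
move=> le; apply: (equality_case hp N0 hk q0 m0 adm jump).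
by have := le_trans cmp le; rewrite gerDl.
Qed.

Lemma better_energy (c : @config R N) : admissible p H Q (multZ m) c ->
  exists2 c' : @config R N, admissible p H q (multZ 1) c' & m%:R * E1 r c' <= EQ r c.
Proof.
move=> adm; have [he|/ltW he] := leP (EQ r c) e.
  by have [c' ? [? _]] := better_config adm he; exists c'.
by exists ground; [exact: gadm|exact: le_trans ge he].
Qed.

Let en1 k c : @admissible R p N H q k c -> energy p H kappa r q c = (E1 r c)%:E.
Proof. by move=> adm; apply: energyE => //; exact: adm_regular adm. Qed.

Let enQ k c : @admissible R p N H Q k c -> energy p H kappa r Q c = (EQ r c)%:E.
Proof. by move=> adm; apply: energyE => //; exact: adm_regular adm. Qed.

Lemma minimizers_coincide :
  coincide p (minimizer p H kappa r Q (@multZ N m)) (minimizer p H kappa r q (@multZ N 1)).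
Proof.
split=> c [adm hmin].
- have le1 (c' : @config R N) : admissible p H q (multZ 1) c' -> EQ r c <= m%:R * E1 r c'.
    move=> adm'; have adm2 := admissible_mult q0 m0 adm'.
    exact: (le_eqr (fin_le (enQ adm) (enQ adm2) (hmin _ adm2)) (EQ_mult adm')).
  (* [ground] also belongs to the long class, so a minimizer there lies below the threshold and may
     be averaged. As it cannot be improved, the average is the same configuration. *)
  have he : EQ r c <= e := le_trans (le1 _ gadm) ge.
  have [c' adm' [le2 same]] := better_config adm he.
  exists c'; last exact: (same (le1 _ adm')).
  split; first exact: adm'.
  move=> c2 adm2; apply: (le_fin (en1 adm') (en1 adm2)).
  by have := le_trans le2 (le1 _ adm2); rewrite ler_pM2l.
- have admQ := admissible_mult q0 m0 adm.
  (* In this direction the configuration itself is the witness: by [better_energy] the energy of any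
     competitor of the long class is at least m times that of some competitor of the short class. *)
  exists c.
    split; first exact: admQ.
    move=> c2 adm2; have [c3 adm3 le3] := better_energy adm2.
    apply: (le_fin (enQ admQ) (enQ adm2)); apply: le_trans le3.
    have le4 := fin_le (en1 adm) (en1 adm3) (hmin _ adm3).
    apply: (@le_trans _ _ (m%:R * E1 r c)); last by rewrite ler_pM2l.
    by rewrite le_eqVlt; apply/orP; left; apply/eqP; exact: EQ_mult adm.
  split; [by move=> n; apply: aeW| |by apply: aeW].
  by exists (fun=> 0) => n; apply: aeW => x; rewrite mulr0 addr0.
Qed.

(** Over m cells both the infimum and the normalizing area are multiplied by m. The infimum scales
    by [better_energy] in one direction and by the inclusion of classes in the other. *)
Lemma min_energy_density_eq :
  min_energy_density p H kappa r Q (@multZ N m) = min_energy_density p H kappa r q (@multZ N 1).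
Proof.
rewrite /min_energy_density.
set iQ := ereal_inf _; set i1 := ereal_inf _.
have NR : 0 < N%:R :> R by rewrite ltr0n.
have cm : (2 * q * N%:R * p)^-1 = (2 * Q * N%:R * p)^-1 * m%:R.
  by field; rewrite !gt_eqF.
have -> : i1 = (m%:R^-1%:E * iQ)%E.
  apply/eqP; rewrite eq_le; apply/andP; split.
    have h : (m%:R%:E * i1 <= iQ)%E.
      apply: le_ereal_inf_tmp => _ [c adm <-].
      have [c' adm' le] := better_energy adm; rewrite (enQ adm).
      apply: (@le_trans _ _ (m%:R%:E * (E1 r c')%:E)%E); last by rewrite -EFinM lee_fin.
      apply: lee_wpmul2l; first by rewrite lee_fin ltW.
      by apply: ereal_inf_lbound; exists c' => //; exact: en1 adm'.
    have := lee_wpmul2l (_ : (0 <= m%:R^-1%:E)%E) h.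
    rewrite muleA -EFinM mulVf ?gt_eqF // mul1e; apply.
    by rewrite lee_fin invr_ge0 ltW.
  apply: le_ereal_inf_tmp => _ [c adm <-].
  have admQ := admissible_mult q0 m0 adm.
  have h : (iQ <= (EQ r c)%:E)%E by apply: ereal_inf_lbound; exists c => //; exact: enQ admQ.
  have := lee_wpmul2l (_ : (0 <= m%:R^-1%:E)%E) h.
  rewrite -EFinM (EQ_mult adm) mulrA mulVf ?gt_eqF // mul1r (en1 adm); apply.
  by rewrite lee_fin invr_ge0 ltW.
by rewrite muleA cm -EFinM mulfK // gt_eqF.
Qed.

End FixedCoupling.

Lemma part_a : exists2 r0 : R, 0 < r0 & forall r : R, 0 < r < r0 ->
  min_energy_density p H kappa r Q (@multZ N m) = min_energy_density p H kappa r q (@multZ N 1) /\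
  coincide p (minimizer p H kappa r Q (@multZ N m)) (minimizer p H kappa r q (@multZ N 1)).
Proof.
have [r0 r00 h] := exists_threshold; exists r0 => // r hr.
have [e sm ge] := h r hr; have /andP[rp _] := hr.
by split; [exact: min_energy_density_eq sm ge|exact: minimizers_coincide sm ge].
Qed.

End PartA.

Theorem theorem7p1 (R : realType) (p : R) (hp : 0 < p) (N : nat) (hN : (0 < N)%N)
    (H kappa : R) (hH : 0 < H) (hkappa : 0 < kappa) :
  (forall m : nat, (0 < m)%N ->
    exists2 r0 : R, 0 < r0 & forall r : R, 0 < r < r0 ->
      min_energy_density p H kappa r (m%:R * pi / (H * p)) (@multZ N m) =
      min_energy_density p H kappa r (pi / (H * p)) (@multZ N 1) /\
      coincide p (minimizer p H kappa r (m%:R * pi / (H * p)) (@multZ N m))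
                 (minimizer p H kappa r (pi / (H * p)) (@multZ N 1))) /\
  (forall (q : R) (k : 'I_N.+1 -> int), 0 < q -> k ord0 = 0 ->
    ~ (exists2 m : nat, (0 < m)%N &
         q = m%:R * pi / (H * p) /\ forall n, k n = multZ m n) ->
    exists r1 omega1 : R, [/\ 0 < r1, 0 < omega1 &
      forall r : R, 0 < r < r1 ->
        (omega1%:E <= min_energy_density p H kappa r q k)%E]).
Proof.
split=> [m m0|q k q0 k0 nm]; last exact: part_b.
by rewrite -mulrA; exact: part_a.
Qed.
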